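(* Suppose that for every integer $N \ge 1$ the entire function $\Xi_N(z)$ has monotonic zeros in the closed first quadrant $Q = \{z \in \mathbb{C} : \Re(z) \ge 0,\ \Im(z) \ge 0\}$. Then the Riemann Hypothesis holds, i.e. all the zeros of the Riemann $\Xi$-function $\Xi(z)$ are real.
   Context: The Riemann $\Xi$-function is the even entire function $$\Xi(z) = \tfrac12\left(\tfrac12+iz\right)\left(-\tfrac12+iz\right)\pi^{-(1/2+iz)/2}\,\Gamma\!\left(\tfrac12\left(\tfrac12+iz\right)\right)\zeta\!\left(\tfrac12+iz\right),$$ where $\zeta$ is the Riemann zeta function. For $z \in \mathbb{C}$ and $a,b \in \mathbb{R}$ with $a>0$, define the hyperbolic gamma function $$G(z;a,b) = 4\int_0^\infty \cos(2zu)\,\exp\!\left(2bu - a e^{2u}\right)du = \frac{\Gamma(b+iz,a)}{a^{b+iz}} + \frac{\Gamma(b-iz,a)}{a^{b-iz}},$$ where $\Gamma(z,a) = \int_a^\infty e^{-t}t^{z}\,\frac{dt}{t}$ is the upper incomplete gamma function. For integers $n \ge 1$ and $N\ge 1$ put $$\Phi_n(z) = 2\pi^2 n^4\, G(z/2;\, n^2\pi,\, 9/4) - 3\pi n^2\, G(z/2;\, n^2\pi,\, 5/4), \qquad \Xi_N(z) = \sum_{n=1}^N \Phi_n(z).$$ Definition (monotonic zeros). A function $F(z)$ has monotonic zeros in a region $D$ of the complex plane if, when the zeros of $F$ in $D$ are listed by increasing real part, their imaginary parts are monotone nondecreasing. Formally: it is assumed that $F$ has at most one zero on the intersection of any vertical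 line with $D$, and if $\alpha_1,\alpha_2,\ldots$ are the zeros of $F$ in $D$, numbered so that $\Re(\alpha_i) < \Re(\alpha_{i+1})$ for $i \ge 1$, then $\Im(\alpha_i) \le \Im(\alpha_{i+1})$ for all $i \ge 1$. *)

(* Defs.v *)
From Stdlib Require Import Reals Lra Lia ClassicalEpsilon.
From Coquelicot Require Import Coquelicot.
Open Scope R_scope.

Definition Cexp (z : C) : C :=
  (exp (Re z) * cos (Im z), exp (Re z) * sin (Im z)).

Definition Ccos (z : C) : C := ((Cexp (Ci * z) + Cexp (- (Ci * z))) / 2)%C.

(* The principal value of x^s; only used for x > 0. *)
Definition rcpow (x : R) (s : C) : C := Cexp (s * ln x)%C.

Definition CSeries (a : nat -> C) : C :=
  (Series (fun n => Re (a n)), Series (fun n => Im (a n))).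

Definition CInt (f : R -> C) (Fa Fb : (R -> Prop) -> Prop) : C :=
  RInt_gen (V := C_R_CompleteNormedModule) f Fa Fb.

Definition analytic_at (f : C -> C) (z : C) : Prop :=
  exists (a : nat -> C) (r : R), 0 < r /\
    forall h : C, Cmod h < r ->
      is_pseries (K := C_AbsRing) (V := C_NormedModule) a h (f (z + h)%C).

(* The analytic continuation to D of the restriction of f to U.  In every use
   below U is open and nonempty and D is open, connected and contains U, so
   that the values on D are determined; the values off D are arbitrary. *)
Definition continuation (U D : C -> Prop) (f : C -> C) : C -> C :=
  epsilon (inhabits (fun _ : C => RtoC 0)) (fun g =>
    (forall z, D z -> analytic_at g z) /\ (forall z, U z -> g z = f z)).

Definition Gamma_dom (s : C) : Prop := forall n : nat, s <> (- INR n)%C.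

Definition Gamma : C -> C :=
  continuation (fun s => 0 < Re s) Gamma_dom
    (fun s => CInt (fun t => exp (- t) * rcpow t s / t)%C
                (at_right 0) (Rbar_locally p_infty)).

Definition zeta_dom (s : C) : Prop := s <> 1%C.

Definition zeta : C -> C :=
  continuation (fun s => 1 < Re s) zeta_dom
    (fun s => CSeries (fun n => rcpow (INR (S n)) (- s)%C)).

Definition Xi_formula (z : C) : C :=
  (/ 2 * (/ 2 + Ci * z) * (- / 2 + Ci * z)
   * rcpow PI (- (/ 2 + Ci * z) / 2)
   * Gamma (/ 2 * (/ 2 + Ci * z))
   * zeta (/ 2 + Ci * z))%C.

(* The formula is meaningless at the poles of its Gamma and zeta factors; these
   are removable singularities, and Xi is the resulting entire function. *)
Definition Xi : C -> C :=
  continuation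
    (fun z => Gamma_dom (/ 2 * (/ 2 + Ci * z))%C /\ zeta_dom (/ 2 + Ci * z)%C)
    (fun _ => True) Xi_formula.

Definition hyp_gamma (z : C) (a b : R) : C :=
  (4 * CInt (fun u => Ccos (2 * z * u) * exp (2 * b * u - a * exp (2 * u)))%C
         (at_point 0%R) (Rbar_locally p_infty))%C.

Definition Phi (n : nat) (z : C) : C :=
  (RtoC (2 * PI ^ 2 * INR n ^ 4) * hyp_gamma (z / 2) (INR n ^ 2 * PI) (9 / 4)
   - RtoC (3 * PI * INR n ^ 2) * hyp_gamma (z / 2) (INR n ^ 2 * PI) (5 / 4))%C.

Definition Xi_N (N : nat) (z : C) : C :=
  sum_n_m (G := C_AbelianMonoid) (fun n => Phi n z) 1 N.

Definition first_quadrant (z : C) : Prop := 0 <= Re z /\ 0 <= Im z.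

(* The second clause compares arbitrary pairs of zeros, which avoids choosing a
   finite or infinite numbering of them; see monotonic_zeros_numbered. *)
Definition monotonic_zeros (F : C -> C) (D : C -> Prop) : Prop :=
  (forall z w : C, D z -> D w -> F z = 0%C -> F w = 0%C -> Re z = Re w -> z = w) /\
  (forall z w : C, D z -> D w -> F z = 0%C -> F w = 0%C ->
     Re z < Re w -> Im z <= Im w).

(* I is the index set of the numbering: an initial segment of nat, or nat. *)
Lemma monotonic_zeros_numbered (F : C -> C) (D : C -> Prop)
    (I : nat -> Prop) (alpha : nat -> C) :
  (forall i, I (S i) -> I i) ->
  (forall z, (D z /\ F z = 0%C) <-> exists i, I i /\ z = alpha i) ->
  (forall i, I (S i) -> Re (alpha i) < Re (alpha (S i))) ->
  monotonic_zeros F D <-> (forall i, I (S i) -> Im (alpha i) <= Im (alpha (S i))).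
Proof.
intros HI Hz Hre.
assert (Hin : forall i, I i -> D (alpha i) /\ F (alpha i) = 0%C).
{ intros i Hi; apply Hz; now exists i. }
assert (HreS : forall k i, I (i + S k)%nat -> Re (alpha i) < Re (alpha (i + S k)%nat)).
{ induction k as [|k IH]; intros i Hi.
  - rewrite Nat.add_1_r in *; auto.
  - replace (i + S (S k))%nat with (S (i + S k)) in * by lia.
    apply Rlt_trans with (Re (alpha (i + S k)%nat)); auto. }
assert (Hlt : forall i j, (i < j)%nat -> I j -> Re (alpha i) < Re (alpha j)).
{ intros i j Hij Hj; replace j with (i + S (j - i - 1))%nat in * by lia; auto. }
split.
- intros [_ H] i Hi.
  destruct (Hin _ (HI _ Hi)), (Hin _ Hi); apply H; auto.
- intros Him.
  assert (Hle : forall k i, I (i + k)%nat -> Im (alpha i) <= Im (alpha (i + k)%nat)).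
  { induction k as [|k IH]; intros i Hi.
    - rewrite Nat.add_0_r; lra.
    - replace (i + S k)%nat with (S (i + k)) in * by lia.
      apply Rle_trans with (Im (alpha (i + k)%nat)); auto. }
  split; intros z w Dz Dw Fz Fw H;
    destruct (proj1 (Hz z) (conj Dz Fz)) as [i [Hi ->]];
    destruct (proj1 (Hz w) (conj Dw Fw)) as [j [Hj ->]];
    destruct (Nat.lt_trichotomy i j) as [L|[E|L]].
  + specialize (Hlt _ _ L Hj); lra.
  + now subst.
  + specialize (Hlt _ _ L Hi); lra.
  + replace j with (i + (j - i))%nat in * by lia; auto.
  + subst; lra.
  + specialize (Hlt _ _ L Hi); lra.
Qed.

(* Main.v *)
Require Import Defs.
From Stdlib Require Import Reals Lra Lia Psatz ClassicalEpsilon Classical Factorial ZArith.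
From Coquelicot Require Import Coquelicot.
Open Scope R_scope.

(** Write X(z) = 2 int_R Phi0(u) e^(izu) du, where Phi0(u) = sum_r (2 pi^2 r^4 e^(9u/2) - 3 pi r^2 e^(5u/2)) exp(-pi r^2 e^(2u)).
    The functional equation of theta makes Phi0 even, so Xi_N is the transform of a truncation of Phi0 symmetrised
    about 0, the Xi_N converge to X locally uniformly, and X = Xi.

    By Hardy's theorem X has arbitrarily large real zeros: otherwise the contour-shifted Fourier inversion of X would bound
    |Phi0(v + i al)| by |Phi0(i al)| + C uniformly for 0 <= al < pi/4, but as al tends to pi/4 the series at i al alternates,
    whereas at v = (ln 2)/2 it does not, so that the left side grows faster.

    Suppose X has a zero a off the real axis; by symmetry it may be taken in the open upper half of the first quadrant.  Pick a
    real zero b > Re a.  By Hurwitz's theorem Xi_N has, for large N, zeros near a and near b.  Folded into the first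
    quadrant, the second has larger real part and smaller imaginary part than the first, which contradicts monotonicity. *)

(** * Integrals of complex functions over the line *)

(** [Gamma], [zeta] and [Xi] are picked by [epsilon], so explicit continuations must be built first
    and then matched by an identity theorem. For zeta the continuation is read off from the
    transform X, multiplied by 1/Gamma; hence Gamma has to be shown zero-free. In the variable t =
    e^u all integrals run over the line and their integrands decay exponentially; explicit decay
    constants take the place of uniform convergence arguments. Fubini and Cauchy's theorem are
    replaced by one device, [quad_const]: a function whose increments are of second order is
    constant.

    The inversion of X would need the decay of X on the real line. A Gaussian factor exp(-eta^2 t^2)
    makes boundedness of X sufficient, and eta tends to 0 at the end. If X had constant sign at
    infinity, its inverse transform would be largest on the imaginary axis, up to a constant; this
    is the source of the bound on |Phi0(v + i al)|. The shift (ln 2)/2 is chosen because e^(2(v + i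
    al)) then tends to 2i instead of i, which squares the signs (-1)^r away. With cos(2 al) = 1/M^2
    the two sides grow like M^5 and at most like M^4. *)

Lemma Ceq (z w : C) : Re z = Re w -> Im z = Im w -> z = w.
Proof. destruct z, w; simpl; intros; subst; reflexivity. Qed.

Lemma Cmod_le_sum (z : C) : Cmod z <= Rabs (Re z) + Rabs (Im z).
Proof.
  rewrite <- (Rabs_pos_eq (Rabs (Re z) + Rabs (Im z)))
    by (generalize (Rabs_pos (Re z)) (Rabs_pos (Im z)); lra).
  rewrite <- (sqrt_Rsqr_abs (Rabs (Re z) + Rabs (Im z))).
  apply sqrt_le_1_alt. unfold Rsqr.
  generalize (Rabs_pos (Re z)) (Rabs_pos (Im z)); intros.
  assert (E1 := pow2_abs (Re z)). assert (E2 := pow2_abs (Im z)).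
  unfold Re, Im in *. nra.
Qed.

Lemma im_le_Cmod (z : C) : Rabs (Im z) <= Cmod z.
Proof. generalize (Rmax_Cmod z) (Rmax_r (Rabs (fst z)) (Rabs (snd z))). unfold Im; lra. Qed.

Lemma Cmod_Cexp (z : C) : Cmod (Cexp z) = exp (Re z).
Proof.
  unfold Cexp, Cmod; simpl.
  replace (_ + _) with (exp (Re z) * exp (Re z)).
  - apply sqrt_square. left; apply exp_pos.
  - generalize (sin2_cos2 (Im z)); unfold Rsqr; intros H.
    transitivity (exp (Re z) * exp (Re z) * (sin (Im z) * sin (Im z) + cos (Im z) * cos (Im z))).
    rewrite H; ring. ring.
Qed.

Lemma Cexp_plus (z w : C) : Cexp (z + w) = (Cexp z * Cexp w)%C.
Proof.
  apply Ceq; unfold Cexp, Cmult, Re, Im; simpl; rewrite exp_plus, ?cos_plus, ?sin_plus; ring.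
Qed.

Lemma Cexp_0 : Cexp 0 = 1%C.
Proof. apply Ceq; unfold Cexp; simpl; rewrite exp_0, ?cos_0, ?sin_0; ring. Qed.

Lemma Cexp_R (x : R) : Cexp x = RtoC (exp x).
Proof. apply Ceq; unfold Cexp; simpl; rewrite ?cos_0, ?sin_0; ring. Qed.

Lemma Cmod_Cexp_i (x : R) : Cmod (Cexp (Ci * x)) = 1.
Proof. rewrite Cmod_Cexp. simpl. replace (0 * x - 1 * 0) with 0 by ring. apply exp_0. Qed.

(** Continuity, derivatives and integrals of complex functions are taken componentwise, so that the
    real theory applies; the price is a factor 2 in several estimates. *)
Definition Ccont (f : R -> C) : Prop :=
  forall u, continuous (fun t => Re (f t)) u /\ continuous (fun t => Im (f t)) u.

Definition Cderiv (f : R -> C) (u : R) (l : C) : Prop :=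
  is_derive (fun t => Re (f t)) u (Re l) /\ is_derive (fun t => Im (f t)) u (Im l).

Lemma Ccont_ext (f g : R -> C) : (forall u, f u = g u) -> Ccont f -> Ccont g.
Proof.
  intros H Hf u; destruct (Hf u) as [H1 H2]; split.
  - apply (continuous_ext (fun t => Re (f t))); auto. intros; rewrite H; reflexivity.
  - apply (continuous_ext (fun t => Im (f t))); auto. intros; rewrite H; reflexivity.
Qed.

Lemma Ccont_const (c : C) : Ccont (fun _ => c).
Proof. intros u; split; apply continuous_const. Qed.

Lemma Ccont_RtoC (g : R -> R) : (forall u, continuous g u) -> Ccont (fun u => RtoC (g u)).
Proof. intros H u; split; simpl; [apply H | apply continuous_const]. Qed.

Lemma Ccont_plus (f g : R -> C) : Ccont f -> Ccont g -> Ccont (fun u => f u + g u)%C.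
Proof.
  intros Hf Hg u; destruct (Hf u), (Hg u); split; simpl.
  - apply (continuous_plus (fun t => Re (f t)) (fun t => Re (g t))); auto.
  - apply (continuous_plus (fun t => Im (f t)) (fun t => Im (g t))); auto.
Qed.

Lemma Ccont_opp (f : R -> C) : Ccont f -> Ccont (fun u => - f u)%C.
Proof.
  intros Hf u; destruct (Hf u); split; simpl.
  - apply (continuous_opp (fun t => Re (f t))); auto.
  - apply (continuous_opp (fun t => Im (f t))); auto.
Qed.

Lemma Ccont_minus (f g : R -> C) : Ccont f -> Ccont g -> Ccont (fun u => f u - g u)%C.
Proof. intros; apply Ccont_plus; auto; apply Ccont_opp; auto. Qed.

Lemma Ccont_mult (f g : R -> C) : Ccont f -> Ccont g -> Ccont (fun u => f u * g u)%C.
Proof.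
  intros Hf Hg u; destruct (Hf u), (Hg u); split; simpl.
  - apply (continuous_minus (fun t => Re (f t) * Re (g t)) (fun t => Im (f t) * Im (g t)));
      apply (continuous_mult (K := R_AbsRing)); auto.
  - apply (continuous_plus (fun t => Re (f t) * Im (g t)) (fun t => Im (f t) * Re (g t)));
      apply (continuous_mult (K := R_AbsRing)); auto.
Qed.

Lemma continuous_of_derivable (f : R -> R) (df : R -> R) :
  (forall u, is_derive f u (df u)) -> forall u, continuous f u.
Proof. intros H u; apply (ex_derive_continuous (V := R_NormedModule)); exists (df u); apply H. Qed.

Lemma continuous_exp (x : R) : continuous exp x.
Proof. apply (continuous_of_derivable _ exp). apply is_derive_exp. Qed.

Lemma continuous_comp' (f g : R -> R) (u : R) :
  continuous f u -> continuous g (f u) -> continuous (fun t => g (f t)) u.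
Proof. intros; apply (continuous_comp f g); auto. Qed.

Lemma Ccont_Cexp (f : R -> C) : Ccont f -> Ccont (fun u => Cexp (f u)).
Proof.
  intros Hf u; destruct (Hf u) as [A B]; split.
  1: change (continuous (fun t => exp (Re (f t)) * cos (Im (f t))) u).
  2: change (continuous (fun t => exp (Re (f t)) * sin (Im (f t))) u).
  all: apply (continuous_mult (K := R_AbsRing)).
  - apply (continuous_comp' (fun t => Re (f t)) exp); auto using continuous_exp.
  - apply (continuous_comp' (fun t => Im (f t)) cos); auto. apply continuous_cos.
  - apply (continuous_comp' (fun t => Re (f t)) exp); auto using continuous_exp.
  - apply (continuous_comp' (fun t => Im (f t)) sin); auto. apply continuous_sin.
Qed.

Lemma Cderiv_ext (f g : R -> C) u l : (forall t, f t = g t) -> Cderiv f u l -> Cderiv g u l.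
Proof.
  intros H [H1 H2]; split.
  - apply (is_derive_ext (fun t => Re (f t))); auto. intros; rewrite H; reflexivity.
  - apply (is_derive_ext (fun t => Im (f t))); auto. intros; rewrite H; reflexivity.
Qed.

Lemma Cderiv_cont (f f' : R -> C) : (forall u, Cderiv f u (f' u)) -> Ccont f.
Proof.
  intros H u; split.
  - apply continuous_of_derivable with (fun u => Re (f' u)); intros; apply H.
  - apply continuous_of_derivable with (fun u => Im (f' u)); intros; apply H.
Qed.

Lemma Cderiv_const (c : C) u : Cderiv (fun _ => c) u 0.
Proof. split; apply @is_derive_const. Qed.

Lemma Cderiv_RtoC (g : R -> R) u l : is_derive g u l -> Cderiv (fun t => RtoC (g t)) u (RtoC l).
Proof. intros H; split; simpl; auto. apply @is_derive_const. Qed.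

Lemma Cderiv_plus (f g : R -> C) u l m :
  Cderiv f u l -> Cderiv g u m -> Cderiv (fun t => f t + g t)%C u (l + m)%C.
Proof.
  intros [? ?] [? ?]; split; simpl.
  - apply (is_derive_plus (fun t => Re (f t)) (fun t => Re (g t))); auto.
  - apply (is_derive_plus (fun t => Im (f t)) (fun t => Im (g t))); auto.
Qed.

Lemma Cderiv_mult (f g : R -> C) u l m :
  Cderiv f u l -> Cderiv g u m ->
  Cderiv (fun t => f t * g t)%C u (l * g u + f u * m)%C.
Proof.
  intros [A B] [D E]; split; simpl.
  - replace (_ + _) with ((Re l * Re (g u) + Re (f u) * Re m) - (Im l * Im (g u) + Im (f u) * Im m))
      by (unfold Re, Im; ring).
    apply (is_derive_minus (fun t => Re (f t) * Re (g t)) (fun t => Im (f t) * Im (g t)));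
    apply (is_derive_mult (K := R_AbsRing)); auto; intros; apply Rmult_comm.
  - replace (_ + _) with ((Re l * Im (g u) + Re (f u) * Im m) + (Im l * Re (g u) + Im (f u) * Re m))
      by (unfold Re, Im; ring).
    apply (is_derive_plus (fun t => Re (f t) * Im (g t)) (fun t => Im (f t) * Re (g t)));
    apply (is_derive_mult (K := R_AbsRing)); auto; intros; apply Rmult_comm.
Qed.

Lemma Cderiv_Cexp (f : R -> C) u l : Cderiv f u l -> Cderiv (fun t => Cexp (f t)) u (l * Cexp (f u))%C.
Proof.
  intros [A B]; split.
  - change (is_derive (fun t => exp (Re (f t)) * cos (Im (f t))) u
      (Re l * (exp (Re (f u)) * cos (Im (f u))) - Im l * (exp (Re (f u)) * sin (Im (f u))))).
    replace (_ - _) with ((Re l * exp (Re (f u))) * cos (Im (f u)) + exp (Re (f u)) * (Im l * (- sin (Im (f u)))))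
      by (unfold Re, Im; ring).
    apply (is_derive_mult (K := R_AbsRing) (fun t => exp (Re (f t))) (fun t => cos (Im (f t)))).
    + apply (is_derive_comp exp (fun t => Re (f t))); auto. apply is_derive_exp.
    + apply (is_derive_comp cos (fun t => Im (f t))); auto. apply is_derive_cos.
    + intros; apply Rmult_comm.
  - change (is_derive (fun t => exp (Re (f t)) * sin (Im (f t))) u
      (Re l * (exp (Re (f u)) * sin (Im (f u))) + Im l * (exp (Re (f u)) * cos (Im (f u))))).
    replace (_ + _) with ((Re l * exp (Re (f u))) * sin (Im (f u)) + exp (Re (f u)) * (Im l * cos (Im (f u))))
      by (unfold Re, Im; ring).
    apply (is_derive_mult (K := R_AbsRing) (fun t => exp (Re (f t))) (fun t => sin (Im (f t)))).
    + apply (is_derive_comp exp (fun t => Re (f t))); auto. apply is_derive_exp.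
    + apply (is_derive_comp sin (fun t => Im (f t))); auto. apply is_derive_sin.
    + intros; apply Rmult_comm.
Qed.

(* Mean value inequality; the constant 2 comes from treating components separately. *)
Lemma Cderiv_bounded (f f' : R -> C) (a b M : R) :
  (forall t, Rmin a b <= t <= Rmax a b -> Cderiv f t (f' t)) ->
  (forall t, Rmin a b <= t <= Rmax a b -> Cmod (f' t) <= M) ->
  Cmod (f b - f a) <= 2 * M * Rabs (b - a).
Proof.
  intros Hd Hb.
  eapply Rle_trans; [apply Cmod_le_sum|].
  assert (A : forall p p' : R -> R,
    (forall t, Rmin a b <= t <= Rmax a b -> is_derive p t (p' t)) ->
    (forall t, Rmin a b <= t <= Rmax a b -> Rabs (p' t) <= M) ->
    Rabs (p b - p a) <= M * Rabs (b - a)).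
  { intros p p' Hp Hp'.
    destruct (MVT_gen p a b p') as [c [Hc E]].
    - intros x Hx; apply Hp; lra.
    - intros x Hx. apply continuity_pt_filterlim.
      apply (ex_derive_continuous (V := R_NormedModule)). eexists; apply Hp; lra.
    - rewrite E, Rabs_mult. apply Rmult_le_compat_r; [apply Rabs_pos | apply Hp'; lra]. }
  assert (A1 := A (fun t => Re (f t)) (fun t => Re (f' t))
     (fun t Ht => proj1 (Hd t Ht)) (fun t Ht => Rle_trans _ _ _ (re_le_Cmod _) (Hb t Ht))).
  assert (A2 := A (fun t => Im (f t)) (fun t => Im (f' t))
     (fun t Ht => proj2 (Hd t Ht)) (fun t Ht => Rle_trans _ _ _ (im_le_Cmod _) (Hb t Ht))).
  change (Re (f b - f a)%C) with (Re (f b) - Re (f a)).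
  change (Im (f b - f a)%C) with (Im (f b) - Im (f a)).
  cbv beta in A1, A2. lra.
Qed.

(** The constants are part of the predicate: integrals and tails are bounded linearly in [K], so
    convergence of integrals reduces to convergence of constants. *)
Definition Rdecay (c K : R) (f : R -> R) : Prop :=
  (forall u, continuous f u) /\ forall u, Rabs (f u) <= K * exp (- c * Rabs u).

Definition Int (f : R -> R) : R :=
  RInt_gen (V := R_CompleteNormedModule) f (Rbar_locally m_infty) (Rbar_locally p_infty).

Lemma Rdecay_ex_RInt c K f a b : Rdecay c K f -> ex_RInt f a b.
Proof. intros [H _]; apply (ex_RInt_continuous (V := R_CompleteNormedModule)); intros; apply H. Qed.

Lemma Rdecay_K_pos c K f : Rdecay c K f -> 0 <= K.
Proof.
  intros [_ H]. generalize (H 0) (Rabs_pos (f 0)).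
  rewrite Rabs_R0, Rmult_0_r, exp_0. lra.
Qed.

Lemma Rdecay_tail_r c K f a b : 0 < c -> Rdecay c K f -> 0 <= a <= b ->
  Rabs (RInt f a b) <= K / c * exp (- c * a).
Proof.
  intros Hc Hf [Ha Hab].
  assert (HK := Rdecay_K_pos _ _ _ Hf).
  assert (D : is_RInt (fun u => K * exp (- c * u)) a b (K / c * exp (- c * a) - K / c * exp (- c * b))).
  { replace (_ - _) with ((- (K / c) * exp (- c * b)) - (- (K / c) * exp (- c * a))) by ring.
    apply (is_RInt_derive (V := R_CompleteNormedModule) (fun u => - (K / c) * exp (- c * u))).
    - intros x _. auto_derive; auto. field. apply Rgt_not_eq; lra.
    - intros x _. apply (ex_derive_continuous (V := R_NormedModule)). auto_derive; auto. }
  apply Rle_trans with (RInt (fun u => K * exp (- c * u)) a b).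
    eapply Rle_trans; [apply abs_RInt_le; auto; apply (Rdecay_ex_RInt c K); auto|].
    apply RInt_le; auto.
    + apply (ex_RInt_continuous (V := R_CompleteNormedModule)); intros.
      apply continuous_comp'; [apply Hf | apply continuous_Rabs].
    + eexists; apply D.
    + intros x Hx. rewrite <- (Rabs_pos_eq x) at 2 by lra. apply Hf.
  - rewrite (is_RInt_unique _ _ _ _ D).
    assert (0 <= K / c * exp (- c * b)); [|lra].
    apply Rmult_le_pos; [apply Rdiv_le_0_compat; lra | left; apply exp_pos].
Qed.

Lemma Rdecay_opp c K f : Rdecay c K f -> Rdecay c K (fun u => f (- u)).
Proof.
  intros [H1 H2]; split.
  - intros u. apply (continuous_comp' Ropp f); auto.
    apply (continuous_opp (fun t : R => t)), continuous_id.
  - intros u. rewrite <- (Rabs_Ropp u). apply H2.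
Qed.

Lemma RInt_reflect c K f a b : Rdecay c K f -> RInt f a b = RInt (fun u => f (- u)) (- b) (- a).
Proof.
  intros Hf. symmetry. apply is_RInt_unique.
  assert (H := RInt_correct f a b (Rdecay_ex_RInt c K f a b Hf)).
  apply (is_RInt_swap (V := R_NormedModule)) in H.
  rewrite <- (Ropp_involutive a), <- (Ropp_involutive b) in H.
  apply (is_RInt_comp_opp (V := R_NormedModule)) in H.
  apply (is_RInt_opp (V := R_NormedModule)) in H.
  rewrite !Ropp_involutive in H.
  revert H. apply is_RInt_ext. intros x _. apply (opp_opp (G := R_AbelianGroup)).
Qed.

Lemma Rdecay_tail_l c K f a b : 0 < c -> Rdecay c K f -> a <= b <= 0 ->
  Rabs (RInt f a b) <= K / c * exp (c * b).
Proof.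
  intros Hc Hf Hab. rewrite (RInt_reflect c K) by auto.
  replace (c * b) with (- c * (- b)) by ring.
  apply Rdecay_tail_r; auto using Rdecay_opp. lra.
Qed.

Lemma Rdecay_sum c K f a b : 0 < c -> Rdecay c K f -> a <= 0 <= b -> Rabs (RInt f a b) <= 2 * K / c.
Proof.
  intros Hc Hf Hab.
  rewrite <- (RInt_Chasles (V := R_CompleteNormedModule) f a 0 b) by (apply (Rdecay_ex_RInt c K); auto).
  eapply Rle_trans; [apply Rabs_triang|].
  generalize (Rdecay_tail_l c K f a 0 Hc Hf ltac:(lra)) (Rdecay_tail_r c K f 0 b Hc Hf ltac:(lra)).
  rewrite !Rmult_0_r, exp_0, !Rmult_1_r. lra.
Qed.

Lemma exp_decay_small (c K eps : R) : 0 < c -> 0 <= K -> 0 < eps ->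
  exists M, 0 < M /\ forall u, M <= u -> K * exp (- c * u) < eps.
Proof.
  intros Hc HK He.
  (* Beyond this point c u > K / eps, and exp (c u) exceeds c u. *)
  exists (Rmax 1 (K / (c * eps) + 1)). split.
  - generalize (Rmax_l 1 (K / (c * eps) + 1)); lra.
  - intros u Hu.
    assert (H1 := Rmax_l 1 (K / (c * eps) + 1)). assert (H2 := Rmax_r 1 (K / (c * eps) + 1)).
    assert (Hu' : K / (c * eps) < u) by lra.
    replace (- c * u) with (- (c * u)) by ring. rewrite exp_Ropp.
    assert (Hcu : 0 < c * u) by (apply Rmult_lt_0_compat; lra).
    assert (H3 := exp_ineq1 (c * u) ltac:(lra)).
    apply Rmult_lt_reg_r with (exp (c * u)); [apply exp_pos|].
    rewrite Rmult_assoc, Rinv_l, Rmult_1_r by (apply Rgt_not_eq, exp_pos).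
    assert (H4 : K < u * (c * eps)).
    { apply Rmult_lt_reg_r with (/ (c * eps)).
      - apply Rinv_0_lt_compat, Rmult_lt_0_compat; lra.
      - rewrite Rmult_assoc, Rinv_r, Rmult_1_r; [exact Hu'|].
        apply Rgt_not_eq, Rmult_lt_0_compat; lra. }
    nra.
Qed.

Definition line := filter_prod (Rbar_locally m_infty) (Rbar_locally p_infty).

Lemma line_intro (P : R * R -> Prop) (M : R) :
  (forall a b, a < - M -> M < b -> P (a, b)) -> line P.
Proof.
  intros H. apply (Filter_prod _ _ _ (fun a => a < - M) (fun b => M < b)).
  - exists (- M); auto.
  - exists M; auto.
  - intros; apply H; auto.
Qed.

(** Cauchy's criterion along the product filter: two truncations beyond [M] differ by one integral
    in each tail, and each of these is below eps / 2. *)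
Lemma Int_correct c K f : 0 < c -> Rdecay c K f ->
  filterlim (fun ab => RInt f (fst ab) (snd ab)) line (locally (Int f)).
Proof.
  intros Hc Hf.
  assert (Hex := fun a b => Rdecay_ex_RInt c K f a b Hf).
  assert (L : exists l, filterlim (fun ab => RInt f (fst ab) (snd ab)) line (locally l)).
  { apply (filterlim_locally_cauchy (U := R_CompleteSpace)
      (F := line) (fun ab => RInt f (fst ab) (snd ab))).
    intros eps.
    destruct (exp_decay_small c (4 * (K / c)) eps Hc) as [M [HM0 HM]].
    - apply Rmult_le_pos; [lra|]. apply Rdiv_le_0_compat; [eapply Rdecay_K_pos; eauto|lra].
    - apply cond_pos.
    - exists (fun ab => fst ab < - M /\ M < snd ab). split.
      + apply line_intro with M; auto.
      + intros [a b] [a' b'] [Ha Hb] [Ha' Hb']; simpl in *.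
        assert (T1 : forall x y, M < x -> M < y -> Rabs (RInt f x y) < eps / 2).
        { intros x y Hx Hy.
          assert (T : forall x y, M < x -> x <= y -> Rabs (RInt f x y) < eps / 2).
          { clear x y Hx Hy. intros x y Hx Hxy.
            apply Rle_lt_trans with (K / c * exp (- c * x)).
            - apply Rdecay_tail_r; auto; lra.
            - generalize (HM x ltac:(lra)) (exp_pos (- c * x)) (Rdecay_K_pos _ _ _ Hf).
              intros A B D. assert (0 <= K / c * exp (- c * x)).
              { apply Rmult_le_pos; [apply Rdiv_le_0_compat; lra|lra]. } 
              assert (0 < eps) by apply cond_pos. lra. }
          destruct (Rle_dec x y); [auto|].
          rewrite <- (opp_RInt_swap (V := R_CompleteNormedModule)) by auto.
          change (Rabs (- RInt f y x) < eps / 2). rewrite Rabs_Ropp. apply T; lra. }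
        assert (T2 : forall x y, x < - M -> y < - M -> Rabs (RInt f x y) < eps / 2).
        { intros x y Hx Hy.
          assert (T : forall x y, y < - M -> x <= y -> Rabs (RInt f x y) < eps / 2).
          { clear x y Hx Hy. intros x y Hx Hxy.
            apply Rle_lt_trans with (K / c * exp (c * y)).
            - apply Rdecay_tail_l; auto; lra.
            - generalize (HM (- y) ltac:(lra)) (exp_pos (c * y)) (Rdecay_K_pos _ _ _ Hf).
              replace (- c * - y) with (c * y) by ring.
              intros A B D. assert (0 <= K / c * exp (c * y)).
              { apply Rmult_le_pos; [apply Rdiv_le_0_compat; lra|lra]. } 
              assert (0 < eps) by apply cond_pos. lra. }
          destruct (Rle_dec x y); [auto|].
          rewrite <- (opp_RInt_swap (V := R_CompleteNormedModule)) by auto.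
          change (Rabs (- RInt f y x) < eps / 2). rewrite Rabs_Ropp. apply T; lra. }
        change (Rabs (RInt f a' b' - RInt f a b) < eps).
        assert (E1 := RInt_Chasles (V := R_CompleteNormedModule) f a' a b' (Hex _ _) (Hex _ _)).
        assert (E2 := RInt_Chasles (V := R_CompleteNormedModule) f a b b' (Hex _ _) (Hex _ _)).
        unfold plus in E1, E2; simpl in E1, E2.
        rewrite <- E1, <- E2.
        generalize (T1 b b' ltac:(lra) ltac:(lra)) (T2 a' a ltac:(lra) ltac:(lra)).
        intros A B.
        replace (_ - _) with (RInt f a' a + RInt f b b') by ring.
        eapply Rle_lt_trans; [apply Rabs_triang|]. lra. }
  destruct L as [l Hl].
  replace (Int f) with l; auto.
  symmetry. apply is_RInt_gen_unique.
  intros P HP. specialize (Hl P HP). unfold filtermapi, filtermap in *.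
  revert Hl. apply filter_imp. intros [a b] H; simpl in *.
  exists (RInt f a b); split; [|exact H]. apply (RInt_correct (V := R_CompleteNormedModule)); auto.
Qed.

Lemma Int_is_RInt_gen c K f : 0 < c -> Rdecay c K f ->
  is_RInt_gen f (Rbar_locally m_infty) (Rbar_locally p_infty) (Int f).
Proof.
  intros Hc Hf P HP. generalize (Int_correct c K f Hc Hf P HP).
  unfold filtermapi, filtermap. apply filter_imp. intros [a b] H; simpl in *.
  exists (RInt f a b); split; [|exact H]. apply (RInt_correct (V := R_CompleteNormedModule)), (Rdecay_ex_RInt c K); auto.
Qed.

Lemma Int_lim_seq c K f (a b : nat -> R) : 0 < c -> Rdecay c K f ->
  is_lim_seq a m_infty -> is_lim_seq b p_infty ->
  is_lim_seq (fun n => RInt f (a n) (b n)) (Int f).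
Proof.
  intros Hc Hf Ha Hb.
  apply (filterlim_comp nat (R * R) R (fun n => (a n, b n)) (fun ab => RInt f (fst ab) (snd ab))
    eventually line).
  - apply filterlim_pair; auto.
  - apply (Int_correct c K); auto.
Qed.

Lemma is_lim_seq_INR_opp : is_lim_seq (fun n => - INR n) m_infty.
Proof. apply (is_lim_seq_opp INR p_infty), is_lim_seq_INR. Qed.

Lemma Int_seq c K f : 0 < c -> Rdecay c K f -> is_lim_seq (fun n => RInt f (- INR n) (INR n)) (Int f).
Proof. intros; apply (Int_lim_seq c K); auto using is_lim_seq_INR_opp, is_lim_seq_INR. Qed.

Lemma Int_unique c K f l : 0 < c -> Rdecay c K f ->
  is_lim_seq (fun n => RInt f (- INR n) (INR n)) (Finite l) -> Int f = l.
Proof.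
  intros Hc Hf Hl. generalize (is_lim_seq_unique _ _ (Int_seq c K f Hc Hf)).
  rewrite (is_lim_seq_unique _ _ Hl). congruence.
Qed.

Lemma Int_bound c K f : 0 < c -> Rdecay c K f -> Rabs (Int f) <= 2 * K / c.
Proof.
  intros Hc Hf.
  apply (is_lim_seq_le (fun n => Rabs (RInt f (- INR n) (INR n))) (fun _ => 2 * K / c)
    (Rabs (Int f)) (2 * K / c)).
  - intros n. apply Rdecay_sum; auto. generalize (pos_INR n); lra.
  - apply (is_lim_seq_abs _ (Int f)), (Int_seq c K); auto.
  - apply is_lim_seq_const.
Qed.

Lemma Int_ext f g : (forall u, f u = g u) -> Int f = Int g.
Proof. intros H. unfold Int. f_equal. apply FunctionalExtensionality.functional_extensionality; auto. Qed.

Lemma Int_lin c K1 K2 f g x y : 0 < c -> Rdecay c K1 f -> Rdecay c K2 g ->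
  Int (fun u => x * f u + y * g u) = x * Int f + y * Int g.
Proof.
  intros Hc Hf Hg.
  assert (H := is_RInt_gen_plus (V := R_NormedModule) (Fa := Rbar_locally m_infty)
    (Fb := Rbar_locally p_infty) _ _ _ _
    (is_RInt_gen_scal (V := R_NormedModule) f x _ (Int_is_RInt_gen c K1 f Hc Hf))
    (is_RInt_gen_scal (V := R_NormedModule) g y _ (Int_is_RInt_gen c K2 g Hc Hg))).
  exact (is_RInt_gen_unique (V := R_CompleteNormedModule) _ _ H).
Qed.

Lemma Int_le c K1 K2 f g : 0 < c -> Rdecay c K1 f -> Rdecay c K2 g ->
  (forall u, f u <= g u) -> Int f <= Int g.
Proof.
  intros Hc Hf Hg H.
  apply (is_lim_seq_le (fun n => RInt f (- INR n) (INR n)) (fun n => RInt g (- INR n) (INR n))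
    (Int f) (Int g)).
  - intros n. apply RInt_le.
    + generalize (pos_INR n); lra.
    + eapply Rdecay_ex_RInt; eauto.
    + eapply Rdecay_ex_RInt; eauto.
    + auto.
  - eapply Int_seq; eauto.
  - eapply Int_seq; eauto.
Qed.

(** Sums the indices below [n], so inductions start from the empty sum; [sum_n a n] corresponds to
    [Csum a (S n)]. *)
Fixpoint Csum (a : nat -> C) (n : nat) : C :=
  match n with O => 0 | S n => Csum a n + a n end%C.

(** Convergence is expressed by the modulus of the remainder, a real sequence, so that squeezing
    arguments apply directly. *)
Definition Cser (a : nat -> C) (l : C) : Prop :=
  is_lim_seq (fun n => Cmod (l - Csum a n)) 0.

Lemma is_lim_seq_squeeze0 (u v : nat -> R) :
  (forall n, 0 <= u n <= v n) -> is_lim_seq v 0 -> is_lim_seq u 0.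
Proof. intros H Hv. apply is_lim_seq_le_le with (fun _ => 0) v; auto. apply is_lim_seq_const. Qed.

Lemma is_lim_seq_plus0 (u v : nat -> R) :
  is_lim_seq u 0 -> is_lim_seq v 0 -> is_lim_seq (fun n => u n + v n) 0.
Proof. intros. replace (Finite 0) with (Finite (0 + 0)) by (f_equal; ring). apply is_lim_seq_plus'; auto. Qed.

Lemma is_lim_seq_scal0 (u : nat -> R) k : is_lim_seq u 0 -> is_lim_seq (fun n => k * u n) 0.
Proof.
  intros H. replace (Finite 0) with (Rbar_mult k 0) by (simpl; f_equal; ring).
  apply is_lim_seq_scal_l; auto.
Qed.

Lemma zero_of_small (z : C) (u : nat -> R) :
  (forall n, Cmod z <= u n) -> is_lim_seq u 0 -> z = 0%C.
Proof.
  intros H Hu. apply Cmod_eq_0. apply Rle_antisym; [|apply Cmod_ge_0].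
  apply (is_lim_seq_le (fun _ => Cmod z) u (Cmod z) 0); auto. apply is_lim_seq_const.
Qed.

Lemma Cminus_eq (x y : C) : (x - y = 0)%C -> x = y.
Proof. intros H. replace x with (x - y + y)%C by ring. rewrite H; ring. Qed.

Lemma Cmod_sub_sym (x y : C) : Cmod (x - y) = Cmod (y - x).
Proof. rewrite <- Cmod_opp. f_equal; ring. Qed.

Lemma Cmod_tri (x y z : C) : Cmod (x - z) <= Cmod (x - y) + Cmod (y - z).
Proof. replace (x - z)%C with ((x - y) + (y - z))%C by ring. apply Cmod_triangle. Qed.

Lemma Cser_unique a l m : Cser a l -> Cser a m -> l = m.
Proof.
  intros H1 H2. apply Cminus_eq.
  apply zero_of_small with (fun n => Cmod (l - Csum a n) + Cmod (m - Csum a n)).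
  - intros n. rewrite (Cmod_sub_sym m). apply Cmod_tri.
  - apply is_lim_seq_plus0; auto.
Qed.

Lemma Csum_ext a b n : (forall k, (k < n)%nat -> a k = b k) -> Csum a n = Csum b n.
Proof. induction n as [|n IH]; intros H; simpl; auto. rewrite IH, H; auto. Qed.

Lemma Csum_plus a b n : Csum (fun k => a k + b k)%C n = (Csum a n + Csum b n)%C.
Proof. induction n as [|n IH]; simpl; [ring | rewrite IH; ring]. Qed.

Lemma Csum_scal c a n : Csum (fun k => c * a k)%C n = (c * Csum a n)%C.
Proof. induction n as [|n IH]; simpl; [ring | rewrite IH; ring]. Qed.

Lemma Cser_ext a b l : (forall k, a k = b k) -> Cser a l -> Cser b l.
Proof.
  intros H. apply is_lim_seq_ext. intros n. rewrite (Csum_ext a b); auto.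
Qed.

Lemma Cser_plus a b l m : Cser a l -> Cser b m -> Cser (fun k => a k + b k)%C (l + m)%C.
Proof.
  intros H1 H2.
  apply is_lim_seq_squeeze0 with (fun n => Cmod (l - Csum a n) + Cmod (m - Csum b n)).
  - intros n; split; [apply Cmod_ge_0|]. rewrite Csum_plus.
    replace (l + m - (Csum a n + Csum b n))%C with ((l - Csum a n) + (m - Csum b n))%C by ring.
    apply Cmod_triangle.
  - apply is_lim_seq_plus0; auto.
Qed.

Lemma Cser_scal c a l : Cser a l -> Cser (fun k => c * a k)%C (c * l)%C.
Proof.
  intros H. apply is_lim_seq_ext with (fun n => Cmod c * Cmod (l - Csum a n)).
  - intros n. rewrite Csum_scal, <- Cmod_mult. f_equal; ring.
  - apply is_lim_seq_scal0; auto.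
Qed.

Lemma Cser_minus a b l m : Cser a l -> Cser b m -> Cser (fun k => a k - b k)%C (l - m)%C.
Proof.
  intros H1 H2. generalize (Cser_plus _ _ _ _ H1 (Cser_scal (-(1))%C _ _ H2)).
  replace (l + - (1) * m)%C with (l - m)%C by ring.
  apply Cser_ext. intros; ring.
Qed.

Lemma Re_Csum a n : Re (Csum a (S n)) = sum_n (fun k => Re (a k)) n.
Proof.
  induction n as [|n IH].
  - simpl. rewrite sum_O. unfold Re; simpl. ring.
  - rewrite sum_Sn, <- IH. reflexivity.
Qed.

Lemma Im_Csum a n : Im (Csum a (S n)) = sum_n (fun k => Im (a k)) n.
Proof.
  induction n as [|n IH].
  - simpl. rewrite sum_O. unfold Im; simpl. ring.
  - rewrite sum_Sn, <- IH. reflexivity.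
Qed.

Lemma is_lim_seq_minus0 (u : nat -> R) l : is_lim_seq (fun n => Rabs (l - u n)) 0 <-> is_lim_seq u l.
Proof.
  rewrite <- (is_lim_seq_spec u), <- is_lim_seq_spec. split; intros H eps;
  destruct (H eps) as [N HN]; exists N; intros n Hn; specialize (HN n Hn).
  - rewrite Rminus_0_r, Rabs_Rabsolu in HN. rewrite Rabs_minus_sym. exact HN.
  - rewrite Rminus_0_r, Rabs_Rabsolu, Rabs_minus_sym. exact HN.
Qed.

Lemma Cser_components a l :
  Cser a l <-> is_series (fun k => Re (a k)) (Re l) /\ is_series (fun k => Im (a k)) (Im l).
Proof.
  split.
  - intros H. apply is_lim_seq_incr_1 in H. split.
    + apply (proj1 (is_lim_seq_minus0 (sum_n (fun k => Re (a k))) (Re l))).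
      refine (is_lim_seq_squeeze0 _ _ _ H). intros n; split; [apply Rabs_pos|].
      rewrite <- Re_Csum. apply (re_le_Cmod (l - Csum a (S n))).
    + apply (proj1 (is_lim_seq_minus0 (sum_n (fun k => Im (a k))) (Im l))).
      refine (is_lim_seq_squeeze0 _ _ _ H). intros n; split; [apply Rabs_pos|].
      rewrite <- Im_Csum. apply (im_le_Cmod (l - Csum a (S n))).
  - intros [H1 H2]. apply (is_lim_seq_incr_1 (fun n => Cmod (l - Csum a n))).
    apply (proj2 (is_lim_seq_minus0 (sum_n (fun k => Re (a k))) (Re l))) in H1.
    apply (proj2 (is_lim_seq_minus0 (sum_n (fun k => Im (a k))) (Im l))) in H2.
    refine (is_lim_seq_squeeze0 _ _ _ (is_lim_seq_plus0 _ _ H1 H2)).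
    intros n; split; [apply Cmod_ge_0|].
    rewrite <- Re_Csum, <- Im_Csum. apply Cmod_le_sum.
Qed.

Lemma Csum_tail a n m : Csum a (n + m) = (Csum a n + Csum (fun k => a (n + k)%nat) m)%C.
Proof.
  induction m as [|m IH]; simpl.
  - rewrite Nat.add_0_r. ring.
  - rewrite Nat.add_succ_r. simpl. rewrite IH. ring.
Qed.

Lemma Cser_le a b l : Cser a l -> (forall n, Cmod (a n) <= b n) -> ex_series b -> Cmod l <= Series b.
Proof.
  intros Ha Hb [B HB].
  rewrite (is_series_unique _ _ HB).
  apply is_lim_seq_incr_1 in Ha.
  apply (is_lim_seq_le (fun _ => Cmod l) (fun n => Cmod (l - Csum a (S n)) + sum_n b n) (Cmod l) B).
  - intros n. assert (E : Cmod (Csum a (S n)) <= sum_n b n).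
    { induction n as [|n IH].
      - simpl. rewrite sum_O. eapply Rle_trans; [apply Cmod_triangle|]. rewrite Cmod_0.
        generalize (Hb 0%nat); lra.
      - rewrite sum_Sn. change (Csum a (S (S n))) with (Csum a (S n) + a (S n))%C.
        eapply Rle_trans; [apply Cmod_triangle|]. apply Rplus_le_compat; auto. }
    generalize (Cmod_triangle (l - Csum a (S n)) (Csum a (S n))).
    replace (l - Csum a (S n) + Csum a (S n))%C with l by ring. lra.
  - apply is_lim_seq_const.
  - replace (Finite B) with (Finite (0 + B)) by (f_equal; ring).
    apply is_lim_seq_plus'; auto.
Qed.

Lemma Cser_ex a b : (forall n, Cmod (a n) <= b n) -> ex_series b -> exists l, Cser a l.
Proof.
  intros Ha Hb.
  destruct (ex_series_le (V := R_CompleteNormedModule) (fun k => Re (a k)) b) as [x Hx]; auto.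
  { intros n. eapply Rle_trans; [apply re_le_Cmod|apply Ha]. }
  destruct (ex_series_le (V := R_CompleteNormedModule) (fun k => Im (a k)) b) as [y Hy]; auto.
  { intros n. eapply Rle_trans; [apply im_le_Cmod|apply Ha]. }
  exists (x, y). apply Cser_components; split; auto.
Qed.

Lemma Cser_incr_n a l n : Cser a l -> Cser (fun k => a (n + k)%nat) (l - Csum a n)%C.
Proof.
  intros H. unfold Cser in *. apply is_lim_seq_incr_n with (N := n) in H.
  eapply is_lim_seq_ext; [|exact H].
  intros k; simpl. f_equal. rewrite Nat.add_comm, Csum_tail. ring.
Qed.

Definition tail (b : nat -> R) (n : nat) : R := Series (fun k => b (n + k)%nat).

Lemma ex_series_tail (b : nat -> R) n : ex_series b -> ex_series (fun k => b (n + k)%nat).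
Proof. intros H. apply ex_series_incr_n; auto. Qed.

Lemma tail_lim (b : nat -> R) : ex_series b -> is_lim_seq (tail b) 0.
Proof.
  intros H. apply is_lim_seq_incr_1.
  apply is_lim_seq_ext with (fun n => Series b - sum_n b n).
  - intros n. unfold tail. rewrite (Series_incr_n b (S n)); auto; [|lia].
    rewrite <- sum_n_Reals. simpl pred. ring.
  - replace (Finite 0) with (Finite (Series b - Series b)) by (f_equal; ring).
    apply is_lim_seq_minus'; [apply is_lim_seq_const|]. apply (Series_correct _ H).
Qed.

Lemma Cser_tail a b l n : Cser a l -> (forall k, Cmod (a k) <= b k) -> ex_series b ->
  Cmod (l - Csum a n) <= tail b n.
Proof.
  intros. apply Cser_le with (fun k => a (n + k)%nat); auto using Cser_incr_n.
  apply ex_series_tail; auto.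
Qed.

(** The eps / 3 argument, run once for an additive projection [p] bounded by the modulus and then
    used for [Re] and [Im]. *)
Lemma Ccont_unif (f : R -> C) (g : nat -> R -> C) (T : nat -> R) :
  (forall n, Ccont (g n)) -> (forall n u, Cmod (f u - g n u) <= T n) -> is_lim_seq T 0 -> Ccont f.
Proof.
  intros Hg Hf HT.
  assert (A : forall (p : C -> R) (u : R), (forall x y, p (x - y)%C = p x - p y) ->
    (forall x, Rabs (p x) <= Cmod x) -> (forall n, continuous (fun t => p (g n t)) u) ->
    continuous (fun t => p (f t)) u).
  { intros p u Hp Hp' Hc. apply filterlim_locally. intros eps.
    assert (He : 0 < eps / 3) by (generalize (cond_pos eps); lra).
    apply is_lim_seq_spec in HT. destruct (HT (mkposreal _ He)) as [n Hn].
    specialize (Hn n (le_n n)). simpl in Hn.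
    generalize (proj1 (filterlim_locally (fun t => p (g n t)) (p (g n u))) (Hc n) (mkposreal _ He)).
    apply filter_imp. intros t Ht. change (Rabs (p (g n t) - p (g n u)) < eps / 3) in Ht.
    change (Rabs (p (f t) - p (f u)) < eps).
    assert (H1 := Hp' (f t - g n t)%C). assert (H2 := Hp' (f u - g n u)%C).
    rewrite Hp in H1, H2. assert (H3 := Hf n t). assert (H4 := Hf n u).
    rewrite Rminus_0_r in Hn. assert (H5 := Rle_abs (T n)).
    apply Rabs_def2 in Ht. apply Rabs_def1;
    assert (H6 := Rle_trans _ _ _ H1 H3); assert (H7 := Rle_trans _ _ _ H2 H4);
    apply Rabs_le_between in H6; apply Rabs_le_between in H7; lra. }
  intros u; split.
  - apply (A Re). { intros; reflexivity. } { apply re_le_Cmod. } intros; apply Hg.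
  - apply (A Im). { intros; reflexivity. } { apply im_le_Cmod. } intros; apply Hg.
Qed.

(** * Complex integrals of exponentially decaying functions *)

Definition CR (f : R -> C) (a b : R) : C := (RInt (fun t => Re (f t)) a b, RInt (fun t => Im (f t)) a b).

Definition CI (f : R -> C) : C := (Int (fun t => Re (f t)), Int (fun t => Im (f t))).

Definition Cdecay (c K : R) (f : R -> C) : Prop :=
  Ccont f /\ forall u, Cmod (f u) <= K * exp (- c * Rabs u).

Lemma Cdecay_re c K f : Cdecay c K f -> Rdecay c K (fun u => Re (f u)).
Proof. intros [H1 H2]; split; [apply H1|]. intros. eapply Rle_trans; [apply re_le_Cmod|auto]. Qed.

Lemma Cdecay_im c K f : Cdecay c K f -> Rdecay c K (fun u => Im (f u)).
Proof. intros [H1 H2]; split; [apply H1|]. intros. eapply Rle_trans; [apply im_le_Cmod|auto]. Qed.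

Lemma Cdecay_K_pos c K f : Cdecay c K f -> 0 <= K.
Proof. intros H; apply Cdecay_re in H; eapply Rdecay_K_pos; eauto. Qed.

Lemma Rdecay_plus c K1 K2 f g : Rdecay c K1 f -> Rdecay c K2 g -> Rdecay c (K1 + K2) (fun u => f u + g u).
Proof.
  intros [A B] [A' B']; split.
  - intros; apply (continuous_plus f g); auto.
  - intros u. generalize (B u) (B' u) (Rabs_triang (f u) (g u)); lra.
Qed.

Lemma Rdecay_scal c K k f : Rdecay c K f -> Rdecay c (Rabs k * K) (fun u => k * f u).
Proof.
  intros [A B]; split.
  - intros; apply (continuous_scal_r k f); auto.
  - intros u. rewrite Rabs_mult, Rmult_assoc. apply Rmult_le_compat_l; auto using Rabs_pos.
Qed.

Lemma exp_le (x y : R) : x <= y -> exp x <= exp y.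
Proof. intros [H| ->]; [left; apply exp_increasing; auto | right; auto]. Qed.

Lemma Cdecay_weaken c c' K K' f : c' <= c -> K <= K' -> Cdecay c K f -> Cdecay c' K' f.
Proof.
  intros Hc HK H. assert (HK0 := Cdecay_K_pos _ _ _ H). destruct H as [A B]; split; auto.
  intros u; eapply Rle_trans; [apply B|].
  apply Rmult_le_compat; auto; [left; apply exp_pos|].
  apply exp_le. generalize (Rabs_pos u). nra.
Qed.

Lemma Cdecay_plus c K1 K2 f g : Cdecay c K1 f -> Cdecay c K2 g -> Cdecay c (K1 + K2) (fun u => f u + g u)%C.
Proof.
  intros [A B] [A' B']; split.
  - apply Ccont_plus; auto.
  - intros u. generalize (B u) (B' u) (Cmod_triangle (f u) (g u)); lra.
Qed.

Lemma Cdecay_scal c K z f : Cdecay c K f -> Cdecay c (Cmod z * K) (fun u => z * f u)%C.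
Proof.
  intros [A B]; split.
  - apply Ccont_mult; auto using Ccont_const.
  - intros u. rewrite Cmod_mult, Rmult_assoc. apply Rmult_le_compat_l; auto using Cmod_ge_0.
Qed.

Lemma Cdecay_minus c K1 K2 f g : Cdecay c K1 f -> Cdecay c K2 g -> Cdecay c (K1 + K2) (fun u => f u - g u)%C.
Proof.
  intros [A B] [A' B']; split.
  - apply Ccont_minus; auto.
  - intros u. generalize (B u) (B' u) (Cmod_triangle (f u) (- g u)). rewrite Cmod_opp. 
    unfold Cminus. lra.
Qed.

Lemma Cdecay_ext c K f g : (forall u, f u = g u) -> Cdecay c K f -> Cdecay c K g.
Proof.
  intros H [A B]; split. apply (Ccont_ext f); auto. intros; rewrite <- H; auto.
Qed.

Lemma CI_ext f g : (forall u, f u = g u) -> CI f = CI g.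
Proof. intros H; unfold CI; f_equal; apply Int_ext; intros; rewrite H; auto. Qed.

Lemma CI_plus c K1 K2 f g : 0 < c -> Cdecay c K1 f -> Cdecay c K2 g ->
  CI (fun u => f u + g u)%C = (CI f + CI g)%C.
Proof.
  intros Hc Hf Hg. apply Ceq; simpl.
  - rewrite <- (Rmult_1_l (Int (fun t => Re (f t)))), <- (Rmult_1_l (Int (fun t => Re (g t)))).
    rewrite <- (Int_lin c K1 K2); auto using Cdecay_re. apply Int_ext; intros; unfold Re, Im; simpl; ring.
  - rewrite <- (Rmult_1_l (Int (fun t => Im (f t)))), <- (Rmult_1_l (Int (fun t => Im (g t)))).
    rewrite <- (Int_lin c K1 K2); auto using Cdecay_im. apply Int_ext; intros; unfold Re, Im; simpl; ring.
Qed.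

Lemma CI_scal c K z f : 0 < c -> Cdecay c K f -> CI (fun u => z * f u)%C = (z * CI f)%C.
Proof.
  intros Hc Hf. apply Ceq; simpl.
  - replace (fst z * Int (fun t => Re (f t)) - snd z * Int (fun t => Im (f t)))
      with (fst z * Int (fun t => Re (f t)) + - snd z * Int (fun t => Im (f t))) by ring.
    rewrite <- (Int_lin c K K); auto using Cdecay_re, Cdecay_im. all: try (apply Int_ext; intros; unfold Re, Im; simpl; ring).
  - rewrite <- (Int_lin c K K); auto using Cdecay_re, Cdecay_im. all: try (apply Int_ext; intros; unfold Re, Im; simpl; ring).
Qed.

Lemma CI_minus c K1 K2 f g : 0 < c -> Cdecay c K1 f -> Cdecay c K2 g ->
  CI (fun u => f u - g u)%C = (CI f - CI g)%C.
Proof.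
  intros Hc Hf Hg. transitivity (CI f + (-(1)) * CI g)%C; [|ring].
  rewrite <- (CI_scal c K2) by auto.
  rewrite <- (CI_plus c K1 (Cmod (-(1)) * K2)); auto using Cdecay_scal.
  apply CI_ext; intros; ring.
Qed.

(** One K / c for each half-line and each component. *)
Lemma CI_bound c K f : 0 < c -> Cdecay c K f -> Cmod (CI f) <= 4 * K / c.
Proof.
  intros Hc Hf. eapply Rle_trans; [apply Cmod_le_sum|]. simpl.
  generalize (Int_bound c K _ Hc (Cdecay_re _ _ _ Hf)) (Int_bound c K _ Hc (Cdecay_im _ _ _ Hf)).
  unfold Rdiv; lra.
Qed.

(** Here the constant must be 1, since [J_ineq] compares two integrals of the same size. Multiplying
    by the conjugate of [CI f] makes the integral real: |CI f|^2 is the integral of Re(conj(CI f)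
    f), which is at most |CI f| times the integral of [g]. *)
Lemma CI_le c K f g : 0 < c -> Cdecay c K f -> Rdecay c K g -> (forall u, Cmod (f u) <= g u) ->
  Cmod (CI f) <= Int g.
Proof.
  intros Hc Hf Hg H.
  destruct (Req_dec (Cmod (CI f)) 0) as [E|E].
  - rewrite E. replace 0 with (0 * Int g + 0 * Int g) by ring.
    rewrite <- (Int_lin c K K) by auto.
    eapply (Int_le c); [exact Hc| | |].
    + apply Rdecay_plus; apply Rdecay_scal; eauto.
    + eauto.
    + intros u. generalize (H u) (Cmod_ge_0 (f u)); lra.
  - assert (P : 0 < Cmod (CI f)) by (generalize (Cmod_ge_0 (CI f)); lra).
    apply Rmult_le_reg_l with (Cmod (CI f)); auto.
    transitivity (Re (CI f) * Int (fun u => Re (f u)) + Im (CI f) * Int (fun u => Im (f u))).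
    + right. change (Int (fun u => Re (f u))) with (Re (CI f)).
      change (Int (fun u => Im (f u))) with (Im (CI f)).
      generalize (Cmod2_alt (CI f)). simpl. lra.
    + rewrite <- (Int_lin c K K) by auto using Cdecay_re, Cdecay_im.
      transitivity (Cmod (CI f) * Int g + 0 * Int g); [|lra].
      rewrite <- (Int_lin c K K) by auto.
      eapply (Int_le c); [exact Hc| | |].
      * apply Rdecay_plus; apply Rdecay_scal; eauto using Cdecay_re, Cdecay_im.
      * apply Rdecay_plus; apply Rdecay_scal; eauto.
      * intros u. rewrite Rmult_0_l, Rplus_0_r.
        transitivity (Cmod (CI f) * Cmod (f u)); [|apply Rmult_le_compat_l; auto; lra].
        transitivity (Re (Cconj (CI f) * f u)).
        { right; destruct (CI f), (f u); simpl; ring. }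
        eapply Rle_trans; [apply Rle_abs|]. eapply Rle_trans; [apply re_le_Cmod|].
        rewrite Cmod_mult, Cmod_conj. lra.
Qed.

Lemma Int_zero : Int (fun _ => 0) = 0.
Proof.
  unfold Int.
  apply (is_RInt_gen_unique (V := R_CompleteNormedModule)).
  intros P HP. unfold filtermapi. apply filter_forall. intros [a b]. exists 0. split; simpl.
  - assert (H := is_RInt_const (V := R_NormedModule) a b 0).
    replace (scal (b - a) (0 : R_NormedModule)) with 0 in H; auto.
    symmetry. apply Rmult_0_r.
  - apply locally_singleton; auto.
Qed.

Lemma CI_RtoC g : (CI (fun u => RtoC (g u))) = RtoC (Int g).
Proof.
  apply Ceq; simpl; auto. apply Int_zero.
Qed.

Lemma Rdecay_lin c K k v f : 0 <= c -> 0 < k -> Rdecay c K f -> Rdecay (c * k) (K * exp (c * Rabs v)) (fun u => f (k * u + v)).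
Proof.
  intros Hc Hk Hf. assert (HK := Rdecay_K_pos _ _ _ Hf). destruct Hf as [A B]; split.
  - intros u. apply (continuous_comp' (fun u => k * u + v) f); auto.
    apply (continuous_of_derivable _ (fun _ => k)). intros; auto_derive; auto; ring.
  - intros u. eapply Rle_trans; [apply B|].
    rewrite Rmult_assoc. apply Rmult_le_compat_l; auto.
    rewrite <- exp_plus. apply exp_le.
    assert (H := Rabs_triang (k * u + v) (- v)). replace (k * u + v + - v) with (k * u) in H by ring.
    rewrite Rabs_Ropp, Rabs_mult, (Rabs_pos_eq k) in H by lra. nra.
Qed.

Lemma is_lim_seq_aff k v : 0 < k -> is_lim_seq (fun n => k * INR n + v) p_infty.
Proof.
  intros Hk.
  apply (is_lim_seq_plus (fun n => k * INR n) (fun _ => v) p_infty v p_infty).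
  - replace p_infty with (Rbar_mult k p_infty).
    + apply (is_lim_seq_scal_l INR k p_infty). apply is_lim_seq_INR.
    + simpl. destruct (Rle_dec 0 k) as [h|h]; [|lra]. destruct (Rle_lt_or_eq_dec 0 k h); [auto|lra].
  - apply is_lim_seq_const.
  - reflexivity.
Qed.

Lemma Int_lin_comp c K k v f : 0 < c -> 0 < k -> Rdecay c K f -> k * Int (fun u => f (k * u + v)) = Int f.
Proof.
  intros Hc Hk Hf.
  assert (Hg := Rdecay_lin c K k v f ltac:(lra) Hk Hf).
  assert (Hck : 0 < c * k) by (apply Rmult_lt_0_compat; auto).
  assert (A := Int_seq _ _ _ Hck Hg).
  assert (B : is_lim_seq (fun n => RInt f (k * (- INR n) + v) (k * INR n + v)) (Int f)).
  { apply (Int_lim_seq c K); auto.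
    - apply is_lim_seq_ext with (fun n => - (k * INR n + - v)); [intros; ring|].
      apply (is_lim_seq_opp _ p_infty). apply is_lim_seq_aff; auto.
    - apply is_lim_seq_aff; auto. }
  assert (D := is_lim_seq_scal_l _ k _ A).
  apply is_lim_seq_ext with (v := (fun n => RInt f (k * (- INR n) + v) (k * INR n + v))) in D.
  - generalize (is_lim_seq_unique _ _ B). rewrite (is_lim_seq_unique _ _ D). simpl. congruence.
  - intros n. rewrite <- (RInt_comp_lin (V := R_CompleteNormedModule) f k v)
      by (apply (Rdecay_ex_RInt c K); auto).
    symmetry. apply (RInt_scal (V := R_CompleteNormedModule)). eapply Rdecay_ex_RInt; eauto.
Qed.

Lemma Int_opp c K f : 0 < c -> Rdecay c K f -> Int (fun u => f (- u)) = Int f.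
Proof.
  intros Hc Hf. apply (Int_unique c K); auto using Rdecay_opp.
  apply is_lim_seq_ext with (fun n => RInt f (- INR n) (INR n)).
  - intros n. rewrite (RInt_reflect c K) by auto. rewrite Ropp_involutive. auto.
  - apply (Int_seq c K); auto.
Qed.

Lemma CI_shift c K v f : 0 < c -> Cdecay c K f -> CI (fun u => f (u + v)) = CI f.
Proof.
  intros Hc Hf. apply Ceq; simpl.
  - rewrite <- (Int_lin_comp c K 1 v (fun t => Re (f t))); auto using Cdecay_re; [|lra].
    rewrite Rmult_1_l. apply Int_ext; intros; f_equal; f_equal; ring.
  - rewrite <- (Int_lin_comp c K 1 v (fun t => Im (f t))); auto using Cdecay_im; [|lra].
    rewrite Rmult_1_l. apply Int_ext; intros; f_equal; f_equal; ring.
Qed.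

Lemma CI_dilate c K k f : 0 < c -> 0 < k -> Cdecay c K f -> (RtoC k * CI (fun u => f (k * u)%R))%C = CI f.
Proof.
  intros Hc Hk Hf. apply Ceq; simpl.
  - rewrite <- (Int_lin_comp c K k 0 (fun t => Re (f t))); auto using Cdecay_re.
    rewrite Rmult_0_l, Rminus_0_r.  f_equal. apply Int_ext; intros; f_equal; f_equal; ring.
  - rewrite <- (Int_lin_comp c K k 0 (fun t => Im (f t))); auto using Cdecay_im.
    rewrite Rmult_0_l, Rplus_0_r.  f_equal. apply Int_ext; intros; f_equal; f_equal; ring.
Qed.

Lemma CI_opp c K f : 0 < c -> Cdecay c K f -> CI (fun u => f (- u)) = CI f.
Proof.
  intros Hc Hf. apply Ceq; simpl.
  - apply (Int_opp c K (fun t => Re (f t))); auto using Cdecay_re.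
  - apply (Int_opp c K (fun t => Im (f t))); auto using Cdecay_im.
Qed.

Lemma Int_FTC c K K' f f' : 0 < c -> (forall u, is_derive f u (f' u)) ->
  Rdecay c K f -> Rdecay c K' f' -> Int f' = 0.
Proof.
  intros Hc Hd Hf Hf'. apply (Int_unique c K'); auto.
  apply (proj1 (is_lim_seq_minus0 _ 0)).
  apply is_lim_seq_squeeze0 with (fun n => 2 * K * exp (- c * INR n)).
  - intros n; split; [apply Rabs_pos|].
    rewrite (is_RInt_unique f' (- INR n) (INR n) (f (INR n) - f (- INR n))).
    + generalize (proj2 Hf (INR n)) (proj2 Hf (- INR n)). rewrite Rabs_Ropp.
      rewrite !(Rabs_pos_eq (INR n)) by apply pos_INR.
      intros A B. unfold Rminus. rewrite Rplus_0_l, Rabs_Ropp.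
      eapply Rle_trans; [apply Rabs_triang|]. rewrite Rabs_Ropp. lra.
    + apply (is_RInt_derive (V := R_CompleteNormedModule)); intros; auto. apply Hf'.
  - apply is_lim_seq_scal0.
    apply is_lim_seq_spec. intros eps.
    destruct (exp_decay_small c 1 eps Hc ltac:(lra) (cond_pos eps)) as [M [_ HM]].
    destruct (INR_unbounded M) as [N HN]. exists N. intros n Hn.
    rewrite Rminus_0_r, Rabs_pos_eq by (left; apply exp_pos).
    apply le_INR in Hn. generalize (HM (INR n) ltac:(lra)). lra.
Qed.

Lemma CI_FTC c K K' f f' : 0 < c -> (forall u, Cderiv f u (f' u)) ->
  Cdecay c K f -> Cdecay c K' f' -> CI f' = 0%C.
Proof.
  intros Hc Hd Hf Hf'. apply Ceq; simpl.
  - apply (Int_FTC c K K' (fun t => Re (f t)) (fun t => Re (f' t))); auto using Cdecay_re. apply Hd.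
  - apply (Int_FTC c K K' (fun t => Im (f t)) (fun t => Im (f' t))); auto using Cdecay_im. apply Hd.
Qed.

Lemma Csum_Cdecay c (K : nat -> R) (f : nat -> R -> C) n : 0 < c -> (forall k, Cdecay c (K k) (f k)) ->
  (exists K', Cdecay c K' (fun u => Csum (fun k => f k u) n)) /\
  CI (fun u => Csum (fun k => f k u) n) = Csum (fun k => CI (f k)) n.
Proof.
  intros Hc H. induction n as [|n [[K' H1] H2]]; simpl.
  - split.
    + exists 0. split; [apply Ccont_const|]. intros; rewrite Cmod_0; lra.
    + rewrite (CI_RtoC (fun _ => 0)). f_equal. apply Int_zero.
  - split.
    + eexists. apply Cdecay_plus; [apply H1|apply H].
    + rewrite (CI_plus c K' (K n)); auto. rewrite H2; auto.
Qed.

(** The remainder after n terms decays at rate [c] with constant [tail K n], so its integral tends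
    to 0 by [CI_bound]. *)
Lemma CI_series c (K : nat -> R) (f : nat -> R -> C) g : 0 < c -> (forall k, Cdecay c (K k) (f k)) ->
  ex_series K -> (forall u, Cser (fun k => f k u) (g u)) ->
  Cdecay c (Series K) g /\ Cser (fun k => CI (f k)) (CI g).
Proof.
  intros Hc H HK Hg.
  assert (T : forall n u, Cmod (g u - Csum (fun k => f k u) n) <= tail K n * exp (- c * Rabs u)).
  { intros n u.
    assert (E : tail K n * exp (- c * Rabs u) = tail (fun k => K k * exp (- c * Rabs u)) n).
    { unfold tail. symmetry. apply Series_scal_r. }
    rewrite E. apply (Cser_tail (fun k => f k u)); auto.
    - intros k; apply H.
    - apply ex_series_scal_r; auto. }
  assert (Tp : forall n, 0 <= tail K n).
  { intros n. generalize (T n 0) (Cmod_ge_0 (g 0 - Csum (fun k => f k 0) n)).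
    rewrite Rabs_R0, Rmult_0_r, exp_0. lra. }
  assert (Cg : Ccont g).
  { apply Ccont_unif with (fun n u => Csum (fun k => f k u) n) (tail K).
    - intros n. destruct (Csum_Cdecay c K f n Hc H) as [[K' [E _]] _]; auto.
    - intros n u. eapply Rle_trans; [apply T|].
      rewrite <- (Rmult_1_r (tail K n)) at 2. apply Rmult_le_compat_l; auto.
      rewrite <- exp_0. apply exp_le. generalize (Rabs_pos u); nra.
    - apply tail_lim; auto. }
  assert (Wg : Cdecay c (Series K) g).
  { split; auto. intros u. generalize (T 0%nat u). simpl.
    replace (g u - 0)%C with (g u) by ring. auto. }
  split; auto.
  apply is_lim_seq_squeeze0 with (fun n => 4 / c * tail K n).
  - intros n; split; [apply Cmod_ge_0|].
    destruct (Csum_Cdecay c K f n Hc H) as [[K' E1] E2].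
    rewrite <- E2, <- (CI_minus c (Series K) K'); auto.
    replace (4 / c * tail K n) with (4 * tail K n / c) by (field; apply Rgt_not_eq; auto).
    apply CI_bound; auto. split; auto. apply Ccont_minus; auto. apply E1.
  - apply is_lim_seq_scal0, tail_lim; auto.
Qed.

(** * Power series and the identity theorem *)

Lemma Cser_is_series (a : nat -> C) (l : C) :
  Cser a l <-> is_series (K := C_AbsRing) (V := C_NormedModule) a l.
Proof.
  assert (E : forall n, sum_n (G := C_NormedModule) a n = Csum a (S n)).
  { induction n as [|n IH].
    - rewrite sum_O. simpl. ring.
    - rewrite sum_Sn, IH. reflexivity. }
  split.
  - intros H. apply is_lim_seq_incr_1 in H.
    apply filterlim_locally. intros eps.
    apply is_lim_seq_spec in H. destruct (H eps) as [N HN]. exists N. intros n Hn.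
    specialize (HN n Hn). rewrite E.
    rewrite Rminus_0_r, Rabs_pos_eq in HN by apply Cmod_ge_0.
    apply C_NormedModule_mixin_compat1. change (Cmod (Csum a (S n) - l) < eps).
    rewrite Cmod_sub_sym. exact HN.
  - intros H. apply (is_lim_seq_incr_1 (fun n => Cmod (l - Csum a n))). apply is_lim_seq_spec. intros eps.
    assert (He : 0 < eps / 2) by (generalize (cond_pos eps); lra).
    destruct (proj1 (filterlim_locally _ _) H (mkposreal _ He)) as [N HN].
    exists N. intros n Hn. specialize (HN n Hn).
    rewrite Rminus_0_r, Rabs_pos_eq by apply Cmod_ge_0.
    rewrite Cmod_sub_sym, <- E.
    (* Balls of [C] are products of intervals: radius eps / 2 only bounds the modulus by sqrt 2
       times eps / 2, and sqrt 2 < 2 closes the gap. *)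
    apply C_NormedModule_mixin_compat2 in HN. simpl in HN.
    change (Cmod (sum_n (G := C_NormedModule) a n - l) < sqrt 2 * (eps / 2)) in HN.
    assert (Hs : sqrt 2 < 2).
    { replace 2 with (sqrt (2 * 2)) at 2 by (apply sqrt_square; lra). apply sqrt_lt_1_alt. lra. }
    nra.
Qed.

Lemma is_pseries_Cser (a : nat -> C) (h l : C) :
  is_pseries (K := C_AbsRing) (V := C_NormedModule) a h l <-> Cser (fun k => a k * h ^ k)%C l.
Proof.
  rewrite Cser_is_series. unfold is_pseries. 
  split; apply is_series_ext; intros n.
  - change (pow_n (K := C_Ring) h n * a n = a n * h ^ n)%C. apply Cmult_comm.
  - change (a n * h ^ n = pow_n (K := C_Ring) h n * a n)%C. apply Cmult_comm.
Qed.

Lemma Cser_terms_bounded (a : nat -> C) l : Cser a l -> exists M, forall n, Cmod (a n) <= M.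
Proof.
  intros H.
  assert (B : exists M, forall n, Cmod (l - Csum a n) <= M).
  { assert (H' := H). apply is_lim_seq_spec in H'. destruct (H' (mkposreal 1 Rlt_0_1)) as [N HN].
    assert (F : forall N, exists M, forall n, (n < N)%nat -> Cmod (l - Csum a n) <= M).
    { clear. induction N as [|N [M HM]].
      - exists 0; intros; lia.
      - exists (Rmax M (Cmod (l - Csum a N))). intros n Hn.
        destruct (Nat.eq_dec n N) as [->|]; [apply Rmax_r|].
        eapply Rle_trans; [apply HM; lia | apply Rmax_l]. }
    destruct (F N) as [M HM]. exists (Rmax M 1). intros n.
    destruct (Compare_dec.le_lt_dec N n) as [h|h].
    - specialize (HN n h). simpl in HN. rewrite Rminus_0_r in HN.
      apply Rle_trans with 1; [|apply Rmax_r].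
      apply Rle_trans with (Rabs (Cmod (l - Csum a n))); [apply Rle_abs|lra].
    - eapply Rle_trans; [apply HM; auto | apply Rmax_l]. }
  destruct B as [M HM]. exists (2 * M). intros n.
  replace (a n) with ((l - Csum a n) - (l - Csum a (S n)))%C by (simpl; ring).
  generalize (HM n) (HM (S n)) (Cmod_triangle (l - Csum a n) (- (l - Csum a (S n)))).
  rewrite Cmod_opp. change (l - Csum a n + - (l - Csum a (S n)))%C with (l - Csum a n - (l - Csum a (S n)))%C. lra.
Qed.

(* The bound M makes the terms geometrically dominated, which products and quotients of expansions need. *)
Definition expansion (a : nat -> C) (r M : R) (f : C -> C) (z : C) : Prop :=
  0 < r /\ (forall k, Cmod (a k) * r ^ k <= M) /\
  forall h, Cmod h < r -> Cser (fun k => a k * h ^ k)%C (f (z + h)%C).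

Definition analytic (f : C -> C) (z : C) : Prop := exists a r M, expansion a r M f z.

(** Convergence at the single point r / 2 bounds the terms there; this supplies [M] at the cost of
    half the radius. *)
Lemma analytic_iff_analytic_at f z : analytic f z <-> analytic_at f z.
Proof.
  split.
  - intros (a & r & M & Hr & _ & H). exists a, r. split; auto.
    intros h Hh. apply is_pseries_Cser; auto.
  - intros (a & r & Hr & H).
    destruct (Cser_terms_bounded (fun k => a k * RtoC (r / 2) ^ k)%C (f (z + RtoC (r / 2))%C)) as [M HM].
    { apply is_pseries_Cser, H. rewrite Cmod_R, Rabs_pos_eq; lra. }
    exists a, (r / 2), M. split; [lra|split].
    + intros k. specialize (HM k). rewrite Cmod_mult, Cmod_pow, Cmod_R, Rabs_pos_eq in HM by lra. exact HM.
    + intros h Hh. apply is_pseries_Cser, H. lra.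
Qed.

Lemma expansion_M_pos a r M f z : expansion a r M f z -> 0 <= M.
Proof.
  intros (Hr & H & _). generalize (H 0%nat) (Cmod_ge_0 (a 0%nat)). simpl. lra.
Qed.

Lemma expansion_shrink a r M f z r' : 0 < r' <= r -> expansion a r M f z -> expansion a r' M f z.
Proof.
  intros Hr' (Hr & H & H'). split; [lra|split].
  - intros k. eapply Rle_trans; [|apply (H k)].
    apply Rmult_le_compat_l; [apply Cmod_ge_0|]. apply pow_incr; lra.
  - intros h Hh; apply H'; lra.
Qed.

Lemma ex_series_geom' (q : R) : 0 <= q < 1 -> ex_series (fun k => q ^ k).
Proof. intros; apply ex_series_geom. rewrite Rabs_pos_eq; lra. Qed.

Lemma expansion_term a r M f z h k : expansion a r M f z -> Cmod (a k * h ^ k)%C <= M * (Cmod h / r) ^ k.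
Proof.
  intros (Hr & H & _). rewrite Cmod_mult, Cmod_pow.
  replace (Cmod (a k) * Cmod h ^ k) with ((Cmod (a k) * r ^ k) * (Cmod h / r) ^ k).
  - apply Rmult_le_compat_r; auto. apply pow_le. apply Rdiv_le_0_compat; auto using Cmod_ge_0.
  - unfold Rdiv. rewrite Rpow_mult_distr, pow_inv. field. apply pow_nonzero; lra.
Qed.

Lemma Cser_of_zero_head (a : nat -> C) (l : C) n : (forall k, (k < n)%nat -> a k = 0%C) -> Cser a l ->
  Cser (fun k => a (n + k)%nat) l.
Proof.
  intros Ha H. replace l with (l - Csum a n)%C.
  - apply Cser_incr_n; auto.
  - rewrite (Csum_ext a (fun _ => RtoC 0) n Ha).
    assert (E : Csum (fun _ => 0%C) n = 0%C) by (clear; induction n; simpl; [auto|rewrite IHn; ring]).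
    rewrite E. ring.
Qed.

(** The terms after the n-th are dominated by a geometric series of ratio at most 1/2, whose sum is
    at most twice its first term. *)
Lemma expansion_lead a r M f z h n : expansion a r M f z -> Cmod h <= r / 2 ->
  (forall j, (j < n)%nat -> a j = 0%C) ->
  Cmod (f (z + h)%C - a n * h ^ n) <= 2 * M * (Cmod h / r) ^ S n.
Proof.
  intros H Hh Ha. assert (HM := expansion_M_pos _ _ _ _ _ H). assert (Hr := proj1 H).
  set (q := Cmod h / r).
  assert (Hq : 0 <= q <= / 2).
  { unfold q; split. apply Rdiv_le_0_compat; auto using Cmod_ge_0.
    apply Rmult_le_reg_r with r; auto. unfold Rdiv. rewrite Rmult_assoc, Rinv_l by lra. lra. }
  assert (S1 : Cser (fun k => a (n + k)%nat * h ^ (n + k))%C (f (z + h)%C)).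
  { apply (Cser_of_zero_head (fun k => a k * h ^ k)%C).
    - intros k Hk; rewrite Ha; auto; ring.
    - apply H. lra. }
  apply (Cser_incr_n _ _ 1) in S1. simpl in S1. rewrite Nat.add_0_r in S1.
  replace (f (z + h) - (0 + a n * h ^ n))%C with (f (z + h) - a n * h ^ n)%C in S1 by ring.
  eapply Rle_trans; [eapply (Cser_le _ (fun k => M * q ^ S n * q ^ k) _ S1)|].
  - intros k. eapply Rle_trans; [apply (expansion_term _ _ _ _ _ _ _ H)|].
    fold q. rewrite Rmult_assoc, <- pow_add. replace (n + S k)%nat with (S n + k)%nat by lia. lra.
  - apply (ex_series_scal (V := R_NormedModule)). apply ex_series_geom'; lra.
  - rewrite Series_scal_l, Series_geom by (rewrite Rabs_pos_eq; lra).
    assert (P : 0 <= M * q ^ S n) by (apply Rmult_le_pos; auto; apply pow_le; lra).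
    assert (/ (1 - q) <= 2).
    { rewrite <- (Rinv_inv 2). apply Rinv_le_contravar; lra. }
    nra.
Qed.

Lemma analytic_continuous f z : analytic f z -> forall eps, 0 < eps ->
  exists d, 0 < d /\ forall h, Cmod h < d -> Cmod (f (z + h)%C - f z) < eps.
Proof.
  intros (a & r & M & H) eps He. assert (HM := expansion_M_pos _ _ _ _ _ H). assert (Hr := proj1 H).
  assert (L : forall h, Cmod h <= r / 2 -> Cmod (f (z + h)%C - a 0%nat) <= 2 * M * (Cmod h / r)).
  { intros h Hh. generalize (expansion_lead _ _ _ _ _ _ 0 H Hh ltac:(intros; lia)).
    simpl. rewrite !Cmult_1_r, Rmult_1_r. auto. }
  assert (E : f z = a 0%nat).
  { apply Cminus_eq. apply Cmod_eq_0. apply Rle_antisym; [|apply Cmod_ge_0].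
    generalize (L 0%C ltac:(rewrite Cmod_0; lra)).
    rewrite Cmod_0, Cplus_0_r. unfold Rdiv. lra. }
  exists (Rmin (r / 2) (eps * r / (2 * M + 1))). split.
  - apply Rmin_glb_lt; [lra|]. apply Rdiv_lt_0_compat; [apply Rmult_lt_0_compat; auto|lra].
  - intros h Hh. rewrite E. eapply Rle_lt_trans; [apply L|].
    + generalize (Rmin_l (r / 2) (eps * r / (2 * M + 1))); lra.
    + assert (Hh' := Rlt_le_trans _ _ _ Hh (Rmin_r _ _)).
      assert (A : Cmod h / r < eps / (2 * M + 1)).
      { apply Rmult_lt_reg_r with r; auto. unfold Rdiv in *.
        rewrite (Rmult_assoc (Cmod h)), Rinv_l, Rmult_1_r by lra.
        eapply Rlt_le_trans; [exact Hh'|]. right; ring. }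
      assert (B : 0 <= Cmod h / r) by (apply Rdiv_le_0_compat; auto using Cmod_ge_0).
      assert (D : (2 * M + 1) * (eps / (2 * M + 1)) = eps) by (field; lra).
      nra.
Qed.

Lemma expansion_value a r M f z : expansion a r M f z -> f z = a 0%nat.
Proof.
  intros H. apply Cminus_eq. apply Cmod_eq_0. apply Rle_antisym; [|apply Cmod_ge_0].
  generalize (expansion_lead _ _ _ _ _ 0%C 0 H ltac:(rewrite Cmod_0; generalize (proj1 H); lra) ltac:(intros; lia)).
  simpl. rewrite !Cmult_1_r, Rmult_1_r, Cmod_0, Cplus_0_r. unfold Rdiv. lra.
Qed.

Lemma analytic_ext_loc f g z d : 0 < d -> (forall h, Cmod h < d -> f (z + h)%C = g (z + h)%C) ->
  analytic f z -> analytic g z.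
Proof.
  intros Hd E (a & r & M & H). exists a, (Rmin r d), M.
  assert (Hr := proj1 H). 
  assert (Hm : 0 < Rmin r d <= r) by (split; [apply Rmin_glb_lt; auto | apply Rmin_l]).
  destruct (expansion_shrink _ _ _ _ _ _ Hm H) as (A & B & D).
  split; [auto|split; auto]. intros h Hh. rewrite <- E; auto.
  eapply Rlt_le_trans; [exact Hh|apply Rmin_r].
Qed.

Lemma analytic_ext f g z : (forall w, f w = g w) -> analytic f z -> analytic g z.
Proof. intros H; apply analytic_ext_loc with 1; auto; lra. Qed.

Lemma Cser_finite (a : nat -> C) n (l : C) : (forall k, (n <= k)%nat -> a k = 0%C) -> Csum a n = l -> Cser a l.
Proof.
  intros Ha Hl. apply (is_lim_seq_ext_loc (fun _ => 0)).
  - exists n. intros m Hm. symmetry.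
    replace m with (n + (m - n))%nat by lia. rewrite Csum_tail, Hl.
    rewrite (Csum_ext (fun k => a (n + k)%nat) (fun _ => 0%C)).
    + assert (E : forall p, Csum (fun _ => 0%C) p = 0%C) by (clear; induction p; simpl; [auto|rewrite IHp; ring]).
      rewrite E. replace (l - (l + 0))%C with (RtoC 0) by ring. apply Cmod_0.
    + intros; apply Ha; lia.
  - apply is_lim_seq_const.
Qed.

Lemma analytic_const c z : analytic (fun _ => c) z.
Proof.
  exists (fun k => match k with O => c | _ => 0%C end), 1, (Cmod c).
  split; [lra|split].
  - intros [|k]; rewrite pow1; [lra|]. rewrite Cmod_0. generalize (Cmod_ge_0 c); lra.
  - intros h _. apply (Cser_finite _ 1); [|simpl; ring]. intros [|k] Hk; [lia|ring].
Qed.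

Lemma Cpow_mul (x y : C) n : ((x * y) ^ n = x ^ n * y ^ n)%C.
Proof. induction n as [|n IH]; simpl; [ring|rewrite IH; ring]. Qed.

Lemma analytic_aff f al be z : analytic f (al * z + be)%C -> analytic (fun w => f (al * w + be)%C) z.
Proof.
  intros (a & r & M & H). destruct H as (Hr & HM & H).
  assert (Ha := Cmod_ge_0 al).
  exists (fun k => a k * al ^ k)%C, (r / (Cmod al + 1)), M.
  (* The [+ 1] covers [al = 0]. *)
  assert (Hr' : 0 < r / (Cmod al + 1)) by (apply Rdiv_lt_0_compat; lra).
  assert (Hrr : Cmod al * (r / (Cmod al + 1)) <= r).
  { apply Rmult_le_reg_r with (Cmod al + 1); [lra|].
    replace (Cmod al * (r / (Cmod al + 1)) * (Cmod al + 1)) with (Cmod al * r) by (field; lra). nra. }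
  split; [auto|split].
  - intros k. eapply Rle_trans; [|apply (HM k)].
    rewrite Cmod_mult, Cmod_pow, Rmult_assoc, <- Rpow_mult_distr.
    apply Rmult_le_compat_l; [apply Cmod_ge_0|]. apply pow_incr; split; auto.
    apply Rmult_le_pos; lra.
  - intros h Hh. replace (al * (z + h) + be)%C with (al * z + be + al * h)%C by ring.
    apply (Cser_ext (fun k => a k * (al * h) ^ k)%C).
    + intros k. rewrite Cpow_mul. ring.
    + apply H. rewrite Cmod_mult.
      apply Rle_lt_trans with (Cmod al * Cmod h); [lra|].
      destruct (Req_dec (Cmod al) 0) as [E|E]; [rewrite E; lra|].
      eapply Rlt_le_trans; [|exact Hrr]. apply Rmult_lt_compat_l; lra.
Qed.

Definition Cconv (a b : nat -> C) (n : nat) : C := Csum (fun k => a k * b (n - k)%nat)%C (S n).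

(** Mertens' theorem for the four products of real and imaginary parts, recombined. *)
Lemma Cser_conv a b la lb A B :
  Cser a la -> Cser b lb -> (forall n, Cmod (a n) <= A n) -> (forall n, Cmod (b n) <= B n) ->
  ex_series A -> ex_series B -> Cser (Cconv a b) (la * lb)%C.
Proof.
  intros Ha Hb HA HB EA EB.
  apply Cser_components in Ha. apply Cser_components in Hb.
  destruct Ha as [a1 a2], Hb as [b1 b2].
  assert (X : forall (p : C -> R) (u : nat -> C) (U : nat -> R), (forall z, Rabs (p z) <= Cmod z) ->
     (forall n, Cmod (u n) <= U n) -> ex_series U -> ex_series (fun n => Rabs (p (u n)))).
  { intros p u U Hp Hu. apply (ex_series_le (V := R_CompleteNormedModule) (fun n => Rabs (p (u n))) U).
    intros n. change (Rabs (Rabs (p (u n))) <= U n). rewrite Rabs_Rabsolu.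
    eapply Rle_trans; [apply Hp|apply Hu]. }
  assert (ar := X Re a A re_le_Cmod HA EA). assert (ai := X Im a A im_le_Cmod HA EA).
  assert (br := X Re b B re_le_Cmod HB EB). assert (bi := X Im b B im_le_Cmod HB EB).
  assert (m1 := is_series_mult _ _ _ _ a1 b1 ar br). assert (m2 := is_series_mult _ _ _ _ a2 b2 ai bi).
  assert (m3 := is_series_mult _ _ _ _ a1 b2 ar bi). assert (m4 := is_series_mult _ _ _ _ a2 b1 ai br).
  apply Cser_components. split.
  - generalize (is_series_minus _ _ _ _ m1 m2). apply is_series_ext. intros n.
    unfold Cconv. rewrite Re_Csum.
    assert (E : forall m N, minus (sum_f_R0 (fun k => Re (a k) * Re (b (m - k)%nat)) N)
      (sum_f_R0 (fun k => Im (a k) * Im (b (m - k)%nat)) N) = sum_n (fun k => Re (a k * b (m - k)%nat)%C) N).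
    { intros m N. induction N as [|N IH].
      - rewrite sum_O. reflexivity.
      - rewrite sum_Sn, <- IH. unfold plus, minus, opp; simpl. unfold plus; simpl. unfold Re, Im; ring. }
    apply E.
  - generalize (is_series_plus _ _ _ _ m3 m4). apply is_series_ext. intros n.
    unfold Cconv. rewrite Im_Csum.
    assert (E : forall m N, plus (sum_f_R0 (fun k => Re (a k) * Im (b (m - k)%nat)) N)
      (sum_f_R0 (fun k => Im (a k) * Re (b (m - k)%nat)) N) = sum_n (fun k => Im (a k * b (m - k)%nat)%C) N).
    { intros m N. induction N as [|N IH].
      - rewrite sum_O. reflexivity.
      - rewrite sum_Sn, <- IH. unfold plus; simpl. unfold Re, Im; ring. }
    apply E.
Qed.

Lemma expansion_summable a r M f z h : expansion a r M f z -> Cmod h < r -> ex_series (fun k => M * (Cmod h / r) ^ k).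
Proof.
  intros (Hr & _) Hh. apply (ex_series_scal (V := R_NormedModule)). apply ex_series_geom'.
  split; [apply Rdiv_le_0_compat; auto using Cmod_ge_0|].
  apply Rmult_lt_reg_r with r; auto. unfold Rdiv. rewrite Rmult_assoc, Rinv_l by lra. lra.
Qed.

Lemma analytic_plus f g z : analytic f z -> analytic g z -> analytic (fun w => f w + g w)%C z.
Proof.
  intros (a & r & M & H1) (b & r' & N & H2).
  set (r0 := Rmin r r').
  assert (Hm1 : 0 < r0 <= r) by (split; [apply Rmin_glb_lt; [apply H1|apply H2] | apply Rmin_l]).
  assert (Hm2 : 0 < r0 <= r') by (split; [apply Hm1 | apply Rmin_r]).
  apply (expansion_shrink _ _ _ _ _ _ Hm1) in H1. apply (expansion_shrink _ _ _ _ _ _ Hm2) in H2.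
  exists (fun k => a k + b k)%C, r0, (M + N).
  split; [apply Hm1|split].
  - intros k. destruct H1 as (_ & H1 & _), H2 as (_ & H2 & _).
    generalize (H1 k) (H2 k) (Cmod_triangle (a k) (b k)) (pow_lt r0 k (proj1 Hm1)). nra.
  - intros h Hh. apply (Cser_ext (fun k => a k * h ^ k + b k * h ^ k)%C); [intros; ring|].
    apply Cser_plus; [apply H1|apply H2]; auto.
Qed.

Lemma pow2_ge n : INR n + 1 <= 2 ^ n.
Proof. induction n as [|n IH]; simpl pow; rewrite ?S_INR; simpl; [lra|]. generalize (pos_INR n); lra. Qed.

Lemma Csum_le (a : nat -> C) B n : (forall k, (k < n)%nat -> Cmod (a k) <= B) -> Cmod (Csum a n) <= INR n * B.
Proof.
  induction n as [|n IH]; intros H.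
  - simpl. rewrite Cmod_0. lra.
  - rewrite S_INR. simpl Csum. eapply Rle_trans; [apply Cmod_triangle|].
    generalize (H n ltac:(lia)) (IH ltac:(auto)). lra.
Qed.

Lemma Cpow_add (x : C) n m : (x ^ (n + m) = x ^ n * x ^ m)%C.
Proof. induction n as [|n IH]; simpl; [ring|rewrite IH; ring]. Qed.

Lemma Cconv_scale a b h n : Cconv (fun k => a k * h ^ k)%C (fun k => b k * h ^ k)%C n = (Cconv a b n * h ^ n)%C.
Proof.
  unfold Cconv. transitivity (Csum (fun k => h ^ n * (a k * b (n - k)%nat))%C (S n)).
  - apply Csum_ext. intros k Hk.
    replace n with (k + (n - k))%nat at 3 by lia. rewrite Cpow_add. ring.
  - rewrite Csum_scal. ring.
Qed.

(** A coefficient of the Cauchy product has n + 1 terms, each at most M N / r0^n; halving the radius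
    pays for n + 1 <= 2^n. *)
Lemma analytic_mult f g z : analytic f z -> analytic g z -> analytic (fun w => f w * g w)%C z.
Proof.
  intros (a & r & M & H1) (b & r' & N & H2).
  set (r0 := Rmin r r').
  assert (Hm1 : 0 < r0 <= r) by (split; [apply Rmin_glb_lt; [apply H1|apply H2] | apply Rmin_l]).
  assert (Hm2 : 0 < r0 <= r') by (split; [apply Hm1 | apply Rmin_r]).
  apply (expansion_shrink _ _ _ _ _ _ Hm1) in H1. apply (expansion_shrink _ _ _ _ _ _ Hm2) in H2.
  assert (HM := expansion_M_pos _ _ _ _ _ H1). assert (HN := expansion_M_pos _ _ _ _ _ H2).
  exists (Cconv a b), (r0 / 2), (M * N).
  split; [lra|split].
  - intros n.
    assert (E : Cmod (Cconv a b n) * r0 ^ n <= INR (S n) * (M * N)).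
    { assert (P := pow_lt r0 n (proj1 Hm1)).
      apply Rmult_le_reg_r with (/ r0 ^ n); [apply Rinv_0_lt_compat; auto|].
      rewrite !Rmult_assoc, Rinv_r, Rmult_1_r by lra.
      replace (INR (S n) * (M * (N * / r0 ^ n))) with (INR (S n) * (M * N * / r0 ^ n)) by ring.
      apply Csum_le. intros k Hk.
      apply Rmult_le_reg_r with (r0 ^ n); auto. rewrite !Rmult_assoc, Rinv_l, Rmult_1_r by lra.
      rewrite Cmod_mult. replace (r0 ^ n) with (r0 ^ k * r0 ^ (n - k)) by (rewrite <- pow_add; f_equal; lia).
      replace (Cmod (a k) * Cmod (b (n - k)%nat) * (r0 ^ k * r0 ^ (n - k)))
        with ((Cmod (a k) * r0 ^ k) * (Cmod (b (n - k)%nat) * r0 ^ (n - k))) by ring.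
      destruct H1 as (_ & H1 & _), H2 as (_ & H2 & _).
      apply Rmult_le_compat; auto; apply Rmult_le_pos; auto using Cmod_ge_0; left; apply pow_lt, Hm1. }
    unfold Rdiv. rewrite Rpow_mult_distr, pow_inv.
    assert (P2 := pow2_ge n). rewrite S_INR in E.
    assert (0 < 2 ^ n) by (apply pow_lt; lra).
    apply Rmult_le_reg_r with (2 ^ n); auto.
    replace (Cmod (Cconv a b n) * (r0 ^ n * / 2 ^ n) * 2 ^ n) with (Cmod (Cconv a b n) * r0 ^ n) by (field; lra).
    eapply Rle_trans; [exact E|]. rewrite (Rmult_comm (M * N)).
    apply Rmult_le_compat_r; auto. apply Rmult_le_pos; auto.
  - intros h Hh.
    apply (Cser_ext (Cconv (fun k => a k * h ^ k)%C (fun k => b k * h ^ k)%C)).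
    { intros; apply Cconv_scale. }
    eapply (Cser_conv _ _ _ _ (fun k => M * (Cmod h / r0) ^ k) (fun k => N * (Cmod h / r0) ^ k)).
    + apply H1; lra.
    + apply H2; lra.
    + intros n; apply (expansion_term _ _ _ _ _ _ _ H1).
    + intros n; apply (expansion_term _ _ _ _ _ _ _ H2).
    + apply (expansion_summable _ _ _ _ _ _ H1); lra.
    + apply (expansion_summable _ _ _ _ _ _ H2); lra.
Qed.

Lemma analytic_minus f g z : analytic f z -> analytic g z -> analytic (fun w => f w - g w)%C z.
Proof.
  intros Hf Hg. apply (analytic_ext (fun w => f w + (-(1)) * g w)%C); [intros; ring|].
  apply analytic_plus; auto. apply analytic_mult; auto. apply analytic_const.
Qed.

Lemma analytic_id z : analytic (fun w => w) z.
Proof.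
  exists (fun k => match k with O => z | S O => 1 | _ => 0 end)%C, 1, (Cmod z + 1).
  assert (H := Cmod_ge_0 z).
  split; [lra|split].
  - intros [|[|k]]; rewrite pow1, ?Cmod_0, ?Cmod_1; lra.
  - intros h _. apply (Cser_finite _ 2); [|simpl; ring]. intros [|[|k]] Hk; [lia|lia|ring].
Qed.

(** Coefficients b_k of the reciprocal power series. The recurrence for b_(n+1) uses all earlier
    ones, so stage [n] carries the whole table b_0, ..., b_n and the recursion stays structural; b_n
    is [inv_coefs a n n]. *)
Fixpoint inv_coefs (a : nat -> C) (n : nat) : nat -> C :=
  match n with
  | O => fun _ => (/ a O)%C
  | S n => fun k => if (k <=? n)%nat then inv_coefs a n k
      else (- / a O * Csum (fun j => a (S j) * inv_coefs a n (n - j)%nat) (S n))%C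
  end.

Lemma inv_coefs_stable a n k : (k <= n)%nat -> inv_coefs a n k = inv_coefs a k k.
Proof.
  induction n as [|n IH]; intros H.
  - replace k with O by lia. auto.
  - destruct (Nat.eq_dec k (S n)) as [->|]; auto.
    cbn [inv_coefs]. replace (k <=? n)%nat with true by (symmetry; apply Nat.leb_le; lia).
    apply IH; lia.
Qed.

Lemma inv_coefs_S a n : inv_coefs a (S n) (S n) =
  (- / a O * Csum (fun j => a (S j) * inv_coefs a (n - j)%nat (n - j)%nat) (S n))%C.
Proof.
  cbn [inv_coefs]. replace (S n <=? n)%nat with false by (symmetry; apply Nat.leb_gt; lia).
  f_equal. apply Csum_ext. intros j Hj. f_equal. apply inv_coefs_stable. lia.
Qed.

Lemma Csum_S_head (a : nat -> C) n : Csum a (S n) = (a O + Csum (fun k => a (S k)) n)%C.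
Proof. change (S n) with (1 + n)%nat. rewrite Csum_tail. simpl. ring. Qed.

Lemma Csum_le_series (a : nat -> C) (b : nat -> R) B n :
  (forall k, (k < n)%nat -> Cmod (a k) <= b k) -> (forall k, 0 <= b k) -> is_series b B ->
  Cmod (Csum a n) <= B.
Proof.
  intros H Hb HB.
  assert (S1 : Cser (fun k => if (k <? n)%nat then a k else 0%C) (Csum a n)).
  { apply (Cser_finite _ n).
    - intros k Hk. replace (k <? n)%nat with false; auto. symmetry; apply Nat.ltb_ge; lia.
    - apply Csum_ext. intros k Hk. replace (k <? n)%nat with true; auto. symmetry; apply Nat.ltb_lt; lia. }
  rewrite <- (is_series_unique _ _ HB).
  apply (Cser_le _ _ _ S1); [|exists B; auto].
  intros k. destruct (k <? n)%nat eqn:E; [apply H, Nat.ltb_lt; auto|]. rewrite Cmod_0; auto.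
Qed.

Lemma analytic_inv f z : analytic f z -> f z <> 0%C -> analytic (fun w => / f w)%C z.
Proof.
  intros (a & r & M & H) Hz.
  rewrite (expansion_value _ _ _ _ _ H) in Hz.
  assert (Ha : 0 < Cmod (a O)) by (apply Cmod_gt_0; auto).
  assert (HaM : Cmod (a O) <= M) by (generalize (proj1 (proj2 H) 0%nat); simpl; lra).
  assert (Hr := proj1 H).
  (* With this ratio M q / |a_0| = 1/2 <= 1 - q, exactly what the induction for |b_n| rho^n <= 1 /
     |a_0| needs when the recurrence is dominated by a geometric series. *)
  set (q := Cmod (a O) / (2 * M)).
  assert (Hq : 0 < q <= / 2).
  { unfold q; split; [apply Rdiv_lt_0_compat; lra|].
    apply Rmult_le_reg_r with (2 * M); [lra|]. unfold Rdiv. rewrite Rmult_assoc, Rinv_l by lra. lra. }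
  set (rho := q * r). assert (Hrho : 0 < rho) by (apply Rmult_lt_0_compat; lra).
  set (b := fun n => inv_coefs a n n).
  assert (Hb : forall n, Cmod (b n) * rho ^ n <= / Cmod (a O)).
  { intros n. induction n as [n IH] using (well_founded_induction Wf_nat.lt_wf).
    destruct n as [|n].
    - unfold b; simpl. rewrite Cmod_inv, Rmult_1_r by auto. lra.
    - unfold b. rewrite inv_coefs_S, Cmod_mult, Cmod_opp, Cmod_inv by auto.
      assert (P := pow_lt rho (S n) Hrho).
      rewrite Rmult_assoc. rewrite <- (Rmult_1_r (/ Cmod (a O))) at 2.
      apply Rmult_le_compat_l; [left; apply Rinv_0_lt_compat; auto|].
      rewrite Rmult_comm, <- (Rabs_pos_eq (rho ^ S n)), <- Cmod_R, <- Cmod_mult, <- Csum_scal by lra.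
      apply Rle_trans with (M * q * / Cmod (a O) * / (1 - q)).
      2: { unfold q at 1. replace (M * (Cmod (a O) / (2 * M)) * / Cmod (a O)) with (/ 2) by (field; lra).
           apply Rmult_le_reg_r with (1 - q); [lra|]. rewrite Rmult_assoc, Rinv_l by lra. lra. }
      apply (Csum_le_series _ (fun k => M * q * / Cmod (a O) * q ^ k)).
      + intros k Hk. specialize (IH (n - k)%nat ltac:(lia)). fold (b (n - k)%nat).
        rewrite !Cmod_mult, Cmod_R, Rabs_pos_eq by lra.
        replace (rho ^ S n) with (rho ^ S k * rho ^ (n - k)) by (rewrite <- pow_add; f_equal; lia).
        assert (E : Cmod (a (S k)) * rho ^ S k <= M * (q * q ^ k)).
        { unfold rho. rewrite Rpow_mult_distr. change (q * q ^ k) with (q ^ S k).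
          generalize (proj1 (proj2 H) (S k)) (pow_lt q (S k) ltac:(lra)). nra. }
        replace (rho ^ S k * rho ^ (n - k) * (Cmod (a (S k)) * Cmod (b (n - k)%nat)))
          with ((Cmod (a (S k)) * rho ^ S k) * (Cmod (b (n - k)%nat) * rho ^ (n - k))) by ring.
        replace (M * q * / Cmod (a O) * q ^ k) with ((M * (q * q ^ k)) * / Cmod (a O)) by ring.
        apply Rmult_le_compat; auto; apply Rmult_le_pos; auto using Cmod_ge_0; left; apply pow_lt; auto.
      + intros k. apply Rmult_le_pos; [|left; apply pow_lt; lra].
        apply Rmult_le_pos; [apply Rmult_le_pos; lra|left; apply Rinv_0_lt_compat; auto].
      + apply (is_series_scal (V := R_NormedModule)). apply is_series_geom. rewrite Rabs_pos_eq; lra. }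
  exists b, rho, (/ Cmod (a O)). split; [auto|split; auto].
  intros h Hh.
  set (B := fun k => / Cmod (a O) * (Cmod h / rho) ^ k).
  assert (HB : forall k, Cmod (b k * h ^ k)%C <= B k).
  { intros k. unfold B, Rdiv. rewrite Cmod_mult, Cmod_pow, Rpow_mult_distr, pow_inv.
    replace (Cmod (b k) * Cmod h ^ k) with ((Cmod (b k) * rho ^ k) * (Cmod h ^ k * / rho ^ k))
      by (field; apply pow_nonzero; lra).
    apply Rmult_le_compat_r; auto. apply Rmult_le_pos; [apply pow_le, Cmod_ge_0|].
    left; apply Rinv_0_lt_compat, pow_lt; auto. }
  assert (EB : ex_series B).
  { apply (ex_series_scal (V := R_NormedModule)). apply ex_series_geom'.
    split; [apply Rdiv_le_0_compat; auto using Cmod_ge_0|].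
    apply Rmult_lt_reg_r with rho; auto. unfold Rdiv. rewrite Rmult_assoc, Rinv_l by lra. lra. }
  destruct (Cser_ex _ _ HB EB) as [l Hl].
  assert (Hhr : Cmod h < r) by (unfold rho in Hh; nra).
  assert (E1 := Cser_conv _ _ _ _ _ _ (proj2 (proj2 H) h Hhr) Hl
    (fun k => expansion_term _ _ _ _ _ h k H) HB (expansion_summable _ _ _ _ _ _ H Hhr) EB).
  (* The Cauchy product of the two expansions has coefficients 1, 0, 0, ..., by the recurrence. *)
  assert (E2 : (f (z + h) * l = 1)%C).
  { apply (Cser_unique _ _ _ E1). apply (Cser_finite _ 1).
    - intros [|n] Hn; [lia|]. rewrite Cconv_scale.
      replace (Cconv a b (S n)) with (RtoC 0); [ring|].
      unfold Cconv. rewrite Csum_S_head.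
      set (T := Csum (fun j => a (S j) * inv_coefs a (n - j)%nat (n - j)%nat)%C (S n)).
      change (RtoC 0 = a O * inv_coefs a (S n) (S n) + T)%C.
      rewrite inv_coefs_S. fold T. field. auto.
    - cbn [Csum]. rewrite Cconv_scale. unfold Cconv, b. simpl. field. auto. }
  replace (/ f (z + h))%C with l; auto.
  assert (f (z + h)%C <> 0%C).
  { intros E0. rewrite E0, Cmult_0_l in E2. apply C1_nz. auto. }
  replace l with (/ f (z + h) * (f (z + h) * l))%C by (field; auto).
  rewrite E2; ring.
Qed.

(** * Identity theorem along rays and lines *)

Lemma expansion_zero_of_ray a r M f z (d : C) del : expansion a r M f z -> d <> 0%C -> 0 < del ->
  (forall t, 0 < t < del -> f (z + RtoC t * d)%C = 0%C) -> forall k, a k = 0%C.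
Proof.
  intros H Hd Hdel Hf. assert (HM := expansion_M_pos _ _ _ _ _ H). assert (Hr := proj1 H).
  apply Cmod_gt_0 in Hd.
  intros n. induction n as [n IH] using (well_founded_induction Wf_nat.lt_wf).
  apply Cmod_eq_0. apply Rle_antisym; [|apply Cmod_ge_0].
  assert (P : 0 < Cmod d ^ n) by (apply pow_lt; auto).
  apply Rmult_le_reg_r with (Cmod d ^ n); auto. rewrite Rmult_0_l.
  set (K := 2 * M * (Cmod d / r) ^ S n).
  assert (HK : 0 <= K).
  { apply Rmult_le_pos; [lra|]. apply pow_le. apply Rdiv_le_0_compat; lra. }
  apply le_epsilon. intros eps He. rewrite Rplus_0_l.
  (* Inside the segment where [f] vanishes, inside half the radius, and small enough for K t <= eps.
     Since the lower coefficients vanish by induction, [expansion_lead] then gives |a_n| |d|^n <= K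
     t. *)
  set (t := Rmin (Rmin (del / 2) (r / 2 / Cmod d)) (eps / (K + 1))).
  assert (Ht0 : 0 < t).
  { unfold t. repeat apply Rmin_glb_lt; try lra; apply Rdiv_lt_0_compat; lra. }
  assert (T1 : t <= del / 2) by (eapply Rle_trans; apply Rmin_l).
  assert (T2 : t <= r / 2 / Cmod d) by (eapply Rle_trans; [apply Rmin_l|apply Rmin_r]).
  assert (T3 : t <= eps / (K + 1)) by apply Rmin_r.
  assert (E : Cmod (RtoC t * d) = t * Cmod d) by (rewrite Cmod_mult, Cmod_R, Rabs_pos_eq; lra).
  assert (L := expansion_lead _ _ _ _ _ (RtoC t * d)%C n H).
  rewrite Hf, E in L by lra.
  assert (T2' : t * Cmod d <= r / 2).
  { apply Rmult_le_reg_r with (/ Cmod d); [apply Rinv_0_lt_compat; auto|].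
    rewrite Rmult_assoc, Rinv_r, Rmult_1_r by lra. exact T2. }
  specialize (L T2' IH).
  replace (0 - a n * (t * d) ^ n)%C with (- (a n * (t * d) ^ n))%C in L by ring.
  rewrite Cmod_opp, Cmod_mult, Cmod_pow, E, Rpow_mult_distr in L.
  replace (t * Cmod d / r) with (t * (Cmod d / r)) in L by (unfold Rdiv; ring).
  rewrite Rpow_mult_distr in L.
  assert (Pt : 0 < t ^ n) by (apply pow_lt; auto).
  assert (L2 : Cmod (a n) * Cmod d ^ n <= K * t).
  { apply Rmult_le_reg_r with (t ^ n); auto. unfold K. simpl pow in *. nra. }
  eapply Rle_trans; [exact L2|].
  apply Rle_trans with (K * (eps / (K + 1))); [apply Rmult_le_compat_l; auto|].
  assert (D : (K + 1) * (eps / (K + 1)) = eps) by (field; lra).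
  assert (0 < eps / (K + 1)) by (apply Rdiv_lt_0_compat; lra). lra.
Qed.

Lemma analytic_zero_of_ray f z (d : C) del : analytic f z -> d <> 0%C -> 0 < del ->
  (forall t, 0 < t < del -> f (z + RtoC t * d)%C = 0%C) ->
  exists r, 0 < r /\ forall h, Cmod h < r -> f (z + h)%C = 0%C.
Proof.
  intros (a & r & M & H) Hd Hdel Hf. exists r. split; [apply H|]. intros h Hh.
  assert (Z := expansion_zero_of_ray _ _ _ _ _ _ _ H Hd Hdel Hf).
  apply (Cser_unique (fun k => a k * h ^ k)%C); [apply H; auto|].
  apply (Cser_finite _ 0); auto. intros; rewrite Z; ring.
Qed.

(** If the zeros stopped at a finite supremum s, the expansion at s would vanish because [f] is zero
    behind it, in direction -d; the zeros would then continue past s. *)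
Lemma identity_ray f z (d : C) del : (forall t : R, analytic f (z + RtoC t * d)%C) -> d <> 0%C -> 0 < del ->
  (forall t, 0 < t < del -> f (z + RtoC t * d)%C = 0%C) ->
  forall t, 0 < t -> f (z + RtoC t * d)%C = 0%C.
Proof.
  intros Hf Hd Hdel H0 T HT. apply NNPP. intros Hne.
  set (E := fun x => 0 < x /\ forall t, 0 < t < x -> f (z + RtoC t * d)%C = 0%C).
  destruct (completeness E) as [s [Hs1 Hs2]].
  - exists T. intros x [Hx Hx']. apply Rnot_lt_le. intros Hl. apply Hne, Hx'. lra.
  - exists del. split; auto.
  - assert (Hsd : del <= s) by (apply Hs1; split; auto).
    assert (Z : forall t, 0 < t < s -> f (z + RtoC t * d)%C = 0%C).
    { intros t Ht. apply NNPP. intros Hn.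
      assert (s <= t); [|lra]. apply Hs2. intros x [Hx Hx']. apply Rnot_lt_le. intros Hl. apply Hn, Hx'. lra. }
    destruct (analytic_zero_of_ray f (z + RtoC s * d)%C (- d)%C s (Hf s)) as [r [Hr Hz]].
    + intros E0. apply Hd. replace d with (- - d)%C by ring. rewrite E0; ring.
    + lra.
    + intros t Ht. replace (z + s * d + t * - d)%C with (z + RtoC (s - t) * d)%C.
      * apply Z; lra.
      * rewrite RtoC_minus. ring.
    + apply Cmod_gt_0 in Hd.
      assert (Hx : E (s + r / Cmod d)).
      { assert (0 < r / Cmod d) by (apply Rdiv_lt_0_compat; auto).
        split; [lra|]. intros t Ht. destruct (Rlt_le_dec t s) as [h|h]; [apply Z; lra|].
        replace (z + t * d)%C with (z + s * d + RtoC (t - s) * d)%C by (rewrite RtoC_minus; ring).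
        apply Hz. rewrite Cmod_mult, Cmod_R, Rabs_pos_eq by lra.
        apply Rmult_lt_reg_r with (/ Cmod d); [apply Rinv_0_lt_compat; auto|].
        rewrite Rmult_assoc, Rinv_r, Rmult_1_r by lra. unfold Rdiv in Ht. lra. }
      apply Hs1 in Hx. assert (0 < r / Cmod d) by (apply Rdiv_lt_0_compat; auto). lra.
Qed.

Lemma identity_line f z (d : C) del : (forall t : R, analytic f (z + RtoC t * d)%C) -> d <> 0%C -> 0 < del ->
  (forall t, 0 < t < del -> f (z + RtoC t * d)%C = 0%C) ->
  forall t : R, f (z + RtoC t * d)%C = 0%C.
Proof.
  intros Hf Hd Hdel H0 t.
  assert (Hz : analytic f z) by (generalize (Hf 0); rewrite Cmult_0_l, Cplus_0_r; auto).
  destruct (analytic_zero_of_ray f z d del Hz Hd Hdel H0) as [r [Hr Hz0]].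
  destruct (Rtotal_order t 0) as [h|[h|h]].
  - replace (z + t * d)%C with (z + RtoC (- t) * (- d))%C by (rewrite RtoC_opp; ring).
    assert (Pd : 0 < Cmod d) by (apply Cmod_gt_0; auto).
    apply (identity_ray f z (- d)%C (r / Cmod d)); [| |apply Rdiv_lt_0_compat; auto| |lra].
    + intros x. replace (z + x * - d)%C with (z + RtoC (- x) * d)%C by (rewrite RtoC_opp; ring). apply Hf.
    + intros E0. apply Hd. replace d with (- - d)%C by ring. rewrite E0; ring.
    + intros x Hx. apply Hz0. rewrite Cmod_mult, Cmod_opp, Cmod_R, Rabs_pos_eq by lra.
      apply Rmult_lt_reg_r with (/ Cmod d); [apply Rinv_0_lt_compat; auto|].
      rewrite Rmult_assoc, Rinv_r, Rmult_1_r by lra. unfold Rdiv in Hx. lra.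
  - subst. apply Hz0. rewrite Cmult_0_l, Cmod_0. auto.
  - apply (identity_ray f z d del); auto.
Qed.

(** The horizontal line through a nonreal point avoids the real axis and enters the half-plane Re >
    c. *)
Lemma zero_nonreal f c : (forall s, Im s <> 0 -> analytic f s) -> (forall s, c < Re s -> f s = 0%C) ->
  forall s, Im s <> 0 -> f s = 0%C.
Proof.
  intros Hf H0 s Hs.
  set (z := ((c + 1, Im s) : C)).
  replace s with (z + RtoC (Re s - c - 1) * 1)%C by (apply Ceq; simpl; ring).
  apply (identity_line f z 1%C 1); [| |lra|].
  - intros t. apply Hf. simpl. lra.
  - apply C1_nz.
  - intros t Ht. apply H0. simpl. lra.
Qed.

Lemma zero_by_continuity f s (d : C) : analytic f s -> Cmod d = 1 ->
  (forall t, 0 < t -> f (s + RtoC t * d)%C = 0%C) -> f s = 0%C.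
Proof.
  intros Hf Hd H. apply Cmod_eq_0. apply Rle_antisym; [|apply Cmod_ge_0].
  apply le_epsilon. intros eps He.
  destruct (analytic_continuous _ _ Hf eps He) as [del [Hdel Hc]].
  specialize (Hc (RtoC (del / 2) * d)%C). rewrite H in Hc by lra.
  replace (0 - f s)%C with (- f s)%C in Hc by ring.
  rewrite Cmod_opp, Cmod_mult, Hd, Cmod_R, Rabs_pos_eq in Hc by lra. specialize (Hc ltac:(lra)). lra.
Qed.

(** The form of the identity theorem that suits Gamma and zeta, whose singularities are real:
    nonreal points are reached along horizontal lines, and a real point of [D] is a limit of points
    above it. *)
Lemma zero_right_half f c (D : C -> Prop) : (forall s, Im s <> 0 -> D s) -> (forall s, D s -> analytic f s) ->
  (forall s, c < Re s -> f s = 0%C) -> forall s, D s -> f s = 0%C.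
Proof.
  intros HD Hf H0.
  assert (N := zero_nonreal f c (fun s Hs => Hf s (HD s Hs)) H0).
  intros s Hs. destruct (Req_dec (Im s) 0) as [E|E]; auto.
  apply (zero_by_continuity f s Ci); auto.
  - apply Cmod_Ci.
  - intros t Ht. apply N. unfold Im in *. simpl. rewrite E. lra.
Qed.

Lemma is_derive_cont (p : R -> R) x l : is_derive p x l -> continuity_pt p x.
Proof.
  intros H. apply continuity_pt_filterlim. apply (ex_derive_continuous (V := R_NormedModule)). exists l; auto.
Qed.

Lemma derive_nonneg_incr (p p' : R -> R) a b : a <= b -> (forall t, a <= t <= b -> is_derive p t (p' t)) ->
  (forall t, a <= t <= b -> 0 <= p' t) -> p a <= p b.
Proof.
  intros Hab Hd Hp. destruct (MVT_gen p a b p') as [c [Hc E]];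
    rewrite ?Rmin_left, ?Rmax_right in * by lra.
  - intros x Hx; apply Hd; lra.
  - intros x Hx. eapply is_derive_cont. apply Hd; lra.
  - generalize (Hp c Hc). intros. assert (0 <= p' c * (b - a)) by (apply Rmult_le_pos; lra). lra.
Qed.

Lemma is_derive_pow_fact n x : is_derive (fun t => t ^ S n / INR (fact (S n))) x (x ^ n / INR (fact n)).
Proof.
  assert (H1 : INR (fact n) <> 0) by apply INR_fact_neq_0.
  assert (H2 : INR (S n) <> 0) by (apply not_0_INR; lia).
  replace (x ^ n / INR (fact n)) with (/ INR (fact (S n)) * (INR (S n) * 1 * x ^ n)).
  - apply (is_derive_ext (fun t => / INR (fact (S n)) * t ^ S n)).
    { intros t; unfold Rdiv; apply Rmult_comm. }
    apply is_derive_scal. apply (is_derive_pow (fun t => t) (S n)). apply @is_derive_id.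
  - change (fact (S n)) with (S n * fact n)%nat. rewrite mult_INR. field. auto.
Qed.

Lemma pow_fact_le_exp n x : 0 <= x -> x ^ n / INR (fact n) <= exp x.
Proof.
  revert x. induction n as [|n IH]; intros x Hx.
  - simpl. replace (1 / 1) with 1 by field. rewrite <- exp_0. apply exp_le; auto.
  - assert (H : exp 0 - 0 ^ S n / INR (fact (S n)) <= exp x - x ^ S n / INR (fact (S n))).
    { apply (derive_nonneg_incr (fun t => exp t - t ^ S n / INR (fact (S n)))
        (fun t => exp t - t ^ n / INR (fact n))); auto.
      - intros t Ht. apply (is_derive_minus exp (fun t => t ^ S n / INR (fact (S n)))).
        apply is_derive_exp. apply is_derive_pow_fact.
      - intros t Ht. specialize (IH t ltac:(lra)). lra. }
    rewrite exp_0, pow_i in H by lia. unfold Rdiv in *. lra.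
Qed.

(** Applied with x = a e^u it turns double exponential decay into decay faster than any prescribed
    exponential. *)
Lemma exp_neg_le_pow n x : 0 < x -> exp (- x) <= INR (fact n) / x ^ n.
Proof.
  intros Hx. assert (H := pow_fact_le_exp n x ltac:(lra)).
  assert (P := pow_lt x n Hx). assert (Q := INR_fact_lt_0 n). assert (E := exp_pos x).
  rewrite exp_Ropp. apply Rmult_le_reg_r with (exp x * x ^ n / INR (fact n)).
  - apply Rdiv_lt_0_compat; auto. apply Rmult_lt_0_compat; auto.
  - replace (/ exp x * (exp x * x ^ n / INR (fact n))) with (x ^ n / INR (fact n)) by (field; split; lra).
    replace (INR (fact n) / x ^ n * (exp x * x ^ n / INR (fact n))) with (exp x) by (field; split; lra).
    auto.
Qed.

(** For each component p, K t^(n+1)/(n+1)! plus or minus p is nondecreasing; adding the two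
    components gives the factor 2. *)
Lemma Cderiv_pow_bound (f f' : R -> C) K n b : 0 <= b ->
  (forall t, 0 <= t <= b -> Cderiv f t (f' t)) ->
  (forall t, 0 <= t <= b -> Cmod (f' t) <= K * (t ^ n / INR (fact n))) ->
  Cmod (f b - f 0) <= 2 * K * (b ^ S n / INR (fact (S n))).
Proof.
  intros Hb Hd Hf.
  assert (A : forall p p' : R -> R,
    (forall t, 0 <= t <= b -> is_derive p t (p' t)) ->
    (forall t, 0 <= t <= b -> Rabs (p' t) <= K * (t ^ n / INR (fact n))) ->
    Rabs (p b - p 0) <= K * (b ^ S n / INR (fact (S n)))).
  { intros p p' Hp Hp'.
    assert (A1 : K * (0 ^ S n / INR (fact (S n))) - p 0 <= K * (b ^ S n / INR (fact (S n))) - p b).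
    { apply (derive_nonneg_incr (fun t => K * (t ^ S n / INR (fact (S n))) - p t)
        (fun t => K * (t ^ n / INR (fact n)) - p' t)); auto.
      - intros t Ht. apply (is_derive_minus (fun t => K * (t ^ S n / INR (fact (S n)))) p); auto.
        apply (is_derive_scal (fun t => t ^ S n / INR (fact (S n)))). apply is_derive_pow_fact.
      - intros t Ht. specialize (Hp' t Ht). apply Rabs_le_between in Hp'. lra. }
    assert (A2 : K * (0 ^ S n / INR (fact (S n))) + p 0 <= K * (b ^ S n / INR (fact (S n))) + p b).
    { apply (derive_nonneg_incr (fun t => K * (t ^ S n / INR (fact (S n))) + p t)
        (fun t => K * (t ^ n / INR (fact n)) + p' t)); auto.
      - intros t Ht. apply (is_derive_plus (fun t => K * (t ^ S n / INR (fact (S n)))) p); auto.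
        apply (is_derive_scal (fun t => t ^ S n / INR (fact (S n)))). apply is_derive_pow_fact.
      - intros t Ht. specialize (Hp' t Ht). apply Rabs_le_between in Hp'. lra. }
    rewrite pow_i in A1, A2 by lia. unfold Rdiv in A1 at 1, A2 at 1.
    rewrite Rmult_0_l, Rmult_0_r in A1, A2.
    apply Rabs_le_between. lra. }
  eapply Rle_trans; [apply Cmod_le_sum|].
  assert (A1 := A (fun t => Re (f t)) (fun t => Re (f' t)) (fun t Ht => proj1 (Hd t Ht))
    (fun t Ht => Rle_trans _ _ _ (re_le_Cmod _) (Hf t Ht))).
  assert (A2 := A (fun t => Im (f t)) (fun t => Im (f' t)) (fun t Ht => proj2 (Hd t Ht))
    (fun t Ht => Rle_trans _ _ _ (im_le_Cmod _) (Hf t Ht))).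
  change (Re (f b - f 0)%C) with (Re (f b) - Re (f 0)).
  change (Im (f b - f 0)%C) with (Im (f b) - Im (f 0)).
  cbv beta in A1, A2. lra.
Qed.

Definition exp_coef (k : nat) : C := RtoC (/ INR (fact k)).

Lemma Cderiv_minus f g u l m :
  Cderiv f u l -> Cderiv g u m -> Cderiv (fun t => f t - g t)%C u (l - m)%C.
Proof.
  intros Hf Hg. assert (H := Cderiv_mult (fun _ => (-(1))%C) g u _ _ (Cderiv_const _ u) Hg).
  apply (Cderiv_ext (fun t => f t + (-(1)) * g t)%C); [intros; ring|].
  replace (l - m)%C with (l + (0 * g u + (-(1)) * m))%C by ring. apply Cderiv_plus; auto.
Qed.

Lemma Cderiv_scal (c : C) f u l : Cderiv f u l -> Cderiv (fun t => c * f t)%C u (c * l)%C.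
Proof.
  intros H. replace (c * l)%C with (0 * f u + c * l)%C by ring. apply (Cderiv_mult (fun _ => c)); auto.
  apply Cderiv_const.
Qed.

(** Along the segment from 0 to h the remainder of order n + 1 vanishes at 0 and has derivative h
    times the remainder of order n. Each step costs the factor 2 of [Cderiv_pow_bound], which n!
    absorbs. *)
Lemma Cexp_remainder (h : C) n t : 0 <= t <= 1 ->
  Cmod (Cexp (RtoC t * h) - Csum (fun k => exp_coef k * (RtoC t * h) ^ k)%C n)
    <= exp (Cmod h) * (2 * Cmod h) ^ n * (t ^ n / INR (fact n)).
Proof.
  revert t. induction n as [|n IH]; intros t Ht.
  - simpl. replace (Cexp (t * h) - 0)%C with (Cexp (t * h)) by ring.
    rewrite Cmod_Cexp. replace (exp (Cmod h) * 1 * (1 / 1)) with (exp (Cmod h)) by field.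
    apply exp_le. simpl.
    assert (H := re_le_Cmod h). apply Rabs_le_between in H. unfold Re in H. generalize (Cmod_ge_0 h). nra.
  - set (R := fun n t => (Cexp (RtoC t * h) - Csum (fun k => exp_coef k * (RtoC t * h) ^ k)%C n)%C).
    assert (Hd : forall t, Cderiv (R (S n)) t (h * R n t)%C).
    { intros x. clear - x. unfold R.
      assert (A : forall m, Cderiv (fun t => Csum (fun k => exp_coef k * (RtoC t * h) ^ k)%C (S m)) x
         (h * Csum (fun k => exp_coef k * (RtoC x * h) ^ k)%C m)%C).
      { induction m as [|m IHm].
        - simpl. replace (h * 0)%C with (RtoC 0) by ring. 
          apply (Cderiv_ext (fun _ => exp_coef 0)); [intros; ring|]. apply Cderiv_const.
        - replace (h * Csum (fun k => exp_coef k * (x * h) ^ k) (S m))%C with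
            (h * Csum (fun k => exp_coef k * (x * h) ^ k) m + h ^ S m * RtoC (x ^ m / INR (fact m)))%C.
          + change (Cderiv (fun t => Csum (fun k => exp_coef k * (RtoC t * h) ^ k)%C (S m) +
              exp_coef (S m) * (RtoC t * h) ^ S m)%C x
              (h * Csum (fun k => exp_coef k * (x * h) ^ k) m + h ^ S m * RtoC (x ^ m / INR (fact m)))%C).
            apply Cderiv_plus; auto.
            apply (Cderiv_ext (fun t => h ^ S m * RtoC (t ^ S m / INR (fact (S m))))%C).
            * intros y. unfold exp_coef, Rdiv. rewrite Cpow_mul, RtoC_mult, RtoC_pow. ring.
            * apply Cderiv_scal, Cderiv_RtoC, is_derive_pow_fact.
          + cbn [Csum]. unfold exp_coef at 3, Rdiv. rewrite Cpow_mul, RtoC_mult, RtoC_pow.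
            change (h ^ S m)%C with (h * h ^ m)%C. ring. }
      replace (h * (Cexp (x * h) - Csum (fun k => exp_coef k * (x * h) ^ k) n))%C with
        (h * Cexp (x * h) - h * Csum (fun k => exp_coef k * (x * h) ^ k) n)%C by ring.
      apply Cderiv_minus; [|apply A].
      apply (Cderiv_Cexp (fun t => RtoC t * h)%C).
      apply (Cderiv_ext (fun t => h * RtoC t)%C); [intros; ring|].
      assert (D : Cderiv (fun t => h * RtoC t)%C x (h * RtoC 1)%C).
      { apply Cderiv_scal, Cderiv_RtoC. apply @is_derive_id. }
      rewrite Cmult_1_r in D. exact D. }
    assert (R0 : R (S n) 0 = 0%C).
    { unfold R. rewrite Cmult_0_l, Cexp_0. 
      assert (E : forall m, Csum (fun k => exp_coef k * 0 ^ k)%C (S m) = 1%C).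
      { induction m as [|m IHm]; [simpl; unfold exp_coef; simpl; rewrite Rinv_1; ring|].
        change (Csum (fun k => exp_coef k * 0 ^ k)%C (S m) + exp_coef (S m) * 0 ^ S m = 1)%C.
        rewrite IHm. simpl. ring. }
      rewrite E. ring. }
    assert (B := Cderiv_pow_bound (R (S n)) (fun t => h * R n t)%C
      (Cmod h * (exp (Cmod h) * (2 * Cmod h) ^ n)) n t (proj1 Ht) (fun t _ => Hd t)).
    rewrite R0 in B. replace (R (S n) t - 0)%C with (R (S n) t) in B by ring.
    eapply Rle_trans; [apply B|].
    + intros s Hs. rewrite Cmod_mult, !Rmult_assoc. apply Rmult_le_compat_l; [apply Cmod_ge_0|].
      rewrite <- !Rmult_assoc. apply IH. lra.
    + right. simpl pow. ring.
Qed.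

Lemma exp_series (x : R) : is_series (fun k => x ^ k / INR (fact k)) (exp x).
Proof.
  generalize (is_exp_Reals x). unfold is_pseries. apply is_series_ext. intros n.
  unfold scal; simpl; unfold mult; simpl. rewrite pow_n_pow. unfold Rdiv; auto.
Qed.

Lemma Cexp_series (h : C) : Cser (fun k => exp_coef k * h ^ k)%C (Cexp h).
Proof.
  apply is_lim_seq_squeeze0 with (fun n => exp (Cmod h) * ((2 * Cmod h) ^ n / INR (fact n))).
  - intros n; split; [apply Cmod_ge_0|].
    assert (H := Cexp_remainder h n 1 ltac:(lra)).
    rewrite Cmult_1_l in H. rewrite pow1 in H. eapply Rle_trans; [exact H|]. right; unfold Rdiv; ring.
  - apply is_lim_seq_scal0. apply ex_series_lim_0. eexists; apply exp_series.
Qed.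

Lemma Cmod_exp_coef k (h : C) : Cmod (exp_coef k * h ^ k)%C = Cmod h ^ k / INR (fact k).
Proof.
  rewrite Cmod_mult, Cmod_pow. unfold exp_coef. rewrite Cmod_R, Rabs_pos_eq.
  - unfold Rdiv; ring.
  - left; apply Rinv_0_lt_compat, INR_fact_lt_0.
Qed.

Lemma analytic_Cexp z : analytic Cexp z.
Proof.
  exists (fun k => Cexp z * exp_coef k)%C, 1, (Cmod (Cexp z)). split; [lra|split].
  - intros k. rewrite pow1, Cmod_mult, Rmult_1_r.
    rewrite <- (Rmult_1_r (Cmod (Cexp z))) at 2. apply Rmult_le_compat_l; [apply Cmod_ge_0|].
    unfold exp_coef. rewrite Cmod_R, Rabs_pos_eq by (left; apply Rinv_0_lt_compat, INR_fact_lt_0).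
    rewrite <- Rinv_1. apply Rinv_le_contravar; [lra|]. change 1 with (INR 1). apply le_INR.
    generalize (lt_O_fact k). lia.
  - intros h _. rewrite Cexp_plus.
    apply (Cser_ext (fun k => Cexp z * (exp_coef k * h ^ k))%C); [intros; ring|].
    apply Cser_scal, Cexp_series.
Qed.

Lemma Ccont_id : Ccont (fun u => RtoC u).
Proof. apply Ccont_RtoC. intros; apply continuous_id. Qed.

Lemma Ccont_pow (f : R -> C) n : Ccont f -> Ccont (fun u => f u ^ n)%C.
Proof. intros H. induction n as [|n IH]; simpl; [apply Ccont_const|apply Ccont_mult; auto]. Qed.

(** Part of the decay rate is spent on the powers of u: |z u|^k / k! <= (|z| / rho)^k exp(rho
    |u|). *)
Lemma Cdecay_term c K (g : R -> C) (z : C) rho k : 0 < rho -> Cdecay c K g ->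
  Cdecay (c - rho) (K * (Cmod z / rho) ^ k) (fun u => g u * (exp_coef k * (z * RtoC u) ^ k))%C.
Proof.
  intros Hr Hg. assert (HK := Cdecay_K_pos _ _ _ Hg). destruct Hg as [A B]; split.
  - apply Ccont_mult; auto. apply Ccont_mult; [apply Ccont_const|].
    apply Ccont_pow, Ccont_mult; [apply Ccont_const|apply Ccont_id].
  - intros u. rewrite Cmod_mult, Cmod_exp_coef, Cmod_mult, Cmod_R.
    replace (- (c - rho) * Rabs u) with (- c * Rabs u + rho * Rabs u) by ring. rewrite exp_plus.
    replace (K * (Cmod z / rho) ^ k * (exp (- c * Rabs u) * exp (rho * Rabs u)))
      with ((K * exp (- c * Rabs u)) * ((Cmod z / rho) ^ k * exp (rho * Rabs u))) by ring.
    assert (P : 0 <= Cmod z * Rabs u) by (apply Rmult_le_pos; auto using Cmod_ge_0, Rabs_pos).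
    apply Rmult_le_compat; auto using Cmod_ge_0.
    + apply Rdiv_le_0_compat; [apply pow_le; auto | apply INR_fact_lt_0].
    + replace (Cmod z * Rabs u) with ((Cmod z / rho) * (rho * Rabs u)) by (field; lra).
      rewrite Rpow_mult_distr. unfold Rdiv at 1. rewrite Rmult_assoc.
      apply Rmult_le_compat_l.
      * apply pow_le, Rdiv_le_0_compat; auto using Cmod_ge_0.
      * apply pow_fact_le_exp. apply Rmult_le_pos; auto using Rabs_pos; lra.
Qed.

Lemma CI_exp_series c K (g : R -> C) (z : C) rho : 0 < rho < c -> Cmod z < rho -> Cdecay c K g ->
  (exists K', Cdecay (c - rho) K' (fun u => g u * Cexp (z * RtoC u))%C) /\
  Cser (fun k => CI (fun u => g u * (exp_coef k * (z * RtoC u) ^ k))%C) (CI (fun u => g u * Cexp (z * RtoC u))%C).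
Proof.
  intros Hr Hz Hg.
  destruct (CI_series (c - rho) (fun k => K * (Cmod z / rho) ^ k)
    (fun k u => g u * (exp_coef k * (z * RtoC u) ^ k))%C (fun u => g u * Cexp (z * RtoC u))%C) as [H1 H2]; auto.
  - lra.
  - intros k. apply Cdecay_term; auto; lra.
  - apply (ex_series_scal (V := R_NormedModule)). apply ex_series_geom'.
    split; [apply Rdiv_le_0_compat; [apply Cmod_ge_0|lra]|].
    apply Rmult_lt_reg_r with rho; [lra|]. unfold Rdiv. rewrite Rmult_assoc, Rinv_l by lra. lra.
  - intros u. apply Cser_scal, Cexp_series.
  - split; auto. eexists; eauto.
Qed.

(** The factor e^(hu) is expanded under the integral. Half of the decay rate pays for the powers of
    u, and the other half keeps the coefficients integrable. *)
Lemma analytic_laplace c K (g : R -> C) (s0 : C) : 0 < c -> Cdecay c K (fun u => g u * Cexp (s0 * RtoC u))%C ->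
  analytic (fun s => CI (fun u => g u * Cexp (s * RtoC u))%C) s0.
Proof.
  intros Hc Hg. set (G := fun u => (g u * Cexp (s0 * RtoC u))%C) in *.
  exists (fun k => CI (fun u => G u * (exp_coef k * (1 * RtoC u) ^ k))%C), (c / 4),
    (4 * K / (c / 2)).
  assert (HK := Cdecay_K_pos _ _ _ Hg).
  split; [lra|split].
  - intros k.
    assert (B := CI_bound (c - c / 2) _ _ ltac:(lra) (Cdecay_term c K G 1%C (c / 2) k ltac:(lra) Hg)).
    replace (c - c / 2) with (c / 2) in B by field.
    apply Rle_trans with (4 * (K * (Cmod 1 / (c / 2)) ^ k) / (c / 2) * (c / 2) ^ k).
    + apply Rmult_le_compat; auto using Cmod_ge_0.
      * apply pow_le; lra.
      * apply pow_incr; lra.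
    + right. rewrite Cmod_1. unfold Rdiv at 2. rewrite Rmult_1_l, pow_inv. field.
      split; [lra|apply pow_nonzero; lra].
  - intros h Hh.
    destruct (CI_exp_series c K G h (c / 2) ltac:(lra) ltac:(lra) Hg) as [_ H2].
    replace (CI (fun u => g u * Cexp ((s0 + h) * RtoC u))%C) with (CI (fun u => G u * Cexp (h * RtoC u))%C).
    + revert H2. apply Cser_ext. intros k.
      rewrite Cmult_comm.
      rewrite <- (CI_scal (c - c / 2) (K * (Cmod 1 / (c / 2)) ^ k)).
      * apply CI_ext. intros u. rewrite !Cpow_mul.
        replace (1 ^ k)%C with (RtoC 1) by (clear; induction k; simpl; [auto|rewrite <- IHk; ring]). ring.
      * lra.
      * apply Cdecay_term; auto; lra.
    + apply CI_ext. intros u. unfold G. rewrite <- Cmult_assoc, <- Cexp_plus. do 2 f_equal. ring.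
Qed.

(** * The Gamma function *)

Lemma Int_pos c K f u0 : 0 < c -> Rdecay c K f -> (forall u, 0 <= f u) -> 0 < f u0 -> 0 < Int f.
Proof.
  intros Hc Hf H0 Hu.
  assert (Hex := fun a b => Rdecay_ex_RInt c K f a b Hf).
  destruct (proj1 (filterlim_locally f (f u0)) (proj1 Hf u0) (mkposreal _ (Rdiv_lt_0_compat _ 2 Hu ltac:(lra)))) as [d Hd].
  assert (P : 0 < RInt f (u0 - d / 2) (u0 + d / 2)).
  { assert (Hdp := cond_pos d). apply RInt_gt_0; [lra| |].
    - intros x Hx. specialize (Hd x). simpl in Hd.
      assert (Hb : ball u0 d x) by (apply Rabs_def1; unfold minus, plus, opp; simpl; lra).
      specialize (Hd Hb). change (Rabs (f x - f u0) < f u0 / 2) in Hd. apply Rabs_def2 in Hd. lra.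
    - intros x Hx. apply Hf. }
  eapply Rlt_le_trans; [exact P|].
  destruct (INR_unbounded (Rabs u0 + d)) as [N HN].
  apply (is_lim_seq_le_loc (fun _ => RInt f (u0 - d / 2) (u0 + d / 2)) (fun n => RInt f (- INR n) (INR n))
    (RInt f (u0 - d / 2) (u0 + d / 2)) (Int f)).
  - exists N. intros n Hn. apply le_INR in Hn.
    assert (Hdp := cond_pos d).
    assert (A := Rle_abs u0). assert (B := Rle_abs (- u0)). rewrite Rabs_Ropp in B.
    rewrite <- (RInt_Chasles (V := R_CompleteNormedModule) f (- INR n) (u0 - d / 2) (INR n)) by auto.
    rewrite <- (RInt_Chasles (V := R_CompleteNormedModule) f (u0 - d / 2) (u0 + d / 2) (INR n)) by auto.
    assert (Q1 := RInt_ge_0 f (- INR n) (u0 - d / 2) ltac:(lra) (Hex _ _) (fun x _ => H0 x)).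
    assert (Q2 := RInt_ge_0 f (u0 + d / 2) (INR n) ltac:(lra) (Hex _ _) (fun x _ => H0 x)).
    unfold plus; simpl. lra.
  - apply is_lim_seq_const.
  - apply (Int_seq c K); auto.
Qed.

(** Euler's integrand e^(-at) t^s after t = e^u, where dt/t becomes du. *)
Definition gker (a : R) (s : C) (u : R) : C := (RtoC (exp (- a * exp u)) * Cexp (s * RtoC u))%C.

Lemma Ccont_gker a s : Ccont (gker a s).
Proof.
  apply Ccont_mult.
  - apply Ccont_RtoC. apply (continuous_of_derivable _ (fun u => - a * exp u * exp (- a * exp u))).
    intros u. auto_derive; auto. ring.
  - apply Ccont_Cexp, Ccont_mult; [apply Ccont_const|apply Ccont_id].
Qed.

Lemma nat_above (x : R) : exists n : nat, x <= INR n.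
Proof. destruct (INR_unbounded x) as [n Hn]; exists n; lra. Qed.

Lemma Cdecay_gker a s : 0 < a -> 0 < Re s -> exists K, Cdecay (Re s) K (gker a s).
Proof.
  (* On the right the decay e^(-nu) must turn the growth e^(Re s u) into e^(-Re s u), whence n >= 2
     Re s; on the left e^(su) decays by itself. *)
  intros Ha Hs. destruct (nat_above (2 * Re s)) as [n Hn].
  exists (1 + INR (fact n) / a ^ n). split; [apply Ccont_gker|].
  assert (Q : 0 < INR (fact n) / a ^ n) by (apply Rdiv_lt_0_compat; [apply INR_fact_lt_0|apply pow_lt; auto]).
  intros u. unfold gker. rewrite Cmod_mult, Cmod_R, Cmod_Cexp, Rabs_pos_eq by (left; apply exp_pos).
  replace (Re (s * RtoC u)) with (Re s * u) by (unfold Re; simpl; ring).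
  assert (E0 := exp_pos u).
  destruct (Rle_dec u 0) as [h|h].
  - rewrite Rabs_left1 by auto. replace (- Re s * - u) with (Re s * u) by ring.
    apply Rmult_le_compat_r; [left; apply exp_pos|].
    apply Rle_trans with 1; [|lra]. rewrite <- exp_0. apply exp_le. nra.
  - rewrite Rabs_pos_eq by lra.
    assert (E := exp_neg_le_pow n (a * exp u) ltac:(apply Rmult_lt_0_compat; auto)).
    replace (- (a * exp u)) with (- a * exp u) in E by ring.
    rewrite Rpow_mult_distr in E.
    apply Rle_trans with (INR (fact n) / (a ^ n * exp u ^ n) * exp (Re s * u)).
    { apply Rmult_le_compat_r; auto. left; apply exp_pos. }
    replace (INR (fact n) / (a ^ n * exp u ^ n)) with (INR (fact n) / a ^ n * / exp u ^ n).
    2: { field; split; apply pow_nonzero; lra. }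
    rewrite Rmult_assoc. apply Rle_trans with (INR (fact n) / a ^ n * exp (- Re s * u)).
    + apply Rmult_le_compat_l; [lra|].
      assert (Hp : exp u ^ n = exp (INR n * u)).
      { clear. induction n as [|n IH]; [simpl; rewrite Rmult_0_l, exp_0; auto|].
        rewrite S_INR. simpl. rewrite IH, <- exp_plus. f_equal. ring. }
      rewrite Hp, <- exp_Ropp, <- exp_plus. apply exp_le. nra.
    + apply Rmult_le_compat_r; [left; apply exp_pos|lra].
Qed.

Definition Gam0 (s : C) : C := CI (gker 1 s).

(** Scaling t by x is translation of u by ln x. *)
Lemma gker_integral x s : 0 < x -> 0 < Re s -> CI (gker x s) = (Cexp (- s * RtoC (ln x)) * Gam0 s)%C.
Proof.
  intros Hx Hs. destruct (Cdecay_gker 1 s Rlt_0_1 Hs) as [K HK].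
  unfold Gam0. rewrite <- (CI_shift (Re s) K (ln x) (gker 1 s)) by auto.
  destruct (Cdecay_gker x s Hx Hs) as [K' HK'].
  assert (E : forall u, gker 1 s (u + ln x) = (Cexp (s * RtoC (ln x)) * gker x s u)%C).
  { intros u. unfold gker. rewrite exp_plus, exp_ln by auto.
    replace (- (1) * (exp u * x)) with (- x * exp u) by ring.
    rewrite RtoC_plus, Cmult_plus_distr_l, Cexp_plus. ring. }
  rewrite (CI_ext _ _ E), (CI_scal (Re s) K') by auto.
  rewrite Cmult_assoc, <- Cexp_plus.
  replace (- s * RtoC (ln x) + s * RtoC (ln x))%C with (RtoC 0) by ring. rewrite Cexp_0. ring.
Qed.

(** Integration by parts: the derivative of [gker 1 s] is [s * gker 1 s - gker 1 (s + 1)]. *)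
Lemma Gam0_recurrence s : 0 < Re s -> Gam0 (s + 1) = (s * Gam0 s)%C.
Proof.
  intros Hs. destruct (Cdecay_gker 1 s Rlt_0_1 Hs) as [K HK].
  assert (Hs1 : 0 < Re (s + 1)%C) by (simpl; unfold Re in Hs; lra).
  destruct (Cdecay_gker 1 (s + 1) Rlt_0_1 Hs1) as [K' HK'].
  assert (HK2 : Cdecay (Re s) K' (gker 1 (s + 1))).
  { eapply Cdecay_weaken; [|apply Rle_refl|exact HK']. simpl. unfold Re. lra. }
  assert (Z : CI (fun u => s * gker 1 s u - gker 1 (s + 1) u)%C = 0%C).
  { apply (CI_FTC (Re s) K (Cmod s * K + K') (gker 1 s)); auto.
    - intros u. unfold gker.
      replace (s * (RtoC (exp (- (1) * exp u)) * Cexp (s * u)) - RtoC (exp (- (1) * exp u)) * Cexp ((s + 1) * u))%C with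
        (RtoC (- exp u * exp (- (1) * exp u)) * Cexp (s * u) + RtoC (exp (- (1) * exp u)) * ((s * 1) * Cexp (s * u)))%C.
      + apply (Cderiv_mult (fun u => RtoC (exp (- (1) * exp u)))).
        * apply Cderiv_RtoC. auto_derive; auto. ring.
        * apply (Cderiv_Cexp (fun u => s * RtoC u)%C). apply Cderiv_scal, Cderiv_RtoC, @is_derive_id.
      + replace ((s + 1) * u)%C with (s * u + u)%C by ring. rewrite Cexp_plus, Cexp_R, RtoC_mult, RtoC_opp. ring.
    - apply Cdecay_minus; auto. apply Cdecay_scal; auto. }
  rewrite (CI_minus (Re s) (Cmod s * K) K'), (CI_scal (Re s) K) in Z; auto using Cdecay_scal.
  symmetry. apply Cminus_eq. exact Z.
Qed.

Lemma analytic_Gam0 s : 0 < Re s -> analytic Gam0 s.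
Proof.
  intros Hs. destruct (Cdecay_gker 1 s Rlt_0_1 Hs) as [K HK].
  apply (analytic_laplace (Re s) K (fun u => RtoC (exp (- (1) * exp u)))); auto.
Qed.

Lemma cos_ge (x : R) : 1 - x ^ 2 / 2 <= cos x.
Proof.
  assert (H : forall y, 0 <= y -> sin y ^ 2 <= y ^ 2).
  { intros y Hy. destruct (Rle_lt_or_eq_dec 0 y Hy) as [h|h].
    - assert (A := sin_lt_x y h). assert (B := sin_lt_x). 
      assert (- y <= sin y).
      { destruct (Rle_dec y 1) as [h1|h1].
        - assert (0 <= sin y) by (apply sin_ge_0; generalize PI_RGT_0 PI2_1; lra). lra.
        - generalize (SIN_bound y); lra. }
      nra.
    - subst. rewrite sin_0. lra. }
  replace x with (2 * (x / 2)) at 2 by field. rewrite cos_2a_sin.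
  destruct (Rle_dec 0 (x / 2)) as [h|h].
  - generalize (H (x / 2) h). nra.
  - generalize (H (- (x / 2)) ltac:(lra)). rewrite sin_neg. nra.
Qed.

(* If Gam0 s = 0 then, by gker_integral, e^(su) is orthogonal to the powers of y = exp(-e^u).  The polynomials
   (4y(1-y))^n, which concentrate at the point y = 1/2, contradict this. *)
Lemma Gam0_nonzero s : 0 < Re s -> Gam0 s <> 0%C.
Proof.
  intros Hs H0. set (sg := Re s) in *.
  set (y := fun u => exp (- exp u)).
  assert (Hy : forall u, 0 < y u < 1).
  { intros u; unfold y; split; [apply exp_pos|]. rewrite <- exp_0. apply exp_increasing.
    generalize (exp_pos u); lra. }
  assert (Cy : forall u, continuous y u).
  { apply (continuous_of_derivable _ (fun u => - exp u * exp (- exp u))). intros u; unfold y. auto_derive; auto. ring. }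
  destruct (Cdecay_gker 1 s Rlt_0_1 Hs) as [K HK]. fold sg in HK.
  assert (HK0 := Cdecay_K_pos _ _ _ HK).
  set (F := fun (p : R -> R) (u : R) => (RtoC (p (y u)) * gker 1 s u)%C).
  assert (WF : forall p, (forall x, continuous p x) -> (forall x, 0 < x < 1 -> Rabs (p x) <= 1) -> Cdecay sg K (F p)).
  { intros p Cp Bp. split.
    - apply Ccont_mult; [|apply Ccont_gker]. apply Ccont_RtoC. intros u. apply continuous_comp'; auto.
    - intros u. unfold F. rewrite Cmod_mult, Cmod_R.
      rewrite <- (Rmult_1_l (K * _)). apply Rmult_le_compat; auto using Rabs_pos, Cmod_ge_0. apply HK. }
  assert (Cpoly : forall k n x, continuous (fun x => x ^ k * (x * (1 - x)) ^ n) x).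
  { intros k n. apply (continuous_of_derivable _ (Derive (fun x => x ^ k * (x * (1 - x)) ^ n))).
    intros x. apply Derive_correct. auto_derive; auto. }
  assert (Bpoly : forall k n x, 0 < x < 1 -> Rabs (x ^ k * (x * (1 - x)) ^ n) <= 1).
  { intros k n x Hx. rewrite Rabs_pos_eq.
    - rewrite <- (Rmult_1_l 1). apply Rmult_le_compat.
      + apply pow_le; lra.
      + apply pow_le; nra.
      + apply Rle_trans with (1 ^ k); [apply pow_incr; lra|rewrite pow1; lra].
      + apply Rle_trans with (1 ^ n); [apply pow_incr; nra|rewrite pow1; lra].
    - apply Rmult_le_pos; apply pow_le; nra. }
  (* For n = 0 the integrand is [gker (k + 1) s], whose integral is (k + 1)^(-s) Gamma(s). The step
     in n uses x^k (x (1 - x)) = x^(k+1) - x^(k+2). *)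
  assert (Z : forall n k, CI (F (fun x => x ^ k * (x * (1 - x)) ^ n)) = 0%C).
  { induction n as [|n IH]; intros k.
    - transitivity (CI (gker (INR (S k)) s)).
      + apply CI_ext. intros u. unfold F, gker, y. rewrite Cmult_assoc, <- RtoC_mult. do 2 f_equal.
        simpl pow at 2. rewrite Rmult_1_r.
        assert (Hp : exp (- exp u) ^ k = exp (INR k * - exp u)).
        { clear. induction k as [|k IH]; [simpl; rewrite Rmult_0_l, exp_0; auto|].
          rewrite S_INR. simpl. rewrite IH, <- exp_plus. f_equal. ring. }
        rewrite Hp, <- exp_plus, S_INR. f_equal. ring.
      + rewrite gker_integral, H0; auto; [ring|]. apply lt_0_INR; lia.
    - transitivity (CI (fun u => F (fun x => x ^ (S k) * (x * (1 - x)) ^ n)%R u - F (fun x => x ^ (S (S k)) * (x * (1 - x)) ^ n)%R u)%C).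
      + apply CI_ext. intros u. unfold F.
        transitivity ((RtoC (y u ^ S k * (y u * (1 - y u)) ^ n) - RtoC (y u ^ S (S k) * (y u * (1 - y u)) ^ n)) * gker 1 s u)%C; [|ring].
        rewrite <- RtoC_minus. do 2 f_equal. simpl. ring.
      + rewrite (CI_minus sg K K); auto. rewrite !IH. ring. }
  set (t0 := ln (ln 2)).
  assert (Hl2 : 0 < ln 2) by (rewrite <- ln_1; apply ln_increasing; lra).
  assert (Hy0 : y t0 = / 2). { unfold y, t0. rewrite exp_ln by auto. rewrite exp_Ropp, exp_ln; lra. }
  (* Within this distance of t0 the phase Im s (u - t0) is at most 1 in modulus, so its cosine is at
     least 1/2. *)
  set (eta := / (Rabs (Im s) + 1)).
  assert (Heta : 0 < eta) by (apply Rinv_0_lt_compat; generalize (Rabs_pos (Im s)); lra).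
  assert (Mono : forall u v, u < v -> y v < y u).
  { intros u v Huv. apply exp_increasing. apply Ropp_lt_contravar, exp_increasing; auto. }
  set (W := fun u => 4 * (y u * (1 - y u))).
  assert (HW : forall u, 0 <= W u <= 1) by (intros u; unfold W; assert (A := Hy u); assert (B := pow2_ge_0 (1 - 2 * y u)); split; nra).
  set (rho := Rmax (W (t0 + eta)) (W (t0 - eta))).
  assert (Hrho : 0 <= rho < 1).
  { unfold rho; split.
    - eapply Rle_trans; [|apply Rmax_l]. apply HW.
    - generalize (Mono t0 (t0 + eta) ltac:(lra)) (Mono (t0 - eta) t0 ltac:(lra)). rewrite Hy0.
      intros A B. apply Rmax_lub_lt; unfold W; nra. }
  assert (Far : forall u, eta <= Rabs (u - t0) -> W u <= rho).
  { intros u Hu. unfold rho. destruct (Rle_dec t0 u) as [h|h].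
    - rewrite Rabs_pos_eq in Hu by lra. eapply Rle_trans; [|apply Rmax_l].
      assert (y u <= y (t0 + eta)). { destruct (Req_dec u (t0 + eta)) as [->|]; [lra|]. left; apply Mono; lra. }
      generalize (Mono t0 (t0 + eta) ltac:(lra)). rewrite Hy0. unfold W. nra.
    - rewrite Rabs_left in Hu by lra. eapply Rle_trans; [|apply Rmax_r].
      assert (y (t0 - eta) <= y u). { destruct (Req_dec u (t0 - eta)) as [->|]; [lra|]. left; apply Mono; lra. }
      generalize (Mono (t0 - eta) t0 ltac:(lra)). rewrite Hy0. unfold W. nra. }
  set (w := fun u => exp (- (1) * exp u) * exp (sg * u)).
  assert (Gw : forall u, Cmod (gker 1 s u) = w u).
  { intros u. unfold gker, w. rewrite Cmod_mult, Cmod_R, Cmod_Cexp, Rabs_pos_eq by (left; apply exp_pos).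
    do 2 f_equal. unfold sg, Re; simpl; ring. }
  assert (wpos : forall u, 0 < w u) by (intros u; apply Rmult_lt_0_compat; apply exp_pos).
  assert (Cw : forall u, continuous w u).
  { apply (continuous_of_derivable _ (fun u => (sg - exp u) * w u)). intros u; unfold w. auto_derive; auto. ring. }
  assert (Rww : forall p : R -> R, (forall u, continuous p u) -> (forall u, Rabs (p u) <= 1) -> Rdecay sg K (fun u => p u * w u)).
  { intros p Cp Bp. split.
    - intros u. apply (continuous_mult (K := R_AbsRing) p w); auto.
    - intros u. rewrite Rabs_mult. rewrite <- (Rmult_1_l (K * _)).
      apply Rmult_le_compat; auto using Rabs_pos. rewrite Rabs_pos_eq by (left; auto). rewrite <- Gw. apply HK. }
  assert (CWc : forall u, continuous W u).
  { intros u. apply (continuous_comp' y (fun x => 4 * (x * (1 - x)))); auto.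
    apply (continuous_of_derivable _ (fun x => 4 - 8 * x)). intros x; auto_derive; auto. ring. }
  assert (CWn : forall n u, continuous (fun u => W u ^ n) u).
  { intros n u. apply (continuous_comp' W (fun x => x ^ n)); auto.
    apply (continuous_of_derivable _ (fun x => INR n * x ^ pred n)). intros x. auto_derive; auto. ring. }
  assert (BWn : forall n u, Rabs (W u ^ n) <= 1).
  { intros n u. rewrite Rabs_pos_eq by (apply pow_le, HW). rewrite <- (pow1 n). apply pow_incr, HW. }
  (* After rotation by e^(-i Im s t0), the real part of the vanishing integral has weight W^n cos(Im
     s (u - t0)). This weight is at least W^n / 2 - (3/2) rho^n: near t0 by the choice of [eta], far
     from it because W <= rho. *)
  assert (Up : forall n, Int (fun u => W u ^ n * w u) <= 3 * rho ^ n * Int (fun u => 1 * w u)).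
  { intros n.
    assert (Z1 : CI (fun u => RtoC (W u ^ n) * (Cexp (- (Ci * RtoC (Im s) * RtoC t0)) * gker 1 s u))%C = 0%C).
    { transitivity (CI (fun u => (RtoC (4 ^ n) * Cexp (- (Ci * RtoC (Im s) * RtoC t0))) * F (fun x => x ^ 0 * (x * (1 - x)) ^ n)%R u)%C).
      - apply CI_ext. intros u. unfold F, W. rewrite Rpow_mult_distr, RtoC_mult. simpl pow. rewrite Rmult_1_l. ring.
      - rewrite (CI_scal sg K), Z by auto. ring. }
    apply (f_equal Re) in Z1.
    assert (Z2 : Int (fun u => (W u ^ n * cos (Im s * (u - t0))) * w u) = 0).
    { transitivity (Re (CI (fun u => RtoC (W u ^ n) * (Cexp (- (Ci * RtoC (Im s) * RtoC t0)) * gker 1 s u))%C)); [|exact Z1].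
      unfold CI. apply Int_ext. intros u.
      replace (Cexp (- (Ci * RtoC (Im s) * RtoC t0)) * gker 1 s u)%C with
        (RtoC (exp (- (1) * exp u)) * Cexp (s * RtoC u - Ci * RtoC (Im s) * RtoC t0))%C.
      - unfold w, Cexp. 
        replace (Re (s * u - Ci * Im s * t0)) with (sg * u) by (unfold sg, Re, Im; simpl; ring).
        replace (Im (s * u - Ci * Im s * t0)) with (Im s * (u - t0)) by (unfold sg, Re, Im; simpl; ring).
        generalize (W u ^ n) (exp (- (1) * exp u)) (exp (sg * u)) (cos (Im s * (u - t0))) (sin (Im s * (u - t0))).
        intros; unfold Re; simpl; ring.
      - unfold gker. unfold Cminus. rewrite Cexp_plus. ring. }
    assert (RW1 : Rdecay sg K (fun u => W u ^ n * w u)) by (apply (Rww (fun u => W u ^ n)); auto).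
    assert (RW2 : Rdecay sg K (fun u => 1 * w u)).
    { apply (Rww (fun _ => 1)); [intros; apply continuous_const|intros; rewrite Rabs_R1; lra]. }
    assert (RW3 : Rdecay sg K (fun u => (W u ^ n * cos (Im s * (u - t0))) * w u)).
    { apply (Rww (fun u => W u ^ n * cos (Im s * (u - t0)))).
      - intros u. apply (continuous_mult (K := R_AbsRing) (fun u => W u ^ n)); auto.
        apply (continuous_comp' (fun u => Im s * (u - t0)) cos); [|apply continuous_cos].
        apply (continuous_of_derivable _ (fun _ => Im s)). intros v; auto_derive; auto. ring.
      - intros u. rewrite Rabs_mult. rewrite <- (Rmult_1_l 1). apply Rmult_le_compat; auto using Rabs_pos.
        apply Rabs_le_between. generalize (COS_bound (Im s * (u - t0))); lra. }
    assert (L : Int (fun u => / 2 * (W u ^ n * w u) + (- (3 / 2 * rho ^ n)) * (1 * w u)) <= 0).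
    { rewrite <- Z2. eapply (Int_le sg); auto.
      - apply Rdecay_plus; apply Rdecay_scal; eauto.
      - exact RW3.
      - intros u.
        assert (P : 0 <= W u ^ n) by (apply pow_le, HW).
        assert (Pr : 0 <= rho ^ n) by (apply pow_le, Hrho).
        replace (/ 2 * (W u ^ n * w u) + - (3 / 2 * rho ^ n) * (1 * w u)) with ((W u ^ n / 2 - 3 / 2 * rho ^ n) * w u) by field.
        apply Rmult_le_compat_r; [left; auto|].
        destruct (Rle_dec eta (Rabs (u - t0))) as [h|h].
        + assert (W u ^ n <= rho ^ n) by (apply pow_incr; split; [apply HW|apply Far; auto]).
          generalize (COS_bound (Im s * (u - t0))). nra.
        + assert (Hx : Rabs (Im s * (u - t0)) <= 1).
          { rewrite Rabs_mult. unfold eta in h. assert (A := Rabs_pos (Im s)).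
            assert (B : Rabs (u - t0) <= / (Rabs (Im s) + 1)) by lra.
            apply Rle_trans with (Rabs (Im s) * / (Rabs (Im s) + 1)).
            - apply Rmult_le_compat_l; auto.
            - apply Rmult_le_reg_r with (Rabs (Im s) + 1); [lra|]. rewrite Rmult_assoc, Rinv_l by lra. lra. }
          assert (Hc := cos_ge (Im s * (u - t0))).
          assert ((Im s * (u - t0)) ^ 2 <= 1).
          { rewrite <- pow2_abs. generalize (Rabs_pos (Im s * (u - t0))). nra. }
          nra. }
    rewrite (Int_lin sg K K (fun u => W u ^ n * w u) (fun u => 1 * w u)) in L by auto. lra. }
  set (rho' := (1 + rho) / 2).
  assert (Hrho' : rho < rho' < 1) by (unfold rho'; lra).
  (* A continuous bump supported where W >= rho'. It gives a lower bound of order rho'^n, which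
     contradicts the upper bound of order rho^n since rho < rho'. *)
  set (B := fun u => Rmax 0 ((W u - rho') / (1 - rho'))).
  assert (HB : forall u, 0 <= B u <= 1).
  { intros u; unfold B; split; [apply Rmax_l|]. apply Rmax_lub; [lra|].
    apply Rmult_le_reg_r with (1 - rho'); [lra|]. unfold Rdiv. rewrite Rmult_assoc, Rinv_l by lra.
    generalize (HW u); lra. }
  assert (CB : forall u, continuous B u).
  { intros u. unfold B. apply (continuous_ext (fun u => / 2 * ((W u - rho') / (1 - rho') + Rabs ((W u - rho') / (1 - rho'))))).
    - intros v. match goal with |- @eq _ ?a ?b => change (@eq R a b) end.
      unfold Rmax. destruct (Rle_dec 0 ((W v - rho') / (1 - rho'))).
      + rewrite Rabs_pos_eq by auto. field. lra.
      + rewrite Rabs_left by lra. field. lra.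
    - apply (continuous_comp' (fun u => (W u - rho') / (1 - rho')) (fun x => / 2 * (x + Rabs x))).
      + apply (continuous_comp' W (fun x => (x - rho') / (1 - rho'))); auto.
        apply (continuous_of_derivable _ (fun x => / (1 - rho'))). intros x; auto_derive; auto; lra.
      + apply (continuous_scal_r (/ 2) (fun x => x + Rabs x)).
        apply (continuous_plus (fun x => x) Rabs); [apply continuous_id|apply continuous_Rabs]. }
  assert (RB : Rdecay sg K (fun u => B u * w u)).
  { apply (Rww B); auto. intros u. rewrite Rabs_pos_eq; apply HB. }
  assert (PB : 0 < Int (fun u => B u * w u)).
  { apply (Int_pos sg K _ t0); auto.
    - intros u. apply Rmult_le_pos; [apply HB|left; auto].
    - apply Rmult_lt_0_compat; auto. eapply Rlt_le_trans; [|apply Rmax_r].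
      unfold W. rewrite Hy0. apply Rdiv_lt_0_compat; lra. }
  assert (Low : forall n, rho' ^ n * Int (fun u => B u * w u) <= Int (fun u => W u ^ n * w u)).
  { intros n. replace (rho' ^ n * Int (fun u => B u * w u)) with
      (rho' ^ n * Int (fun u => B u * w u) + 0 * Int (fun u => B u * w u)) by ring.
    rewrite <- (Int_lin sg K K) by auto.
    eapply (Int_le sg); auto.
    - apply Rdecay_plus; apply Rdecay_scal; eauto.
    - intros u. rewrite Rmult_0_l, Rplus_0_r, <- Rmult_assoc. apply Rmult_le_compat_r; [left; auto|].
      unfold B. destruct (Rle_dec rho' (W u)) as [h|h].
      + apply Rle_trans with (W u ^ n * 1); [|lra].
        apply Rmult_le_compat; try apply HB; [apply pow_le; lra|]. apply pow_incr; lra.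
      + rewrite Rmax_left. rewrite Rmult_0_r. apply pow_le, HW.
        apply Rmult_le_reg_r with (1 - rho'); [lra|]. unfold Rdiv. rewrite Rmult_assoc, Rinv_l by lra. lra. }
  set (IB := Int (fun u => B u * w u)) in *. set (I0 := Int (fun u => 1 * w u)) in *.
  assert (Hq : 0 <= rho / rho' < 1).
  { split; [apply Rdiv_le_0_compat; lra|]. apply Rmult_lt_reg_r with rho'; [lra|].
    unfold Rdiv; rewrite Rmult_assoc, Rinv_l by lra. lra. }
  assert (Lim : is_lim_seq (fun n => 3 * I0 * (rho / rho') ^ n) 0).
  { apply is_lim_seq_scal0. apply is_lim_seq_geom. rewrite Rabs_pos_eq; lra. }
  assert (IB <= 0); [|lra].
  apply (is_lim_seq_le (fun _ => IB) (fun n => 3 * I0 * (rho / rho') ^ n) IB 0); auto.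
  - intros n. assert (P : 0 < rho' ^ n) by (apply pow_lt; lra).
    apply Rmult_le_reg_l with (rho' ^ n); auto.
    eapply Rle_trans; [apply Low|]. eapply Rle_trans; [apply Up|].
    unfold Rdiv. rewrite Rpow_mult_distr, pow_inv. right. field. lra.
  - apply is_lim_seq_const.
Qed.

Lemma Gamma_integral s : 0 < Re s ->
  CInt (fun t => exp (- t) * rcpow t s / t)%C (at_right 0) (Rbar_locally p_infty) = Gam0 s.
Proof.
  intros Hs. destruct (Cdecay_gker 1 s Rlt_0_1 Hs) as [K HK].
  unfold CInt. apply (is_RInt_gen_unique (V := C_R_CompleteNormedModule)).
  assert (Hint : forall a b, 0 < a -> 0 < b ->
    is_RInt (V := C_R_NormedModule) (fun t => exp (- t) * rcpow t s / t)%C a b (CR (gker 1 s) (ln a) (ln b))).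
  { intros a b Ha Hb.
    assert (Hp : forall x, Rmin a b <= x <= Rmax a b -> 0 < x).
    { intros x Hx. assert (0 < Rmin a b) by (apply Rmin_glb_lt; auto). lra. }
    assert (H : forall p : C -> R, (forall (r : R) z, p (RtoC r * z)%C = r * p z) -> (forall u, continuous (fun t => p (gker 1 s t)) u) ->
      is_RInt (fun t => p (exp (- t) * rcpow t s / t)%C) a b (RInt (fun u => p (gker 1 s u)) (ln a) (ln b))).
    { intros p Hl Hc.
      apply (is_RInt_ext (fun t => scal (/ t) (p (gker 1 s (ln t))))).
      - intros x Hx. assert (Hx0 := Hp x ltac:(lra)).
        change (/ x * p (gker 1 s (ln x)) = p (exp (- x) * rcpow x s / x)%C).
        rewrite <- Hl. f_equal. unfold gker, rcpow. rewrite exp_ln by auto.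
        replace (- (1) * x) with (- x) by ring. rewrite RtoC_inv by (apply Rgt_not_eq; lra). unfold Cdiv. ring.
      - apply (is_RInt_comp (V := R_CompleteNormedModule) (fun u => p (gker 1 s u)) ln (fun t => / t)).
        + intros; apply Hc.
        + intros x Hx. assert (Hx0 := Hp x Hx). split.
          * apply is_derive_ln; auto.
          * apply (ex_derive_continuous (V := R_NormedModule)). auto_derive. lra. }
    assert (HRe := H Re ltac:(intros r [z1 z2]; unfold Re; simpl; ring) (fun u => proj1 (Ccont_gker 1 s u))).
    assert (HIm := H Im ltac:(intros r [z1 z2]; unfold Im; simpl; ring) (fun u => proj2 (Ccont_gker 1 s u))).
    exact (is_RInt_fct_extend_pair (U := R_NormedModule) (V := R_NormedModule) _ _ _ _ _ HRe HIm). }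
  (* The substitution t = e^u carries the endpoints (0, infinity) to the two ends of the line. *)
  assert (L : filterlim (fun ab : R * R => (ln (fst ab), ln (snd ab))) (filter_prod (at_right 0) (Rbar_locally p_infty)) line).
  { apply (filterlim_pair (fun ab : R * R => ln (fst ab)) (fun ab : R * R => ln (snd ab))).
    - apply (filterlim_comp _ _ _ fst ln _ (at_right 0)); [apply filterlim_fst|]. apply is_lim_ln_0.
    - apply (filterlim_comp _ _ _ snd ln _ (Rbar_locally p_infty)); [apply filterlim_snd|]. apply is_lim_ln_p. }
  assert (A1 := filterlim_comp _ _ _ _ _ _ _ _ L (Int_correct _ _ _ Hs (Cdecay_re _ _ _ HK))).
  assert (A2 := filterlim_comp _ _ _ _ _ _ _ _ L (Int_correct _ _ _ Hs (Cdecay_im _ _ _ HK))).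
  intros P [eps HP].
  assert (B1 := proj1 (filterlim_locally _ _) A1 eps). assert (B2 := proj1 (filterlim_locally _ _) A2 eps).
  assert (B3 : filter_prod (at_right 0) (Rbar_locally p_infty) (fun ab => 0 < fst ab /\ 0 < snd ab)).
  { apply (Filter_prod _ _ _ (fun a => 0 < a) (fun b => 0 < b)).
    - exists (mkposreal 1 Rlt_0_1). intros; auto.
    - exists 0; auto.
    - intros; auto. }
  unfold filtermapi.
  generalize (filter_and _ _ B3 (filter_and _ _ B1 B2)). apply filter_imp.
  intros [a b] [[Ha Hb] [C1 C2]]; simpl in Ha, Hb, C1, C2 |- *.
  exists (CR (gker 1 s) (ln a) (ln b)). split; [apply Hint; auto|].
  apply HP. split; auto.
Qed.

(** The value of [epsilon] is known only through its specification, so an actual continuation [g]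
    has to be supplied; equality with [g] on D is left to an identity theorem. *)
Lemma continuation_spec U D f g :
  (forall z, D z -> analytic g z) -> (forall z, U z -> g z = f z) ->
  (forall z, D z -> analytic (continuation U D f) z) /\ (forall z, U z -> continuation U D f z = f z).
Proof.
  intros H1 H2. unfold continuation.
  match goal with |- context [epsilon ?i ?P] =>
    assert (H : P (epsilon i P)) by (apply epsilon_spec; exists g; split; auto;
      intros z Hz; apply analytic_iff_analytic_at; auto) end.
  destruct H as [A B]. split; auto. intros z Hz. apply analytic_iff_analytic_at. auto.
Qed.

Fixpoint rise (s : C) (n : nat) : C :=
  match n with O => 1 | S n => rise s n * (s + INR n) end%C.

Lemma rise_add s n m : rise s (n + m) = (rise s n * rise (s + INR n) m)%C.
Proof.
  induction m as [|m IH]; simpl rise.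
  - rewrite Nat.add_0_r. ring.
  - rewrite Nat.add_succ_r. simpl rise. rewrite IH, plus_INR, RtoC_plus. ring.
Qed.

Lemma Re_add_INR s n : Re (s + INR n)%C = Re s + INR n.
Proof. reflexivity. Qed.

Lemma Gam0_rise s n : 0 < Re s -> Gam0 (s + INR n) = (rise s n * Gam0 s)%C.
Proof.
  intros Hs. induction n as [|n IH].
  - simpl. rewrite Cplus_0_r. ring.
  - rewrite S_INR, RtoC_plus, Cplus_assoc, Gam0_recurrence.
    + rewrite IH. simpl. ring.
    + rewrite Re_add_INR. generalize (pos_INR n); lra.
Qed.

Lemma analytic_rise s n : analytic (fun w => rise w n) s.
Proof.
  induction n as [|n IH]; simpl; [apply analytic_const|].
  apply analytic_mult; auto. apply analytic_plus; [apply analytic_id|apply analytic_const].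
Qed.

Lemma rise_nonzero s n : Gamma_dom s -> rise s n <> 0%C.
Proof.
  intros Hs. induction n as [|n IH]; simpl; [apply C1_nz|].
  apply Cmult_neq_0; auto. intros E. apply (Hs n).
  replace s with (s + INR n - INR n)%C by ring. rewrite E. ring.
Qed.

(* Gam and its reciprocal RGam are computed as Gamma(s) = Gamma(s + n) / (s(s+1)...(s+n-1)) for some n with Re s + n > 0. *)
Definition steps (s : C) : nat := Z.to_nat (up (- Re s)).

Lemma steps_spec s : 0 < Re s + INR (steps s).
Proof.
  destruct (archimed (- Re s)) as [A _]. unfold steps. rewrite INR_IZR_INZ.
  assert (IZR (up (- Re s)) <= IZR (Z.of_nat (Z.to_nat (up (- Re s))))) by (apply IZR_le; lia). lra.
Qed.

Definition RGam (s : C) : C := (rise s (steps s) / Gam0 (s + INR (steps s)))%C.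

Definition Gam (s : C) : C := (Gam0 (s + INR (steps s)) / rise s (steps s))%C.

(** Independence of the number of steps, cross-multiplied so that it also holds where the rising
    factorials vanish. *)
Lemma shift_ratio s n m : 0 < Re s + INR n -> 0 < Re s + INR m ->
  (rise s n * Gam0 (s + INR m) = rise s m * Gam0 (s + INR n))%C.
Proof.
  assert (A : forall n k, 0 < Re s + INR n ->
    (rise s n * Gam0 (s + INR (n + k)) = rise s (n + k) * Gam0 (s + INR n))%C).
  { intros n' k H. rewrite rise_add, plus_INR, RtoC_plus, Cplus_assoc, Gam0_rise; [ring|].
    rewrite Re_add_INR; auto. }
  intros Hn Hm. destruct (Nat.le_ge_cases n m) as [h|h].
  - replace m with (n + (m - n))%nat by lia. apply A; auto.
  - replace n with (m + (n - m))%nat by lia. symmetry. apply A; auto.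
Qed.

Lemma RGam_eq s n : 0 < Re s + INR n -> RGam s = (rise s n / Gam0 (s + INR n))%C.
Proof.
  intros H. assert (E := shift_ratio s n (steps s) H (steps_spec s)).
  assert (N1 : Gam0 (s + INR n) <> 0%C) by (apply Gam0_nonzero; rewrite Re_add_INR; auto).
  assert (N2 : Gam0 (s + INR (steps s)) <> 0%C) by (apply Gam0_nonzero; rewrite Re_add_INR; apply steps_spec).
  unfold RGam. apply (f_equal (fun z => z / (Gam0 (s + INR n) * Gam0 (s + INR (steps s))))%C) in E.
  transitivity (rise s (steps s) * Gam0 (s + INR n) / (Gam0 (s + INR n) * Gam0 (s + INR (steps s))))%C;
    [field; auto|]. rewrite <- E. field; auto.
Qed.

Lemma Gam_RGam s : Gamma_dom s -> (Gam s * RGam s = 1)%C.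
Proof.
  intros Hs. unfold Gam, RGam. field. split.
  2: apply rise_nonzero; auto.
  - apply Gam0_nonzero; rewrite Re_add_INR; apply steps_spec.
Qed.

(** The reciprocal is entire because [Gam0] has no zeros. In [zeta_ext] it appears as a factor, so
    the poles of Gamma need no separate treatment. *)
Lemma analytic_RGam s : analytic RGam s.
Proof.
  (* [steps] jumps with Re s; one step more than needed gives a fixed n that is valid on the whole
     unit disc around s. *)
  set (n := S (steps s)).
  assert (Hn : 1 < Re s + INR n) by (unfold n; rewrite S_INR; generalize (steps_spec s); lra).
  apply (analytic_ext_loc (fun w => rise w n * / Gam0 (1 * w + INR n))%C _ s 1); [lra| |].
  - intros h Hh. rewrite Cmult_1_l. symmetry. apply RGam_eq.
    assert (A := re_le_Cmod h). apply Rabs_le_between in A.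
    change (Re (s + h)%C) with (Re s + Re h). lra.
  - apply analytic_mult; [apply analytic_rise|].
    assert (P : 0 < Re (1 * s + INR n)%C) by (rewrite Cmult_1_l, Re_add_INR; lra).
    apply (analytic_inv (fun w => Gam0 (1 * w + INR n))%C).
    + apply analytic_aff. apply analytic_Gam0; auto.
    + apply Gam0_nonzero; auto.
Qed.

Lemma Cinv_0 : (/ 0)%C = 0%C.
Proof. apply Ceq; simpl; unfold Rdiv; ring. Qed.

Lemma analytic_Gam s : Gamma_dom s -> analytic Gam s.
Proof.
  intros Hs. apply (analytic_ext (fun w => / RGam w)%C).
  (* The identity holds at the poles too, where both sides are 0 by the convention / 0 = 0. *)
  - intros w. unfold RGam, Gam.
    assert (N : Gam0 (w + INR (steps w)) <> 0%C) by (apply Gam0_nonzero; rewrite Re_add_INR; apply steps_spec).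
    destruct (classic (rise w (steps w) = 0%C)) as [E|E].
    + rewrite E. unfold Cdiv. rewrite Cmult_0_l, Cinv_0, Cmult_0_r. auto.
    + field; auto.
  - apply (analytic_inv RGam); [apply analytic_RGam|].
    intros E. generalize (Gam_RGam s Hs). rewrite E, Cmult_0_r. intros E'. apply C1_nz; auto.
Qed.

Lemma Gam_right s : 0 < Re s -> Gam s = Gam0 s.
Proof.
  intros Hs. assert (E := RGam_eq s 0 ltac:(simpl; lra)). simpl in E. rewrite Cplus_0_r in E.
  assert (Hd : Gamma_dom s).
  { intros n En. rewrite En in Hs. simpl in Hs. generalize (pos_INR n). lra. }
  assert (N := Gam0_nonzero s Hs).
  generalize (Gam_RGam s Hd). rewrite E. intros E1.
  transitivity (Gam s * (1 / Gam0 s) * Gam0 s)%C; [field; auto|rewrite E1; ring].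
Qed.

Lemma Gamma_dom_nonreal s : Im s <> 0 -> Gamma_dom s.
Proof. intros H n E. rewrite E in H. apply H. simpl. ring. Qed.

Lemma Gamma_eq s : Gamma_dom s -> Gamma s = Gam s.
Proof.
  intros Hs.
  destruct (continuation_spec (fun s => 0 < Re s) Gamma_dom
    (fun s => CInt (fun t => exp (- t) * rcpow t s / t)%C (at_right 0) (Rbar_locally p_infty)) Gam) as [A B].
  - apply analytic_Gam.
  - intros z Hz. rewrite Gamma_integral, Gam_right; auto.
  - fold Gamma in A, B. apply Cminus_eq.
    apply (zero_right_half (fun s => Gamma s - Gam s)%C 0 Gamma_dom); auto.
    + apply Gamma_dom_nonreal.
    + intros w Hw. apply analytic_minus; auto. apply analytic_Gam; auto.
    + intros w Hw. rewrite B, Gamma_integral, Gam_right; auto. ring.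
Qed.

(** * Jacobi's theta function *)

(** Dominated convergence for series: cut where the tail of [b] is below eps / 4 and pass to the
    limit in the finitely many remaining terms. *)
Lemma tannery (a : nat -> nat -> R) (b L : nat -> R) :
  (forall q k, Rabs (a q k) <= b k) -> ex_series b ->
  (forall k, is_lim_seq (fun q => a q k) (L k)) -> 
  is_lim_seq (fun q => Series (a q)) (Series L).
Proof.
  intros Ha Hb HL.
  assert (HLb : forall k, Rabs (L k) <= b k).
  { intros k. apply (is_lim_seq_le (fun q => Rabs (a q k)) (fun _ => b k) (Rabs (L k)) (b k)); auto.
    - apply (is_lim_seq_abs _ (L k)); auto.
    - apply is_lim_seq_const. }
  assert (Exa : forall q, ex_series (a q)) by (intros q; apply (ex_series_le (V := R_CompleteNormedModule) (a q) b); auto).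
  assert (ExL : ex_series L) by (apply (ex_series_le (V := R_CompleteNormedModule) L b); auto).
  apply (proj1 (is_lim_seq_minus0 (fun q => Series (a q)) (Series L))).
  assert (B : forall N q, Rabs (Series L - Series (a q)) <= sum_n (fun k => Rabs (L k - a q k)) N + 2 * tail b (S N)).
  { intros N q. rewrite <- Series_minus by auto.
    assert (E : forall k, Rabs (L k - a q k) <= 2 * b k).
    { intros k. generalize (Ha q k) (HLb k) (Rabs_triang (L k) (- a q k)). rewrite Rabs_Ropp. unfold Rminus. lra. }
    assert (Ex : ex_series (fun k => Rabs (L k - a q k))).
    { apply (ex_series_le (V := R_CompleteNormedModule) _ (fun k => 2 * b k)).
      - intros k. change (Rabs (Rabs (L k - a q k)) <= 2 * b k). rewrite Rabs_Rabsolu. auto.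
      - apply (ex_series_scal (V := R_NormedModule)); auto. }
    eapply Rle_trans; [apply Series_Rabs; auto|].
    rewrite (Series_incr_n _ (S N)); auto; [|lia]. rewrite <- sum_n_Reals. simpl pred.
    apply Rplus_le_compat_l. unfold tail. rewrite <- Series_scal_l.
    apply Series_le.
    - intros n; split; [apply Rabs_pos|apply E].
    - apply (ex_series_scal (V := R_NormedModule)). apply ex_series_tail; auto. }
  apply is_lim_seq_spec. intros eps.
  assert (He : 0 < eps / 4) by (generalize (cond_pos eps); lra).
  assert (HT := tail_lim b Hb). apply is_lim_seq_spec in HT. destruct (HT (mkposreal _ He)) as [N HN].
  specialize (HN (S N) ltac:(lia)). simpl in HN. rewrite Rminus_0_r in HN.
  assert (HS : is_lim_seq (fun q => sum_n (fun k => Rabs (L k - a q k)) N) 0).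
  { clear HN. induction N as [|N IH].
    - apply (is_lim_seq_ext (fun q => Rabs (L 0%nat - a q 0%nat))). { intros; rewrite sum_O; auto. }
      apply (proj2 (is_lim_seq_minus0 (fun q => a q 0%nat) (L 0%nat))); auto.
    - apply (is_lim_seq_ext (fun q => sum_n (fun k => Rabs (L k - a q k)) N + Rabs (L (S N) - a q (S N)))).
      { intros; rewrite sum_Sn; auto. }
      apply is_lim_seq_plus0; auto.
      apply (proj2 (is_lim_seq_minus0 (fun q => a q (S N)) (L (S N)))); auto. }
  apply is_lim_seq_spec in HS. destruct (HS (mkposreal _ He)) as [Q HQ]. exists Q. intros q Hq.
  specialize (HQ q Hq). simpl in HQ. rewrite Rminus_0_r in *. rewrite Rabs_Rabsolu.
  apply Rabs_def2 in HQ. apply Rabs_def2 in HN. generalize (B N q) (cond_pos eps). lra.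
Qed.

(* Transition probabilities of the lazy walk with steps -1, 0, 1 of weights 1/4, 1/2, 1/4:
   walk n d = 4^-n binomial(2n, n + d). *)
Fixpoint walk (n : nat) (d : Z) : R :=
  match n with
  | O => if Z.eq_dec d 0 then 1 else 0
  | S n => (walk n (d - 1) + 2 * walk n d + walk n (d + 1)) / 4
  end.

Lemma walk_nonneg n d : 0 <= walk n d.
Proof.
  revert d; induction n as [|n IH]; intros d; cbn [walk].
  - destruct (Z.eq_dec d 0); lra.
  - generalize (IH (d - 1)%Z) (IH d) (IH (d + 1)%Z); lra.
Qed.

Lemma walk_sym n d : walk n (- d) = walk n d.
Proof.
  revert d; induction n as [|n IH]; intros d; cbn [walk].
  - destruct (Z.eq_dec (- d) 0), (Z.eq_dec d 0); auto; lia.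
  - rewrite <- (IH (d - 1)%Z), <- (IH d), <- (IH (d + 1)%Z).
    replace (- d - 1)%Z with (- (d + 1))%Z by ring. replace (- d + 1)%Z with (- (d - 1))%Z by ring. lra.
Qed.

Lemma walk_support n d : (Z.of_nat n < Z.abs d)%Z -> walk n d = 0.
Proof.
  revert d; induction n as [|n IH]; intros d Hd; cbn [walk].
  - destruct (Z.eq_dec d 0); auto; lia.
  - rewrite !IH by lia. lra.
Qed.

(** The ratio of neighbouring binomial coefficients, obtained from the recurrence and
    cross-multiplied so that it holds for every integer d. *)
Lemma walk_ratio n d : (INR n + IZR d + 1) * walk n (d + 1) = (INR n - IZR d) * walk n d.
Proof.
  revert d; induction n as [|n IH]; intros d.
  - cbn [walk]. simpl INR. destruct (Z.eq_dec (d + 1) 0) as [E|E], (Z.eq_dec d 0) as [F|F].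
    + lia.
    + replace d with (-1)%Z by lia. lra.
    + subst. lra.
    + lra.
  - cbn [walk]. rewrite S_INR.
    assert (H1 := IH d). assert (H2 := IH (d + 1)%Z). assert (H3 := IH (d - 1)%Z).
    rewrite minus_IZR in H3. rewrite plus_IZR in H2.
    replace (d - 1 + 1)%Z with d in H3 by ring. replace (d + 1 - 1)%Z with d by ring.
    nra.
Qed.

Definition centre (n : nat) : R := walk n 0.

Lemma centre_S n : centre (S n) = centre n * ((2 * INR n + 1) / (2 * (INR n + 1))).
Proof.
  unfold centre. cbn [walk]. assert (H := walk_ratio n 0).
  assert (S1 := walk_sym n 1). simpl in *. change (- (1))%Z with (-1)%Z in S1. rewrite S1.
  assert (P := pos_INR n).
  rewrite Rplus_0_r, Rminus_0_r in H.
  assert (E : walk n 1 = INR n * walk n 0 / (INR n + 1)) by (rewrite <- H; field; lra).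
  rewrite E. field. lra.
Qed.

Lemma centre_pos n : 0 < centre n.
Proof.
  induction n as [|n IH]; [unfold centre; simpl; lra|]. rewrite centre_S.
  apply Rmult_lt_0_compat; auto. generalize (pos_INR n); intros. apply Rdiv_lt_0_compat; lra.
Qed.

(** Wallis: n centre(n)^2 increases, while (2n + 1) centre(n)^2 decreases from 1. The value g = 1 /
    sqrt PI comes out later, inside [psi_functional]. *)
Lemma centre_limit : exists g, 0 < g /\ is_lim_seq (fun n => sqrt (INR n) * centre n) g.
Proof.
  set (u := fun n => INR n * centre n ^ 2).
  assert (Hinc : forall n, u n <= u (S n)).
  { intros n. unfold u. rewrite centre_S, S_INR. assert (P := pos_INR n). assert (Q := centre_pos n).
    replace ((INR n + 1) * (centre n * ((2 * INR n + 1) / (2 * (INR n + 1)))) ^ 2)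
      with (centre n ^ 2 * ((2 * INR n + 1) ^ 2 / (4 * (INR n + 1)))) by (field; lra).
    rewrite Rmult_comm. apply Rmult_le_compat_l; [apply pow2_ge_0|].
    apply Rmult_le_reg_r with (4 * (INR n + 1)); [lra|]. unfold Rdiv. rewrite Rmult_assoc, Rinv_l by lra. nra. }
  assert (Hbd : forall n, (2 * INR n + 1) * centre n ^ 2 <= 1).
  { induction n as [|n IH]; [unfold centre; simpl; lra|].
    rewrite centre_S, S_INR. assert (P := pos_INR n). eapply Rle_trans; [|exact IH].
    replace ((2 * (INR n + 1) + 1) * (centre n * ((2 * INR n + 1) / (2 * (INR n + 1)))) ^ 2)
      with ((2 * INR n + 1) * centre n ^ 2 * ((2 * INR n + 3) * (2 * INR n + 1) / (4 * (INR n + 1) ^ 2))) by (field; lra).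
    rewrite <- (Rmult_1_r ((2 * INR n + 1) * centre n ^ 2)) at 2.
    apply Rmult_le_compat_l; [apply Rmult_le_pos; [lra|apply pow2_ge_0]|].
    apply Rmult_le_reg_r with (4 * (INR n + 1) ^ 2); [nra|]. unfold Rdiv. rewrite Rmult_assoc, Rinv_l by nra. nra. }
  destruct (ex_finite_lim_seq_incr u 1) as [l Hl]; auto.
  { intros n. unfold u. generalize (Hbd n) (pow2_ge_0 (centre n)) (pos_INR n). nra. }
  assert (Hl0 : u 1%nat <= l).
  { apply (is_lim_seq_le_loc (fun _ => u 1%nat) u (u 1%nat) l); auto.
    - exists 1%nat. intros n Hn. induction Hn; [lra|]. eapply Rle_trans; [exact IHHn|apply Hinc].
    - apply is_lim_seq_const. }
  assert (P1 : 0 < u 1%nat) by (unfold u; simpl; generalize (centre_pos 1); nra).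
  exists (sqrt l). split; [apply sqrt_lt_R0; lra|].
  apply (is_lim_seq_ext (fun n => sqrt (u n))).
  - intros n. unfold u. rewrite sqrt_mult_alt by apply pos_INR. f_equal.
    apply sqrt_pow2. left; apply centre_pos.
  - apply (is_lim_seq_continuous sqrt u l); auto. apply continuity_pt_sqrt. lra.
Qed.

Lemma one_minus_le_exp x : 1 - x <= exp (- x).
Proof.
  destruct (Req_dec x 0) as [->|h]; [rewrite Ropp_0, exp_0; lra|]. generalize (exp_ineq1 (- x) ltac:(lra)); lra.
Qed.

Lemma one_minus_ge_exp x : x < 1 -> exp (- (x / (1 - x))) <= 1 - x.
Proof.
  intros Hx. assert (H := one_minus_le_exp (- (x / (1 - x)))). rewrite Ropp_involutive in H.
  replace (1 - - (x / (1 - x))) with (/ (1 - x)) in H by (field; lra).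
  rewrite exp_Ropp. apply Rle_trans with (/ / (1 - x)); [|rewrite Rinv_inv; lra].
  apply Rinv_le_contravar; auto. apply Rinv_0_lt_compat; lra.
Qed.

(** Local limit theorem from above. The ratios are 1 - (2k + 1)/(n + k + 1) <= exp(-(2k + 1)/(n +
    D)), and the odd numbers 2k + 1 for k < d add up to d^2. *)
Lemma walk_upper n d D : (d <= D)%nat -> (D <= n)%nat ->
  walk n (Z.of_nat d) <= centre n * exp (- (INR d ^ 2 / (INR n + INR D))).
Proof.
  intros Hd HD. induction d as [|d IH].
  - simpl. unfold Rdiv. rewrite !Rmult_0_l, Ropp_0, exp_0. unfold centre. lra.
  - specialize (IH ltac:(lia)). assert (R := walk_ratio n (Z.of_nat d)).
    rewrite <- INR_IZR_INZ in R. replace (Z.of_nat d + 1)%Z with (Z.of_nat (S d)) in R by lia.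
    assert (P := pos_INR d). assert (Q := pos_INR n).
    assert (Hdn : INR d + 1 <= INR n) by (rewrite <- S_INR; apply le_INR; lia).
    assert (HdD : INR d + 1 <= INR D) by (rewrite <- S_INR; apply le_INR; lia).
    assert (E : walk n (Z.of_nat (S d)) = walk n (Z.of_nat d) * (1 - (2 * INR d + 1) / (INR n + INR d + 1))).
    { apply Rmult_eq_reg_l with (INR n + INR d + 1); [|lra]. rewrite R. field. lra. }
    rewrite E, S_INR.
    replace (- ((INR d + 1) ^ 2 / (INR n + INR D))) with
      (- (INR d ^ 2 / (INR n + INR D)) + - ((2 * INR d + 1) / (INR n + INR D))) by (field; lra).
    rewrite exp_plus, <- Rmult_assoc.
    apply Rmult_le_compat; auto using walk_nonneg.
    + assert ((2 * INR d + 1) / (INR n + INR d + 1) <= 1); [|lra].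
      apply Rmult_le_reg_r with (INR n + INR d + 1); [lra|]. unfold Rdiv; rewrite Rmult_assoc, Rinv_l; lra.
    + eapply Rle_trans; [apply one_minus_le_exp|]. apply exp_le, Ropp_le_contravar.
      apply Rmult_le_compat_l; [lra|]. apply Rinv_le_contravar; lra.
Qed.

(** The counterpart from below, with 1 - x >= exp(-x/(1 - x)), which turns the denominator n + k + 1
    into n - k. *)
Lemma walk_lower n d D : (d <= D)%nat -> (D < n)%nat ->
  centre n * exp (- (INR d ^ 2 / (INR n - INR D))) <= walk n (Z.of_nat d).
Proof.
  intros Hd HD. assert (HDn : INR D + 1 <= INR n) by (rewrite <- S_INR; apply le_INR; lia).
  induction d as [|d IH].
  - simpl. unfold Rdiv. rewrite !Rmult_0_l, Ropp_0, exp_0. unfold centre. lra.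
  - specialize (IH ltac:(lia)). assert (R := walk_ratio n (Z.of_nat d)).
    rewrite <- INR_IZR_INZ in R. replace (Z.of_nat d + 1)%Z with (Z.of_nat (S d)) in R by lia.
    assert (P := pos_INR d). assert (Q := pos_INR n).
    assert (HdD : INR d + 1 <= INR D) by (rewrite <- S_INR; apply le_INR; lia).
    assert (E : walk n (Z.of_nat (S d)) = walk n (Z.of_nat d) * (1 - (2 * INR d + 1) / (INR n + INR d + 1))).
    { apply Rmult_eq_reg_l with (INR n + INR d + 1); [|lra]. rewrite R. field. lra. }
    rewrite E, S_INR.
    replace (- ((INR d + 1) ^ 2 / (INR n - INR D))) with
      (- (INR d ^ 2 / (INR n - INR D)) + - ((2 * INR d + 1) / (INR n - INR D))) by (field; lra).
    rewrite exp_plus, <- Rmult_assoc.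
    apply Rmult_le_compat; auto.
    + apply Rmult_le_pos; left; [apply centre_pos|apply exp_pos].
    + left; apply exp_pos.
    + eapply Rle_trans; [|apply one_minus_ge_exp].
      * apply exp_le, Ropp_le_contravar.
        replace ((2 * INR d + 1) / (INR n + INR d + 1) / (1 - (2 * INR d + 1) / (INR n + INR d + 1)))
          with ((2 * INR d + 1) / (INR n - INR d)) by (field; lra).
        apply Rmult_le_compat_l; [lra|]. apply Rinv_le_contravar; lra.
      * apply Rmult_lt_reg_r with (INR n + INR d + 1); [lra|]. unfold Rdiv; rewrite Rmult_assoc, Rinv_l; lra.
Qed.

Fixpoint Rsum (f : nat -> R) (n : nat) : R := match n with O => 0 | S n => Rsum f n + f (S n) end.

Lemma Rsum_ext f g n : (forall k, (1 <= k <= n)%nat -> f k = g k) -> Rsum f n = Rsum g n.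
Proof. induction n as [|n IH]; intros H; simpl; auto. rewrite IH, H; auto; lia || (intros; apply H; lia). Qed.

(* The walk on Z/l, l = 2q + 1, summed over the preimages in Z (wrapped) and diagonalised (spectral).  With n ~ t l^2
   steps, the equality of the two tends to the functional equation of theta (a proof due to Polya). *)
Definition wrapped (l : nat) (K : nat) (n : nat) (x : Z) : R :=
  walk n x + Rsum (fun k => walk n (x + Z.of_nat (k * l)) + walk n (x - Z.of_nat (k * l))) K.

Definition spectral (q : nat) (n : nat) (x : Z) : R :=
  / INR (2 * q + 1) * (1 + 2 * Rsum (fun j => cos (PI * INR j / INR (2 * q + 1)) ^ (2 * n) * cos (2 * PI * INR j * IZR x / INR (2 * q + 1))) q).

Lemma wrapped_S l K n x : wrapped l K (S n) x = (wrapped l K n (x - 1) + 2 * wrapped l K n x + wrapped l K n (x + 1)) / 4.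
Proof.
  unfold wrapped. induction K as [|K IH].
  - simpl Rsum. cbn [walk]. lra.
  - cbn [Rsum]. cbn [walk] in *.
    replace (x - 1 + Z.of_nat (S K * l))%Z with (x + Z.of_nat (S K * l) - 1)%Z by ring.
    replace (x - 1 - Z.of_nat (S K * l))%Z with (x - Z.of_nat (S K * l) - 1)%Z by ring.
    replace (x + 1 + Z.of_nat (S K * l))%Z with (x + Z.of_nat (S K * l) + 1)%Z by ring.
    replace (x + 1 - Z.of_nat (S K * l))%Z with (x - Z.of_nat (S K * l) + 1)%Z by ring.
    lra.
Qed.

Lemma spectral_S q n x : spectral q (S n) x = (spectral q n (x - 1) + 2 * spectral q n x + spectral q n (x + 1)) / 4.
Proof.
  unfold spectral. set (l := INR (2 * q + 1)).
  assert (Hl : l <> 0) by (apply not_0_INR; lia).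
  assert (E : forall m, Rsum (fun j => cos (PI * INR j / l) ^ (2 * S n) * cos (2 * PI * INR j * IZR x / l)) m =
    (Rsum (fun j => cos (PI * INR j / l) ^ (2 * n) * cos (2 * PI * INR j * IZR (x - 1) / l)) m +
     2 * Rsum (fun j => cos (PI * INR j / l) ^ (2 * n) * cos (2 * PI * INR j * IZR x / l)) m +
     Rsum (fun j => cos (PI * INR j / l) ^ (2 * n) * cos (2 * PI * INR j * IZR (x + 1) / l)) m) / 4).
  { induction m as [|m IH]; [simpl; lra|]. cbn [Rsum]. rewrite IH.
    set (a := PI * INR (S m) / l). set (b := 2 * PI * INR (S m) * IZR x / l).
    replace (2 * PI * INR (S m) * IZR (x - 1) / l) with (b - 2 * a)
      by (unfold a, b; rewrite minus_IZR; field; auto).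
    replace (2 * PI * INR (S m) * IZR (x + 1) / l) with (b + 2 * a)
      by (unfold a, b; rewrite plus_IZR; field; auto).
    rewrite cos_plus, cos_minus, (cos_2a_cos a).
    replace (2 * S n)%nat with (S (S (2 * n))) by lia. simpl pow. field. }
  rewrite E. field. auto.
Qed.

Lemma dirichlet_sum q a : sin (a / 2) * (1 + 2 * Rsum (fun j => cos (INR j * a)) q) = sin ((INR q + / 2) * a).
Proof.
  induction q as [|q IH].
  - simpl. rewrite Rmult_0_r, Rplus_0_r, Rmult_1_r. f_equal. lra.
  - cbn [Rsum]. rewrite S_INR.
    replace (sin (a / 2) * (1 + 2 * (Rsum (fun j => cos (INR j * a)) q + cos ((INR q + 1) * a))))
      with (sin (a / 2) * (1 + 2 * Rsum (fun j => cos (INR j * a)) q) + 2 * (sin (a / 2) * cos ((INR q + 1) * a))) by ring.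
    rewrite IH. replace ((INR q + / 2) * a) with ((INR q + 1) * a - a / 2) by field.
    replace ((INR q + 1 + / 2) * a) with ((INR q + 1) * a + a / 2) by field.
    rewrite sin_plus, sin_minus. ring.
Qed.

Lemma sin_PI_Z (x : Z) : sin (PI * IZR x) = 0.
Proof. rewrite Rmult_comm. apply sin_eq_0_1. exists x; auto. Qed.

(** Orthogonality of the characters of Z/l. With a = 2 PI x / l the Dirichlet kernel equals sin(PI
    x) / sin(a/2) = 0, unless sin(a/2) = 0, which means that l divides x. *)
Lemma spectral_0 q x : spectral q 0 x = if Z.eq_dec (x mod Z.of_nat (2 * q + 1)) 0 then 1 else 0.
Proof.
  unfold spectral. set (l := (2 * q + 1)%nat).
  assert (Hl : 0 < INR l) by (apply lt_0_INR; lia).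
  rewrite (Rsum_ext _ (fun j => cos (INR j * (2 * PI * IZR x / INR l)))).
  2: { intros k _. simpl. rewrite Rmult_1_l. f_equal. field. lra. }
  set (a := 2 * PI * IZR x / INR l).
  assert (D := dirichlet_sum q a).
  assert (Hlq : INR q + / 2 = INR l / 2) by (unfold l; rewrite plus_INR, mult_INR; simpl; field).
  rewrite Hlq in D. replace (INR l / 2 * a) with (PI * IZR x) in D by (unfold a; field; lra).
  rewrite sin_PI_Z in D.
  destruct (Z.eq_dec (x mod Z.of_nat l) 0) as [E|E].
  - apply Z.mod_divide in E; [|lia]. destruct E as [y ->].
    assert (Ha : forall j, cos (INR j * a) = 1).
    { intros j. replace (INR j * a) with (0 + 2 * IZR (Z.of_nat j * y) * PI).
      - transitivity (cos 0); [|apply cos_0].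
        destruct (Z_le_gt_dec 0 (Z.of_nat j * y)) as [h|h].
        + rewrite <- (Z2Nat.id _ h), <- INR_IZR_INZ. apply cos_period.
        + replace (Z.of_nat j * y)%Z with (- Z.of_nat (Z.to_nat (- (Z.of_nat j * y))))%Z by lia.
          rewrite opp_IZR, <- INR_IZR_INZ.
          rewrite <- (cos_period (0 + 2 * - INR (Z.to_nat (- (Z.of_nat j * y))) * PI) (Z.to_nat (- (Z.of_nat j * y)))).
          f_equal. ring.
      - unfold a. rewrite !mult_IZR, <- !INR_IZR_INZ. field. lra. }
    rewrite (Rsum_ext _ (fun _ => 1)) by (intros; apply Ha).
    assert (F : forall m, Rsum (fun _ => 1) m = INR m) by (induction m as [|m IH]; [auto|rewrite S_INR; simpl; rewrite IH; auto]).
    rewrite F. unfold l. rewrite plus_INR, mult_INR. simpl. field. generalize (pos_INR q); lra.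
  - assert (Hs : sin (a / 2) <> 0).
    { intros Hs. apply sin_eq_0_0 in Hs. destruct Hs as [k Hk]. apply E.
      assert (Hx : IZR x = IZR (k * Z.of_nat l)).
      { rewrite mult_IZR, <- INR_IZR_INZ. unfold a in Hk.
        apply Rmult_eq_reg_r with (PI / INR l).
        - transitivity (IZR k * PI); [rewrite <- Hk; field; lra|field; lra].
        - apply Rgt_not_eq. apply Rdiv_lt_0_compat; auto. apply PI_RGT_0. }
      apply eq_IZR in Hx. rewrite Hx. apply Z.mod_mul. lia. }
    assert (1 + 2 * Rsum (fun j => cos (INR j * a)) q = 0).
    { destruct (Rmult_integral _ _ D); auto; contradiction. }
    rewrite H. ring.
Qed.

Lemma wrapped_0 l K x : (0 < l)%nat -> (Z.abs x <= Z.of_nat (K * l))%Z ->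
  wrapped l K 0 x = if Z.eq_dec (x mod Z.of_nat l) 0 then 1 else 0.
Proof.
  intros Hl Hx. unfold wrapped.
  assert (G : forall M, walk 0 x + Rsum (fun k => walk 0 (x + Z.of_nat (k * l)) + walk 0 (x - Z.of_nat (k * l))) M =
    if Z.eq_dec (x mod Z.of_nat l) 0 then (if Z_le_gt_dec (Z.abs x) (Z.of_nat (M * l)) then 1 else 0) else 0).
  { induction M as [|M IH].
    - simpl. destruct (Z.eq_dec x 0) as [->|E].
      + rewrite Zmod_0_l. simpl. lra.
      + destruct (Z_le_gt_dec (Z.abs x) 0); [lia|]. destruct (Z.eq_dec (x mod Z.of_nat l) 0); lra.
    - cbn [Rsum]. rewrite <- Rplus_assoc, IH. clear IH. cbn [walk].
      destruct (Z.eq_dec (x mod Z.of_nat l) 0) as [E|E].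
      + apply Z.mod_divide in E; [|lia]. destruct E as [y ->].
        destruct (Z.eq_dec (y * Z.of_nat l + Z.of_nat (S M * l)) 0) as [h|h],
          (Z.eq_dec (y * Z.of_nat l - Z.of_nat (S M * l)) 0) as [h'|h'],
          (Z_le_gt_dec (Z.abs (y * Z.of_nat l)) (Z.of_nat (M * l))) as [h1|h1],
          (Z_le_gt_dec (Z.abs (y * Z.of_nat l)) (Z.of_nat (S M * l))) as [h2|h2]; try lra; exfalso; try nia.
        rewrite !Nat2Z.inj_mul, Z.abs_mul, (Z.abs_eq (Z.of_nat l)) in * by lia.
        assert (Z.of_nat M < Z.abs y <= Z.of_nat (S M))%Z by nia.
        assert (Z.abs y = Z.of_nat (S M)) by lia. 
        destruct (Z.abs_eq_or_opp y) as [e|e]; rewrite e in *; [apply h'|apply h]; nia.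
      + destruct (Z.eq_dec (x + Z.of_nat (S M * l)) 0) as [h|h].
        { exfalso; apply E. replace x with ((- Z.of_nat (S M)) * Z.of_nat l)%Z by lia. apply Z.mod_mul; lia. }
        destruct (Z.eq_dec (x - Z.of_nat (S M * l)) 0) as [h'|h'].
        { exfalso; apply E. replace x with ((Z.of_nat (S M)) * Z.of_nat l)%Z by lia. apply Z.mod_mul; lia. }
        lra. }
  rewrite G. destruct (Z_le_gt_dec (Z.abs x) (Z.of_nat (K * l))); [auto|lia].
Qed.

(** Both sides satisfy the recurrence of the walk and agree at time 0. The hypothesis says that [K]
    copies on each side cover everything reachable from x in n steps, so it survives a step to x - 1
    or x + 1. *)
Lemma wrapped_spectral q K n x : (Z.abs x + Z.of_nat n <= Z.of_nat (K * (2 * q + 1)))%Z ->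
  wrapped (2 * q + 1) K n x = spectral q n x.
Proof.
  revert x. induction n as [|n IH]; intros x Hx.
  - rewrite spectral_0, wrapped_0; auto; lia.
  - rewrite wrapped_S, spectral_S, !IH; auto; lia.
Qed.

(** The function exp(t^2/2) cos t decreases, since t cos t <= sin t. *)
Lemma cos_le_gauss x : 0 <= x <= PI / 2 -> cos x <= exp (- (x ^ 2 / 2)).
Proof.
  intros Hx.
  assert (A : forall y, 0 <= y <= PI / 2 -> y * cos y <= sin y).
  { intros y Hy.
    assert (H : sin 0 - 0 * cos 0 <= sin y - y * cos y).
    { apply (derive_nonneg_incr (fun t => sin t - t * cos t) (fun t => t * sin t)); [lra| |].
      - intros t Ht. auto_derive; auto. ring.
      - intros t Ht. apply Rmult_le_pos; [lra|]. apply sin_ge_0; generalize PI_RGT_0; lra. }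
    rewrite sin_0 in H. lra. }
  assert (H : - (exp (0 ^ 2 / 2) * cos 0) <= - (exp (x ^ 2 / 2) * cos x)).
  { apply (derive_nonneg_incr (fun t => - (exp (t ^ 2 / 2) * cos t)) (fun t => exp (t ^ 2 / 2) * (sin t - t * cos t))); [lra| |].
    - intros t Ht. auto_derive; auto. change (t * (t * 1) * / 2) with (t ^ 2 / 2). field.
    - intros t Ht. apply Rmult_le_pos; [left; apply exp_pos|]. generalize (A t ltac:(lra)); lra. }
  rewrite cos_0 in H. replace (0 ^ 2 / 2) with 0 in H by (simpl; field). rewrite exp_0 in H.
  rewrite exp_Ropp. apply Rmult_le_reg_l with (exp (x ^ 2 / 2)); [apply exp_pos|].
  rewrite Rinv_r by (apply Rgt_not_eq, exp_pos). lra.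
Qed.

Lemma exp_pow_INR x n : exp x ^ n = exp (INR n * x).
Proof.
  induction n as [|n IH]; [simpl; rewrite Rmult_0_l, exp_0; auto|].
  rewrite S_INR. simpl. rewrite IH, <- exp_plus. f_equal. ring.
Qed.

Lemma Series_finite (f : nat -> R) n : (forall k, (n <= k)%nat -> f k = 0) ->
  Series f = Rsum (fun k => f (pred k)) n.
Proof.
  intros H. destruct n as [|n].
  - simpl.
    apply is_series_unique. apply (is_lim_seq_ext (fun _ => 0) (sum_n f) (Finite 0)); [|apply is_lim_seq_const].
    intros m. induction m as [|m IH]; [rewrite sum_O, H; auto; lia|].
    rewrite sum_Sn, <- IH, H by lia. unfold plus; simpl. lra.
  - apply is_series_unique.
    assert (E : forall m, sum_n f m = Rsum (fun k => f (pred k)) (S m)).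
    { induction m as [|m IH]; [rewrite sum_O; simpl; lra|]. rewrite sum_Sn, IH. reflexivity. }
    apply (is_lim_seq_ext_loc (fun _ => Rsum (fun k => f (pred k)) (S n)) (sum_n f) (Finite (Rsum (fun k => f (pred k)) (S n)))); [|apply is_lim_seq_const].
    exists n. intros m Hm. rewrite <- E. induction Hm as [|m Hm IH]; auto.
    rewrite IH, sum_Sn, (H (S m)) by lia. unfold plus; simpl. lra.
Qed.

Lemma Rsum_scal c f n : Rsum (fun k => c * f k) n = c * Rsum f n.
Proof. induction n as [|n IH]; simpl; [lra|rewrite IH; ring]. Qed.

(** Jacobi's theta is 1 + 2 psi. *)
Definition psi (x : R) : R := Series (fun k => exp (- (PI * INR (S k) ^ 2 * x))).

Lemma ex_series_exp_geom c : 0 < c -> ex_series (fun k => exp (- (c * INR (S k)))).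
Proof.
  intros Hc. apply (ex_series_ext (fun k => exp (- c) * exp (- c) ^ k)).
  - intros k. rewrite exp_pow_INR, <- exp_plus, S_INR. f_equal. ring.
  - apply (ex_series_scal (V := R_NormedModule)). apply ex_series_geom'. split; [left; apply exp_pos|].
    rewrite <- exp_0. apply exp_increasing. lra.
Qed.

Lemma INR_S_sq k : INR (S k) <= INR (S k) ^ 2.
Proof. rewrite S_INR. generalize (pos_INR k). nra. Qed.

Lemma ex_series_gauss c : 0 < c -> ex_series (fun k => exp (- (c * INR (S k) ^ 2))).
Proof.
  intros Hc. apply (ex_series_le (V := R_CompleteNormedModule) _ (fun k => exp (- (c * INR (S k))))).
  - intros k. change (Rabs (exp (- (c * INR (S k) ^ 2))) <= exp (- (c * INR (S k)))).
    rewrite Rabs_pos_eq by (left; apply exp_pos). apply exp_le. generalize (INR_S_sq k). nra.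
  - apply ex_series_exp_geom; auto.
Qed.

Lemma psi_pos x : 0 < x -> 0 <= psi x.
Proof.
  intros Hx. unfold psi. rewrite <- (Rmult_0_l (Series (fun k => exp (- (PI * x * INR (S k) ^ 2))))).
  rewrite <- Series_scal_l. apply Series_le.
  - intros n. rewrite Rmult_0_l. split; [lra|left; apply exp_pos].
  - apply (ex_series_ext (fun k => exp (- (PI * x * INR (S k) ^ 2)))).
    { intros; f_equal; ring. }
    apply ex_series_gauss. apply Rmult_lt_0_compat; auto. apply PI_RGT_0.
Qed.

Lemma is_lim_seq_inv_odd : is_lim_seq (fun q => / INR (2 * q + 1)) 0.
Proof.
  replace (Finite 0) with (Rbar_inv p_infty) by reflexivity.
  apply is_lim_seq_inv; [|discriminate].
  apply (is_lim_seq_ext (fun q => 2 * INR q + 1)).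
  - intros q. rewrite plus_INR, mult_INR. reflexivity.
  - apply is_lim_seq_aff. lra.
Qed.

Lemma is_lim_seq_eval (f : R -> R) (u : nat -> R) (l : R) : continuous f l -> is_lim_seq u l ->
  is_lim_seq (fun n => f (u n)) (f l).
Proof. intros Hf Hu. apply (filterlim_comp _ _ _ u f eventually (locally l)); auto. Qed.

Lemma theta_limit (g t : R) : 0 < g -> 0 < t -> is_lim_seq (fun n => sqrt (INR n) * centre n) g ->
  g / sqrt t * (1 + 2 * psi (/ (PI * t))) = 1 + 2 * psi (PI * t).
Proof.
  intros Hg Ht Hc. assert (HPI := PI_RGT_0).
  set (l := fun q : nat => INR (2 * q + 1)).
  assert (Hl : forall q, 1 <= l q). { intros q. unfold l. rewrite plus_INR, mult_INR. simpl. generalize (pos_INR q); lra. }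
  assert (Hx : forall q, 0 <= t * l q ^ 2) by (intros q; apply Rmult_le_pos; [lra|apply pow2_ge_0]).
  set (n := fun q => proj1_sig (nfloor_ex _ (Hx q))).
  assert (Hn : forall q, INR (n q) <= t * l q ^ 2 < INR (n q) + 1) by (intros q; unfold n; destruct (nfloor_ex _ (Hx q)); auto).
  set (N := fun q => INR (n q) / l q ^ 2).
  assert (Li : is_lim_seq (fun q => / l q) 0) by apply is_lim_seq_inv_odd.
  assert (LN : is_lim_seq N t).
  { apply is_lim_seq_le_le with (fun q => t - / l q * / l q) (fun _ => t).
    - intros q. assert (P := Hl q). assert (P2 : 0 < l q ^ 2) by nra. destruct (Hn q) as [A B]. unfold N. split.
      + apply Rmult_le_reg_r with (l q ^ 2); auto. unfold Rdiv. rewrite (Rmult_assoc (INR (n q))), Rinv_l by lra.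
        replace ((t - / l q * / l q) * l q ^ 2) with (t * l q ^ 2 - 1) by (field; lra). lra.
      + apply Rmult_le_reg_r with (l q ^ 2); auto. unfold Rdiv. rewrite Rmult_assoc, Rinv_l by lra. lra.
    - replace (Finite t) with (Finite (t - 0 * 0)) by (f_equal; ring).
      apply is_lim_seq_minus'; [apply is_lim_seq_const|]. apply is_lim_seq_mult'; auto.
    - apply is_lim_seq_const. }
  set (A := fun q k => if (S k <=? q)%nat then cos (PI * INR (S k) / l q) ^ (2 * n q) else 0).
  set (B := fun q k => walk (n q) (Z.of_nat (S k * (2 * q + 1))) / centre (n q)).
  (* [wrapped_spectral] at x = 0 with K = n, divided by the central weight. In the limit [A] becomes
     psi(PI t) and [B] becomes psi(1/(PI t)). *)
  assert (Id : forall q, l q * centre (n q) * (1 + 2 * Series (B q)) = 1 + 2 * Series (A q)).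
  { intros q. assert (W := wrapped_spectral q (n q) (n q) 0 ltac:(simpl; nia)).
    rewrite (Series_finite (A q) q), (Series_finite (B q) (n q)).
    - unfold wrapped, spectral in W. fold (l q) in W. fold (centre (n q)) in W.
      assert (Cp := centre_pos (n q)). assert (P := Hl q).
      rewrite (Rsum_ext (fun k => B q (pred k)) (fun k => / centre (n q) * walk (n q) (Z.of_nat (k * (2 * q + 1))))).
      2: { intros k Hk. unfold B. replace (S (pred k)) with k by lia. unfold Rdiv; ring. }
      rewrite (Rsum_ext (fun k => A q (pred k)) (fun k => cos (PI * INR k / l q) ^ (2 * n q))).
      2: { intros k Hk. unfold A. replace (S (pred k)) with k by lia.
           replace (k <=? q)%nat with true; auto. symmetry; apply Nat.leb_le; lia. }
      rewrite Rsum_scal.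
      rewrite (Rsum_ext _ (fun k => 2 * walk (n q) (Z.of_nat (k * (2 * q + 1))))) in W.
      2: { intros k Hk. rewrite Z.add_0_l, Z.sub_0_l, walk_sym. ring. }
      rewrite (Rsum_ext (fun j => cos (PI * INR j / l q) ^ (2 * n q) * cos _) (fun k => cos (PI * INR k / l q) ^ (2 * n q))) in W.
      2: { intros k Hk. replace (2 * PI * INR k * 0 / l q) with 0 by (field; lra). rewrite cos_0. ring. }
      rewrite Rsum_scal in W.
      apply (f_equal (Rmult (l q))) in W. rewrite <- Rmult_assoc, Rinv_r, Rmult_1_l in W by lra.
      rewrite <- W. field. lra.
    - intros k Hk. unfold B. rewrite walk_support; [unfold Rdiv; ring|]. nia.
    - intros k Hk. unfold A. replace (S k <=? q)%nat with false; auto. symmetry; apply Nat.leb_gt; lia. }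
  assert (LA : is_lim_seq (fun q => Series (A q)) (psi (PI * t))).
  (* Rounding t l^2 down to n loses less than one step, hence a factor at most exp(x^2) with x = PI
     j / l <= PI / 2, and x^2 <= 4. *)
  { apply tannery with (fun k => exp 4 * exp (- (PI ^ 2 * t * INR (S k) ^ 2))).
    - intros q k. unfold A. destruct (S k <=? q)%nat eqn:E.
      + apply Nat.leb_le in E. apply le_INR in E.
        assert (P := Hl q). assert (Hlq : l q = 2 * INR q + 1) by (unfold l; rewrite plus_INR, mult_INR; reflexivity).
        set (x := PI * INR (S k) / l q).
        assert (Px : 0 <= x <= PI / 2).
        { unfold x; split.
          - apply Rdiv_le_0_compat; [|lra]. apply Rmult_le_pos; [lra|apply pos_INR].
          - apply Rmult_le_reg_r with (l q); [lra|]. unfold Rdiv. rewrite Rmult_assoc, Rinv_l by lra. nra. }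
        assert (Cx : 0 <= cos x) by (apply cos_ge_0; lra).
        rewrite Rabs_pos_eq by (apply pow_le; auto).
        eapply Rle_trans; [apply pow_incr; split; [auto|apply cos_le_gauss; auto]|].
        rewrite exp_pow_INR, <- exp_plus. apply exp_le. rewrite mult_INR. simpl (INR 2).
        assert (Ex : l q ^ 2 * x ^ 2 = PI ^ 2 * INR (S k) ^ 2) by (unfold x; field; lra).
        assert (x ^ 2 <= 4). { assert (PI <= 4) by apply PI_4. nra. }
        destruct (Hn q) as [_ Hn2]. assert (0 <= x ^ 2) by apply pow2_ge_0. nra.
      + rewrite Rabs_R0. left; apply Rmult_lt_0_compat; apply exp_pos.
    - apply (ex_series_scal (V := R_NormedModule)). apply ex_series_gauss. apply Rmult_lt_0_compat; nra.
    - intros k. set (j := INR (S k)).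
      assert (Lx : is_lim_seq (fun q => PI * j / l q) 0).
      { apply (is_lim_seq_ext (fun q => PI * j * / l q)); [intros; reflexivity|].
        apply is_lim_seq_scal0; auto. }
      assert (Lnx : is_lim_seq (fun q => N q * (PI * j) ^ 2) (t * (PI * j) ^ 2)).
      { apply is_lim_seq_mult'; auto. apply is_lim_seq_const. }
      assert (Lx2 : is_lim_seq (fun q => 1 - (PI * j / l q) ^ 2 / 2) 1).
      { replace (Finite 1) with (Finite ((fun x => 1 - x ^ 2 / 2) 0)) by (f_equal; simpl; field).
        apply (is_lim_seq_eval (fun x => 1 - x ^ 2 / 2)); auto.
        apply (continuous_of_derivable _ (fun x => - x)). intros x; auto_derive; auto. simpl; field. }
      assert (Ej : INR (S k) = j) by reflexivity.
      apply is_lim_seq_le_le_loc with (fun q => exp (- (N q * (PI * j) ^ 2 / (1 - (PI * j / l q) ^ 2 / 2))))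
         (fun q => exp (- (N q * (PI * j) ^ 2))).
      + apply is_lim_seq_spec in Lx. destruct (Lx (mkposreal 1 Rlt_0_1)) as [Q HQ].
        exists (Q + S k)%nat. intros q Hq. specialize (HQ q ltac:(lia)). simpl in HQ. rewrite Rminus_0_r in HQ.
        unfold A. replace (S k <=? q)%nat with true by (symmetry; apply Nat.leb_le; lia). fold j.
        assert (P := Hl q). set (x := PI * j / l q) in *.
        assert (Px : 0 <= x). { apply Rdiv_le_0_compat; [|lra]. apply Rmult_le_pos; [lra|apply pos_INR]. }
        rewrite Rabs_pos_eq in HQ by auto.
        assert (Ex : N q * (PI * j) ^ 2 = INR (n q) * x ^ 2) by (unfold N, x; field; lra).
        rewrite Ex. assert (Hx2 : 0 <= x ^ 2 < 1) by (split; [apply pow2_ge_0|nra]).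
        split.
        * apply Rle_trans with ((1 - x ^ 2 / 2) ^ (2 * n q)).
          -- apply Rle_trans with (exp (- (x ^ 2 / 2 / (1 - x ^ 2 / 2))) ^ (2 * n q)).
             ++ rewrite exp_pow_INR, mult_INR. right; f_equal. simpl (INR 2). field. lra.
             ++ apply pow_incr; split; [left; apply exp_pos|]. apply one_minus_ge_exp. lra.
          -- apply pow_incr; split; [lra|apply cos_ge].
        * apply Rle_trans with (exp (- (x ^ 2 / 2)) ^ (2 * n q)).
          -- apply pow_incr; split; [|apply cos_le_gauss; generalize PI2_1; lra].
             apply cos_ge_0; generalize PI2_1; lra.
          -- rewrite exp_pow_INR, mult_INR. right; f_equal. simpl (INR 2). field.
      + replace (Finite (exp (- (PI * j ^ 2 * (PI * t))))) with
          (Finite (exp (- (t * (PI * j) ^ 2 / 1)))) by (do 2 f_equal; field).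
        apply (is_lim_seq_eval (fun x => exp (- x)) (fun q => N q * (PI * j) ^ 2 / (1 - (PI * j / l q) ^ 2 / 2))).
        * apply (continuous_of_derivable _ (fun x => - exp (- x))). intros x; auto_derive; auto. ring.
        * apply (is_lim_seq_div' _ _ _ 1 Lnx Lx2). apply R1_neq_R0.
      + replace (Finite (exp (- (PI * j ^ 2 * (PI * t))))) with
          (Finite (exp (- (t * (PI * j) ^ 2)))) by (do 2 f_equal; field).
        apply (is_lim_seq_eval (fun x => exp (- x)) (fun q => N q * (PI * j) ^ 2)); auto.
        apply (continuous_of_derivable _ (fun x => - exp (- x))). intros x; auto_derive; auto. ring. }
  assert (LB : is_lim_seq (fun q => Series (B q)) (psi (/ (PI * t)))).
  (* [walk_upper] with D = n has denominator 2 n <= 2 t l^2. This loses a factor 2 in the exponent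
     but holds uniformly up to the edge of the walk; the exact exponent is recovered in the limit
     with D = d. *)
  { apply tannery with (fun k => exp (- (/ (2 * t) * INR (S k) ^ 2))).
    - intros q k. unfold B. assert (Cp := centre_pos (n q)).
      rewrite Rabs_pos_eq by (apply Rdiv_le_0_compat; auto; apply walk_nonneg).
      destruct (Compare_dec.le_lt_dec (S k * (2 * q + 1)) (n q)) as [h|h].
      + apply Rmult_le_reg_r with (centre (n q)); auto. unfold Rdiv. rewrite Rmult_assoc, Rinv_l, Rmult_1_r by lra.
        eapply Rle_trans; [apply (walk_upper _ _ (n q) h); lia|]. rewrite Rmult_comm. apply Rmult_le_compat_r; [lra|].
        apply exp_le, Ropp_le_contravar. rewrite mult_INR. fold (l q).
        assert (P := Hl q). destruct (Hn q) as [Hn1 _].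
        assert (0 < INR (n q)). { apply lt_0_INR. lia. }
        apply Rle_trans with ((INR (S k) * l q) ^ 2 / (t * l q ^ 2 + t * l q ^ 2)).
        * right. field. lra.
        * apply Rmult_le_compat_l; [apply pow2_ge_0|]. apply Rinv_le_contravar; lra.
      + rewrite walk_support by lia. unfold Rdiv. rewrite Rmult_0_l. left; apply exp_pos.
    - apply ex_series_gauss. apply Rinv_0_lt_compat; lra.
    - intros k. set (j := INR (S k)).
      assert (Ej : INR (S k) = j) by reflexivity.
      assert (Lj : is_lim_seq (fun q => j * / l q) 0) by (apply is_lim_seq_scal0; auto).
      assert (L1 : is_lim_seq (fun q => N q - j * / l q) t).
      { replace (Finite t) with (Finite (t - 0)) by (f_equal; ring). apply is_lim_seq_minus'; auto. }
      assert (L2 : is_lim_seq (fun q => N q + j * / l q) t).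
      { replace (Finite t) with (Finite (t + 0)) by (f_equal; ring). apply is_lim_seq_plus'; auto. }
      apply is_lim_seq_le_le_loc with (fun q => exp (- (j ^ 2 / (N q - j * / l q))))
         (fun q => exp (- (j ^ 2 / (N q + j * / l q)))).
      + apply is_lim_seq_spec in L1. destruct (L1 (mkposreal _ Ht)) as [Q HQ].
        exists Q. intros q Hq. specialize (HQ q Hq). simpl in HQ. apply Rabs_def2 in HQ.
        assert (P := Hl q). set (d := (S k * (2 * q + 1))%nat).
        assert (Ed : INR d = j * l q) by (unfold d; rewrite mult_INR; reflexivity).
        assert (Hd : (d < n q)%nat).
        { apply INR_lt. rewrite Ed. assert (H0 : 0 < N q - j * / l q) by lra.
          apply Rmult_lt_compat_r with (r := l q ^ 2) in H0; [|nra].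
          replace ((N q - j * / l q) * l q ^ 2) with (INR (n q) - j * l q) in H0 by (unfold N; field; lra). lra. }
        assert (Cp := centre_pos (n q)). apply lt_INR in Hd. rewrite Ed in Hd. unfold B. fold d.
        assert (Hj : 0 <= j * l q) by (rewrite <- Ed; apply pos_INR).
        split; apply Rmult_le_reg_r with (centre (n q)); auto; unfold Rdiv; rewrite (Rmult_assoc (walk _ _)), Rinv_l, Rmult_1_r by lra.
        * rewrite Rmult_comm. eapply Rle_trans; [|apply (walk_lower _ d d); auto; apply INR_lt; lra].
          right. do 3 f_equal. rewrite Ed. unfold N. field. repeat split; nra.
        * rewrite Rmult_comm. eapply Rle_trans; [apply (walk_upper _ d d); auto; apply INR_le; lra|].
          right. do 3 f_equal. rewrite Ed. unfold N. field. repeat split; nra.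
      + replace (Finite (exp (- (PI * j ^ 2 * / (PI * t))))) with
          (Finite (exp (- (j ^ 2 / t)))) by (do 2 f_equal; field; lra).
        apply (is_lim_seq_eval (fun x => exp (- x)) (fun q => j ^ 2 / (N q - j * / l q))).
        * apply (continuous_of_derivable _ (fun x => - exp (- x))). intros x; auto_derive; auto. ring.
        * apply (is_lim_seq_div' (fun _ => j ^ 2) _ (j ^ 2) t (is_lim_seq_const _) L1). apply Rgt_not_eq; lra.
      + replace (Finite (exp (- (PI * j ^ 2 * / (PI * t))))) with
          (Finite (exp (- (j ^ 2 / t)))) by (do 2 f_equal; field; lra).
        apply (is_lim_seq_eval (fun x => exp (- x)) (fun q => j ^ 2 / (N q + j * / l q))).
        * apply (continuous_of_derivable _ (fun x => - exp (- x))). intros x; auto_derive; auto. ring.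
        * apply (is_lim_seq_div' (fun _ => j ^ 2) _ (j ^ 2) t (is_lim_seq_const _) L2). apply Rgt_not_eq; lra. }
  assert (Fn : filterlim n eventually eventually).
  { intros P [M HM]. destruct (INR_unbounded ((INR M + 1) / t)) as [Q HQ]. exists Q. intros q Hq. apply HM.
    apply INR_le. destruct (Hn q) as [_ H2]. assert (P1 := Hl q).
    assert (Hlq : l q = 2 * INR q + 1) by (unfold l; rewrite plus_INR, mult_INR; reflexivity).
    apply le_INR in Hq. assert (INR q <= l q ^ 2) by (generalize (pos_INR q); nra).
    apply Rmult_lt_compat_l with (r := t) in HQ; auto.
    replace (t * ((INR M + 1) / t)) with (INR M + 1) in HQ by (field; lra). nra. }
  assert (Lc : is_lim_seq (fun q => l q * centre (n q)) (g / sqrt t)).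
  { apply (is_lim_seq_ext_loc (fun q => (sqrt (INR (n q)) * centre (n q)) / sqrt (N q))).
    - destruct (proj2 (is_lim_seq_spec N t) LN (mkposreal _ Ht)) as [Q HQ]. exists Q. intros q Hq.
      specialize (HQ q Hq). simpl in HQ. apply Rabs_def2 in HQ.
      assert (P := Hl q). assert (HN : 0 < N q) by lra.
      assert (Hnq : 0 < INR (n q)).
      { apply Rmult_lt_compat_r with (r := l q ^ 2) in HN; [|nra]. unfold N in HN.
        replace (INR (n q) / l q ^ 2 * l q ^ 2) with (INR (n q)) in HN by (field; lra). lra. }
      unfold N. rewrite sqrt_div_alt by nra. rewrite sqrt_pow2 by lra. field. split; [lra|].
      apply Rgt_not_eq, sqrt_lt_R0; auto.
    - apply is_lim_seq_div'.
      + apply (filterlim_comp _ _ _ n (fun m => sqrt (INR m) * centre m) eventually eventually); auto.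
      + apply (is_lim_seq_continuous sqrt N t); auto. apply continuity_pt_sqrt. lra.
      + apply Rgt_not_eq, sqrt_lt_R0; auto. }
  assert (LL : is_lim_seq (fun q => l q * centre (n q) * (1 + 2 * Series (B q))) (g / sqrt t * (1 + 2 * psi (/ (PI * t))))).
  { apply is_lim_seq_mult'; auto. apply is_lim_seq_plus'; [apply is_lim_seq_const|].
    apply is_lim_seq_mult'; [apply is_lim_seq_const|auto]. }
  assert (LR : is_lim_seq (fun q => 1 + 2 * Series (A q)) (1 + 2 * psi (PI * t))).
  { apply is_lim_seq_plus'; [apply is_lim_seq_const|].
    apply is_lim_seq_mult'; [apply is_lim_seq_const|auto]. }
  apply (is_lim_seq_ext _ _ _ Id) in LL.
  generalize (is_lim_seq_unique _ _ LL). rewrite (is_lim_seq_unique _ _ LR). congruence.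
Qed.

Theorem psi_functional x : 0 < x -> 1 + 2 * psi (/ x) = sqrt x * (1 + 2 * psi x).
Proof.
  intros Hx. destruct centre_limit as [g [Hg Hc]]. assert (HPI := PI_RGT_0).
  assert (E1 := theta_limit g (x / PI) Hg (Rdiv_lt_0_compat _ _ Hx HPI) Hc).
  assert (Hx' : 0 < / x) by (apply Rinv_0_lt_compat; auto).
  assert (E2 := theta_limit g (/ x / PI) Hg (Rdiv_lt_0_compat _ _ Hx' HPI) Hc).
  replace (PI * (x / PI)) with x in E1 by (field; lra).
  replace (PI * (/ x / PI)) with (/ x) in E2 by (field; lra).
  rewrite Rinv_inv in E2.
  assert (P1 := psi_pos x Hx). assert (P2 := psi_pos (/ x) Hx').
  set (a := 1 + 2 * psi x) in *. set (b := 1 + 2 * psi (/ x)) in *.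
  assert (Ha : 0 < a) by (unfold a; lra). assert (Hb : 0 < b) by (unfold b; lra).
  rewrite sqrt_div_alt in E1, E2 by lra. rewrite sqrt_inv in E2.
  assert (Sx : 0 < sqrt x) by (apply sqrt_lt_R0; auto). assert (SP : 0 < sqrt PI) by (apply sqrt_lt_R0; auto).
  set (G := g * sqrt PI). assert (HG : 0 < G) by (apply Rmult_lt_0_compat; auto).
  replace (g / (sqrt x / sqrt PI)) with (G / sqrt x) in E1 by (unfold G; field; lra).
  replace (g / (/ sqrt x / sqrt PI)) with (G * sqrt x) in E2 by (unfold G; field; lra).
  (* The relation at x and at 1/x reads G b = a sqrt x and G a sqrt x = b, where G = g sqrt PI;
     together they force G = 1. *)
  assert (G2 : G * G = 1).
  { apply Rmult_eq_reg_r with b; [|apply Rgt_not_eq; lra].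
    transitivity (G * sqrt x * (G / sqrt x * b)); [field; apply Rgt_not_eq; lra|]. rewrite E1, E2. ring. }
  assert (HG1 : G = 1) by nra. rewrite HG1 in E2. lra.
Qed.

(** * The Fourier representation of Xi *)

Definition inv_sq (k : nat) : R := / INR (S k) ^ 2.

Lemma inv_sq_pos k : 0 < inv_sq k.
Proof. apply Rinv_0_lt_compat, pow_lt, lt_0_INR. lia. Qed.

Lemma ex_series_inv_sq : ex_series inv_sq.
Proof.
  apply (ex_series_le (V := R_CompleteNormedModule) _ (fun k => 2 * (/ INR (S k) - / INR (S (S k))))).
  - intros k. change (Rabs (inv_sq k) <= 2 * (/ INR (S k) - / INR (S (S k)))).
    rewrite Rabs_pos_eq by (left; apply inv_sq_pos). unfold inv_sq. rewrite !S_INR.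
    assert (P := pos_INR k).
    replace (2 * (/ (INR k + 1) - / (INR k + 1 + 1))) with (2 / ((INR k + 1) * (INR k + 2))) by (field; lra).
    apply Rmult_le_reg_r with ((INR k + 1) ^ 2 * (INR k + 2)); [nra|].
    replace (/ (INR k + 1) ^ 2 * ((INR k + 1) ^ 2 * (INR k + 2))) with (INR k + 2) by (field; lra).
    replace (2 / ((INR k + 1) * (INR k + 2)) * ((INR k + 1) ^ 2 * (INR k + 2))) with (2 * (INR k + 1)) by (field; lra). lra.
  - apply (ex_series_scal (V := R_NormedModule)). exists 1.
    apply (is_lim_seq_ext (fun n => 1 - / (INR n + 2)) _ (Finite 1)).
    + intros n. induction n as [|n IH].
      * rewrite sum_O. simpl. field.
      * rewrite sum_Sn, <- IH.
        change (1 - / (INR (S n) + 2) = (1 - / (INR n + 2)) + (/ INR (S (S n)) - / INR (S (S (S n))))). rewrite !S_INR. assert (P := pos_INR n). field. lra.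
    + replace (Finite 1) with (Finite (1 - 0)) by (f_equal; ring).
      apply is_lim_seq_minus'; [apply is_lim_seq_const|].
      replace (Finite 0) with (Rbar_inv p_infty) by reflexivity.
      apply is_lim_seq_inv; [|discriminate].
      apply (is_lim_seq_ext (fun q => 1 * INR q + 2)); [intros; ring|]. apply is_lim_seq_aff. lra.
Qed.

Definition ker (r u : R) : R :=
  (2 * PI ^ 2 * r ^ 4 * exp (9 / 2 * u) - 3 * PI * r ^ 2 * exp (5 / 2 * u)) * exp (- (PI * r ^ 2 * exp (2 * u))).

Definition Phi0 (u : R) : R := Series (fun k => ker (INR (S k)) u).

(** Majorant of the continued kernel [kerC r] at v + iy when c = cos(2y); c = 1 serves the real
    line. *)
Definition envelope (c r v : R) : R :=
  (2 * PI ^ 2 * r ^ 4 * exp (9 / 2 * v) + 3 * PI * r ^ 2 * exp (5 / 2 * v)) * exp (- (PI * r ^ 2 * c * exp (2 * v))).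

Lemma PI_bounds : 3 <= PI <= 4.
Proof. generalize PI2_3_2 PI_4. lra. Qed.

Lemma Rmult4_le_pos a b c d : 0 <= a -> 0 <= b -> 0 <= c -> 0 <= d -> 0 <= a * b * c * d.
Proof. intros; repeat apply Rmult_le_pos; auto. Qed.

(** The double exponential is replaced by N!/y^N. For N >= 3 the powers of r leave r^4 / r^(2N) <= 1
    / r^2, which is summable, and a larger N buys faster decay in v. *)
Lemma envelope_bound c k v N : 0 < c -> (3 <= N)%nat ->
  envelope c (INR (S k)) v <= 50 * INR (fact N) / c ^ N * inv_sq k * ((exp (9 / 2 * v) + exp (5 / 2 * v)) * exp (- (2 * INR N * v))).
Proof.
  intros Hc HN. set (r := INR (S k)).
  assert (Hr : 1 <= r) by (unfold r; rewrite S_INR; generalize (pos_INR k); lra).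
  assert (HPI := PI_bounds).
  assert (E1 := exp_pos (9 / 2 * v)). assert (E2 := exp_pos (5 / 2 * v)). assert (E3 := exp_pos (2 * v)).
  assert (Hy : 0 < PI * r ^ 2 * c * exp (2 * v)).
  { apply Rmult_lt_0_compat; auto. apply Rmult_lt_0_compat; auto. apply Rmult_lt_0_compat; nra. }
  assert (B := exp_neg_le_pow N _ Hy).
  assert (FN := INR_fact_lt_0 N).
  assert (Hr2 : r ^ 4 <= r ^ (2 * N) * inv_sq k).
  { unfold inv_sq. fold r. replace (2 * N)%nat with (6 + (2 * N - 6))%nat by lia. rewrite pow_add.
    assert (1 <= r ^ (2 * N - 6)) by (apply pow_R1_Rle; auto).
    replace (r ^ 6 * r ^ (2 * N - 6) * / r ^ 2) with (r ^ 4 * r ^ (2 * N - 6)) by (field; lra).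
    assert (0 < r ^ 4) by (apply pow_lt; lra). nra. }
  assert (B2 : exp (- (PI * r ^ 2 * c * exp (2 * v))) <= INR (fact N) / c ^ N / r ^ (2 * N) * exp (- (2 * INR N * v))).
  { eapply Rle_trans; [exact B|].
    rewrite !Rpow_mult_distr, exp_pow_INR.
    replace (- (2 * INR N * v)) with (- (INR N * (2 * v))) by ring. rewrite exp_Ropp.
    rewrite <- pow_mult.
    assert (P1 : 1 <= PI ^ N) by (apply pow_R1_Rle; lra).
    assert (P2 : 0 < c ^ N) by (apply pow_lt; auto). assert (P3 : 0 < r ^ (2 * N)) by (apply pow_lt; lra).
    assert (P4 := exp_pos (INR N * (2 * v))).
    unfold Rdiv. rewrite !Rmult_assoc. apply Rmult_le_compat_l; [lra|].
    rewrite <- !Rinv_mult. apply Rinv_le_contravar.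
    - repeat apply Rmult_lt_0_compat; auto.
    - match goal with |- ?a <= ?b =>
        replace a with (1 * (c ^ N * r ^ (2 * N) * exp (INR N * (2 * v)))) by ring;
        replace b with (PI ^ N * (c ^ N * r ^ (2 * N) * exp (INR N * (2 * v)))) by ring end.
      apply Rmult_le_compat_r; auto. repeat apply Rmult_le_pos; lra. }
  assert (A : 2 * PI ^ 2 * r ^ 4 * exp (9 / 2 * v) + 3 * PI * r ^ 2 * exp (5 / 2 * v) <= 50 * r ^ 4 * (exp (9 / 2 * v) + exp (5 / 2 * v))).
  { assert (2 * PI ^ 2 <= 50) by nra. assert (0 < r ^ 4) by (apply pow_lt; lra). assert (r ^ 2 <= r ^ 4).
    { replace (r ^ 4) with (r ^ 2 * r ^ 2) by ring. assert (1 <= r ^ 2) by nra. nra. }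
    assert (0 <= r ^ 2) by nra.
    assert (2 * PI ^ 2 * r ^ 4 * exp (9 / 2 * v) <= 50 * r ^ 4 * exp (9 / 2 * v)) by (repeat apply Rmult_le_compat_r; lra).
    assert (3 * PI * r ^ 2 * exp (5 / 2 * v) <= 50 * r ^ 4 * exp (5 / 2 * v)).
    { apply Rmult_le_compat_r; [lra|]. apply Rmult_le_compat; lra. }
    lra. }
  unfold envelope. eapply Rle_trans.
  - apply Rmult_le_compat; [| |exact A|exact B2].
    + apply Rplus_le_le_0_compat; apply Rmult4_le_pos; try lra; apply pow_le; lra.
    + left; apply exp_pos.
  - assert (P1 : 0 < c ^ N) by (apply pow_lt; auto). assert (P3 : 0 < r ^ (2 * N)) by (apply pow_lt; lra).
    assert (P4 := exp_pos (- (2 * INR N * v))).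
    replace (50 * r ^ 4 * (exp (9 / 2 * v) + exp (5 / 2 * v)) * (INR (fact N) / c ^ N / r ^ (2 * N) * exp (- (2 * INR N * v))))
      with ((50 * INR (fact N) / c ^ N * ((exp (9 / 2 * v) + exp (5 / 2 * v)) * exp (- (2 * INR N * v)))) * (r ^ 4 / r ^ (2 * N))) by (field; lra).
    replace (50 * INR (fact N) / c ^ N * inv_sq k * ((exp (9 / 2 * v) + exp (5 / 2 * v)) * exp (- (2 * INR N * v))))
      with ((50 * INR (fact N) / c ^ N * ((exp (9 / 2 * v) + exp (5 / 2 * v)) * exp (- (2 * INR N * v)))) * inv_sq k) by ring.
    apply Rmult_le_compat_l.
    + apply Rmult_le_pos; [apply Rdiv_le_0_compat; lra|]. apply Rmult_le_pos; lra.
    + apply Rmult_le_reg_r with (r ^ (2 * N)); auto. unfold Rdiv. rewrite Rmult_assoc, Rinv_l by lra. lra.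
Qed.

Lemma ker_envelope r u : 0 <= r -> Rabs (ker r u) <= envelope 1 r u.
Proof.
  intros Hr. assert (HPI := PI_bounds). unfold ker, envelope. rewrite Rabs_mult, (Rabs_pos_eq (exp _)) by (left; apply exp_pos).
  rewrite Rmult_1_r. apply Rmult_le_compat_r; [left; apply exp_pos|].
  assert (0 <= 2 * PI ^ 2 * r ^ 4 * exp (9 / 2 * u)).
  { apply Rmult4_le_pos; try lra; try (apply pow_le; lra). left; apply exp_pos. }
  assert (0 <= 3 * PI * r ^ 2 * exp (5 / 2 * u)).
  { apply Rmult4_le_pos; try lra; try (apply pow_le; lra). left; apply exp_pos. }
  apply Rabs_le_between. lra.
Qed.

Lemma ker_decay k u N : (3 <= N)%nat -> 0 <= u ->
  Rabs (ker (INR (S k)) u) <= 100 * INR (fact N) * inv_sq k * exp (- (2 * INR N - 9 / 2) * u).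
Proof.
  intros HN Hu. eapply Rle_trans; [apply ker_envelope, pos_INR|].
  eapply Rle_trans; [apply (envelope_bound 1 k u N); auto; lra|].
  rewrite pow1. assert (E : exp (5 / 2 * u) <= exp (9 / 2 * u)) by (apply exp_le; lra).
  assert (P := inv_sq_pos k). assert (F := INR_fact_lt_0 N).
  replace (- (2 * INR N - 9 / 2) * u) with (9 / 2 * u + - (2 * INR N * u)) by ring. rewrite exp_plus.
  assert (Q := exp_pos (- (2 * INR N * u))).
  replace (50 * INR (fact N) / 1 * inv_sq k * ((exp (9 / 2 * u) + exp (5 / 2 * u)) * exp (- (2 * INR N * u))))
    with (50 * INR (fact N) * inv_sq k * exp (- (2 * INR N * u)) * (exp (9 / 2 * u) + exp (5 / 2 * u))) by field.
  replace (100 * INR (fact N) * inv_sq k * (exp (9 / 2 * u) * exp (- (2 * INR N * u))))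
    with (50 * INR (fact N) * inv_sq k * exp (- (2 * INR N * u)) * (2 * exp (9 / 2 * u))) by ring.
  apply Rmult_le_compat_l; [|lra]. repeat apply Rmult_le_pos; lra.
Qed.

Lemma ker_summable u : ex_series (fun k => Rabs (ker (INR (S k)) u)).
Proof.
  apply (ex_series_le (V := R_CompleteNormedModule) _
    (fun k => (50 * INR (fact 3) / 1 ^ 3 * ((exp (9 / 2 * u) + exp (5 / 2 * u)) * exp (- (2 * INR 3 * u)))) * inv_sq k)).
  - intros k. change (Rabs (Rabs (ker (INR (S k)) u)) <= (50 * INR (fact 3) / 1 ^ 3 * ((exp (9 / 2 * u) + exp (5 / 2 * u)) * exp (- (2 * INR 3 * u)))) * inv_sq k).
    rewrite Rabs_Rabsolu. eapply Rle_trans; [apply ker_envelope, pos_INR|].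
    eapply Rle_trans; [apply (envelope_bound 1 k u 3); auto; lra|]. right; ring.
  - apply (ex_series_scal (V := R_NormedModule)). apply ex_series_inv_sq.
Qed.

Lemma ex_series_of_abs (f : nat -> R) : ex_series (fun k => Rabs (f k)) -> ex_series f.
Proof. apply ex_series_Rabs. Qed.

Lemma is_derive_quad (F : R -> R) u l B :
  (forall h, Rabs h <= 1 -> Rabs (F (u + h) - F u - h * l) <= B * h ^ 2) -> is_derive F u l.
Proof.
  intros H. apply is_derive_Reals. intros eps He.
  assert (HB : 0 <= B). { generalize (H 1 ltac:(rewrite Rabs_R1; lra)) (Rabs_pos (F (u + 1) - F u - 1 * l)). lra. }
  assert (Hd : 0 < Rmin 1 (eps / (B + 1))) by (apply Rmin_glb_lt; [lra|apply Rdiv_lt_0_compat; lra]).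
  exists (mkposreal _ Hd). intros h Hh Hh'. simpl in Hh'.
  assert (H1 := Rlt_le_trans _ _ _ Hh' (Rmin_l _ _)). assert (H2 := Rlt_le_trans _ _ _ Hh' (Rmin_r _ _)).
  specialize (H h ltac:(lra)).
  assert (Hp : 0 < Rabs h) by (apply Rabs_pos_lt; auto).
  replace ((F (u + h) - F u) / h - l) with ((F (u + h) - F u - h * l) / h) by (field; auto).
  unfold Rdiv. rewrite Rabs_mult, Rabs_inv.
  apply Rmult_lt_reg_r with (Rabs h); auto. rewrite Rmult_assoc, Rinv_l, Rmult_1_r by lra.
  eapply Rle_lt_trans; [exact H|]. rewrite <- pow2_abs.
  assert (Q : (B + 1) * (eps / (B + 1)) = eps) by (field; lra).
  assert (Q0 : 0 < eps / (B + 1)) by (apply Rdiv_lt_0_compat; lra).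
  assert (Q1 : B * Rabs h <= B * (eps / (B + 1))) by (apply Rmult_le_compat_l; lra).
  replace (B * Rabs h ^ 2) with ((B * Rabs h) * Rabs h) by ring.
  apply Rmult_lt_compat_r; auto. lra.
Qed.

(** Two applications of the mean value theorem bound each first-order remainder by b_k h^2;
    summation leaves a quadratic remainder for the series. *)
Lemma is_derive_Series (f f1 f2 : nat -> R -> R) (b : nat -> R) u :
  (forall k t, is_derive (f k) t (f1 k t)) -> (forall k t, is_derive (f1 k) t (f2 k t)) ->
  (forall k t, Rabs (t - u) <= 1 -> Rabs (f2 k t) <= b k) -> ex_series b ->
  (forall t, ex_series (fun k => f k t)) -> (forall t, ex_series (fun k => f1 k t)) ->
  is_derive (fun t => Series (fun k => f k t)) u (Series (fun k => f1 k u)).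
Proof.
  intros D1 D2 Hb Eb E0 E1. apply is_derive_quad with (Series b).
  intros h Hh.
  assert (T : forall k, Rabs (f k (u + h) - f k u - h * f1 k u) <= b k * h ^ 2).
  { intros k.
    assert (M1 : forall t, Rabs (t - u) <= Rabs h -> Rabs (f1 k t - f1 k u) <= b k * Rabs h).
    { intros t Ht. destruct (MVT_gen (f1 k) u t (f2 k)) as [c [Hc E]].
      - intros; apply D2.
      - intros x _. eapply is_derive_cont; apply D2.
      - rewrite E, Rabs_mult.
        assert (Hcu : Rabs (c - u) <= Rabs (t - u)).
        { unfold Rmin, Rmax in Hc. destruct (Rle_dec u t); [rewrite !Rabs_pos_eq; lra|rewrite !Rabs_left1; lra]. }
        apply Rmult_le_compat; auto using Rabs_pos. apply Hb. lra. }
    destruct (MVT_gen (fun t => f k t - t * f1 k u) u (u + h) (fun t => f1 k t - f1 k u)) as [c [Hc E]].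
    - intros x _. apply (is_derive_minus (f k)); auto. auto_derive; auto. ring.
    - intros x _. eapply is_derive_cont.
      apply (is_derive_minus (f k) (fun t => t * f1 k u) x); auto. auto_derive; auto.
    - replace (f k (u + h) - f k u - h * f1 k u) with (f k (u + h) - (u + h) * f1 k u - (f k u - u * f1 k u)) by ring.
      rewrite E, Rabs_mult. replace (u + h - u) with h by ring.
      rewrite <- pow2_abs. simpl pow. rewrite Rmult_1_r, <- Rmult_assoc.
      apply Rmult_le_compat_r; [apply Rabs_pos|]. apply M1.
      unfold Rmin, Rmax in Hc. destruct (Rle_dec u (u + h)).
      + rewrite !Rabs_pos_eq; lra.
      + rewrite !Rabs_left1; lra. }
  rewrite <- Series_scal_l, <- Series_minus, <- Series_minus, <- Series_scal_r; auto.
  - assert (Ex : ex_series (fun k => Rabs (f k (u + h) - f k u - h * f1 k u))).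
    { apply (ex_series_le (V := R_CompleteNormedModule) _ (fun k => b k * h ^ 2)).
      - intros k. change (Rabs (Rabs (f k (u + h) - f k u - h * f1 k u)) <= b k * h ^ 2). rewrite Rabs_Rabsolu; auto.
      - apply ex_series_scal_r; auto. }
    eapply Rle_trans; [apply Series_Rabs; auto|]. apply Series_le.
    + intros; split; [apply Rabs_pos|auto].
    + apply ex_series_scal_r; auto.
  - apply (ex_series_minus (V := R_NormedModule)); auto.
  - apply (ex_series_scal (V := R_NormedModule)); auto.
Qed.

(* th_term p0 is the k-th term of (vth u - e^(u/2)) / 2, and p1, p2, p3 give its derivatives.  Phi0 is even because vth is
   and 4 Phi0 = vth'' - vth / 4. *)
Definition th_term (p : R -> R) (k : nat) (u : R) : R :=
  p (PI * INR (S k) ^ 2 * exp (2 * u)) * (exp (/ 2 * u) * exp (- (PI * INR (S k) ^ 2 * exp (2 * u)))).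

(** Since y = PI r^2 e^(2u) satisfies dy/du = 2y, differentiation acts on the factor p(y) alone. *)
Lemma th_term_derive (p p' : R -> R) : (forall y, is_derive p y (p' y)) -> forall k u,
  is_derive (th_term p k) u (th_term (fun y => 2 * y * p' y + (/ 2 - 2 * y) * p y) k u).
Proof.
  intros Hp k u. unfold th_term. set (c := PI * INR (S k) ^ 2).
  assert (D1 : is_derive (fun u => c * exp (2 * u)) u (2 * (c * exp (2 * u)))).
  { auto_derive; auto. ring. }
  assert (D2 := is_derive_comp p (fun u => c * exp (2 * u)) u _ _ (Hp _) D1).
  assert (D3 : is_derive (fun u => exp (/ 2 * u) * exp (- (c * exp (2 * u)))) u
    ((/ 2 - 2 * (c * exp (2 * u))) * (exp (/ 2 * u) * exp (- (c * exp (2 * u)))))).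
  { auto_derive; auto. field. }
  assert (D4 := is_derive_mult (K := R_AbsRing) _ _ u _ _ D2 D3 Rmult_comm).
  unfold plus, mult, scal in D4; simpl in D4. unfold mult in D4; simpl in D4.
  match goal with |- is_derive _ _ ?l => match type of D4 with is_derive _ _ ?l' => replace l with l' by ring end end.
  exact D4.
Qed.

Lemma th_term_bound (p : R -> R) C k u : 0 <= C -> (forall y, 0 <= y -> Rabs (p y) <= C * (1 + y) ^ 3) ->
  Rabs (th_term p k u) <= C * 24 * exp 1 * exp (- (3 / 2 * u)) * inv_sq k.
Proof.
  intros HC Hp. unfold th_term, inv_sq. set (r := INR (S k)). set (y := PI * r ^ 2 * exp (2 * u)).
  assert (Hr : 1 <= r) by (unfold r; rewrite S_INR; generalize (pos_INR k); lra).
  assert (HPI := PI_bounds). assert (E0 := exp_pos (2 * u)).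
  assert (Hry : r ^ 2 * exp (2 * u) <= y).
  { unfold y. rewrite Rmult_assoc. assert (0 <= r ^ 2 * exp (2 * u)) by (apply Rmult_le_pos; nra). nra. }
  assert (Hy : 0 < y). { assert (0 < r ^ 2 * exp (2 * u)) by (apply Rmult_lt_0_compat; nra). lra. }
  assert (B : (1 + y) ^ 3 * exp (- y) <= 24 * exp 1 / (r ^ 2 * exp (2 * u))).
  (* Order four, one above the cubic factor: the spare power of 1 + y exceeds r^2 e^(2u) and yields
     the summable 1 / r^2. *)
  { assert (H := pow_fact_le_exp 4 (1 + y) ltac:(lra)). simpl fact in H. 
    replace (INR 24) with 24 in H by (simpl; lra). rewrite exp_plus in H.
    rewrite exp_Ropp. assert (E1 := exp_pos y). assert (E2 := exp_pos 1).
    assert (P : 0 < r ^ 2 * exp (2 * u)) by (apply Rmult_lt_0_compat; nra).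
    apply Rmult_le_reg_r with (exp y * (r ^ 2 * exp (2 * u))); [apply Rmult_lt_0_compat; auto|].
    replace ((1 + y) ^ 3 * / exp y * (exp y * (r ^ 2 * exp (2 * u)))) with ((1 + y) ^ 3 * (r ^ 2 * exp (2 * u))) by (field; lra).
    replace (24 * exp 1 / (r ^ 2 * exp (2 * u)) * (exp y * (r ^ 2 * exp (2 * u)))) with (24 * (exp 1 * exp y)) by (field; split; lra).
    apply Rle_trans with ((1 + y) ^ 3 * (1 + y)); [|simpl pow in *; lra].
    apply Rmult_le_compat_l; [apply pow_le; lra|lra]. }
  rewrite !Rabs_mult, !(Rabs_pos_eq (exp _)) by (left; apply exp_pos).
  assert (E1 := exp_pos (/ 2 * u)). assert (E2 := exp_pos (- y)).
  apply Rle_trans with (C * (1 + y) ^ 3 * (exp (/ 2 * u) * exp (- y))).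
  { apply Rmult_le_compat_r; [apply Rmult_le_pos; lra|]. apply Hp; lra. }
  replace (C * (1 + y) ^ 3 * (exp (/ 2 * u) * exp (- y))) with (C * exp (/ 2 * u) * ((1 + y) ^ 3 * exp (- y))) by ring.
  apply Rle_trans with (C * exp (/ 2 * u) * (24 * exp 1 / (r ^ 2 * exp (2 * u)))).
  { apply Rmult_le_compat_l; auto. apply Rmult_le_pos; lra. }
  right. replace (- (3 / 2 * u)) with (/ 2 * u + - (2 * u)) by field. rewrite exp_plus, exp_Ropp. field. split; lra.
Qed.

Lemma th_term_summable (p : R -> R) C u : 0 <= C -> (forall y, 0 <= y -> Rabs (p y) <= C * (1 + y) ^ 3) ->
  ex_series (fun k => th_term p k u).
Proof.
  intros HC Hp. apply (ex_series_le (V := R_CompleteNormedModule) _ (fun k => C * 24 * exp 1 * exp (- (3 / 2 * u)) * inv_sq k)).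
  - intros k. apply th_term_bound; auto.
  - apply (ex_series_scal (V := R_NormedModule)). apply ex_series_inv_sq.
Qed.

Definition p0 (y : R) : R := 1.

Definition p1 (y : R) : R := / 2 - 2 * y.

Definition p2 (y : R) : R := / 4 - 6 * y + 4 * y ^ 2.

Definition p3 (y : R) : R := / 8 - 31 / 2 * y + 30 * y ^ 2 - 8 * y ^ 3.

Lemma p_cubic (p : R -> R) : p = p0 \/ p = p1 \/ p = p2 \/ p = p3 -> forall y, 0 <= y -> Rabs (p y) <= 60 * (1 + y) ^ 3.
Proof.
  intros Hp y Hy. assert (0 <= y ^ 2) by apply pow2_ge_0. assert (0 <= y ^ 3) by (apply pow_le; auto).
  replace (60 * (1 + y) ^ 3) with (60 + 180 * y + 180 * y ^ 2 + 60 * y ^ 3) by ring.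
  apply Rabs_le_between.
  destruct Hp as [->|[->|[->| ->]]]; unfold p0, p1, p2, p3; split; lra.
Qed.

(** In the variable x = e^(2u) the functional equation of theta is the evenness of this function. *)
Definition vth (u : R) : R := exp (/ 2 * u) * (1 + 2 * psi (exp (2 * u))).

Lemma vth_even u : vth (- u) = vth u.
Proof.
  unfold vth. assert (H := psi_functional (exp (2 * u)) (exp_pos _)).
  rewrite <- exp_Ropp in H. replace (2 * - u) with (- (2 * u)) by ring. rewrite H.
  assert (E : sqrt (exp (2 * u)) = exp u).
  { replace (2 * u) with (u + u) by ring. rewrite exp_plus. apply sqrt_square. left; apply exp_pos. }
  rewrite E, <- Rmult_assoc, <- exp_plus. do 2 f_equal. field.
Qed.

Definition th_sum (p : R -> R) (u : R) : R := Series (fun k => th_term p k u).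

Lemma th_sum_derive (p p' p'' : R -> R) u :
  (forall k t, is_derive (th_term p k) t (th_term p' k t)) ->
  (forall k t, is_derive (th_term p' k) t (th_term p'' k t)) ->
  (forall y, 0 <= y -> Rabs (p y) <= 60 * (1 + y) ^ 3) ->
  (forall y, 0 <= y -> Rabs (p' y) <= 60 * (1 + y) ^ 3) ->
  (forall y, 0 <= y -> Rabs (p'' y) <= 60 * (1 + y) ^ 3) ->
  is_derive (th_sum p) u (th_sum p' u).
Proof.
  intros D1 D2 B0 B1 B2.
  apply (is_derive_Series (th_term p) (th_term p') (th_term p'')
    (fun k => 60 * 24 * exp 1 * exp (- (3 / 2 * (u - 1))) * inv_sq k)); auto.
  - intros k t Ht. eapply Rle_trans; [apply (th_term_bound p'' 60); auto; lra|].
    assert (P := inv_sq_pos k). assert (E := exp_pos 1).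
    apply Rmult_le_compat_r; [lra|]. apply Rmult_le_compat_l; [lra|]. apply exp_le.
    apply Rabs_le_between in Ht. lra.
  - apply (ex_series_scal (V := R_NormedModule)). apply ex_series_inv_sq.
  - intros t. apply th_term_summable with 60; auto; lra.
  - intros t. apply th_term_summable with 60; auto; lra.
Qed.

Lemma th_term_ext p q : (forall y, p y = q y) -> forall k u, th_term p k u = th_term q k u.
Proof. intros H k u. unfold th_term. rewrite H; auto. Qed.

Lemma dp0 k u : is_derive (th_term p0 k) u (th_term p1 k u).
Proof.
  rewrite (th_term_ext p1 (fun y => 2 * y * 0 + (/ 2 - 2 * y) * p0 y)); [|intros; unfold p0, p1; ring].
  apply (th_term_derive p0 (fun _ => 0)). intros y. apply @is_derive_const.
Qed.

Lemma dp1 k u : is_derive (th_term p1 k) u (th_term p2 k u).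
Proof.
  rewrite (th_term_ext p2 (fun y => 2 * y * (- 2) + (/ 2 - 2 * y) * p1 y)); [|intros; unfold p2, p1; field].
  apply (th_term_derive p1 (fun _ => - 2)). intros y. unfold p1. auto_derive; auto. ring.
Qed.

Lemma dp2 k u : is_derive (th_term p2 k) u (th_term p3 k u).
Proof.
  rewrite (th_term_ext p3 (fun y => 2 * y * (- 6 + 8 * y) + (/ 2 - 2 * y) * p2 y)); [|intros; unfold p2, p3; field].
  apply (th_term_derive p2 (fun y => - 6 + 8 * y)). intros y. unfold p2. auto_derive; auto. ring.
Qed.

(** With y = PI r^2 e^(2u), [ker r u] is (2 y^2 - 3 y) e^(u/2 - y), and p2(y) - 1/4 = 2 (2 y^2 - 3
    y). *)
Lemma th_sum_eq u : th_sum p2 u = / 4 * th_sum p0 u + 2 * Phi0 u.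
Proof.
  unfold th_sum, Phi0. rewrite <- !Series_scal_l, <- Series_plus.
  - apply Series_ext. intros k. unfold th_term, p0, p2, ker.
    set (r := INR (S k)). set (E := exp (- (PI * r ^ 2 * exp (2 * u)))).
    replace (exp (9 / 2 * u)) with (exp (/ 2 * u) * (exp (2 * u) * exp (2 * u))) by (rewrite <- !exp_plus; f_equal; field).
    replace (exp (5 / 2 * u)) with (exp (/ 2 * u) * exp (2 * u)) by (rewrite <- !exp_plus; f_equal; field).
    field.
  - apply (ex_series_scal (V := R_NormedModule)). apply th_term_summable with 60; [lra|]. apply p_cubic; auto.
  - apply (ex_series_scal (V := R_NormedModule)). apply ex_series_of_abs, ker_summable.
Qed.

Lemma vth_th_sum u : vth u = exp (/ 2 * u) + 2 * th_sum p0 u.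
Proof.
  unfold vth, psi, th_sum.
  replace (Series (fun k => th_term p0 k u)) with (exp (/ 2 * u) * Series (fun k => exp (- (PI * INR (S k) ^ 2 * exp (2 * u))))).
  - ring.
  - rewrite <- Series_scal_l. apply Series_ext. intros k. unfold th_term, p0. ring.
Qed.

Lemma Phi0_even u : Phi0 (- u) = Phi0 u.
Proof.
  set (v1 := fun u => / 2 * exp (/ 2 * u) + 2 * th_sum p1 u).
  set (v2 := fun u => / 4 * exp (/ 2 * u) + 2 * th_sum p2 u).
  assert (D1 : forall u, is_derive vth u (v1 u)).
  { intros x. apply (is_derive_ext (fun u => exp (/ 2 * u) + 2 * th_sum p0 u)).
    { intros; symmetry; apply vth_th_sum. }
    apply (is_derive_plus (fun u => exp (/ 2 * u)) (fun u => 2 * th_sum p0 u)).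
    - auto_derive; auto. ring.
    - apply is_derive_scal. apply th_sum_derive with p2; auto using dp0, dp1; apply p_cubic; auto. }
  assert (D2 : forall u, is_derive v1 u (v2 u)).
  { intros x. apply (is_derive_plus (fun u => / 2 * exp (/ 2 * u)) (fun u => 2 * th_sum p1 u)).
    - auto_derive; auto. field.
    - apply is_derive_scal. apply th_sum_derive with p3; auto using dp1, dp2; apply p_cubic; auto. }
  assert (Hopp : forall (f f' : R -> R) x, (forall x, is_derive f x (f' x)) -> is_derive (fun t => f (- t)) x (- f' (- x))).
  { intros f f' x Hf. replace (- f' (- x)) with (- 1 * f' (- x)) by ring.
    apply (is_derive_comp f Ropp); auto. auto_derive; auto; ring. }
  assert (O1 : forall u, v1 (- u) = - v1 u).
  { intros x. assert (A := Hopp vth v1 x D1).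
    assert (B := is_derive_ext _ vth _ _ vth_even A).
    generalize (is_derive_unique _ _ _ B). rewrite (is_derive_unique _ _ _ (D1 x)). lra. }
  assert (O2 : v2 (- u) = v2 u).
  { assert (A := Hopp v1 v2 u D2).
    assert (B := is_derive_ext _ (fun t => - v1 t) _ _ O1 A).
    assert (A' := is_derive_opp _ _ _ (D2 u)).
    assert (A1 : Derive (fun t => - v1 t) u = - v2 (- u)) by exact (is_derive_unique _ _ _ B).
    assert (A2 : Derive (fun t => - v1 t) u = - v2 u) by exact (is_derive_unique _ _ _ A').
    rewrite A1 in A2. lra. }
  assert (E : forall u, v2 u = / 4 * vth u + 4 * Phi0 u).
  { intros x. unfold v2. rewrite th_sum_eq, vth_th_sum. field. }
  rewrite !E, vth_even in O2. lra.
Qed.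

(** Decay faster than every exponential makes the transform entire; evenness, with real values,
    gives it the symmetries z to -z and z to conj z. *)
Definition even_rapid (p : R -> R) : Prop :=
  (forall u, continuous p u) /\ (forall u, p (- u) = p u) /\
  forall B, 0 < B -> exists K, forall u, Rabs (p u) <= K * exp (- B * Rabs u).

(** For even p this is 4 times the integral of p(u) cos(zu) over the half-line, the normalisation of
    [hyp_gamma]. *)
Definition T (p : R -> R) (z : C) : C := (2 * CI (fun u => RtoC (p u) * Cexp (Ci * z * RtoC u)))%C.

Lemma Cmod_Cexp_le (s : C) (u : R) : Cmod (Cexp (s * RtoC u)) <= exp (Cmod s * Rabs u).
Proof.
  rewrite Cmod_Cexp. apply exp_le. replace (Re (s * RtoC u)) with (Re s * u) by (unfold Re; simpl; ring).
  eapply Rle_trans; [apply Rle_abs|]. rewrite Rabs_mult. apply Rmult_le_compat_r; [apply Rabs_pos|apply re_le_Cmod].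
Qed.

Lemma Ccont_exp_lin (s : C) : Ccont (fun u => Cexp (s * RtoC u)).
Proof. apply Ccont_Cexp, Ccont_mult; [apply Ccont_const|apply Ccont_id]. Qed.

Lemma Cdecay_RtoC_exp (p : R -> R) K B c (s : C) : (forall u, continuous p u) ->
  (forall u, Rabs (p u) <= K * exp (- B * Rabs u)) -> c + Cmod s <= B ->
  Cdecay c K (fun u => RtoC (p u) * Cexp (s * RtoC u))%C.
Proof.
  intros Hc Hp HB. assert (HK : 0 <= K).
  { generalize (Hp 0) (Rabs_pos (p 0)). rewrite Rabs_R0, Rmult_0_r, exp_0. lra. }
  split.
  - apply Ccont_mult; [apply Ccont_RtoC; auto|apply Ccont_exp_lin].
  - intros u. rewrite Cmod_mult, Cmod_R.
    apply Rle_trans with ((K * exp (- B * Rabs u)) * exp (Cmod s * Rabs u)).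
    + apply Rmult_le_compat; auto using Rabs_pos, Cmod_ge_0, Cmod_Cexp_le.
    + rewrite Rmult_assoc, <- exp_plus. apply Rmult_le_compat_l; auto. apply exp_le.
      generalize (Rabs_pos u). nra.
Qed.

Lemma even_rapid_Cdecay p (s : C) c : even_rapid p -> 0 < c -> exists K, Cdecay c K (fun u => RtoC (p u) * Cexp (s * RtoC u))%C.
Proof.
  intros (Hc & _ & Hb) H0. destruct (Hb (c + Cmod s)) as [K HK].
  { generalize (Cmod_ge_0 s); lra. }
  exists K. apply (Cdecay_RtoC_exp p K (c + Cmod s)); auto. lra.
Qed.

Lemma analytic_T p z : even_rapid p -> analytic (T p) z.
Proof.
  intros Hp. apply analytic_mult; [apply analytic_const|].
  apply (analytic_ext (fun w => CI (fun u => RtoC (p u) * Cexp ((Ci * w + 0) * RtoC u))%C)).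
  - intros w. rewrite Cplus_0_r. auto.
  - apply (analytic_aff (fun s => CI (fun u => RtoC (p u) * Cexp (s * RtoC u))%C) Ci 0).
    destruct (even_rapid_Cdecay p (Ci * z + 0)%C 1 Hp Rlt_0_1) as [K HK].
    apply (analytic_laplace 1 K (fun u => RtoC (p u))); auto; lra.
Qed.

Lemma T_even p z : even_rapid p -> T p (- z) = T p z.
Proof.
  intros Hp. unfold T. f_equal.
  destruct (even_rapid_Cdecay p (Ci * z)%C 1 Hp Rlt_0_1) as [K HK].
  rewrite <- (CI_opp 1 K (fun u => RtoC (p u) * Cexp (Ci * z * RtoC u))%C); auto; [|lra].
  apply CI_ext. intros u. rewrite (proj1 (proj2 Hp)), RtoC_opp. do 2 f_equal. ring.
Qed.

Lemma Cexp_conj z : Cexp (Cconj z) = Cconj (Cexp z).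
Proof. apply Ceq; unfold Cexp, Cconj, Re, Im; simpl; rewrite ?cos_neg, ?sin_neg; ring. Qed.

Lemma Int_neg c K f : 0 < c -> Rdecay c K f -> Int (fun u => - f u) = - Int f.
Proof.
  intros Hc Hf. replace (- Int f) with (- 1 * Int f + 0 * Int f) by ring.
  rewrite <- (Int_lin c K K) by auto. apply Int_ext; intros; ring.
Qed.

Lemma CI_conj c K f : 0 < c -> Cdecay c K f -> CI (fun u => Cconj (f u)) = Cconj (CI f).
Proof.
  intros Hc Hf. unfold CI, Cconj. apply Ceq; simpl; auto.
  apply (Int_neg c K (fun t => Im (f t))); auto using Cdecay_im.
Qed.

Lemma Cconj_mult x y : Cconj (x * y) = (Cconj x * Cconj y)%C.
Proof. apply Ceq; unfold Cconj, Re, Im; simpl; ring. Qed.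

Lemma Cconj_RtoC x : Cconj (RtoC x) = RtoC x.
Proof. apply Ceq; simpl; ring. Qed.

Lemma T_conj p z : even_rapid p -> T p (Cconj z) = Cconj (T p z).
Proof.
  intros Hp. rewrite <- (T_even p (Cconj z)) by auto. unfold T.
  destruct (even_rapid_Cdecay p (Ci * z)%C 1 Hp Rlt_0_1) as [K HK].
  rewrite Cconj_mult, Cconj_RtoC. f_equal.
  rewrite <- (CI_conj 1 K) by (auto; lra). apply CI_ext. intros u.
  rewrite Cconj_mult, Cconj_RtoC, <- Cexp_conj. do 2 f_equal.
  destruct z; apply Ceq; simpl; ring.
Qed.

Lemma T_real p (t : R) : even_rapid p -> T p (RtoC t) = RtoC (Re (T p (RtoC t))).
Proof.
  intros Hp. assert (H := T_conj p (RtoC t) Hp). rewrite Cconj_RtoC in H.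
  apply (f_equal Im) in H. apply Ceq; simpl; auto. unfold Cconj, Im in *. simpl in H. lra.
Qed.

(* Xi_N integrates over the half-line only, so it is the transform of the even function ker r |u|, not of ker r u. *)
Definition kerA (k : nat) (u : R) : R := ker (INR (S k)) (Rabs u).

Lemma continuous_ker r u : continuous (ker r) u.
Proof.
  apply (continuous_of_derivable _ (Derive (ker r))). intros x. apply Derive_correct. unfold ker. auto_derive; auto.
Qed.

Lemma continuous_kerA k u : continuous (kerA k) u.
Proof. apply (continuous_comp' Rabs (ker (INR (S k)))); [apply continuous_Rabs|apply continuous_ker]. Qed.

Lemma kerA_bound B : 0 < B -> exists C0, 0 < C0 /\ forall k u, Rabs (kerA k u) <= C0 * inv_sq k * exp (- B * Rabs u).
Proof.
  (* Chosen so that 2 N - 9/2 >= B and N >= 3 in [ker_decay]. *)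
  intros HB. destruct (nat_above ((B + 9 / 2) / 2 + 3)) as [N HN].
  assert (H3 : (3 <= N)%nat). { apply INR_le. simpl. lra. }
  exists (100 * INR (fact N)). split.
  - generalize (INR_fact_lt_0 N); lra.
  - intros k u. unfold kerA. eapply Rle_trans; [apply (ker_decay k (Rabs u) N); auto using Rabs_pos|].
    apply Rmult_le_compat_l.
    + generalize (INR_fact_lt_0 N) (inv_sq_pos k). intros. repeat apply Rmult_le_pos; lra.
    + apply exp_le. generalize (Rabs_pos u). nra.
Qed.

(** The single summands are not even, yet replacing u by |u| in all of them preserves the sum,
    because [Phi0] is even. Hence the symmetrised truncations converge to [Phi0]. *)
Lemma Phi0_abs u : Series (fun k => kerA k u) = Phi0 u.
Proof.
  change (Phi0 (Rabs u) = Phi0 u). unfold Rabs. destruct (Rcase_abs u); auto. apply Phi0_even.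
Qed.

(** [Rsum] starts at 1 and [kerA] counts from 0, whence [pred]; the summands are those with r = 1,
    ..., N. *)
Definition PN (N : nat) (u : R) : R := Rsum (fun k => kerA (pred k) u) N.

Lemma PN_bound B : 0 < B -> exists C0, 0 < C0 /\
  (forall u, Rabs (Phi0 u) <= C0 * Series inv_sq * exp (- B * Rabs u)) /\
  (forall N u, Rabs (Phi0 u - PN N u) <= C0 * tail inv_sq N * exp (- B * Rabs u)).
Proof.
  intros HB. destruct (kerA_bound B HB) as [C0 [HC HK]]. exists C0. split; auto.
  assert (A : forall N u, Rabs (Phi0 u - PN N u) <= C0 * tail inv_sq N * exp (- B * Rabs u)).
  { intros N u. rewrite <- Phi0_abs.
    assert (Eb : ex_series (fun k => C0 * inv_sq k * exp (- B * Rabs u))).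
    { apply ex_series_scal_r. apply (ex_series_scal (V := R_NormedModule)). apply ex_series_inv_sq. }
    assert (Ea : ex_series (fun k => Rabs (kerA k u))) by apply ker_summable.
    assert (E : Series (fun k => kerA k u) - PN N u = Series (fun k => kerA (N + k)%nat u)).
    { destruct N as [|N].
      - unfold PN; simpl. ring.
      - rewrite (Series_incr_n (fun k => kerA k u) (S N)); [|lia|apply ex_series_of_abs; auto].
        assert (G : forall m, sum_f_R0 (fun k => kerA k u) m = PN (S m) u).
        { induction m as [|m IH]; [unfold PN; simpl; ring|]. cbn [sum_f_R0]. rewrite IH. reflexivity. }
        cbn [pred]. rewrite G. ring. }
    rewrite E. 
    eapply Rle_trans; [apply Series_Rabs; apply (ex_series_tail (fun k => Rabs (kerA k u))); auto|].
    apply Rle_trans with (Series (fun k => C0 * inv_sq (N + k)%nat * exp (- B * Rabs u))).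
    - apply Series_le; [intros; split; [apply Rabs_pos|auto]|].
      apply (ex_series_tail (fun k => C0 * inv_sq k * exp (- B * Rabs u))); auto.
    - rewrite Series_scal_r, Series_scal_l. right; reflexivity. }
  split; auto. intros u. generalize (A 0%nat u). unfold PN, tail. simpl. rewrite Rminus_0_r. auto.
Qed.

Lemma continuous_PN N u : continuous (PN N) u.
Proof.
  unfold PN. induction N as [|N IH]; simpl; [apply continuous_const|].
  apply (continuous_plus (fun u => Rsum (fun k => kerA (pred k) u) N) (kerA N)); auto. apply continuous_kerA.
Qed.

Lemma even_rapid_Phi0 : even_rapid Phi0.
Proof.
  split; [|split].
  - destruct (PN_bound 1 Rlt_0_1) as [C0 [HC [_ H]]].
    assert (Cc : Ccont (fun u => RtoC (Phi0 u))).
    { apply Ccont_unif with (fun N u => RtoC (PN N u)) (fun N => C0 * tail inv_sq N).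
      - intros N. apply Ccont_RtoC. intros; apply continuous_PN.
      - intros N u. rewrite <- RtoC_minus, Cmod_R. eapply Rle_trans; [apply H|].
        assert (0 <= C0 * tail inv_sq N).
        { generalize (H N 0) (Rabs_pos (Phi0 0 - PN N 0)). rewrite Rabs_R0, Rmult_0_r, exp_0. lra. }
        rewrite <- (Rmult_1_r (C0 * tail inv_sq N)) at 2. apply Rmult_le_compat_l; auto.
        apply Rle_trans with (exp 0); [apply exp_le; generalize (Rabs_pos u); lra|rewrite exp_0; lra].
      - apply is_lim_seq_scal0, tail_lim, ex_series_inv_sq. }
    intros u. apply (Cc u).
  - apply Phi0_even.
  - intros B HB. destruct (PN_bound B HB) as [C0 [_ [H _]]]. eexists; apply H.
Qed.

Lemma even_rapid_PN N : even_rapid (PN N).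
Proof.
  split; [apply continuous_PN|split].
  - intros u. unfold PN. apply Rsum_ext. intros k _. unfold kerA. rewrite Rabs_Ropp. auto.
  - intros B HB. destruct (PN_bound B HB) as [C0 [HC [H1 H2]]].
    exists (C0 * Series inv_sq + C0 * tail inv_sq N). intros u.
    replace (PN N u) with (Phi0 u - (Phi0 u - PN N u)) by ring.
    generalize (H1 u) (H2 N u) (Rabs_triang (Phi0 u) (- (Phi0 u - PN N u))). rewrite Rabs_Ropp. unfold Rminus at 4. lra.
Qed.

Definition X (z : C) : C := T Phi0 z.

Lemma X_PN_uniform Rad eps : 0 <= Rad -> 0 < eps ->
  exists N0, forall N, (N0 <= N)%nat -> forall z, Cmod z <= Rad -> Cmod (X z - T (PN N) z) < eps.
Proof.
  intros HR He. destruct (PN_bound (Rad + 1) ltac:(lra)) as [C0 [HC [_ H]]].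
  assert (L : is_lim_seq (fun N => 8 * C0 * tail inv_sq N) 0) by (apply is_lim_seq_scal0, tail_lim, ex_series_inv_sq).
  apply is_lim_seq_spec in L. destruct (L (mkposreal _ He)) as [N0 HN]. exists N0.
  intros N Hn z Hz. specialize (HN N Hn). simpl in HN. rewrite Rminus_0_r in HN. apply Rabs_def2 in HN.
  assert (Hs : Cmod (Ci * z) <= Rad) by (rewrite Cmod_mult, Cmod_Ci; lra).
  destruct (even_rapid_Cdecay Phi0 (Ci * z)%C 1 even_rapid_Phi0 Rlt_0_1) as [K1 HK1].
  destruct (even_rapid_Cdecay (PN N) (Ci * z)%C 1 (even_rapid_PN N) Rlt_0_1) as [K2 HK2].
  unfold X, T.
  replace (2 * CI (fun u : R => Phi0 u * Cexp (Ci * z * u)) - 2 * CI (fun u : R => PN N u * Cexp (Ci * z * u)))%C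
    with (2 * (CI (fun u : R => Phi0 u * Cexp (Ci * z * u)) - CI (fun u : R => PN N u * Cexp (Ci * z * u))))%C by ring.
  rewrite <- (CI_minus 1 K1 K2) by (auto; lra).
  rewrite (CI_ext _ (fun u => RtoC (Phi0 u - PN N u) * Cexp (Ci * z * RtoC u))%C).
  2: { intros u. rewrite RtoC_minus. ring. }
  assert (W : Cdecay 1 (C0 * tail inv_sq N) (fun u => RtoC (Phi0 u - PN N u) * Cexp (Ci * z * RtoC u))%C).
  { apply Cdecay_RtoC_exp with (Rad + 1); [|apply H|lra].
    intros u. apply (continuous_minus Phi0 (PN N)); [apply even_rapid_Phi0|apply even_rapid_PN]. }
  assert (Bd := CI_bound 1 _ _ Rlt_0_1 W).
  rewrite Cmod_mult, Cmod_R, Rabs_pos_eq by lra. unfold Rdiv in Bd. rewrite Rinv_1 in Bd. lra.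
Qed.

(** Bridge from the half-line integrals of the definitions to integrals over the line; [g] is
    constrained only where it is integrated. *)
Lemma half_line_integral c K f g : 0 < c -> Cdecay c K f -> (forall u, f (- u) = f u) ->
  (forall u, 0 <= u -> g u = f u) ->
  (2 * CInt g (at_point 0) (Rbar_locally p_infty))%C = CI f.
Proof.
  intros Hc Hf He Hg.
  assert (E : CInt g (at_point 0) (Rbar_locally p_infty) = (RtoC (/ 2) * CI f)%C).
  { unfold CInt. apply (is_RInt_gen_unique (V := C_R_CompleteNormedModule)).
    apply (is_RInt_gen_ext (V := C_R_NormedModule) f).
    { apply (Filter_prod _ _ _ (fun a => a = 0) (fun b => 0 < b)).
      - reflexivity.
      - exists 0; auto.
      - intros a b -> Hb x Hx. simpl in Hx. rewrite Rmin_left in Hx by lra. symmetry. apply Hg. lra. }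
    assert (L : filterlim (fun ab : R * R => (- snd ab, snd ab)) (filter_prod (at_point 0) (Rbar_locally p_infty)) line).
    { apply (filterlim_pair (fun ab : R * R => - snd ab) (fun ab : R * R => snd ab)); [|apply filterlim_snd].
      apply (filterlim_comp _ _ _ snd Ropp _ (Rbar_locally p_infty)); [apply filterlim_snd|].
      apply (filterlim_Rbar_opp p_infty). }
    assert (A1 := filterlim_comp _ _ _ _ _ _ _ _ L (Int_correct _ _ _ Hc (Cdecay_re _ _ _ Hf))).
    assert (A2 := filterlim_comp _ _ _ _ _ _ _ _ L (Int_correct _ _ _ Hc (Cdecay_im _ _ _ Hf))).
    intros P [eps HP].
    assert (B1 := proj1 (filterlim_locally _ _) A1 eps). assert (B2 := proj1 (filterlim_locally _ _) A2 eps).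
    assert (B3 : filter_prod (at_point 0) (Rbar_locally p_infty) (fun ab => fst ab = 0 /\ 0 < snd ab)).
    { apply (Filter_prod _ _ _ (fun a => a = 0) (fun b => 0 < b)).
      - reflexivity.
      - exists 0; auto.
      - intros; auto. }
    unfold filtermapi.
    generalize (filter_and _ _ B3 (filter_and _ _ B1 B2)). apply filter_imp.
    intros [a b] [[Ha Hb] [C1 C2]]; simpl in Ha, Hb, C1, C2 |- *. subst a.
    assert (Half : forall h, Rdecay c K h -> (forall u, h (- u) = h u) -> RInt h (- b) b = 2 * RInt h 0 b).
    { intros h Hh Hh'.
      rewrite <- (RInt_Chasles (V := R_CompleteNormedModule) h (- b) 0 b) by (apply (Rdecay_ex_RInt c K); auto).
      rewrite (RInt_reflect c K h (- b) 0) by auto. rewrite Ropp_0, Ropp_involutive.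
      rewrite (RInt_ext (fun u => h (- u)) h) by (intros; auto). unfold plus; simpl. ring. }
    rewrite (Half (fun t => Re (f t))) in C1; [|apply Cdecay_re; auto|intros; rewrite He; auto].
    rewrite (Half (fun t => Im (f t))) in C2; [|apply Cdecay_im; auto|intros; rewrite He; auto].
    exists (CR f 0 b). split.
    - apply (is_RInt_fct_extend_pair (U := R_NormedModule) (V := R_NormedModule)).
      + apply (RInt_correct (V := R_CompleteNormedModule) (fun t => Re (f t))), (Rdecay_ex_RInt c K), Cdecay_re; auto.
      + apply (RInt_correct (V := R_CompleteNormedModule) (fun t => Im (f t))), (Rdecay_ex_RInt c K), Cdecay_im; auto.
    - apply HP. split; simpl.
      + change (Rabs (2 * RInt (fun t => Re (f t)) 0 b - Int (fun t => Re (f t))) < eps) in C1.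
        change (Rabs (RInt (fun t => Re (f t)) 0 b - (/ 2 * Int (fun t => Re (f t)) - 0 * Int (fun t => Im (f t)))) < eps).
        assert (Pe := cond_pos eps). apply Rabs_def2 in C1. apply Rabs_def1; lra.
      + change (Rabs (2 * RInt (fun t => Im (f t)) 0 b - Int (fun t => Im (f t))) < eps) in C2.
        change (Rabs (RInt (fun t => Im (f t)) 0 b - (/ 2 * Int (fun t => Im (f t)) + 0 * Int (fun t => Re (f t)))) < eps).
        assert (Pe := cond_pos eps). apply Rabs_def2 in C2. apply Rabs_def1; lra. }
  rewrite E, RtoC_inv by (apply Rgt_not_eq; lra). field. 
Qed.

(* The even extension of the integrand of hyp_gamma. *)
Definition hker (a b u : R) : R := exp (2 * b * Rabs u - a * exp (2 * Rabs u)).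

Lemma even_rapid_hker a b : 0 < a -> even_rapid (hker a b).
Proof.
  intros Ha. split; [|split].
  - intros u. apply (continuous_comp' Rabs (fun x => exp (2 * b * x - a * exp (2 * x)))); [apply continuous_Rabs|].
    apply (continuous_of_derivable _ (Derive (fun x => exp (2 * b * x - a * exp (2 * x))))).
    intros x. apply Derive_correct. auto_derive; auto.
  - intros u. unfold hker. rewrite Rabs_Ropp. auto.
  - intros B HB. destruct (nat_above (Rabs (2 * b) + B)) as [N HN].
    exists (INR (fact N) / a ^ N). intros u. unfold hker. set (x := Rabs u). assert (Hx : 0 <= x) by apply Rabs_pos.
    rewrite Rabs_pos_eq by (left; apply exp_pos).
    unfold Rminus. rewrite exp_plus.
    assert (E := exp_neg_le_pow N (a * exp (2 * x)) ltac:(apply Rmult_lt_0_compat; auto using exp_pos)).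
    rewrite Rpow_mult_distr, exp_pow_INR in E.
    assert (P1 : 0 < a ^ N) by (apply pow_lt; auto). assert (P2 := exp_pos (INR N * (2 * x))).
    assert (P3 := INR_fact_lt_0 N). assert (P4 := exp_pos (2 * b * x)).
    apply Rle_trans with (exp (2 * b * x) * (INR (fact N) / (a ^ N * exp (INR N * (2 * x))))).
    { apply Rmult_le_compat_l; lra. }
    replace (exp (2 * b * x) * (INR (fact N) / (a ^ N * exp (INR N * (2 * x)))))
      with (INR (fact N) / a ^ N * (exp (2 * b * x) * exp (- (INR N * (2 * x))))) by (rewrite exp_Ropp; field; lra).
    apply Rmult_le_compat_l; [apply Rdiv_le_0_compat; lra|]. rewrite <- exp_plus. apply exp_le.
    assert (2 * b <= Rabs (2 * b)) by apply Rle_abs. assert (0 <= Rabs (2 * b)) by apply Rabs_pos. nra.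
Qed.

(** The cosine is the mean of e^(izu) and e^(-izu), whose integrals against an even function
    agree. *)
Lemma hyp_gamma_T z a b : 0 < a -> hyp_gamma (z / 2) a b = T (hker a b) z.
Proof.
  intros Ha. assert (Hp := even_rapid_hker a b Ha).
  destruct (even_rapid_Cdecay _ (Ci * z)%C 1 Hp Rlt_0_1) as [K HK].
  destruct (even_rapid_Cdecay _ (Ci * - z)%C 1 Hp Rlt_0_1) as [K' HK'].
  set (f1 := fun u => (RtoC (hker a b u) * Cexp (Ci * z * RtoC u))%C) in *.
  set (f2 := fun u => (RtoC (hker a b u) * Cexp (Ci * - z * RtoC u))%C) in *.
  set (f := fun u => (RtoC (/ 2) * (f1 u + f2 u))%C).
  assert (Wf : Cdecay 1 (Cmod (/ 2) * (K + K')) f).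
  { rewrite <- RtoC_inv by (apply Rgt_not_eq; lra). apply Cdecay_scal, Cdecay_plus; auto. }
  assert (E := half_line_integral 1 _ f (fun u => Ccos (2 * (z / 2) * u) * exp (2 * b * u - a * exp (2 * u)))%C Rlt_0_1 Wf).
  assert (Two : RtoC 2 <> 0%C).
  { intros Q. apply (f_equal Re) in Q. simpl in Q. lra. }
  assert (E2 : CI f = CI f1).
  { unfold f. rewrite (CI_scal 1 (K + K')), (CI_plus 1 K K'); auto using Cdecay_plus, Rlt_0_1.
    assert (Ev : CI f2 = CI f1).
    { generalize (T_even _ z Hp). unfold T. fold f1 f2. intros Q.
      replace (CI f2) with (/ 2 * (2 * CI f2))%C by (field; auto). rewrite Q. field; auto. }
    rewrite Ev, RtoC_inv by (apply Rgt_not_eq; lra). field; auto. }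
  rewrite E2 in E. unfold hyp_gamma, T. fold f1. rewrite <- E.
  - replace (RtoC 4) with (RtoC 2 * RtoC 2)%C by (rewrite <- RtoC_mult; f_equal; lra). ring.
  - intros u. unfold f, f1, f2. rewrite (proj1 (proj2 Hp)), RtoC_opp. 
    replace (Ci * z * - u)%C with (Ci * - z * u)%C by ring. replace (Ci * - z * - u)%C with (Ci * z * u)%C by ring. ring.
  - intros u Hu. unfold f, f1, f2, Ccos, hker. rewrite (Rabs_pos_eq u) by auto.
    replace (2 * (z / 2) * u)%C with (z * u)%C by (field; auto).
    replace (- (Ci * (z * u)))%C with (Ci * - z * u)%C by ring. replace (Ci * (z * u))%C with (Ci * z * u)%C by ring.
    rewrite RtoC_inv by (apply Rgt_not_eq; lra). field; auto.
Qed.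

Lemma T_lin p q x y z : even_rapid p -> even_rapid q -> T (fun u => x * p u + y * q u) z = (RtoC x * T p z + RtoC y * T q z)%C.
Proof.
  intros Hp Hq. unfold T.
  destruct (even_rapid_Cdecay p (Ci * z)%C 1 Hp Rlt_0_1) as [K1 HK1].
  destruct (even_rapid_Cdecay q (Ci * z)%C 1 Hq Rlt_0_1) as [K2 HK2].
  rewrite (CI_ext _ (fun u => RtoC x * (RtoC (p u) * Cexp (Ci * z * RtoC u)) + RtoC y * (RtoC (q u) * Cexp (Ci * z * RtoC u)))%C).
  2: { intros u. rewrite RtoC_plus, !RtoC_mult. ring. }
  rewrite (CI_plus 1 (Cmod x * K1) (Cmod y * K2)); auto using Cdecay_scal, Rlt_0_1.
  rewrite (CI_scal 1 K1), (CI_scal 1 K2); auto using Rlt_0_1. ring.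
Qed.

Lemma T_ext p q z : (forall u, p u = q u) -> T p z = T q z.
Proof. intros H. unfold T. f_equal. apply CI_ext. intros; rewrite H; auto. Qed.

Lemma even_rapid_kerA k : even_rapid (kerA k).
Proof.
  split; [apply continuous_kerA|split].
  - intros u. unfold kerA. rewrite Rabs_Ropp. auto.
  - intros B HB. destruct (kerA_bound B HB) as [C0 [_ H]]. exists (C0 * inv_sq k). auto.
Qed.

Lemma Phi_T k z : Phi (S k) z = T (kerA k) z.
Proof.
  unfold Phi. set (r := INR (S k)).
  assert (Hr : 0 < r) by (apply lt_0_INR; lia). assert (HPI := PI_RGT_0).
  assert (Ha : 0 < r ^ 2 * PI) by (apply Rmult_lt_0_compat; auto; apply pow_lt; auto).
  rewrite !hyp_gamma_T by auto.
  transitivity (T (fun u => (2 * PI ^ 2 * r ^ 4) * hker (r ^ 2 * PI) (9 / 4) u + (- (3 * PI * r ^ 2)) * hker (r ^ 2 * PI) (5 / 4) u) z).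
  - rewrite T_lin by (apply even_rapid_hker; auto). rewrite (RtoC_opp (3 * PI * r ^ 2)). ring.
  - apply T_ext. intros u. unfold kerA, ker, hker. fold r. unfold Rminus. rewrite !exp_plus.
    replace (2 * (9 / 4) * Rabs u) with (9 / 2 * Rabs u) by field.
    replace (2 * (5 / 4) * Rabs u) with (5 / 2 * Rabs u) by field.
    replace (PI * r ^ 2 * exp (2 * Rabs u)) with (r ^ 2 * PI * exp (2 * Rabs u)) by ring. ring.
Qed.

Lemma Xi_N_T N z : (1 <= N)%nat -> Xi_N N z = T (PN N) z.
Proof.
  intros HN. unfold Xi_N. induction HN as [|N HN IH].
  - rewrite sum_n_n, Phi_T. apply T_ext. intros u. unfold PN. simpl. ring.
  - rewrite sum_n_Sm by lia. rewrite IH, Phi_T.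
    change (T (PN N) z + T (kerA N) z = T (PN (S N)) z)%C.
    transitivity (T (fun u => 1 * PN N u + 1 * kerA N u) z).
    + rewrite T_lin by (apply even_rapid_PN || apply even_rapid_kerA). ring.
    + apply T_ext. intros u. unfold PN. simpl. ring.
Qed.

(** Comparison with the telescoping differences of x^(-q), q = p - 1. The mean value point is at
    most 2 (k + 1), whence the factor 2^p. *)
Lemma ex_series_zeta p : 1 < p -> ex_series (fun k => exp (- p * ln (INR (S k)))).
Proof.
  intros Hp. set (q := p - 1). assert (Hq : 0 < q) by (unfold q; lra).
  set (f := fun x => exp (- q * ln x)).
  assert (Tel : ex_series (fun k => f (INR k + 1) - f (INR k + 2))).
  { exists 1. apply (is_lim_seq_ext (fun n => 1 - f (INR n + 2)) _ (Finite 1)).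
    - intros n. induction n as [|n IH].
      + rewrite sum_O. simpl. rewrite Rplus_0_l. f_equal. unfold f. rewrite Rplus_0_l, ln_1, Rmult_0_r, exp_0. auto.
      + rewrite sum_Sn, <- IH. rewrite S_INR.
        change (1 - f (INR n + 1 + 2) = (1 - f (INR n + 2)) + (f (INR n + 1 + 1) - f (INR n + 1 + 2))).
        replace (INR n + 1 + 1) with (INR n + 2) by ring. ring.
    - replace (Finite 1) with (Finite (1 - 0)) by (f_equal; ring).
      apply is_lim_seq_minus'; [apply is_lim_seq_const|].
      apply (filterlim_comp _ _ _ (fun n => INR n + 2) f eventually (Rbar_locally p_infty)).
      + apply (is_lim_seq_ext (fun q => 1 * INR q + 2) _ p_infty); [intros; ring|]. apply is_lim_seq_aff. lra.
      + intros P [eps HP]. destruct (exp_decay_small q 1 eps Hq ltac:(lra) (cond_pos eps)) as [M [HM0 HM]].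
        exists (exp M). intros x Hx. apply HP.
        assert (M < ln x). { rewrite <- (ln_exp M). apply ln_increasing; auto. apply exp_pos. }
        change (Rabs (f x - 0) < eps). rewrite Rminus_0_r, Rabs_pos_eq by (left; apply exp_pos).
        generalize (HM (ln x) ltac:(lra)). unfold f. lra. }
  apply (ex_series_le (V := R_CompleteNormedModule) _ (fun k => (exp (p * ln 2) / q) * (f (INR k + 1) - f (INR k + 2)))).
  2: { apply (ex_series_scal (V := R_NormedModule)); auto. }
  intros k. change (Rabs (exp (- p * ln (INR (S k)))) <= (exp (p * ln 2) / q) * (f (INR k + 1) - f (INR k + 2))).
  rewrite Rabs_pos_eq by (left; apply exp_pos). assert (Pk := pos_INR k).
  destruct (MVT_gen f (INR k + 1) (INR k + 2) (fun x => - q / x * exp (- q * ln x))) as [c [Hc E]].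
  - intros x Hx. rewrite Rmin_left in Hx by lra. unfold f. auto_derive; [lra|]. field. lra.
  - intros x Hx. rewrite Rmin_left in Hx by lra.
    apply (is_derive_cont f x (- q / x * exp (- q * ln x))). unfold f. auto_derive; [lra|]. field. lra.
  - rewrite Rmin_left, Rmax_right in Hc by lra.
    replace (f (INR k + 1) - f (INR k + 2)) with (- (f (INR k + 2) - f (INR k + 1))) by ring. rewrite E.
    replace (INR k + 2 - (INR k + 1)) with 1 by ring.
    assert (Ec : exp (- q * ln c) / c = exp (- p * ln c)).
    { replace (- p * ln c) with (- q * ln c + - ln c) by (unfold q; ring).
      rewrite exp_plus, exp_Ropp, exp_ln by lra. auto. }
    replace (exp (p * ln 2) / q * - (- q / c * exp (- q * ln c) * 1)) with (exp (p * ln 2) * (exp (- q * ln c) / c)) by (field; lra).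
    rewrite Ec, <- exp_plus. apply exp_le. rewrite S_INR.
    assert (L : ln c <= ln 2 + ln (INR k + 1)).
    { rewrite <- ln_mult by lra. apply Rcomplements.ln_le; lra. }
    nra.
Qed.

(** The integrand of the summand r = 1 in the variable s = 1/2 + iz; all other summands are
    translates of it. *)
Definition hs (s : C) (v : R) : C := (RtoC (ker 1 v) * Cexp ((s - RtoC (/ 2)) * RtoC v))%C.

Lemma Cdecay_dilate c K k f : 0 < k -> Cdecay c K f -> Cdecay (c * k) K (fun u => f (k * u)).
Proof.
  intros Hk [A B]. split.
  - intros u. destruct (A (k * u)) as [A1 A2].
    assert (Ck : continuous (fun u => k * u) u).
    { apply (continuous_of_derivable _ (fun _ => k)). intros; auto_derive; auto; ring. }
    split.
    + apply (continuous_comp' (fun u => k * u) (fun t => Re (f t))); auto.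
    + apply (continuous_comp' (fun u => k * u) (fun t => Im (f t))); auto.
  - intros u. eapply Rle_trans; [apply B|]. right. rewrite Rabs_mult, (Rabs_pos_eq k) by lra.
    do 2 f_equal. ring.
Qed.

Lemma C2_neq_0 : RtoC 2 <> 0%C.
Proof. intros Q. apply (f_equal Re) in Q. simpl in Q. lra. Qed.

Lemma hs_gker s v : hs s v = (RtoC (2 * PI ^ 2) * gker PI (s / 2 + 2) (2 * v) - RtoC (3 * PI) * gker PI (s / 2 + 1) (2 * v))%C.
Proof.
  unfold hs, gker, ker. rewrite !pow1, !Rmult_1_r. rewrite RtoC_mult, RtoC_minus, !RtoC_mult.
  replace (- PI * exp (2 * v)) with (- (PI * exp (2 * v))) by ring.
  rewrite <- !(Cexp_R (9 / 2 * v)), <- !(Cexp_R (5 / 2 * v)).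
  replace ((s / 2 + 2) * (2 * v))%C with ((9 / 2 * v)%R + (s - (/ 2)%R) * v)%C.
  2: { rewrite !RtoC_mult, RtoC_div, RtoC_inv by (apply Rgt_not_eq; lra).
       replace (RtoC 9) with (4 * 2 + 1)%C by (rewrite <- RtoC_mult, <- RtoC_plus; f_equal; ring).
       replace (RtoC 4) with (2 * 2)%C by (rewrite <- RtoC_mult; f_equal; ring). field. }
  replace ((s / 2 + 1) * (2 * v))%C with ((5 / 2 * v)%R + (s - (/ 2)%R) * v)%C.
  2: { rewrite !RtoC_mult, RtoC_div, RtoC_inv by (apply Rgt_not_eq; lra).
       replace (RtoC 5) with (2 * 2 + 1)%C by (rewrite <- RtoC_mult, <- RtoC_plus; f_equal; ring). field. }
  rewrite !Cexp_plus. ring.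
Qed.

Lemma Re_half s : Re (s / 2)%C = Re s / 2.
Proof. unfold Cdiv. rewrite <- RtoC_inv by (apply Rgt_not_eq; lra). unfold Re; simpl. field. Qed.

Lemma Cdecay_hs s : 0 < Re s -> exists K, Cdecay (Re s) K (hs s).
Proof.
  intros Hs.
  assert (R2 : Re (s / 2 + 2)%C = Re s / 2 + 2) by (rewrite <- Re_half; reflexivity).
  assert (R1 : Re (s / 2 + 1)%C = Re s / 2 + 1) by (rewrite <- Re_half; reflexivity).
  destruct (Cdecay_gker PI (s / 2 + 2)%C PI_RGT_0 ltac:(lra)) as [K2 H2].
  destruct (Cdecay_gker PI (s / 2 + 1)%C PI_RGT_0 ltac:(lra)) as [K1 H1].
  apply (Cdecay_dilate _ _ 2) in H2; [|lra]. apply (Cdecay_dilate _ _ 2) in H1; [|lra].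
  apply (Cdecay_weaken _ (Re s) _ K2) in H2; [|lra|lra]. apply (Cdecay_weaken _ (Re s) _ K1) in H1; [|lra|lra].
  eexists. apply (Cdecay_ext (Re s) _ (fun v => RtoC (2 * PI ^ 2) * gker PI (s / 2 + 2) (2 * v) - RtoC (3 * PI) * gker PI (s / 2 + 1) (2 * v))%C).
  - intros; symmetry; apply hs_gker.
  - apply Cdecay_minus; apply Cdecay_scal; eauto.
Qed.

(** Two Gamma integrals, at s/2 + 2 and s/2 + 1, each with a factor 1/2 from the dilation by 2. The
    recurrence brings both to Gamma(s/2), with coefficient (s/2)((s/2 + 1) - 3/2) = s(s - 1)/4. *)
Lemma CI_hs s : 0 < Re s -> CI (hs s) = (/ 4 * s * (s - 1) * (Cexp (- (s / 2) * RtoC (ln PI)) * Gam0 (s / 2)))%C.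
Proof.
  intros Hs.
  assert (R2 : Re (s / 2 + 2)%C = Re s / 2 + 2) by (rewrite <- Re_half; reflexivity).
  assert (R1 : Re (s / 2 + 1)%C = Re s / 2 + 1) by (rewrite <- Re_half; reflexivity).
  destruct (Cdecay_gker PI (s / 2 + 2)%C PI_RGT_0 ltac:(lra)) as [K2 H2].
  destruct (Cdecay_gker PI (s / 2 + 1)%C PI_RGT_0 ltac:(lra)) as [K1 H1].
  assert (D2 := CI_dilate (Re (s / 2 + 2)%C) K2 2 _ ltac:(rewrite R2; lra) ltac:(lra) H2).
  assert (D1 := CI_dilate (Re (s / 2 + 1)%C) K1 2 _ ltac:(rewrite R1; lra) ltac:(lra) H1).
  apply (Cdecay_dilate _ _ 2) in H2; [|lra]. apply (Cdecay_dilate _ _ 2) in H1; [|lra].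
  apply (Cdecay_weaken _ (Re s) _ K2) in H2; [|lra|lra]. apply (Cdecay_weaken _ (Re s) _ K1) in H1; [|lra|lra].
  rewrite (CI_ext _ _ (hs_gker s)).
  rewrite (CI_minus (Re s) (Cmod (RtoC (2 * PI ^ 2)) * K2) (Cmod (RtoC (3 * PI)) * K1)); auto using Cdecay_scal.
  rewrite (CI_scal (Re s) K2), (CI_scal (Re s) K1); auto.
  rewrite gker_integral in D2, D1; try apply PI_RGT_0; try lra.
  assert (E11 : (s / 2 + 2 = s / 2 + 1 + 1)%C) by (rewrite <- Cplus_assoc, <- RtoC_plus; do 2 f_equal; ring).
  rewrite E11 in D2, H2, R2 |- *.
  rewrite Gam0_recurrence in D2 by lra.
  rewrite Gam0_recurrence in D2, D1 by (rewrite Re_half; lra).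
  replace (- (s / 2 + 1 + 1) * RtoC (ln PI))%C with (- (s / 2) * RtoC (ln PI) + RtoC (- ln PI) + RtoC (- ln PI))%C in D2 by (rewrite RtoC_opp; ring).
  replace (- (s / 2 + 1) * RtoC (ln PI))%C with (- (s / 2) * RtoC (ln PI) + RtoC (- ln PI))%C in D1 by (rewrite RtoC_opp; ring).
  rewrite 2!Cexp_plus, Cexp_R, exp_Ropp, exp_ln in D2 by apply PI_RGT_0.
  rewrite Cexp_plus, Cexp_R, exp_Ropp, exp_ln in D1 by apply PI_RGT_0.
  assert (PN0 : RtoC PI <> 0%C). { intros Q. apply (f_equal Re) in Q. simpl in Q. generalize PI_RGT_0; lra. }
  rewrite RtoC_inv in D2, D1 by (apply PI_neq0).
  set (E := Cexp (- (s / 2) * ln PI)) in *. set (G := Gam0 (s / 2)) in *.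
  set (I2 := CI (fun u => gker PI (s / 2 + 1 + 1) (2 * u))) in *. set (I1 := CI (fun u => gker PI (s / 2 + 1) (2 * u))) in *.
  replace I2 with (/ 2 * (2 * I2))%C by field. replace I1 with (/ 2 * (2 * I1))%C by field.
  rewrite D2, D1. rewrite !RtoC_mult, RtoC_pow.
  replace (RtoC 4) with (2 * 2)%C by (rewrite <- RtoC_mult; f_equal; ring).
  replace (RtoC 3) with (2 + 1)%C by (rewrite <- RtoC_plus; f_equal; ring).
  field. auto using C2_neq_0.
Qed.

Definition XS (s : C) : C := (2 * CI (fun u => RtoC (Phi0 u) * Cexp ((s - RtoC (/ 2)) * RtoC u)))%C.

(** Because [ker 1 (u + ln r)] is r^(1/2) times [ker r u], the r-th summand contributes r^(-s) times
    the first: this is how the Dirichlet series arises. *)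
Lemma ker_scale r u s : 0 < r ->
  (RtoC (ker r u) * Cexp ((s - RtoC (/ 2)) * RtoC u) = Cexp (- s * RtoC (ln r)) * hs s (u + ln r))%C.
Proof.
  intros Hr. unfold hs.
  assert (E : ker 1 (u + ln r) = exp (/ 2 * ln r) * ker r u).
  { unfold ker.
    replace (9 / 2 * (u + ln r)) with (9 / 2 * u + / 2 * ln r + INR 4 * ln r) by (simpl; field).
    replace (5 / 2 * (u + ln r)) with (5 / 2 * u + / 2 * ln r + INR 2 * ln r) by (simpl; field).
    replace (2 * (u + ln r)) with (2 * u + INR 2 * ln r) by (simpl; ring).
    rewrite !exp_plus, <- !exp_pow_INR, !exp_ln by auto.
    replace (PI * 1 ^ 2 * (exp (2 * u) * r ^ 2)) with (PI * r ^ 2 * exp (2 * u)) by ring. ring. }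
  rewrite E, RtoC_mult, RtoC_plus, Cmult_plus_distr_l, Cexp_plus, <- (Cexp_R (/ 2 * ln r)), RtoC_mult.
  transitivity ((Cexp (- s * ln r) * Cexp ((/ 2)%R * ln r) * Cexp ((s - (/ 2)%R) * ln r)) * (ker r u * Cexp ((s - (/ 2)%R) * u)))%C; [|ring].
  rewrite <- !Cexp_plus.
  replace (- s * ln r + (/ 2)%R * ln r + (s - (/ 2)%R) * ln r)%C with (RtoC 0) by ring. rewrite Cexp_0. ring.
Qed.

Definition dirichlet (s : C) : C := CSeries (fun n => rcpow (INR (S n)) (- s)%C).

Lemma dirichlet_Cser s : 1 < Re s -> Cser (fun k => Cexp (- s * RtoC (ln (INR (S k))))) (dirichlet s).
Proof.
  intros Hs.
  destruct (Cser_ex (fun k => Cexp (- s * RtoC (ln (INR (S k))))) (fun k => exp (- Re s * ln (INR (S k))))) as [l Hl].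
  - intros k. rewrite Cmod_Cexp. right. f_equal. unfold Re; simpl. ring.
  - apply ex_series_zeta; auto.
  - replace (dirichlet s) with l; auto.
    apply Cser_components in Hl. destruct Hl as [H1 H2].
    apply Ceq; simpl; symmetry; apply is_series_unique; [exact H1|exact H2].
Qed.

Lemma XS_dirichlet s : 1 < Re s ->
  XS s = (/ 2 * s * (s - 1) * (Cexp (- (s / 2) * RtoC (ln PI)) * Gam0 (s / 2)) * dirichlet s)%C.
Proof.
  intros Hs. destruct (Cdecay_hs s ltac:(lra)) as [K HK].
  assert (HK0 := Cdecay_K_pos _ _ _ HK).
  (* Translation by ln r costs r^c in the decay constant; this rate leaves r^(-(Re s + 1)/2), which
     is still summable. *)
  set (c := (Re s - 1) / 2). assert (Hc : 0 < c) by (unfold c; lra).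
  assert (HKc : Cdecay c K (hs s)) by (apply (Cdecay_weaken (Re s) c K K); auto; unfold c; lra).
  assert (Hshift : forall v, Cdecay c (K * exp (c * Rabs v)) (fun u => hs s (u + v))).
  { intros v. destruct HKc as [A B]. split.
    - intros u. destruct (A (u + v)) as [A1 A2].
      assert (Ck : continuous (fun u => u + v) u).
      { apply (continuous_of_derivable _ (fun _ => 1)). intros; auto_derive; auto; ring. }
      split; [apply (continuous_comp' (fun u => u + v) (fun t => Re (hs s t)))|apply (continuous_comp' (fun u => u + v) (fun t => Im (hs s t)))]; auto.
    - intros u. eapply Rle_trans; [apply B|]. rewrite Rmult_assoc, <- exp_plus. apply Rmult_le_compat_l; auto.
      apply exp_le. assert (Q := Rabs_triang (u + v) (- v)). replace (u + v + - v) with u in Q by ring. rewrite Rabs_Ropp in Q. nra. }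
  destruct (CI_series c (fun k => K * exp (- ((Re s + 1) / 2) * ln (INR (S k))))
    (fun k u => RtoC (ker (INR (S k)) u) * Cexp ((s - RtoC (/ 2)) * RtoC u))%C
    (fun u => RtoC (Phi0 u) * Cexp ((s - RtoC (/ 2)) * RtoC u))%C) as [_ H2]; auto.
  - intros k. set (r := INR (S k)).
    assert (Hr : 1 <= r) by (unfold r; rewrite S_INR; generalize (pos_INR k); lra).
    assert (Hln : 0 <= ln r) by (rewrite <- ln_1; apply Rcomplements.ln_le; lra).
    apply (Cdecay_ext c _ (fun u => Cexp (- s * RtoC (ln r)) * hs s (u + ln r))%C).
    + intros u. symmetry. apply ker_scale. lra.
    + eapply Cdecay_weaken; [apply Rle_refl| |apply Cdecay_scal, Hshift].
      rewrite Cmod_Cexp, Rabs_pos_eq by auto.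
      replace (Re (- s * RtoC (ln r))) with (- Re s * ln r) by (unfold Re; simpl; ring).
      rewrite (Rmult_comm K), <- Rmult_assoc, <- exp_plus. rewrite Rmult_comm. right. do 2 f_equal. unfold c. field.
  - apply (ex_series_scal (V := R_NormedModule)). apply ex_series_zeta. lra.
  - intros u. 
    apply (Cser_ext (fun k => Cexp ((s - RtoC (/ 2)) * RtoC u) * RtoC (ker (INR (S k)) u))%C); [intros; ring|].
    rewrite (Cmult_comm (RtoC (Phi0 u))). apply Cser_scal. apply Cser_components. split; simpl.
    + apply Series_correct. apply ex_series_of_abs, ker_summable.
    + apply (is_lim_seq_ext (fun _ => 0) _ (Finite 0)); [|apply is_lim_seq_const].
      intros n. induction n as [|n IH]; [rewrite sum_O; auto|]. rewrite sum_Sn, <- IH. unfold plus; simpl. ring.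
  - assert (H3 : Cser (fun k => CI (hs s) * Cexp (- s * RtoC (ln (INR (S k)))))%C (CI (hs s) * dirichlet s)%C).
    { apply Cser_scal, dirichlet_Cser; auto. }
    assert (H4 : CI (fun u => RtoC (Phi0 u) * Cexp ((s - RtoC (/ 2)) * RtoC u))%C = (CI (hs s) * dirichlet s)%C).
    { apply (Cser_unique _ _ _ H2). revert H3. apply Cser_ext. intros k. set (r := INR (S k)).
      assert (Hr : 1 <= r) by (unfold r; rewrite S_INR; generalize (pos_INR k); lra).
      rewrite (CI_ext (fun u => RtoC (ker r u) * Cexp ((s - RtoC (/ 2)) * RtoC u))%C (fun u => Cexp (- s * RtoC (ln r)) * hs s (u + ln r))%C).
      - rewrite (CI_scal c (K * exp (c * Rabs (ln r)))); auto. rewrite (CI_shift c K); auto. ring.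
      - intros u. apply ker_scale. lra. }
    unfold XS. rewrite H4, CI_hs by lra.
    replace (RtoC 4) with (2 * 2)%C by (rewrite <- RtoC_mult; f_equal; ring). field.
Qed.

Lemma analytic_XS s : analytic XS s.
Proof.
  apply analytic_mult; [apply analytic_const|].
  apply (analytic_ext (fun w => CI (fun u => RtoC (Phi0 u) * Cexp ((1 * w + - RtoC (/ 2)) * RtoC u))%C)).
  - intros w. rewrite Cmult_1_l. auto.
  - apply (analytic_aff (fun s => CI (fun u => RtoC (Phi0 u) * Cexp (s * RtoC u))%C) 1 (- RtoC (/ 2))).
    destruct (even_rapid_Cdecay Phi0 (1 * s + - RtoC (/ 2))%C 1 even_rapid_Phi0 Rlt_0_1) as [K HK].
    apply (analytic_laplace 1 K (fun u => RtoC (Phi0 u))); auto; lra.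
Qed.

Lemma XS_X z : XS (/ 2 + Ci * z) = X z.
Proof.
  unfold XS, X, T. f_equal. apply CI_ext. intros u. rewrite RtoC_inv by (apply Rgt_not_eq; lra). do 3 f_equal. ring.
Qed.

Lemma RGam_recurrence w : RGam w = (w * RGam (w + 1))%C.
Proof.
  assert (S1 := steps_spec (w + 1)). change (Re (w + 1)%C) with (Re w + 1) in S1.
  set (m := steps (w + 1)) in *.
  rewrite (RGam_eq w (S m)) by (rewrite S_INR; lra).
  rewrite (RGam_eq (w + 1) m) by (change (Re (w + 1)%C) with (Re w + 1); lra).
  change (S m) with (1 + m)%nat. rewrite rise_add, plus_INR, RtoC_plus. simpl rise. simpl (INR 0). simpl (INR 1).
  rewrite Cplus_assoc. unfold Cdiv. rewrite Cplus_0_r. ring.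
Qed.

(* Xi = s(s-1)/2 pi^(-s/2) Gamma(s/2) zeta(s) solved for zeta, with s/2 Gamma(s/2) = Gamma(s/2 + 1). *)
Definition zeta_ext (s : C) : C := (XS s * (RGam (s / 2 + 1) * (Cexp (s / 2 * RtoC (ln PI)) * / (s - 1))))%C.

Lemma analytic_half (f : C -> C) (b : C) s : analytic f (s / 2 + b)%C -> analytic (fun w => f (w / 2 + b)%C) s.
Proof.
  intros H. apply (analytic_ext (fun w => f (/ 2 * w + b)%C)).
  - intros w. f_equal. unfold Cdiv. ring.
  - apply analytic_aff. replace (/ 2 * s + b)%C with (s / 2 + b)%C by (unfold Cdiv; ring). auto.
Qed.

Lemma analytic_zeta_ext (s : C) : s <> 1%C -> analytic zeta_ext s.
Proof.
  intros Hs. apply analytic_mult; [apply analytic_XS|]. apply analytic_mult; [|apply analytic_mult].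
  - apply analytic_half, analytic_RGam.
  - apply (analytic_ext (fun w => Cexp (/ 2 * RtoC (ln PI) * w + 0))); [intros w; f_equal; unfold Cdiv; ring|].
    apply analytic_aff, analytic_Cexp.
  - apply (analytic_inv (fun w => w - 1)%C).
    + apply analytic_minus; [apply analytic_id|apply analytic_const].
    + intros E. apply Hs. apply Cminus_eq; auto.
Qed.

Lemma zeta_ext_dirichlet s : 1 < Re s -> zeta_ext s = dirichlet s.
Proof.
  intros Hs. unfold zeta_ext. rewrite XS_dirichlet by auto.
  assert (H2 : 0 < Re (s / 2)%C) by (rewrite Re_half; lra).
  assert (Hn : Gam0 (s / 2) <> 0%C) by (apply Gam0_nonzero; auto).
  assert (Hd : Gamma_dom (s / 2)%C).
  { intros n En. rewrite En in H2. simpl in H2. generalize (pos_INR n). lra. }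
  assert (G := Gam_RGam _ Hd). rewrite Gam_right, RGam_recurrence in G by auto.
  assert (N1 : (s - 1)%C <> 0%C). { intros E. apply Cminus_eq in E. rewrite E in Hs. simpl in Hs. lra. }
  assert (E1 : (Cexp (- (s / 2) * RtoC (ln PI)) * Cexp (s / 2 * RtoC (ln PI)) = 1)%C).
  { rewrite <- Cexp_plus. replace (- (s / 2) * ln PI + s / 2 * ln PI)%C with (RtoC 0) by ring. apply Cexp_0. }
  set (A := Cexp (- (s / 2) * ln PI)) in *. set (B := Cexp (s / 2 * ln PI)) in *.
  set (Q := RGam (s / 2 + 1)) in *. set (G0 := Gam0 (s / 2)) in *.
  transitivity ((A * B) * (G0 * (s / 2 * Q)) * dirichlet s)%C; [field; auto using C2_neq_0|].
  rewrite E1, G. ring.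
Qed.

(** [zeta_ext] first witnesses that a continuation exists and is then identified with the one that
    [epsilon] chose. *)
Lemma zeta_eq (s : C) : s <> 1%C -> zeta s = zeta_ext s.
Proof.
  intros Hs.
  destruct (continuation_spec (fun s => 1 < Re s) zeta_dom
    (fun s => CSeries (fun n => rcpow (INR (S n)) (- s)%C)) zeta_ext) as [A B].
  - apply analytic_zeta_ext.
  - apply zeta_ext_dirichlet.
  - fold zeta in A, B. apply Cminus_eq.
    apply (zero_right_half (fun s => zeta s - zeta_ext s)%C 1 zeta_dom); auto.
    + intros w Hw E. rewrite E in Hw. apply Hw. reflexivity.
    + intros w Hw. apply analytic_minus; auto. apply analytic_zeta_ext; auto.
    + intros w Hw. rewrite B by auto. rewrite zeta_ext_dirichlet by auto. unfold dirichlet. ring.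
Qed.

Lemma Xi_formula_X z : Gamma_dom (/ 2 * (/ 2 + Ci * z))%C -> zeta_dom (/ 2 + Ci * z)%C -> Xi_formula z = X z.
Proof.
  intros Hg Hz. unfold Xi_formula. rewrite Gamma_eq, zeta_eq by auto. rewrite <- XS_X.
  set (s := (/ 2 + Ci * z)%C) in *.
  replace (- / 2 + Ci * z)%C with (s - 1)%C.
  2: { unfold s. replace (RtoC 1) with (/ 2 + / 2)%C; [ring|]. field. }
  assert (Eh : (/ 2 * s = s / 2)%C) by (unfold Cdiv; ring). rewrite Eh in *.
  assert (G := Gam_RGam _ Hg). rewrite RGam_recurrence in G.
  assert (N1 : (s - 1)%C <> 0%C). { intros E. apply Cminus_eq in E. apply Hz; auto. }
  assert (E1 : (rcpow PI (- s / 2) * Cexp (s / 2 * RtoC (ln PI)) = 1)%C).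
  { unfold rcpow. rewrite <- Cexp_plus. replace (- s / 2 * ln PI + s / 2 * ln PI)%C with (RtoC 0) by (unfold Cdiv; ring). apply Cexp_0. }
  unfold zeta_ext.
  set (A := rcpow PI (- s / 2)) in *. set (B := Cexp (s / 2 * ln PI)) in *.
  set (Q := RGam (s / 2 + 1)) in *. set (G0 := Gam (s / 2)) in *.
  transitivity ((A * B) * (G0 * (s / 2 * Q)) * XS s)%C; [field; auto using C2_neq_0|].
  rewrite E1, G. ring.
Qed.

Theorem Xi_eq_X z : Xi z = X z.
Proof.
  destruct (continuation_spec
    (fun z => Gamma_dom (/ 2 * (/ 2 + Ci * z))%C /\ zeta_dom (/ 2 + Ci * z)%C) (fun _ => True) Xi_formula X) as [A B].
  - intros w _. apply analytic_T, even_rapid_Phi0.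
  - intros w [H1 H2]. symmetry. apply Xi_formula_X; auto.
  - fold Xi in A, B. apply Cminus_eq.
    (* Off the imaginary axis s = 1/2 + iw is nonreal, so the formula is meaningful; the axis itself
       follows by continuity. *)
    assert (H : forall w, Re w <> 0 -> (Xi w - X w = 0)%C).
    { intros w Hw.
      assert (I1 : Im (/ 2 + Ci * w)%C = Re w).
      { rewrite <- RtoC_inv by (apply Rgt_not_eq; lra). unfold Re, Im; simpl. ring. }
      assert (I2 : Im (/ 2 * (/ 2 + Ci * w))%C = Re w / 2).
      { rewrite <- RtoC_inv by (apply Rgt_not_eq; lra). unfold Re, Im; simpl. field. }
      assert (H1 : Gamma_dom (/ 2 * (/ 2 + Ci * w))%C) by (apply Gamma_dom_nonreal; rewrite I2; lra).
      assert (H2 : zeta_dom (/ 2 + Ci * w)%C).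
      { intros E. rewrite E in I1. simpl in I1. lra. }
      rewrite B by auto. rewrite Xi_formula_X by auto. ring. }
    destruct (Req_dec (Re z) 0) as [E|E]; auto.
    apply (zero_by_continuity (fun w => Xi w - X w)%C z 1%C).
    + apply analytic_minus; auto. apply analytic_T, even_rapid_Phi0.
    + apply Cmod_1.
    + intros t Ht. apply H. unfold Re in *. simpl. rewrite E. lra.
Qed.

(** * Hardy's theorem *)

(** Subdivision into N equal steps bounds the total change by C0 (b - a)^2 / N. It stands in for
    differentiation under the integral sign in [fourier_mult] and [contour_shift]. *)
Lemma quad_const (D : R -> C) C0 a b : a <= b ->
  (forall x y, a <= x -> x <= y -> y <= b -> Cmod (D y - D x) <= C0 * (y - x) ^ 2) -> D b = D a.
Proof.
  intros Hab H. apply Cminus_eq.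
  apply zero_of_small with (fun n => C0 * (b - a) ^ 2 * / INR (S n)).
  - intros n. set (N := S n). assert (HN : 0 < INR N) by (apply lt_0_INR; unfold N; lia).
    set (h := (b - a) / INR N). assert (Hh : 0 <= h) by (apply Rdiv_le_0_compat; lra).
    assert (HhN : INR N * h = b - a) by (unfold h; field; lra).
    assert (A : forall k, (k <= N)%nat -> Cmod (D (a + INR k * h) - D a) <= INR k * (C0 * h ^ 2)).
    { induction k as [|k IH]; intros Hk.
      - simpl. replace (a + 0 * h) with a by ring. replace (D a - D a)%C with (RtoC 0) by ring. rewrite Cmod_0. lra.
      - eapply Rle_trans; [apply (Cmod_tri _ (D (a + INR k * h)))|].
        assert (Hk' : INR (S k) <= INR N) by (apply le_INR; auto).
        assert (Hk2 : INR (S k) * h <= INR N * h) by (apply Rmult_le_compat_r; auto).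
        assert (Hk0 : 0 <= INR k * h) by (apply Rmult_le_pos; auto using pos_INR).
        specialize (IH ltac:(lia)). rewrite S_INR in *.
        assert (Q := H (a + INR k * h) (a + (INR k + 1) * h) ltac:(lra) ltac:(lra) ltac:(lra)).
        replace (a + (INR k + 1) * h - (a + INR k * h)) with h in Q by ring. lra. }
    specialize (A N (le_n N)). replace (a + INR N * h) with b in A by lra.
    eapply Rle_trans; [exact A|]. right. unfold h. field. lra.
  - apply is_lim_seq_scal0. apply (is_lim_seq_incr_1 (fun n => / INR n)).
    replace (Finite 0) with (Rbar_inv p_infty) by reflexivity.
    apply is_lim_seq_inv; [apply is_lim_seq_INR|discriminate].
Qed.

Lemma Ccont_ex_RInt_re f a b : Ccont f -> ex_RInt (fun t => Re (f t)) a b.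
Proof. intros H; apply (ex_RInt_continuous (V := R_CompleteNormedModule)); intros; apply H. Qed.

Lemma Ccont_ex_RInt_im f a b : Ccont f -> ex_RInt (fun t => Im (f t)) a b.
Proof. intros H; apply (ex_RInt_continuous (V := R_CompleteNormedModule)); intros; apply H. Qed.

Lemma CR_Chasles f a b c : Ccont f -> (CR f a b + CR f b c)%C = CR f a c.
Proof.
  intros Hf. apply Ceq; simpl.
  - apply (RInt_Chasles (V := R_CompleteNormedModule) (fun t => Re (f t))); apply Ccont_ex_RInt_re; auto.
  - apply (RInt_Chasles (V := R_CompleteNormedModule) (fun t => Im (f t))); apply Ccont_ex_RInt_im; auto.
Qed.

Lemma CR_minus f g a b : Ccont f -> Ccont g -> CR (fun t => f t - g t)%C a b = (CR f a b - CR g a b)%C.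
Proof.
  intros Hf Hg. apply Ceq; simpl.
  - apply (RInt_minus (V := R_CompleteNormedModule) (fun t => Re (f t)) (fun t => Re (g t))); apply Ccont_ex_RInt_re; auto.
  - apply (RInt_minus (V := R_CompleteNormedModule) (fun t => Im (f t)) (fun t => Im (g t))); apply Ccont_ex_RInt_im; auto.
Qed.

Lemma CR_const c a b : CR (fun _ => c) a b = (RtoC (b - a) * c)%C.
Proof.
  unfold CR. rewrite !RInt_const. destruct c as [x y]. apply Ceq; simpl; unfold scal; simpl; unfold mult; simpl; ring.
Qed.

Lemma CR_bound f M a b : a <= b -> Ccont f -> (forall t, a <= t <= b -> Cmod (f t) <= M) ->
  Cmod (CR f a b) <= 2 * M * (b - a).
Proof.
  intros Hab Hf HM. eapply Rle_trans; [apply Cmod_le_sum|]. simpl.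
  assert (A := abs_RInt_le_const (fun t => Re (f t)) a b M Hab (Ccont_ex_RInt_re f a b Hf)
    (fun t Ht => Rle_trans _ _ _ (re_le_Cmod _) (HM t Ht))).
  assert (B := abs_RInt_le_const (fun t => Im (f t)) a b M Hab (Ccont_ex_RInt_im f a b Hf)
    (fun t Ht => Rle_trans _ _ _ (im_le_Cmod _) (HM t Ht))). lra.
Qed.

Lemma CR_linear_error f M a b : a <= b -> Ccont f -> (forall t, a <= t <= b -> Cmod (f t - f a) <= M * (t - a)) ->
  Cmod (CR f a b - RtoC (b - a) * f a) <= 2 * M * (b - a) ^ 2.
Proof.
  intros Hab Hf HM. rewrite <- CR_const, <- CR_minus by auto using Ccont_const.
  replace (2 * M * (b - a) ^ 2) with (2 * (M * (b - a)) * (b - a)) by ring.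
  apply CR_bound; auto.
  - apply Ccont_minus; auto using Ccont_const.
  - intros t Ht. destruct (Req_dec b a) as [->|Hne].
    + replace t with a by lra. replace (f a - f a)%C with (RtoC 0) by ring. rewrite Cmod_0. lra.
    + assert (HM0 : 0 <= M).
      { specialize (HM b ltac:(lra)). generalize (Cmod_ge_0 (f b - f a)). intros.
        apply Rmult_le_reg_r with (b - a); lra. }
      eapply Rle_trans; [apply HM; auto|]. apply Rmult_le_compat_l; lra.
Qed.

Lemma Int_tail c K f x : 0 < c -> Rdecay c K f -> 0 <= x -> Rabs (Int f - RInt f (- x) x) <= 2 * K / c * exp (- c * x).
Proof.
  intros Hc Hf Hx.
  destruct (INR_unbounded x) as [N HN].
  apply (is_lim_seq_le_loc (fun n => Rabs (RInt f (- INR n) (INR n) - RInt f (- x) x)) (fun _ => 2 * K / c * exp (- c * x))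
    (Rabs (Int f - RInt f (- x) x)) (2 * K / c * exp (- c * x))).
  - exists N. intros n Hn. apply le_INR in Hn.
    assert (Hex := fun a b => Rdecay_ex_RInt c K f a b Hf).
    rewrite <- (RInt_Chasles (V := R_CompleteNormedModule) f (- INR n) (- x) (INR n)) by auto.
    rewrite <- (RInt_Chasles (V := R_CompleteNormedModule) f (- x) x (INR n)) by auto.
    unfold plus; simpl.
    replace (RInt f (- INR n) (- x) + (RInt f (- x) x + RInt f x (INR n)) - RInt f (- x) x)
      with (RInt f (- INR n) (- x) + RInt f x (INR n)) by ring.
    eapply Rle_trans; [apply Rabs_triang|].
    generalize (Rdecay_tail_l c K f (- INR n) (- x) Hc Hf ltac:(lra)) (Rdecay_tail_r c K f x (INR n) Hc Hf ltac:(lra)).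
    replace (c * - x) with (- c * x) by ring. lra.
  - apply (is_lim_seq_abs _ (Int f - RInt f (- x) x)). apply is_lim_seq_minus'; [apply (Int_seq c K); auto|apply is_lim_seq_const].
  - apply is_lim_seq_const.
Qed.

Lemma CI_tail c K f x : 0 < c -> Cdecay c K f -> 0 <= x -> Cmod (CI f - CR f (- x) x) <= 4 * K / c * exp (- c * x).
Proof.
  intros Hc Hf Hx. eapply Rle_trans; [apply Cmod_le_sum|]. 
  assert (A := Int_tail c K _ x Hc (Cdecay_re _ _ _ Hf) Hx). assert (B := Int_tail c K _ x Hc (Cdecay_im _ _ _ Hf) Hx).
  change (Re (CI f - CR f (- x) x)%C) with (Int (fun t => Re (f t)) - RInt (fun t => Re (f t)) (- x) x).
  change (Im (CI f - CR f (- x) x)%C) with (Int (fun t => Im (f t)) - RInt (fun t => Im (f t)) (- x) x). lra.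
Qed.

Lemma is_lim_seq_exp_INR c : 0 < c -> is_lim_seq (fun n => exp (- c * INR n)) 0.
Proof.
  intros Hc. apply is_lim_seq_spec. intros eps.
  destruct (exp_decay_small c 1 eps Hc ltac:(lra) (cond_pos eps)) as [M [_ HM]].
  destruct (INR_unbounded M) as [N HN]. exists N. intros n Hn.
  rewrite Rminus_0_r, Rabs_pos_eq by (left; apply exp_pos).
  apply le_INR in Hn. generalize (HM (INR n) ltac:(lra)). lra.
Qed.

Lemma Ccont_Lipschitz (f : R -> C) L : (forall x y, Cmod (f x - f y) <= L * Rabs (x - y)) -> Ccont f.
Proof.
  intros H.
  assert (HL : 0 <= L). { generalize (H 1 0) (Cmod_ge_0 (f 1 - f 0)). rewrite Rminus_0_r, Rabs_R1. lra. }
  assert (A : forall p : C -> R, (forall x y, p (x - y)%C = p x - p y) -> (forall z, Rabs (p z) <= Cmod z) ->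
    forall u, continuous (fun t => p (f t)) u).
  { intros p Hp Hp' u. apply filterlim_locally. intros eps.
    assert (Hd : 0 < eps / (L + 1)) by (apply Rdiv_lt_0_compat; [apply cond_pos|lra]).
    exists (mkposreal _ Hd). intros t Ht. change (Rabs (t - u) < eps / (L + 1)) in Ht.
    change (Rabs (p (f t) - p (f u)) < eps). rewrite <- Hp. eapply Rle_lt_trans; [apply Hp'|].
    eapply Rle_lt_trans; [apply H|].
    assert (E : (L + 1) * (eps / (L + 1)) = eps) by (field; lra).
    assert (P := Rabs_pos (t - u)). nra. }
  intros u; split.
  - apply (A Re); [reflexivity|apply re_le_Cmod].
  - apply (A Im); [reflexivity|apply im_le_Cmod].
Qed.

Definition e_it (t u : R) : C := Cexp (Ci * RtoC (t * u)).

Lemma Cmod_e_it t u : Cmod (e_it t u) = 1.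
Proof. apply Cmod_Cexp_i. Qed.

Lemma e_it_sym t u : e_it t u = e_it u t.
Proof. unfold e_it. rewrite Rmult_comm. auto. Qed.

Lemma e_it_Lipschitz t t' u : Cmod (e_it t u - e_it t' u) <= 2 * Rabs u * Rabs (t - t').
Proof.
  apply (Cderiv_bounded (fun t => e_it t u) (fun t => (Ci * RtoC u) * e_it t u)%C).
  - intros s _. unfold e_it. apply (Cderiv_Cexp (fun t => Ci * RtoC (t * u))%C). apply Cderiv_scal.
    apply Cderiv_RtoC. auto_derive; auto. ring.
  - intros s _. rewrite !Cmod_mult, Cmod_e_it, Cmod_Ci, Cmod_R. lra.
Qed.

Lemma Ccont_e_it t : Ccont (e_it t).
Proof.
  apply (Ccont_Lipschitz _ (2 * Rabs t)). intros x y. rewrite (e_it_sym t x), (e_it_sym t y). apply e_it_Lipschitz.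
Qed.

(** The Lipschitz constant of t -> e^(itu) grows like |u|; one unit of the decay rate 2 of [p] in
    [fourier_mult] absorbs it. *)
Lemma abs_exp_le (x : R) : Rabs x * exp (- 2 * Rabs x) <= exp (- (1) * Rabs x).
Proof.
  assert (P := Rabs_pos x). assert (H : Rabs x <= exp (Rabs x)) by (generalize (exp_ineq1_le (Rabs x)); lra).
  replace (- (1) * Rabs x) with (Rabs x + - 2 * Rabs x) by ring. rewrite exp_plus.
  apply Rmult_le_compat_r; auto. left; apply exp_pos.
Qed.

(* Multiplication formula for the Fourier transform.  Both sides, restricted to
   [t] in [0, x], have the same increments up to second order in the length. *)
Lemma fourier_mult (k p : R -> C) K P L : Cdecay 1 K k -> Cdecay 2 P p ->
  (forall t t', Cmod (k t - k t') <= L * Rabs (t - t')) ->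
  CI (fun t => k t * CI (fun u => p u * e_it t u))%C = CI (fun u => p u * CI (fun t => k t * e_it t u))%C.
Proof.
  intros Hk Hp HL.
  assert (HK := Cdecay_K_pos _ _ _ Hk). assert (HP := Cdecay_K_pos _ _ _ Hp).
  assert (HL0 : 0 <= L). { generalize (HL 1 0) (Cmod_ge_0 (k 1 - k 0)). rewrite Rminus_0_r, Rabs_R1. lra. }
  assert (Bk : forall t, Cmod (k t) <= K).
  { intros t. eapply Rle_trans; [apply Hk|]. rewrite <- (Rmult_1_r K) at 2. apply Rmult_le_compat_l; auto.
    apply Rle_trans with (exp 0); [apply exp_le; generalize (Rabs_pos t); lra|rewrite exp_0; lra]. }
  assert (Hp1 : Cdecay 1 P p) by (apply (Cdecay_weaken 2 1 P P); auto; lra).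
  assert (We : forall t, Cdecay 1 P (fun u => p u * e_it t u)%C).
  { intros t. split; [apply Ccont_mult; [apply Hp|apply Ccont_e_it]|]. intros u. rewrite Cmod_mult, Cmod_e_it, Rmult_1_r. apply Hp1. }
  assert (Wk : forall u, Cdecay 1 K (fun t => k t * e_it t u)%C).
  { intros u. split.
    - apply Ccont_mult; [apply Hk|]. apply (Ccont_ext (e_it u)); [intros; apply e_it_sym|apply Ccont_e_it].
    - intros t. rewrite Cmod_mult, Cmod_e_it, Rmult_1_r. apply Hk. }
  set (ph := fun t => CI (fun u => p u * e_it t u)%C).
  assert (Bph : forall t, Cmod (ph t) <= 4 * P).
  { intros t. generalize (CI_bound 1 P _ Rlt_0_1 (We t)). fold (ph t). unfold Rdiv. rewrite Rinv_1. lra. }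
  assert (Lph : forall t t', Cmod (ph t - ph t') <= 8 * P * Rabs (t - t')).
  { intros t t'. unfold ph. rewrite <- (CI_minus 1 P P); auto; [|lra].
    assert (W : Cdecay 1 (2 * P * Rabs (t - t')) (fun u => p u * e_it t u - p u * e_it t' u)%C).
    { split; [apply Ccont_minus; apply We|]. intros u.
      replace (p u * e_it t u - p u * e_it t' u)%C with (p u * (e_it t u - e_it t' u))%C by ring. rewrite Cmod_mult.
      apply Rle_trans with ((P * exp (- 2 * Rabs u)) * (2 * Rabs u * Rabs (t - t'))).
      - apply Rmult_le_compat; auto using Cmod_ge_0, e_it_Lipschitz. apply Hp.
      - replace (P * exp (- 2 * Rabs u) * (2 * Rabs u * Rabs (t - t'))) with
          (2 * P * Rabs (t - t') * (Rabs u * exp (- 2 * Rabs u))) by ring.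
        apply Rmult_le_compat_l; [|apply abs_exp_le]. generalize (Rabs_pos (t - t')). nra. }
    generalize (CI_bound 1 _ _ Rlt_0_1 W). unfold Rdiv. rewrite Rinv_1. lra. }
  assert (Ckph : Ccont (fun t => k t * ph t)%C) by (apply Ccont_mult; [apply Hk|apply (Ccont_Lipschitz _ _ Lph)]).
  assert (Wkph : Cdecay 1 (K * (4 * P)) (fun t => k t * ph t)%C).
  { split; auto. intros t. rewrite Cmod_mult.
    replace (K * (4 * P) * exp (- (1) * Rabs t)) with ((K * exp (- (1) * Rabs t)) * (4 * P)) by ring.
    apply Rmult_le_compat; auto using Cmod_ge_0. apply Hk. }
  set (I := fun x y u => CR (fun t => k t * e_it t u)%C x y).
  assert (BI : forall x y u, x <= y -> Cmod (I x y u) <= 2 * K * (y - x)).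
  { intros x y u Hxy. apply CR_bound; auto; [apply Wk|]. intros t _. rewrite Cmod_mult, Cmod_e_it, Rmult_1_r. auto. }
  assert (CIc : forall x y, x <= y -> Ccont (I x y)).
  { intros x y Hxy. apply (Ccont_Lipschitz _ (2 * (2 * K * Rmax (Rabs x) (Rabs y)) * (y - x))).
    intros u u'. unfold I. rewrite <- CR_minus by apply Wk.
    replace (2 * (2 * K * Rmax (Rabs x) (Rabs y)) * (y - x) * Rabs (u - u')) with
      (2 * (K * (2 * Rmax (Rabs x) (Rabs y) * Rabs (u - u'))) * (y - x)) by ring.
    apply CR_bound; auto; [apply Ccont_minus; apply Wk|].
    intros t Ht. replace (k t * e_it t u - k t * e_it t u')%C with (k t * (e_it t u - e_it t u'))%C by ring.
    rewrite Cmod_mult. apply Rmult_le_compat; auto using Cmod_ge_0.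
    rewrite (e_it_sym t u), (e_it_sym t u'). eapply Rle_trans; [apply e_it_Lipschitz|].
    apply Rmult_le_compat_r; [apply Rabs_pos|]. apply Rmult_le_compat_l; [lra|].
    unfold Rmax. destruct (Rle_dec (Rabs x) (Rabs y)) as [h|h]; unfold Rabs in *;
      destruct (Rcase_abs x), (Rcase_abs y), (Rcase_abs t); lra. }
  assert (WI : forall x y, x <= y -> Cdecay 1 (P * (2 * K * (y - x))) (fun u => p u * I x y u)%C).
  { intros x y Hxy. split; [apply Ccont_mult; [apply Hp|auto]|]. intros u. rewrite Cmod_mult.
    replace (P * (2 * K * (y - x)) * exp (- (1) * Rabs u)) with ((P * exp (- (1) * Rabs u)) * (2 * K * (y - x))) by ring.
    apply Rmult_le_compat; auto using Cmod_ge_0. apply Hp1. }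
  assert (Main : forall a b, a <= b -> CI (fun u => p u * I a b u)%C = CR (fun t => k t * ph t)%C a b).
  { intros a b Hab. apply Cminus_eq.
    set (D := fun y => (CI (fun u => p u * I a y u) - CR (fun t => k t * ph t) a y)%C).
    assert (D0 : D a = 0%C).
    { apply zero_of_small with (fun _ => 0); [|apply is_lim_seq_const]. intros _. unfold D.
      assert (A1 := CI_bound 1 _ _ Rlt_0_1 (WI a a (Rle_refl a))).
      assert (A2 := CR_bound _ (K * (4 * P)) a a (Rle_refl a) Ckph).
      replace (4 * (P * (2 * K * (a - a))) / 1) with 0 in A1 by field.
      replace (2 * (K * (4 * P)) * (a - a)) with 0 in A2 by ring.
      eapply Rle_trans; [apply Cmod_triangle|]. rewrite Cmod_opp.
      assert (Cmod (CR (fun t => k t * ph t)%C a a) <= 0); [|lra]. apply A2.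
      intros t _. rewrite Cmod_mult. apply Rmult_le_compat; auto using Cmod_ge_0. }
    change (D b = 0%C). rewrite <- D0.
    apply (quad_const D (4 * P * (2 * (L + 2 * K)) + 2 * (L * (4 * P) + K * (8 * P))) a b Hab).
    intros x y Hax Hxy Hyb.
    assert (E : (D y - D x = (CI (fun u => p u * (I x y u - RtoC (y - x) * (k x * e_it x u)))
       - (CR (fun t => k t * ph t) x y - RtoC (y - x) * (k x * ph x))))%C).
    { unfold D. rewrite <- (CR_Chasles _ a x y Ckph).
      assert (W1 := WI a x Hax). assert (W2 := WI x y Hxy).
      assert (W3 : Cdecay 1 (Cmod (RtoC (y - x) * k x) * P) (fun u => (RtoC (y - x) * k x) * (p u * e_it x u))%C) by (apply Cdecay_scal, We).
      rewrite (CI_ext (fun u => p u * I a y u)%C (fun u => p u * I a x u + p u * I x y u)%C).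
      2: { intros u. unfold I. rewrite <- (CR_Chasles _ a x y) by apply Wk. ring. }
      rewrite (CI_ext (fun u => p u * (I x y u - _))%C (fun u => p u * I x y u - (RtoC (y - x) * k x) * (p u * e_it x u))%C) by (intros; ring).
      rewrite (CI_plus 1 _ _ _ _ Rlt_0_1 W1 W2), (CI_minus 1 _ _ _ _ Rlt_0_1 W2 W3), (CI_scal 1 P _ _ Rlt_0_1 (We x)).
      fold (ph x). ring. }
    rewrite E. clear E. eapply Rle_trans; [apply Cmod_triangle|]. rewrite Cmod_opp.
    rewrite Rmult_plus_distr_r. apply Rplus_le_compat.
    - assert (W : Cdecay 1 (P * (2 * (L + 2 * K)) * (y - x) ^ 2) (fun u => p u * (I x y u - RtoC (y - x) * (k x * e_it x u)))%C).
      { split.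
        - apply Ccont_mult; [apply Hp|]. apply Ccont_minus; auto.
          apply Ccont_mult; [apply Ccont_const|]. apply Ccont_mult; [apply Ccont_const|apply Ccont_e_it].
        - intros u. rewrite Cmod_mult.
          assert (Eu : Cmod (I x y u - RtoC (y - x) * (k x * e_it x u)) <= 2 * (L + 2 * K * Rabs u) * (y - x) ^ 2).
          { apply (CR_linear_error (fun t => k t * e_it t u)%C); auto; [apply Wk|].
            intros t Ht. replace (k t * e_it t u - k x * e_it x u)%C with
              ((k t - k x) * e_it t u + k x * (e_it t u - e_it x u))%C by ring.
            eapply Rle_trans; [apply Cmod_triangle|]. rewrite !Cmod_mult, Cmod_e_it, Rmult_1_r.
            assert (Q1 := HL t x). assert (Q2 := e_it_Lipschitz t x u). rewrite (Rabs_pos_eq (t - x)) in Q1, Q2 by lra.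
            assert (Q3 : Cmod (k x) * Cmod (e_it t u - e_it x u) <= K * (2 * Rabs u * (t - x))).
            { apply Rmult_le_compat; auto using Cmod_ge_0. }
            lra. }
          apply Rle_trans with ((P * exp (- 2 * Rabs u)) * (2 * (L + 2 * K * Rabs u) * (y - x) ^ 2)).
          + apply Rmult_le_compat; auto using Cmod_ge_0. apply Hp.
          + replace (P * exp (- 2 * Rabs u) * (2 * (L + 2 * K * Rabs u) * (y - x) ^ 2)) with
              (P * 2 * (y - x) ^ 2 * (L * exp (- 2 * Rabs u) + 2 * K * (Rabs u * exp (- 2 * Rabs u)))) by ring.
            replace (P * (2 * (L + 2 * K)) * (y - x) ^ 2 * exp (- (1) * Rabs u)) with
              (P * 2 * (y - x) ^ 2 * (L * exp (- (1) * Rabs u) + 2 * K * exp (- (1) * Rabs u))) by ring.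
            assert (Q0 : 0 <= (y - x) ^ 2) by apply pow2_ge_0.
            apply Rmult_le_compat_l; [apply Rmult_le_pos; lra|].
            assert (Q1 : exp (- 2 * Rabs u) <= exp (- (1) * Rabs u)) by (apply exp_le; generalize (Rabs_pos u); lra).
            assert (Q2 := abs_exp_le u).
            assert (L * exp (- 2 * Rabs u) <= L * exp (- (1) * Rabs u)) by (apply Rmult_le_compat_l; auto).
            assert (2 * K * (Rabs u * exp (- 2 * Rabs u)) <= 2 * K * exp (- (1) * Rabs u)) by (apply Rmult_le_compat_l; lra). lra. }
      eapply Rle_trans; [apply (CI_bound 1 _ _ Rlt_0_1 W)|]. unfold Rdiv. rewrite Rinv_1. right; ring.
    - apply (CR_linear_error (fun t => k t * ph t)%C); auto.
      intros t Ht. replace (k t * ph t - k x * ph x)%C with ((k t - k x) * ph t + k x * (ph t - ph x))%C by ring.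
      eapply Rle_trans; [apply Cmod_triangle|]. rewrite !Cmod_mult.
      assert (Q1 := HL t x). assert (Q2 := Lph t x). rewrite (Rabs_pos_eq (t - x)) in Q1, Q2 by lra.
      assert (Cmod (k t - k x) * Cmod (ph t) <= (L * (t - x)) * (4 * P)) by (apply Rmult_le_compat; auto using Cmod_ge_0).
      assert (Cmod (k x) * Cmod (ph t - ph x) <= K * (8 * P * (t - x))) by (apply Rmult_le_compat; auto using Cmod_ge_0).
      lra. }
  set (kh := fun u => CI (fun t => k t * e_it t u)%C).
  (* Truncation to [-n, n] costs e^(-n) uniformly in u, so the identity over bounded intervals
     passes to the whole line. *)
  assert (Tk : forall n u, Cmod (kh u - I (- INR n) (INR n) u) <= 4 * K * exp (- (1) * INR n)).
  { intros n u. generalize (CI_tail 1 K _ (INR n) Rlt_0_1 (Wk u) (pos_INR n)). unfold Rdiv. rewrite Rinv_1. unfold kh, I. lra. }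
  assert (Hn : forall n, - INR n <= INR n) by (intros n; generalize (pos_INR n); lra).
  assert (Ckh : Ccont kh).
  { apply Ccont_unif with (fun n u => I (- INR n) (INR n) u) (fun n => 4 * K * exp (- (1) * INR n)); auto.
    apply is_lim_seq_scal0, is_lim_seq_exp_INR. lra. }
  assert (Bkh : forall u, Cmod (kh u) <= 4 * K).
  { intros u. generalize (CI_bound 1 K _ Rlt_0_1 (Wk u)). unfold Rdiv. rewrite Rinv_1. unfold kh. lra. }
  assert (Wpk : Cdecay 1 (P * (4 * K)) (fun u => p u * kh u)%C).
  { split; [apply Ccont_mult; [apply Hp|auto]|]. intros u. rewrite Cmod_mult.
    replace (P * (4 * K) * exp (- (1) * Rabs u)) with ((P * exp (- (1) * Rabs u)) * (4 * K)) by ring.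
    apply Rmult_le_compat; auto using Cmod_ge_0. apply Hp1. }
  apply Cminus_eq.
  apply zero_of_small with (fun n => (4 * (K * (4 * P))) * exp (- (1) * INR n) + (4 * (P * (4 * K))) * exp (- (1) * INR n)).
  - intros n.
    replace (CI (fun t => k t * CI (fun u => p u * e_it t u)) - CI (fun u => p u * CI (fun t => k t * e_it t u)))%C
      with ((CI (fun t => k t * ph t) - CR (fun t => k t * ph t) (- INR n)%R (INR n)) +
        (CI (fun u => p u * I (- INR n)%R (INR n) u) - CI (fun u => p u * kh u)))%C.
    2: { rewrite Main by auto. unfold ph, kh. ring. }
    eapply Rle_trans; [apply Cmod_triangle|]. apply Rplus_le_compat.
    + generalize (CI_tail 1 _ _ (INR n) Rlt_0_1 Wkph (pos_INR n)). unfold Rdiv. rewrite Rinv_1. lra.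
    + rewrite <- (CI_minus 1 _ _ _ _ Rlt_0_1 (WI _ _ (Hn n)) Wpk).
      assert (W : Cdecay 1 (P * (4 * K * exp (- (1) * INR n))) (fun u => p u * I (- INR n)%R (INR n) u - p u * kh u)%C).
      { split; [apply Ccont_minus; [apply (WI _ _ (Hn n))|apply Wpk]|]. intros u.
        replace (p u * I (- INR n)%R (INR n) u - p u * kh u)%C with (- (p u * (kh u - I (- INR n)%R (INR n) u)))%C by ring.
        rewrite Cmod_opp, Cmod_mult.
        replace (P * (4 * K * exp (- (1) * INR n)) * exp (- (1) * Rabs u)) with
          ((P * exp (- (1) * Rabs u)) * (4 * K * exp (- (1) * INR n))) by ring.
        apply Rmult_le_compat; auto using Cmod_ge_0. apply Hp1. }
      eapply Rle_trans; [apply (CI_bound 1 _ _ Rlt_0_1 W)|]. unfold Rdiv. rewrite Rinv_1. right; ring.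
  - apply is_lim_seq_plus0; apply is_lim_seq_scal0, is_lim_seq_exp_INR; lra.
Qed.

(** * Shifting contours in a strip *)

Definition xy (u y : R) : C := (RtoC u + Ci * RtoC y)%C.

Lemma Re_xy u y : Re (xy u y) = u.
Proof. unfold xy, Re; simpl; ring. Qed.

Lemma Im_xy u y : Im (xy u y) = y.
Proof. unfold xy, Im; simpl; ring. Qed.

Lemma Re_Cexp z : Re (Cexp z) = exp (Re z) * cos (Im z).
Proof. reflexivity. Qed.

Lemma Re_mult_R (a : R) z : Re (RtoC a * z) = a * Re z.
Proof. unfold Re; simpl; ring. Qed.

Lemma Im_mult_R (a : R) z : Im (RtoC a * z) = a * Im z.
Proof. unfold Im; simpl; ring. Qed.

(** One family of exponents for all integrands that get moved or estimated: Gaussians and damped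
    exponentials (a = 0), and kernel terms times a Gaussian (a > 0). [Q1] and [Q2] are its first two
    derivatives. *)
Definition Qexp (be : C) (a d : R) (w : C) : C := (be * w - RtoC a * Cexp (2 * w) - RtoC d * (w * w))%C.

Definition Ef (be : C) (a d : R) (w : C) : C := Cexp (Qexp be a d w).

Definition Q1 (be : C) (a d : R) (w : C) : C := (be - RtoC (2 * a) * Cexp (2 * w) - RtoC (2 * d) * w)%C.

Definition Q2 (a d : R) (w : C) : C := (- (RtoC (4 * a) * Cexp (2 * w)) - RtoC (2 * d))%C.

Lemma Cderiv_opp f u l : Cderiv f u l -> Cderiv (fun t => - f t)%C u (- l)%C.
Proof.
  intros H. apply (Cderiv_ext (fun t => (-(1)) * f t)%C); [intros; ring|].
  replace (- l)%C with ((-(1)) * l)%C by ring. apply Cderiv_scal; auto.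
Qed.

Lemma Cderiv_eq f u l l' : l = l' -> Cderiv f u l -> Cderiv f u l'.
Proof. intros ->; auto. Qed.

Lemma Cderiv_Ef be a d (w : R -> C) t l : Cderiv w t l ->
  Cderiv (fun t => Ef be a d (w t)) t (l * (Q1 be a d (w t) * Ef be a d (w t)))%C.
Proof.
  intros Hw. unfold Ef.
  eapply Cderiv_eq; [|apply (Cderiv_Cexp (fun t => Qexp be a d (w t)))].
  2: { unfold Qexp. apply Cderiv_minus; [apply Cderiv_minus|].
       - apply Cderiv_scal, Hw.
       - apply Cderiv_scal. apply (Cderiv_Cexp (fun t => 2 * w t)%C). apply Cderiv_scal, Hw.
       - apply Cderiv_scal. apply Cderiv_mult; apply Hw. }
  unfold Q1. rewrite !RtoC_mult. ring.
Qed.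

Lemma Cderiv_Ef1 be a d (w : R -> C) t l : Cderiv w t l ->
  Cderiv (fun t => Q1 be a d (w t) * Ef be a d (w t))%C t
    (l * ((Q1 be a d (w t) * Q1 be a d (w t) + Q2 a d (w t)) * Ef be a d (w t)))%C.
Proof.
  intros Hw.
  eapply Cderiv_eq; [|apply Cderiv_mult; [|apply Cderiv_Ef, Hw]].
  2: { unfold Q1. apply Cderiv_minus; [apply Cderiv_minus|].
       - apply Cderiv_const.
       - apply Cderiv_scal. apply (Cderiv_Cexp (fun t => 2 * w t)%C). apply Cderiv_scal, Hw.
       - apply Cderiv_scal, Hw. }
  unfold Q2. replace (RtoC (4 * a)) with (RtoC (2 * a) * 2)%C by (rewrite <- RtoC_mult; f_equal; ring). ring.
Qed.

Lemma Cderiv_xy_u y u : Cderiv (fun u => xy u y) u 1%C.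
Proof.
  unfold xy. eapply Cderiv_eq; [|apply Cderiv_plus; [apply Cderiv_RtoC, @is_derive_id|apply Cderiv_const]].
  apply Cplus_0_r.
Qed.

Lemma Cderiv_xy_y y u : Cderiv (fun y => xy u y) y Ci.
Proof.
  unfold xy. eapply Cderiv_eq; [|apply Cderiv_plus; [apply Cderiv_const|apply Cderiv_scal, Cderiv_RtoC, @is_derive_id]].
  unfold one; simpl. rewrite Cplus_0_l. apply Cmult_1_r.
Qed.

Lemma Cmod_xy u y : Cmod (xy u y) <= Rabs u + Rabs y.
Proof. eapply Rle_trans; [apply Cmod_le_sum|]. rewrite Re_xy, Im_xy. lra. Qed.

Lemma Re_Qexp be a d u y :
  Re (Qexp be a d (xy u y)) = Re (be * xy u y) - a * (exp (2 * u) * cos (2 * y)) - d * (u ^ 2 - y ^ 2).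
Proof.
  unfold Qexp.
  change (Re (be * xy u y) - Re (RtoC a * Cexp (2 * xy u y)) - Re (RtoC d * (xy u y * xy u y)) =
    Re (be * xy u y) - a * (exp (2 * u) * cos (2 * y)) - d * (u ^ 2 - y ^ 2)).
  rewrite !Re_mult_R, Re_Cexp, Re_mult_R, Im_mult_R, Re_xy, Im_xy.
  replace (Re (xy u y * xy u y)) with (u ^ 2 - y ^ 2) by (unfold xy, Re; simpl; ring). ring.
Qed.

(** Where a cos(2y) >= 0 the double exponential only helps, and the Gaussian e^(-d u^2) beats the
    e^(4|u|) that the derivatives bring down. *)
Lemma Ef_bounds be a d b : 0 <= a -> 0 < d -> 0 <= b ->
  exists K, 0 <= K /\ forall u y, Rabs y <= b -> 0 <= a * cos (2 * y) ->
    Cmod (Ef be a d (xy u y)) <= K * exp (- (1) * Rabs u) /\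
    Cmod (Q1 be a d (xy u y) * Ef be a d (xy u y)) <= K * exp (- (1) * Rabs u) /\
    Cmod ((Q1 be a d (xy u y) * Q1 be a d (xy u y) + Q2 a d (xy u y)) * Ef be a d (xy u y)) <= K * exp (- (1) * Rabs u).
Proof.
  intros Ha Hd Hb. assert (Hbe := Cmod_ge_0 be).
  set (m := Cmod be + 2 * a + 2 * d * (1 + b)).
  set (C1 := 1 + m + (m ^ 2 + 4 * a + 2 * d)).
  assert (Hm : 0 <= m) by (unfold m; nra). assert (HC1 : 0 < C1) by (unfold C1; generalize (pow2_ge_0 m); lra).
  (* Four units for Q1^2, one for the decay that is claimed, and |be| for the linear exponent;
     B^2/(4d) is the maximum of B x - d x^2. *)
  set (B := 5 + Cmod be).
  exists (C1 * exp (Cmod be * b + d * b ^ 2 + B ^ 2 / (4 * d))).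
  split; [apply Rmult_le_pos; [lra|left; apply exp_pos]|].
  intros u y Hy Hc. set (x := Rabs u). assert (Hx : 0 <= x) by apply Rabs_pos.
  assert (Ew : Cmod (xy u y) <= (1 + b) * exp x).
  { eapply Rle_trans; [apply Cmod_xy|]. fold x. generalize (exp_ineq1_le x). intros. nra. }
  assert (E2 : Cmod (Cexp (2 * xy u y)) <= exp (2 * x)).
  { rewrite Cmod_Cexp, Re_mult_R, Re_xy. apply exp_le. generalize (Rle_abs u). fold x. lra. }
  assert (Ex1 : 1 <= exp x) by (rewrite <- exp_0; apply exp_le; auto).
  assert (Ex2 : exp (2 * x) = exp x * exp x) by (rewrite <- exp_plus; f_equal; ring).
  assert (Ex4 : exp (4 * x) = exp (2 * x) * exp (2 * x)) by (rewrite <- exp_plus; f_equal; ring).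
  assert (Ex21 : exp x <= exp (2 * x)) by (rewrite Ex2; nra).
  assert (Ex20 : 1 <= exp (2 * x)) by lra.
  assert (Ex42 : exp (2 * x) <= exp (4 * x)) by (rewrite Ex4; nra).
  assert (BQ1 : Cmod (Q1 be a d (xy u y)) <= m * exp (2 * x)).
  { unfold Q1, m. eapply Rle_trans; [apply Cmod_triangle|]. rewrite Cmod_opp.
    eapply Rle_trans; [apply Rplus_le_compat_r, Cmod_triangle|]. rewrite Cmod_opp, !Cmod_mult, !Cmod_R.
    rewrite !Rabs_pos_eq by lra.
    assert (2 * a * Cmod (Cexp (2 * xy u y)) <= 2 * a * exp (2 * x)) by (apply Rmult_le_compat_l; lra).
    assert (2 * d * Cmod (xy u y) <= 2 * d * ((1 + b) * exp (2 * x))).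
    { apply Rmult_le_compat_l; [lra|]. eapply Rle_trans; [exact Ew|]. apply Rmult_le_compat_l; lra. }
    assert (Cmod be <= Cmod be * exp (2 * x)) by nra. nra. }
  assert (BQ2 : Cmod (Q2 a d (xy u y)) <= (4 * a + 2 * d) * exp (4 * x)).
  { unfold Q2. eapply Rle_trans; [apply Cmod_triangle|]. rewrite !Cmod_opp, Cmod_mult, !Cmod_R, !Rabs_pos_eq by lra.
    assert (4 * a * Cmod (Cexp (2 * xy u y)) <= 4 * a * exp (4 * x)) by (apply Rmult_le_compat_l; lra).
    assert (2 * d <= 2 * d * exp (4 * x)) by nra. lra. }
  assert (BE : Cmod (Ef be a d (xy u y)) <= exp (Cmod be * b + d * b ^ 2) * exp (Cmod be * x - d * x ^ 2)).
  { unfold Ef. rewrite Cmod_Cexp, Re_Qexp, <- exp_plus. apply exp_le.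
    assert (R1 : Re (be * xy u y) <= Cmod be * (x + b)).
    { eapply Rle_trans; [apply Rle_abs|]. eapply Rle_trans; [apply re_le_Cmod|]. rewrite Cmod_mult.
      apply Rmult_le_compat_l; auto. eapply Rle_trans; [apply Cmod_xy|]. fold x. lra. }
    assert (R2 : 0 <= a * (exp (2 * u) * cos (2 * y))).
    { replace (a * (exp (2 * u) * cos (2 * y))) with (exp (2 * u) * (a * cos (2 * y))) by ring.
      apply Rmult_le_pos; [left; apply exp_pos|auto]. }
    assert (R3 : u ^ 2 = x ^ 2) by (unfold x; rewrite pow2_abs; auto).
    assert (R4 : y ^ 2 <= b ^ 2). { rewrite <- (pow2_abs y). generalize (Rabs_pos y). nra. }
    rewrite R3. assert (d * y ^ 2 <= d * b ^ 2) by (apply Rmult_le_compat_l; lra). lra. }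
  assert (Key : exp (4 * x) * Cmod (Ef be a d (xy u y)) <= exp (Cmod be * b + d * b ^ 2 + B ^ 2 / (4 * d)) * exp (- (1) * x)).
  { apply Rle_trans with (exp (4 * x) * (exp (Cmod be * b + d * b ^ 2) * exp (Cmod be * x - d * x ^ 2))).
    - apply Rmult_le_compat_l; auto. left; apply exp_pos.
    - rewrite <- !exp_plus. apply exp_le.
      assert (Sq : B * x - d * x ^ 2 <= B ^ 2 / (4 * d)).
      { apply Rmult_le_reg_r with (4 * d); [lra|]. unfold Rdiv. rewrite Rmult_assoc, Rinv_l, Rmult_1_r by lra.
        generalize (pow2_ge_0 (B - 2 * d * x)). nra. }
      unfold B in *. lra. }
  assert (PE := Cmod_ge_0 (Ef be a d (xy u y))).
  assert (Gen : forall z, Cmod z <= C1 * exp (4 * x) -> Cmod (z * Ef be a d (xy u y)) <=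
     C1 * exp (Cmod be * b + d * b ^ 2 + B ^ 2 / (4 * d)) * exp (- (1) * x)).
  { intros z Hz. rewrite Cmod_mult. apply Rle_trans with (C1 * (exp (4 * x) * Cmod (Ef be a d (xy u y)))).
    - rewrite <- Rmult_assoc. apply Rmult_le_compat_r; auto.
    - rewrite (Rmult_assoc C1). apply Rmult_le_compat_l; lra. }
  assert (Pm := pow2_ge_0 m).
  split; [|split].
  - rewrite <- (Cmult_1_l (Ef be a d (xy u y))). apply Gen. rewrite Cmod_1. unfold C1. nra.
  - apply Gen. eapply Rle_trans; [exact BQ1|]. unfold C1. nra.
  - apply Gen. eapply Rle_trans; [apply Cmod_triangle|]. rewrite Cmod_mult.
    assert (Cmod (Q1 be a d (xy u y)) * Cmod (Q1 be a d (xy u y)) <= m ^ 2 * exp (4 * x)).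
    { rewrite Ex4. replace (m ^ 2 * (exp (2 * x) * exp (2 * x))) with ((m * exp (2 * x)) * (m * exp (2 * x))) by ring.
      apply Rmult_le_compat; auto using Cmod_ge_0. }
    unfold C1. nra.
Qed.

Lemma Ccont_Ef_u be a d y : Ccont (fun u => Ef be a d (xy u y)).
Proof. eapply Cderiv_cont. intros u. apply Cderiv_Ef, Cderiv_xy_u. Qed.

Lemma Ccont_Ef1_u be a d y : Ccont (fun u => Q1 be a d (xy u y) * Ef be a d (xy u y))%C.
Proof. eapply Cderiv_cont. intros u. apply Cderiv_Ef1, Cderiv_xy_u. Qed.

(** By Cauchy-Riemann the y-derivative is i times the u-derivative, whose integral over the line is
    0. The horizontal integral therefore changes only to second order in y. *)
Lemma contour_shift be a d l h : 0 <= a -> 0 < d -> l <= h -> (forall y, l <= y <= h -> 0 <= a * cos (2 * y)) ->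
  CI (fun u => Ef be a d (xy u h)) = CI (fun u => Ef be a d (xy u l)).
Proof.
  intros Ha Hd Hlh Hc.
  destruct (Ef_bounds be a d (Rmax (Rabs l) (Rabs h)) Ha Hd) as [K [HK HB]].
  { eapply Rle_trans; [apply Rabs_pos|apply Rmax_l]. }
  assert (Hy : forall y, l <= y <= h -> Rabs y <= Rmax (Rabs l) (Rabs h)).
  { intros y Hy. unfold Rmax. destruct (Rle_dec (Rabs l) (Rabs h)) as [g|g]; unfold Rabs in *;
      destruct (Rcase_abs l), (Rcase_abs y), (Rcase_abs h); lra. }
  set (F := fun y u => Ef be a d (xy u y)). set (G := fun y u => (Q1 be a d (xy u y) * F y u)%C).
  assert (WF : forall y, l <= y <= h -> Cdecay 1 K (F y)).
  { intros y Hy'. split; [apply Ccont_Ef_u|]. intros u. apply HB; auto. }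
  assert (WG : forall y, l <= y <= h -> Cdecay 1 K (G y)).
  { intros y Hy'. split; [apply Ccont_Ef1_u|]. intros u. apply HB; auto. }
  assert (G0 : forall y, l <= y <= h -> CI (G y) = 0%C).
  { intros y Hy'. apply (CI_FTC 1 K K (F y)); auto; [lra|]. intros u.
    eapply Cderiv_eq; [|apply Cderiv_Ef, Cderiv_xy_u]. unfold G, F. ring. }
  apply (quad_const (fun y => CI (F y)) (16 * K) l h Hlh).
  intros x y Hx Hxy Hyh.
  assert (W3 : Cdecay 1 (Cmod (RtoC (y - x) * Ci) * K) (fun u => (RtoC (y - x) * Ci) * G x u)%C) by (apply Cdecay_scal, WG; lra).
  assert (E : (CI (F y) - CI (F x) = CI (fun u => F y u - F x u - (RtoC (y - x) * Ci) * G x u))%C).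
  { assert (W1 := WF y ltac:(lra)). assert (W2 := WF x ltac:(lra)).
    rewrite (CI_minus 1 (K + K) _ (fun u => F y u - F x u)%C _ Rlt_0_1 (Cdecay_minus 1 K K _ _ W1 W2) W3).
    rewrite (CI_minus 1 K K _ _ Rlt_0_1 W1 W2).
    rewrite (CI_scal 1 K _ _ Rlt_0_1 (WG x ltac:(lra))), (G0 x ltac:(lra)). ring. }
  rewrite E.
  assert (W : Cdecay 1 (4 * K * (y - x) ^ 2) (fun u => F y u - F x u - (RtoC (y - x) * Ci) * G x u)%C).
  { split.
    - apply Ccont_minus; [apply Ccont_minus; apply WF; lra|apply W3].
    - intros u. set (M := K * exp (- (1) * Rabs u)).
      assert (HM : 0 <= M) by (apply Rmult_le_pos; [auto|left; apply exp_pos]).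
      assert (LG : forall s, x <= s <= y -> Cmod (G s u - G x u) <= 2 * M * (s - x)).
      { intros s Hs.
        assert (Q := Cderiv_bounded (fun s => G s u) (fun s => Ci * ((Q1 be a d (xy u s) * Q1 be a d (xy u s) + Q2 a d (xy u s)) * F s u))%C x s M).
        rewrite Rmin_left, Rmax_right, Rabs_pos_eq in Q by lra. apply Q.
        - intros t Ht. apply Cderiv_Ef1, Cderiv_xy_y.
        - intros t Ht. rewrite Cmod_mult, Cmod_Ci, Rmult_1_l. apply HB; [apply Hy|apply Hc]; lra. }
      assert (Q := Cderiv_bounded (fun s => F s u - RtoC s * (Ci * G x u))%C
        (fun s => Ci * G s u - 1 * (Ci * G x u))%C x y (2 * M * (y - x))).
      rewrite Rmin_left, Rmax_right, Rabs_pos_eq in Q by lra.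
      replace (F y u - F x u - RtoC (y - x) * Ci * G x u)%C with
        (F y u - y * (Ci * G x u) - (F x u - x * (Ci * G x u)))%C by (rewrite RtoC_minus; ring).
      replace (4 * K * (y - x) ^ 2 * exp (- (1) * Rabs u)) with (2 * (2 * M * (y - x)) * (y - x)) by (unfold M; ring).
      apply Q.
      + intros t Ht. apply Cderiv_minus; [apply Cderiv_Ef, Cderiv_xy_y|].
        apply (Cderiv_ext (fun s => (Ci * G x u) * RtoC s)%C); [intros; ring|].
        eapply Cderiv_eq; [|apply Cderiv_scal, Cderiv_RtoC, @is_derive_id]. unfold one; simpl. ring.
      + intros t Ht. replace (Ci * G t u - 1 * (Ci * G x u))%C with (Ci * (G t u - G x u))%C by ring.
        rewrite Cmod_mult, Cmod_Ci, Rmult_1_l. eapply Rle_trans; [apply LG; lra|].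
        apply Rmult_le_compat_l; [lra|lra]. }
  generalize (CI_bound 1 _ _ Rlt_0_1 W). unfold Rdiv. rewrite Rinv_1. lra.
Qed.

Definition gauss (w : C) : C := Cexp (- (w * w)).

(** The Gaussian integral, sqrt PI; [Kg_pos] makes it a positive factor that can be cancelled. *)
Definition Kg : C := CI (fun s => gauss (RtoC s)).

Lemma gauss_Ef w : gauss w = Ef 0 0 1 w.
Proof. unfold gauss, Ef, Qexp. f_equal. ring. Qed.

Lemma gauss_R (s : R) : gauss (RtoC s) = RtoC (exp (- s ^ 2)).
Proof.
  unfold gauss. rewrite <- Cexp_R. f_equal. rewrite RtoC_opp, RtoC_pow. simpl. ring.
Qed.

Lemma Cdecay_gauss y : exists K, Cdecay 1 K (fun s => gauss (xy s y)).
Proof.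
  destruct (Ef_bounds 0 0 1 (Rabs y) (Rle_refl 0) Rlt_0_1 (Rabs_pos y)) as [K [_ HB]].
  exists K. apply (Cdecay_ext 1 K (fun s => Ef 0 0 1 (xy s y))); [intros; symmetry; apply gauss_Ef|].
  split; [apply Ccont_Ef_u|]. intros u. apply HB; lra.
Qed.

Lemma xy_0 s : xy s 0 = RtoC s.
Proof. unfold xy. ring. Qed.

Lemma gauss_shift (w : C) : CI (fun s => gauss (RtoC s + w)%C) = Kg.
Proof.
  destruct (Cdecay_gauss (Im w)) as [K HK].
  assert (E : forall s, gauss (RtoC s + w)%C = gauss (xy (s + Re w) (Im w))).
  { intros s. f_equal. apply Ceq; [rewrite Re_xy|rewrite Im_xy]; unfold Re, Im; simpl; ring. }
  rewrite (CI_ext _ _ E), (CI_shift 1 K (Re w) (fun s => gauss (xy s (Im w)))); auto; [|lra].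
  unfold Kg. rewrite (CI_ext (fun s => gauss (RtoC s)) (fun s => Ef 0 0 1 (xy s 0))).
  2: { intros s. rewrite xy_0. apply gauss_Ef. }
  rewrite (CI_ext _ (fun s => Ef 0 0 1 (xy s (Im w)))) by (intros; apply gauss_Ef).
  destruct (Rle_dec 0 (Im w)).
  - apply contour_shift; try lra. intros; lra.
  - symmetry. apply contour_shift; try lra. intros; lra.
Qed.

(** Completing the square leaves a Gaussian shifted by the complex number -iz/2, which [gauss_shift]
    moves back. *)
Lemma gauss_fourier (z : C) : CI (fun s => gauss (RtoC s) * Cexp (Ci * z * RtoC s))%C = (Kg * Cexp (- (z * z) / 4))%C.
Proof.
  rewrite <- (gauss_shift (- (Ci * z / 2))%C).
  assert (F4 : RtoC 4 = (2 * 2)%C) by (rewrite <- RtoC_mult; f_equal; ring).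
  assert (E : forall s, (gauss (RtoC s) * Cexp (Ci * z * RtoC s) = Cexp (- (z * z) / 4) * gauss (RtoC s + - (Ci * z / 2)))%C).
  { intros s. unfold gauss. rewrite <- !Cexp_plus. f_equal.
    transitivity (- (s * s) + Ci * z * s - (1 + Ci * Ci) * (z * z) / 4)%C.
    - replace (Ci * Ci)%C with (- (1))%C by (apply Ceq; simpl; ring). rewrite F4. field.
    - rewrite F4. field. }
  rewrite (CI_ext _ _ E), (Cmult_comm (CI _)).
  destruct (Cdecay_gauss (Im (- (Ci * z / 2))%C)) as [K HK].
  assert (W : exists K', Cdecay 1 K' (fun s => gauss (RtoC s + - (Ci * z / 2))%C)).
  { exists (K * exp (1 * Rabs (Re (- (Ci * z / 2))%C))).
    set (w := (- (Ci * z / 2))%C) in *. destruct HK as [A B].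
    assert (Es : forall s, gauss (RtoC s + w)%C = gauss (xy (s + Re w) (Im w))).
    { intros s. f_equal. apply Ceq; [rewrite Re_xy|rewrite Im_xy]; unfold Re, Im; simpl; ring. }
    apply (Cdecay_ext 1 _ (fun s => gauss (xy (s + Re w) (Im w)))); [intros; symmetry; apply Es|].
    split.
    - intros u. destruct (A (u + Re w)) as [A1 A2].
      assert (Ck : continuous (fun u => u + Re w) u).
      { apply (continuous_of_derivable _ (fun _ => 1)). intros; auto_derive; auto; ring. }
      split; [apply (continuous_comp' (fun u => u + Re w) (fun t => Re (gauss (xy t (Im w)))))
             |apply (continuous_comp' (fun u => u + Re w) (fun t => Im (gauss (xy t (Im w)))))]; auto.
    - intros u. eapply Rle_trans; [apply B|]. rewrite Rmult_assoc, <- exp_plus.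
      apply Rmult_le_compat_l; [apply (Cdecay_K_pos 1 K (fun s => gauss (xy s (Im w)))); split; auto|].
      apply exp_le. assert (Q := Rabs_triang (u + Re w) (- Re w)). replace (u + Re w + - Re w) with u in Q by ring.
      rewrite Rabs_Ropp in Q. lra. }
  destruct W as [K' HK'].
  rewrite (CI_scal 1 K' _ _ Rlt_0_1 HK'). ring.
Qed.

Lemma Kg_pos : exists k, 0 < k /\ Kg = RtoC k.
Proof.
  exists (Int (fun s => exp (- s ^ 2))). split.
  - destruct (Cdecay_gauss 0) as [K HK].
    apply (Int_pos 1 K _ 0); [lra| |intros; left; apply exp_pos|apply exp_pos].
    assert (W := Cdecay_re _ _ _ HK). destruct W as [A B]. split.
    + intros u. apply (continuous_ext (fun u => Re (gauss (xy u 0)))); auto.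
      intros s. rewrite xy_0, gauss_R. reflexivity.
    + intros u. specialize (B u). rewrite xy_0, gauss_R in B. exact B.
  - unfold Kg. rewrite (CI_ext _ (fun s => RtoC (exp (- s ^ 2)))) by apply gauss_R. apply CI_RtoC.
Qed.

(* kerC r and PhiC continue ker r and Phi0 to the strip |Im w| < pi/4. *)
Definition kerC (r : R) (w : C) : C :=
  ((RtoC (2 * PI ^ 2 * r ^ 4) * Cexp (RtoC (9 / 2) * w) - RtoC (3 * PI * r ^ 2) * Cexp (RtoC (5 / 2) * w))
   * Cexp (- (RtoC (PI * r ^ 2) * Cexp (2 * w))))%C.

Lemma kerC_R r u : kerC r (RtoC u) = RtoC (ker r u).
Proof.
  unfold kerC, ker. rewrite <- !RtoC_mult, !Cexp_R, <- !RtoC_mult, <- RtoC_opp, Cexp_R, <- RtoC_minus, <- RtoC_mult. auto.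
Qed.

(** Expanding (w - i al)^2 puts both terms of the product into the family [Ef]; the cross term adds
    2 i al d to the linear coefficient. *)
Lemma kerC_gauss_Ef r v al d y u :
  (kerC r (xy (u + v) y) * Cexp (- (RtoC d * ((xy u y - Ci * RtoC al) * (xy u y - Ci * RtoC al)))) =
   RtoC (2 * PI ^ 2 * r ^ 4 * exp (9 / 2 * v) * exp (d * al ^ 2)) * Ef (RtoC (9 / 2) + Ci * RtoC (2 * al * d)) (PI * r ^ 2 * exp (2 * v)) d (xy u y) -
   RtoC (3 * PI * r ^ 2 * exp (5 / 2 * v) * exp (d * al ^ 2)) * Ef (RtoC (5 / 2) + Ci * RtoC (2 * al * d)) (PI * r ^ 2 * exp (2 * v)) d (xy u y))%C.
Proof.
  assert (E0 : xy (u + v) y = (xy u y + RtoC v)%C) by (unfold xy; rewrite RtoC_plus; ring).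
  rewrite E0. set (w := xy u y). unfold kerC, Ef, Qexp.
  rewrite (RtoC_mult (2 * PI ^ 2 * r ^ 4 * exp (9 / 2 * v))), (RtoC_mult (2 * PI ^ 2 * r ^ 4)).
  rewrite (RtoC_mult (3 * PI * r ^ 2 * exp (5 / 2 * v))), (RtoC_mult (3 * PI * r ^ 2)).
  rewrite (RtoC_mult (PI * r ^ 2) (exp (2 * v))).
  rewrite <- (Cexp_R (9 / 2 * v)), <- (Cexp_R (5 / 2 * v)), <- (Cexp_R (d * al ^ 2)), <- (Cexp_R (2 * v)).
  assert (G : forall be : R, (Cexp (RtoC be * (w + v)) * Cexp (- (RtoC (PI * r ^ 2) * Cexp (2 * (w + v)))) *
     Cexp (- (RtoC d * ((w - Ci * al) * (w - Ci * al)))) =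
     Cexp (RtoC (be * v)) * Cexp (RtoC (d * al ^ 2)) * Cexp ((RtoC be + Ci * RtoC (2 * al * d)) * w - RtoC (PI * r ^ 2) * Cexp (RtoC (2 * v)) * Cexp (2 * w) - RtoC d * (w * w)))%C).
  { intros be. rewrite <- !Cexp_plus. f_equal.
    replace (Cexp (2 * (w + v))) with (Cexp (RtoC (2 * v)) * Cexp (2 * w))%C.
    2: { rewrite <- Cexp_plus, RtoC_mult. f_equal. ring. }
    rewrite !RtoC_mult, RtoC_pow. 
    transitivity (be * (w + v) - PI * r ^ 2 * (Cexp (2 * v) * Cexp (2 * w)) - d * (w * w) + 2 * d * (Ci * al) * w - d * (Ci * Ci) * (al * al))%C.
    - rewrite ?RtoC_pow. simpl Cpow. ring.
    - replace (Ci * Ci)%C with (- (1))%C by (apply Ceq; simpl; ring). rewrite ?RtoC_pow. simpl Cpow. ring. }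
  transitivity (RtoC (2 * PI ^ 2 * r ^ 4) * (Cexp (RtoC (9 / 2) * (w + v)) * Cexp (- (RtoC (PI * r ^ 2) * Cexp (2 * (w + v)))) *
     Cexp (- (RtoC d * ((w - Ci * al) * (w - Ci * al))))) -
    RtoC (3 * PI * r ^ 2) * (Cexp (RtoC (5 / 2) * (w + v)) * Cexp (- (RtoC (PI * r ^ 2) * Cexp (2 * (w + v)))) *
     Cexp (- (RtoC d * ((w - Ci * al) * (w - Ci * al))))))%C; [ring|].
  rewrite !G. ring.
Qed.

(** Moving the line from height 0 to al puts the Gaussian centre back at 0 and the kernel at height
    al; up to PI / 4 the cosine that controls the double exponential stays nonnegative. *)
Lemma ker_contour r v al d : 0 < r -> 0 < d -> 0 <= al <= PI / 4 ->
  CI (fun u => RtoC (ker r (u + v)) * Cexp (- (RtoC d * ((RtoC u - Ci * RtoC al) * (RtoC u - Ci * RtoC al)))))%C =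
  CI (fun u => kerC r (xy (u + v) al) * Cexp (- (RtoC d * (RtoC u * RtoC u))))%C.
Proof.
  intros Hr Hd Hal. assert (HPI := PI_RGT_0).
  set (a := PI * r ^ 2 * exp (2 * v)).
  assert (Ha : 0 <= a).
  { unfold a. apply Rmult_le_pos; [|left; apply exp_pos]. apply Rmult_le_pos; [lra|apply pow2_ge_0]. }
  assert (Hc : forall y, 0 <= y <= al -> 0 <= a * cos (2 * y)).
  { intros y Hy. apply Rmult_le_pos; auto. apply cos_ge_0; lra. }
  set (b9 := (RtoC (9 / 2) + Ci * RtoC (2 * al * d))%C). set (b5 := (RtoC (5 / 2) + Ci * RtoC (2 * al * d))%C).
  set (c9 := RtoC (2 * PI ^ 2 * r ^ 4 * exp (9 / 2 * v) * exp (d * al ^ 2))).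
  set (c5 := RtoC (3 * PI * r ^ 2 * exp (5 / 2 * v) * exp (d * al ^ 2))).
  assert (Main : forall y, 0 <= y <= al ->
    CI (fun u => kerC r (xy (u + v) y) * Cexp (- (RtoC d * ((xy u y - Ci * RtoC al) * (xy u y - Ci * RtoC al)))))%C =
    (c9 * CI (fun u => Ef b9 a d (xy u y)) - c5 * CI (fun u => Ef b5 a d (xy u y)))%C).
  { intros y Hy. rewrite (CI_ext _ _ (kerC_gauss_Ef r v al d y)). fold a b9 b5 c9 c5.
    destruct (Ef_bounds b9 a d al Ha Hd (proj1 Hal)) as [K9 [_ H9]]. destruct (Ef_bounds b5 a d al Ha Hd (proj1 Hal)) as [K5 [_ H5]].
    assert (Ry : Rabs y <= al) by (rewrite Rabs_pos_eq; lra).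
    assert (W9 : Cdecay 1 K9 (fun u => Ef b9 a d (xy u y))) by (split; [apply Ccont_Ef_u|intros u; apply H9; auto]).
    assert (W5 : Cdecay 1 K5 (fun u => Ef b5 a d (xy u y))) by (split; [apply Ccont_Ef_u|intros u; apply H5; auto]).
    rewrite (CI_minus 1 _ _ _ _ Rlt_0_1 (Cdecay_scal 1 K9 c9 _ W9) (Cdecay_scal 1 K5 c5 _ W5)).
    rewrite (CI_scal 1 K9 _ _ Rlt_0_1 W9), (CI_scal 1 K5 _ _ Rlt_0_1 W5). auto. }
  transitivity (CI (fun u => kerC r (xy (u + v) 0) * Cexp (- (RtoC d * ((xy u 0 - Ci * RtoC al) * (xy u 0 - Ci * RtoC al)))))%C).
  { apply CI_ext. intros u. rewrite !xy_0, kerC_R. auto. }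
  rewrite Main by lra.
  rewrite <- (contour_shift b9 a d 0 al), <- (contour_shift b5 a d 0 al) by (auto; lra).
  rewrite <- Main by lra. apply CI_ext. intros u.
  replace (xy u al - Ci * al)%C with (RtoC u) by (unfold xy; ring). auto.
Qed.

Definition PhiC (w : C) : C := CSeries (fun k => kerC (INR (S k)) w).

Lemma Cmod_kernel_exp r x y : Cmod (Cexp (- (RtoC (PI * r ^ 2) * Cexp (2 * xy x y)))) = exp (- (PI * r ^ 2 * cos (2 * y) * exp (2 * x))).
Proof.
  rewrite Cmod_Cexp. f_equal.
  change (- Re (RtoC (PI * r ^ 2) * Cexp (2 * xy x y)) = - (PI * r ^ 2 * cos (2 * y) * exp (2 * x))).
  rewrite Re_mult_R, Re_Cexp, Re_mult_R, Im_mult_R, Re_xy, Im_xy. ring.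
Qed.

Lemma Cmod_exp_xy (b : R) x y : Cmod (Cexp (RtoC b * xy x y)) = exp (b * x).
Proof. rewrite Cmod_Cexp, Re_mult_R, Re_xy. auto. Qed.

Lemma Cmod_RtoC_pos (a : R) : 0 <= a -> Cmod (RtoC a) = a.
Proof. intros; rewrite Cmod_R, Rabs_pos_eq; auto. Qed.

Lemma coef9_pos r : 0 <= 2 * PI ^ 2 * r ^ 4.
Proof. generalize (pow2_ge_0 PI) (pow2_ge_0 (r ^ 2)). replace ((r ^ 2) ^ 2) with (r ^ 4) by ring. nra. Qed.

Lemma coef5_pos r : 0 <= 3 * PI * r ^ 2.
Proof. generalize PI_RGT_0 (pow2_ge_0 r). nra. Qed.

Lemma kerC_envelope r x y : Cmod (kerC r (xy x y)) <= envelope (cos (2 * y)) r x.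
Proof.
  unfold kerC, envelope. rewrite Cmod_mult, Cmod_kernel_exp.
  apply Rmult_le_compat_r; [left; apply exp_pos|].
  eapply Rle_trans; [apply Cmod_triangle|]. rewrite Cmod_opp, !Cmod_mult, !Cmod_exp_xy.
  rewrite !Cmod_RtoC_pos by (apply coef9_pos || apply coef5_pos). lra.
Qed.

Definition kerC' (r : R) (w : C) : C :=
  ((RtoC (9 / 2) * (RtoC (2 * PI ^ 2 * r ^ 4) * Cexp (RtoC (9 / 2) * w)) - RtoC (5 / 2) * (RtoC (3 * PI * r ^ 2) * Cexp (RtoC (5 / 2) * w)))
   * Cexp (- (RtoC (PI * r ^ 2) * Cexp (2 * w)))
   - RtoC 2 * (RtoC (PI * r ^ 2) * Cexp (2 * w)) * kerC r w)%C.

Lemma Cderiv_exp_lin (b : C) (w : R -> C) t l : Cderiv w t l -> Cderiv (fun t => Cexp (b * w t)) t (l * (b * Cexp (b * w t)))%C.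
Proof.
  intros H. eapply Cderiv_eq; [|apply (Cderiv_Cexp (fun t => b * w t)%C); apply Cderiv_scal, H]. ring.
Qed.

Lemma Cderiv_kerC r y x : Cderiv (fun x => kerC r (xy x y)) x (kerC' r (xy x y)).
Proof.
  eapply Cderiv_eq.
  2: { unfold kerC. apply Cderiv_mult.
       - apply Cderiv_minus; apply Cderiv_scal, Cderiv_exp_lin, Cderiv_xy_u.
       - apply (Cderiv_Cexp (fun x => - (RtoC (PI * r ^ 2) * Cexp (2 * xy x y)))%C).
         apply Cderiv_opp, Cderiv_scal, Cderiv_exp_lin, Cderiv_xy_u. }
  unfold kerC', kerC. ring.
Qed.

(** Differentiation brings down Y = PI r^2 e^(2x). Half of the exponent absorbs it, Y e^(-cY) <=
    (2/c) e^(-cY/2), hence the envelope at c / 2. *)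
Lemma kerC'_envelope r x y : 0 < cos (2 * y) ->
  Cmod (kerC' r (xy x y)) <= (9 / 2 + 4 / cos (2 * y)) * envelope (cos (2 * y) / 2) r x.
Proof.
  intros Hc. set (c := cos (2 * y)) in *. set (Y := PI * r ^ 2 * exp (2 * x)).
  assert (HY : 0 <= Y). { apply Rmult_le_pos; [|left; apply exp_pos]. generalize PI_RGT_0 (pow2_ge_0 r). nra. }
  set (A := 2 * PI ^ 2 * r ^ 4 * exp (9 / 2 * x)). set (B := 3 * PI * r ^ 2 * exp (5 / 2 * x)).
  assert (HA : 0 <= A) by (apply Rmult_le_pos; [apply coef9_pos|left; apply exp_pos]).
  assert (HB : 0 <= B) by (apply Rmult_le_pos; [apply coef5_pos|left; apply exp_pos]).
  assert (E1 : envelope c r x = (A + B) * exp (- (Y * c))) by (unfold envelope, A, B, Y; do 3 f_equal; ring).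
  assert (E2 : envelope (c / 2) r x = (A + B) * exp (- (Y * c / 2))) by (unfold envelope, A, B, Y; do 3 f_equal; field).
  assert (P2 := exp_pos (- (Y * c / 2))).
  assert (F1 : exp (- (Y * c)) <= exp (- (Y * c / 2))) by (apply exp_le; nra).
  assert (F2 : Y * exp (- (Y * c)) <= 2 / c * exp (- (Y * c / 2))).
  { replace (- (Y * c)) with (- (Y * c / 2) + - (Y * c / 2)) by field. rewrite exp_plus.
    rewrite <- Rmult_assoc. apply Rmult_le_compat_r; [lra|].
    assert (G := exp_ineq1_le (Y * c / 2)). rewrite exp_Ropp.
    apply Rmult_le_reg_r with (exp (Y * c / 2)); [apply exp_pos|]. rewrite Rmult_assoc, Rinv_l, Rmult_1_r by (apply Rgt_not_eq, exp_pos).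
    apply Rmult_le_reg_l with (c / 2); [lra|].
    replace (c / 2 * (2 / c * exp (Y * c / 2))) with (exp (Y * c / 2)) by (field; lra). lra. }
  unfold kerC'. eapply Rle_trans; [apply Cmod_triangle|]. rewrite Cmod_opp, !Cmod_mult.
  rewrite Cmod_kernel_exp. fold c. rewrite !Cmod_exp_xy.
  assert (B1 : Cmod (RtoC (9 / 2) * (RtoC (2 * PI ^ 2 * r ^ 4) * Cexp (RtoC (9 / 2) * xy x y)) -
     RtoC (5 / 2) * (RtoC (3 * PI * r ^ 2) * Cexp (RtoC (5 / 2) * xy x y))) <= 9 / 2 * (A + B)).
  { eapply Rle_trans; [apply Cmod_triangle|]. rewrite Cmod_opp, !Cmod_mult, !Cmod_exp_xy.
    rewrite !Cmod_RtoC_pos by (apply coef9_pos || apply coef5_pos || lra). fold A B. lra. }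
  assert (B2 : Cmod (RtoC (PI * r ^ 2)) * exp (2 * x) = Y).
  { rewrite Cmod_RtoC_pos; auto. generalize PI_RGT_0 (pow2_ge_0 r). nra. }
  rewrite B2, (Cmod_RtoC_pos 2) by lra.
  assert (B3 := kerC_envelope r x y). fold c in B3. rewrite E1 in B3.
  replace (PI * r ^ 2 * c * exp (2 * x)) with (Y * c) by (unfold Y; ring).
  rewrite E2, Rmult_plus_distr_r. apply Rplus_le_compat.
  - replace (9 / 2 * ((A + B) * exp (- (Y * c / 2)))) with ((9 / 2 * (A + B)) * exp (- (Y * c / 2))) by ring.
    apply Rmult_le_compat; auto using Cmod_ge_0. left; apply exp_pos.
  - apply Rle_trans with (2 * Y * ((A + B) * exp (- (Y * c)))).
    + apply Rmult_le_compat_l; lra.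
    + replace (2 * Y * ((A + B) * exp (- (Y * c)))) with (2 * (A + B) * (Y * exp (- (Y * c)))) by ring.
      replace (4 / c * ((A + B) * exp (- (Y * c / 2)))) with (2 * (A + B) * (2 / c * exp (- (Y * c / 2)))) by (field; lra).
      apply Rmult_le_compat_l; lra.
Qed.

(** N = 3 leaves the exponents 9/2 - 6 and 5/2 - 6, both below 4 in modulus. Growth in x is harmless
    because a Gaussian factor always follows. *)
Lemma envelope_simple c : 0 < c -> exists C0, 0 < C0 /\ forall k x, envelope c (INR (S k)) x <= C0 * inv_sq k * exp (4 * Rabs x).
Proof.
  intros Hc. exists (2 * (50 * INR (fact 3) / c ^ 3)).
  assert (P3 : 0 < c ^ 3) by (apply pow_lt; auto).
  assert (PF := INR_fact_lt_0 3).
  assert (Q : 0 < 50 * INR (fact 3) / c ^ 3) by (apply Rdiv_lt_0_compat; lra).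
  split; [lra|]. intros k x. eapply Rle_trans; [apply (envelope_bound c k x 3); auto|].
  replace (2 * (50 * INR (fact 3) / c ^ 3) * inv_sq k * exp (4 * Rabs x)) with
    (50 * INR (fact 3) / c ^ 3 * inv_sq k * (2 * exp (4 * Rabs x))) by ring.
  apply Rmult_le_compat_l; [apply Rmult_le_pos; [lra|left; apply inv_sq_pos]|].
  rewrite Rmult_plus_distr_r, <- !exp_plus. replace (INR 3) with 3 by (simpl; ring).
  assert (A := Rle_abs x). assert (B := Rle_abs (- x)). rewrite Rabs_Ropp in B.
  assert (exp (9 / 2 * x + - (2 * 3 * x)) <= exp (4 * Rabs x)) by (apply exp_le; lra).
  assert (exp (5 / 2 * x + - (2 * 3 * x)) <= exp (4 * Rabs x)) by (apply exp_le; lra). lra.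
Qed.

Lemma CSeries_Cser a b : (forall n, Cmod (a n) <= b n) -> ex_series b -> Cser a (CSeries a).
Proof.
  intros H Hb. destruct (Cser_ex a b H Hb) as [l Hl]. replace (CSeries a) with l; auto.
  apply Cser_components in Hl. destruct Hl as [H1 H2]. apply Ceq; symmetry; apply is_series_unique; auto.
Qed.

Lemma PhiC_Cser x y : 0 < cos (2 * y) -> Cser (fun k => kerC (INR (S k)) (xy x y)) (PhiC (xy x y)).
Proof.
  intros Hc. destruct (envelope_simple _ Hc) as [C0 [HC H]].
  apply CSeries_Cser with (fun k => C0 * exp (4 * Rabs x) * inv_sq k).
  - intros k. eapply Rle_trans; [apply kerC_envelope|]. eapply Rle_trans; [apply H|]. right; ring.
  - apply (ex_series_scal (V := R_NormedModule)). apply ex_series_inv_sq.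
Qed.

Lemma PhiC_Lip y : 0 < cos (2 * y) -> exists L, 0 <= L /\ forall x h,
  Cmod (PhiC (xy (x + h) y) - PhiC (xy x y)) <= L * (Rabs h * exp (4 * (Rabs x + Rabs h))).
Proof.
  intros Hc. destruct (envelope_simple (cos (2 * y) / 2) ltac:(lra)) as [C0 [HC H]].
  set (D := 9 / 2 + 4 / cos (2 * y)).
  assert (HD : 0 < D). { assert (0 < 4 / cos (2 * y)) by (apply Rdiv_lt_0_compat; lra). unfold D; lra. }
  assert (HS : 0 <= Series inv_sq).
  { rewrite <- (Rmult_0_l (Series inv_sq)), <- Series_scal_l. apply Series_le; [|apply ex_series_inv_sq].
    intros n. generalize (inv_sq_pos n). lra. }
  exists (2 * D * C0 * Series inv_sq). split; [repeat apply Rmult_le_pos; lra|].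
  intros x h.
  assert (S1 := Cser_minus _ _ _ _ (PhiC_Cser (x + h) y Hc) (PhiC_Cser x y Hc)).
  assert (E : 2 * D * C0 * Series inv_sq * (Rabs h * exp (4 * (Rabs x + Rabs h))) =
    Series (fun k => 2 * (D * (C0 * exp (4 * (Rabs x + Rabs h)))) * Rabs h * inv_sq k)).
  { rewrite Series_scal_l. ring. }
  rewrite E. apply (Cser_le _ _ _ S1); [|apply (ex_series_scal (V := R_NormedModule)); apply ex_series_inv_sq].
  intros k.
  assert (Q := Cderiv_bounded (fun x => kerC (INR (S k)) (xy x y)) (fun x => kerC' (INR (S k)) (xy x y)) x (x + h)
    (D * (C0 * exp (4 * (Rabs x + Rabs h))) * inv_sq k)).
  replace (x + h - x) with h in Q by ring.
  eapply Rle_trans; [apply Q|right; ring].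
  - intros t _. apply Cderiv_kerC.
  - intros t Ht. eapply Rle_trans; [apply kerC'_envelope; auto|]. fold D.
    replace (D * (C0 * exp (4 * (Rabs x + Rabs h))) * inv_sq k) with (D * (C0 * inv_sq k * exp (4 * (Rabs x + Rabs h)))) by ring.
    apply Rmult_le_compat_l; [lra|]. eapply Rle_trans; [apply H|].
    apply Rmult_le_compat_l; [apply Rmult_le_pos; [lra|left; apply inv_sq_pos]|]. apply exp_le.
    assert (Rabs t <= Rabs x + Rabs h); [|lra].
    unfold Rmin, Rmax in Ht. destruct (Rle_dec x (x + h)); unfold Rabs; destruct (Rcase_abs t), (Rcase_abs x), (Rcase_abs h); lra.
Qed.

(* damp eta v al t = exp(-i t (v + i al) - eta^2 t^2) *)
Definition damp (eta v al t : R) : C := Ef (- (Ci * xy v al)) 0 (eta ^ 2) (RtoC t).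

(** Damped Fourier inversion of X at v + i al: as eta tends to 0 it recovers a positive multiple of
    [PhiC (xy v al)]. *)
Definition J (eta v al : R) : C := CI (fun t => damp eta v al t * X (RtoC t))%C.

Lemma X_fourier t : X (RtoC t) = (2 * CI (fun u => RtoC (Phi0 u) * e_it t u))%C.
Proof.
  unfold X, T. f_equal. apply CI_ext. intros u. unfold e_it. rewrite RtoC_mult. do 2 f_equal. ring.
Qed.

Lemma damp_Cdecay eta v al : 0 < eta -> exists K, Cdecay 1 K (damp eta v al) /\
  forall t t', Cmod (damp eta v al t - damp eta v al t') <= 2 * K * Rabs (t - t').
Proof.
  intros He. assert (Hd : 0 < eta ^ 2) by (apply pow_lt; auto).
  destruct (Ef_bounds (- (Ci * xy v al))%C 0 (eta ^ 2) 0 (Rle_refl 0) Hd (Rle_refl 0)) as [K [HK HB]].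
  assert (R0 : Rabs 0 <= 0) by (rewrite Rabs_R0; lra).
  exists K. split; [split|].
  - apply (Ccont_ext (fun u => Ef (- (Ci * xy v al)) 0 (eta ^ 2) (xy u 0))); [|apply Ccont_Ef_u].
    intros u. unfold damp. rewrite xy_0. auto.
  - intros u. unfold damp. rewrite <- xy_0. apply HB; [auto|lra].
  - intros t t'. unfold damp. rewrite <- !xy_0.
    apply (Cderiv_bounded (fun t => Ef (- (Ci * xy v al)) 0 (eta ^ 2) (xy t 0))
      (fun t => 1 * (Q1 (- (Ci * xy v al)) 0 (eta ^ 2) (xy t 0) * Ef (- (Ci * xy v al)) 0 (eta ^ 2) (xy t 0)))%C).
    + intros s _. apply (Cderiv_Ef _ _ _ (fun t => xy t 0)), Cderiv_xy_u.
    + intros s _. rewrite Cmult_1_l. destruct (HB s 0 R0 ltac:(lra)) as [_ [H2 _]].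
      eapply Rle_trans; [exact H2|]. rewrite <- (Rmult_1_r K) at 2. apply Rmult_le_compat_l; auto.
      apply Rle_trans with (exp 0); [apply exp_le; generalize (Rabs_pos s); lra|rewrite exp_0; lra].
Qed.

(** The transform of the damping factor is a Gaussian of width of order eta centred at v + i al, an
    approximate identity at a complex point. *)
Lemma damp_fourier eta v al u : 0 < eta ->
  CI (fun t => damp eta v al t * e_it t u)%C =
  (RtoC (/ eta) * (Kg * Cexp (- (RtoC (/ (4 * eta ^ 2)) * ((RtoC u - xy v al) * (RtoC u - xy v al))))))%C.
Proof.
  intros He.
  set (z := ((RtoC u - xy v al) * RtoC (/ eta))%C).
  assert (Ne : RtoC eta <> 0%C). { intros Q. apply (f_equal Re) in Q. simpl in Q. lra. }
  assert (E : forall t, (damp eta v al t * e_it t u = gauss (RtoC (eta * t)) * Cexp (Ci * z * RtoC (eta * t)))%C).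
  { intros t. unfold damp, e_it, Ef, Qexp, gauss, z. rewrite <- !Cexp_plus. f_equal.
    rewrite !RtoC_mult, RtoC_pow, RtoC_inv by (apply Rgt_not_eq; auto). simpl Cpow. field. auto. }
  rewrite (CI_ext _ _ E).
  assert (W : exists K, Cdecay 1 K (fun s => gauss (RtoC s) * Cexp (Ci * z * RtoC s))%C).
  { destruct (Ef_bounds (Ci * z)%C 0 1 0 (Rle_refl 0) Rlt_0_1 (Rle_refl 0)) as [K [HK HB]].
    assert (R0 : Rabs 0 <= 0) by (rewrite Rabs_R0; lra).
    exists K. apply (Cdecay_ext 1 K (fun s => Ef (Ci * z) 0 1 (xy s 0))).
    - intros s. rewrite xy_0. unfold Ef, Qexp, gauss. rewrite <- Cexp_plus. f_equal. ring.
    - split; [apply Ccont_Ef_u|]. intros s. apply HB; [auto|lra]. }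
  destruct W as [K HK].
  assert (Dl := CI_dilate 1 K eta _ Rlt_0_1 He HK).
  rewrite gauss_fourier in Dl.
  replace (CI (fun t => gauss (RtoC (eta * t)) * Cexp (Ci * z * RtoC (eta * t)))%C)
    with (RtoC (/ eta) * (RtoC eta * CI (fun t => gauss (RtoC (eta * t)) * Cexp (Ci * z * RtoC (eta * t)))))%C.
  2: { rewrite RtoC_inv by (apply Rgt_not_eq; auto). field. auto. }
  rewrite Dl. do 3 f_equal. unfold z.
  rewrite !RtoC_inv by (apply Rgt_not_eq; try apply Rmult_lt_0_compat; try apply pow_lt; lra).
  rewrite RtoC_mult, RtoC_pow. simpl Cpow. field.
  auto.
Qed.

Lemma Ccont_analytic_R (f : C -> C) : (forall z, analytic f z) -> Ccont (fun t => f (RtoC t)).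
Proof.
  intros Hf t. assert (HX := analytic_continuous f (RtoC t) (Hf _)).
  assert (G : forall p : C -> R, (forall x y, p (x - y)%C = p x - p y) -> (forall w, Rabs (p w) <= Cmod w) ->
    continuous (fun s => p (f (RtoC s))) t).
  { intros p Hp1 Hp2. apply filterlim_locally. intros eps. destruct (HX eps (cond_pos eps)) as [d [Hd0 Hd]].
    exists (mkposreal d Hd0). intros s Hs. change (Rabs (s - t) < d) in Hs.
    change (Rabs (p (f (RtoC s)) - p (f (RtoC t))) < eps). rewrite <- Hp1. eapply Rle_lt_trans; [apply Hp2|].
    replace (RtoC s) with (RtoC t + RtoC (s - t))%C by (rewrite RtoC_minus; ring). apply Hd. rewrite Cmod_R. auto. }
  split; [apply (G Re)|apply (G Im)]; auto using re_le_Cmod, im_le_Cmod.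
Qed.

Lemma Phi0_Cdecay : exists P, Cdecay 2 P (fun u => RtoC (Phi0 u)).
Proof.
  destruct (even_rapid_Cdecay Phi0 0%C 2 even_rapid_Phi0 ltac:(lra)) as [P HP]. exists P.
  apply (Cdecay_ext 2 P (fun u => RtoC (Phi0 u) * Cexp (0 * RtoC u))%C); auto.
  intros u. rewrite Cmult_0_l, Cexp_0. ring.
Qed.

Lemma Ccont_X : Ccont (fun t => X (RtoC t)).
Proof. apply Ccont_analytic_R. intros z. apply analytic_T, even_rapid_Phi0. Qed.

Lemma X_bounded : exists M, 0 <= M /\ forall t, Cmod (X (RtoC t)) <= M.
Proof.
  destruct Phi0_Cdecay as [P HP]. assert (HP0 := Cdecay_K_pos _ _ _ HP).
  exists (2 * (4 * P)). split; [lra|]. intros t. rewrite X_fourier, Cmod_mult.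
  rewrite Cmod_R, Rabs_pos_eq by lra. apply Rmult_le_compat_l; [lra|].
  assert (W : Cdecay 1 P (fun u => RtoC (Phi0 u) * e_it t u)%C).
  { split; [apply Ccont_mult; [apply HP|apply Ccont_e_it]|]. intros u. rewrite Cmod_mult, Cmod_e_it, Rmult_1_r.
    apply (Cdecay_weaken 2 1 P P) in HP; [apply HP|lra|lra]. }
  generalize (CI_bound 1 P _ Rlt_0_1 W). unfold Rdiv. rewrite Rinv_1. lra.
Qed.

Lemma J_Cdecay eta v al : 0 < eta -> exists K, Cdecay 1 K (fun t => damp eta v al t * X (RtoC t))%C.
Proof.
  intros He. destruct (damp_Cdecay eta v al He) as [K [WK _]]. destruct X_bounded as [M [HM HX]].
  exists (K * M). split; [apply Ccont_mult; [apply WK|apply Ccont_X]|].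
  intros t. rewrite Cmod_mult. replace (K * M * exp (- (1) * Rabs t)) with ((K * exp (- (1) * Rabs t)) * M) by ring.
  apply Rmult_le_compat; auto using Cmod_ge_0. apply WK.
Qed.

Lemma J_formula1 eta v al : 0 < eta ->
  J eta v al = (2 * (RtoC (/ eta) * Kg) * CI (fun u => RtoC (Phi0 u) *
    Cexp (- (RtoC (/ (4 * eta ^ 2)) * ((RtoC u - xy v al) * (RtoC u - xy v al))))))%C.
Proof.
  intros He. destruct (damp_Cdecay eta v al He) as [K [WK LK]].
  destruct Phi0_Cdecay as [P HP'].
  assert (F := fourier_mult (damp eta v al) (fun u => RtoC (Phi0 u)) K P (2 * K) WK HP' LK).
  unfold J.
  rewrite (CI_ext _ (fun t => 2 * (damp eta v al t * CI (fun u => RtoC (Phi0 u) * e_it t u)))%C).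
  2: { intros t. rewrite X_fourier. ring. }
  destruct (J_Cdecay eta v al He) as [K1 WJ].
  assert (W1 : Cdecay 1 (Cmod (/ 2) * K1) (fun t => damp eta v al t * CI (fun u => RtoC (Phi0 u) * e_it t u))%C).
  { eapply Cdecay_ext; [|apply Cdecay_scal, WJ]. intros t. simpl. rewrite X_fourier. field. }
  rewrite (CI_scal 1 _ _ _ Rlt_0_1 W1), F.
  set (g := fun u => Cexp (- (RtoC (/ (4 * eta ^ 2)) * ((RtoC u - xy v al) * (RtoC u - xy v al))))).
  assert (Hd : 0 < / (4 * eta ^ 2)) by (apply Rinv_0_lt_compat; apply Rmult_lt_0_compat; [lra|apply pow_lt; auto]).
  assert (W2 : exists K2, Cdecay 1 K2 (fun u => RtoC (Phi0 u) * g u)%C).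
  { destruct (Kg_pos) as [kg [Hkg Ekg]].
    assert (Bg : forall u, Cmod (g u) <= exp (/ (4 * eta ^ 2) * al ^ 2)).
    { intros u. unfold g. rewrite Cmod_Cexp. apply exp_le.
      change (- Re (RtoC (/ (4 * eta ^ 2)) * ((RtoC u - xy v al) * (RtoC u - xy v al))) <= / (4 * eta ^ 2) * al ^ 2).
      rewrite Re_mult_R. set (d := / (4 * eta ^ 2)) in *.
      replace (Re ((RtoC u - xy v al) * (RtoC u - xy v al))) with ((u - v) ^ 2 - al ^ 2) by (unfold xy, Re; simpl; ring).
      generalize (pow2_ge_0 (u - v)). nra. }
    exists (P * exp (/ (4 * eta ^ 2) * al ^ 2)). split.
    - apply Ccont_mult; [apply HP'|]. unfold g. apply Ccont_Cexp, Ccont_opp, Ccont_mult; [apply Ccont_const|].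
      apply Ccont_mult; apply Ccont_minus; auto using Ccont_id, Ccont_const.
    - intros u. rewrite Cmod_mult.
      replace (P * exp (/ (4 * eta ^ 2) * al ^ 2) * exp (- (1) * Rabs u)) with ((P * exp (- (1) * Rabs u)) * exp (/ (4 * eta ^ 2) * al ^ 2)) by ring.
      apply Rmult_le_compat; auto using Cmod_ge_0. apply (Cdecay_weaken 2 1 P P) in HP'; [apply HP'|lra|lra]. }
  destruct W2 as [K2 W2].
  rewrite (CI_ext (fun u => RtoC (Phi0 u) * CI (fun t => damp eta v al t * e_it t u))%C
    (fun u => (RtoC (/ eta) * Kg) * (RtoC (Phi0 u) * g u))%C).
  2: { intros u. rewrite damp_fourier by auto. unfold g. ring. }
  rewrite (CI_scal 1 K2 _ _ Rlt_0_1 W2). unfold g. ring.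
Qed.

Lemma PhiC_R u : PhiC (xy u 0) = RtoC (Phi0 u).
Proof.
  assert (Hc : 0 < cos (2 * 0)) by (rewrite Rmult_0_r, cos_0; lra).
  apply Ceq.
  - change (Series (fun n => Re (kerC (INR (S n)) (xy u 0))) = Series (fun k => ker (INR (S k)) u)).
    apply Series_ext. intros n. rewrite xy_0, kerC_R. auto.
  - change (Series (fun n => Im (kerC (INR (S n)) (xy u 0))) = 0).
    rewrite (Series_ext _ (fun _ => 0 * 0)), Series_scal_l; [ring|].
    intros n. rewrite xy_0, kerC_R. simpl. ring.
Qed.

(** The maximum of 5 |u| - d u^2 is 25/(4d): four units from the growth of the envelope, one for the
    decay. *)
Lemma quad_exp_bound d v u : 0 < d ->
  exp (4 * Rabs (u + v)) * exp (- (d * u ^ 2)) <= exp (4 * Rabs v + 25 / (4 * d)) * exp (- (1) * Rabs u).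
Proof.
  intros Hd. rewrite <- !exp_plus. apply exp_le.
  assert (A := Rabs_triang u v).
  assert (E : u ^ 2 = Rabs u ^ 2) by (rewrite pow2_abs; auto). rewrite E.
  assert (S := pow2_ge_0 (Rabs u - 5 / (2 * d))).
  assert (Q : d * (Rabs u - 5 / (2 * d)) ^ 2 = d * Rabs u ^ 2 - 5 * Rabs u + 25 / (4 * d)) by (field; lra).
  assert (0 <= d * (Rabs u - 5 / (2 * d)) ^ 2) by (apply Rmult_le_pos; lra). lra.
Qed.

(** [y] is the height of the kernel and [z] that of the Gaussian centre: (0, al) before the contour
    is shifted, (al, 0) after. *)
Lemma PhiC_CI_series y z v d : 0 < d -> 0 < cos (2 * y) ->
  exists K, Cdecay 1 K (fun u => PhiC (xy (u + v) y) * Cexp (- (RtoC d * ((RtoC u - Ci * RtoC z) * (RtoC u - Ci * RtoC z)))))%C /\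
  Cser (fun k => CI (fun u => kerC (INR (S k)) (xy (u + v) y) * Cexp (- (RtoC d * ((RtoC u - Ci * RtoC z) * (RtoC u - Ci * RtoC z)))))%C)
    (CI (fun u => PhiC (xy (u + v) y) * Cexp (- (RtoC d * ((RtoC u - Ci * RtoC z) * (RtoC u - Ci * RtoC z)))))%C).
Proof.
  intros Hd Hc. destruct (envelope_simple _ Hc) as [C0 [HC H]].
  set (K0 := C0 * exp (d * z ^ 2) * exp (4 * Rabs v + 25 / (4 * d))).
  destruct (CI_series 1 (fun k => K0 * inv_sq k)
    (fun k u => kerC (INR (S k)) (xy (u + v) y) * Cexp (- (RtoC d * ((RtoC u - Ci * RtoC z) * (RtoC u - Ci * RtoC z)))))%C
    (fun u => PhiC (xy (u + v) y) * Cexp (- (RtoC d * ((RtoC u - Ci * RtoC z) * (RtoC u - Ci * RtoC z)))))%C Rlt_0_1) as [A B].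
  - intros k. split.
    + apply Ccont_mult.
      * apply (Ccont_ext (fun u => kerC (INR (S k)) (RtoC u + xy v y))%C).
        { intros u. f_equal. unfold xy. rewrite RtoC_plus. ring. }
        unfold kerC.
        assert (L : forall b : C, Ccont (fun u => Cexp (b * (RtoC u + xy v y)))%C).
        { intros b. apply Ccont_Cexp, Ccont_mult; [apply Ccont_const|]. apply Ccont_plus; auto using Ccont_id, Ccont_const. }
        apply Ccont_mult; [apply Ccont_minus; apply Ccont_mult; auto using Ccont_const|].
        apply Ccont_Cexp, Ccont_opp, Ccont_mult; auto using Ccont_const.
      * apply Ccont_Cexp, Ccont_opp, Ccont_mult; [apply Ccont_const|].
        apply Ccont_mult; apply Ccont_minus; auto using Ccont_id, Ccont_const.
    + intros u. rewrite Cmod_mult.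
      assert (E : Cmod (Cexp (- (RtoC d * ((RtoC u - Ci * RtoC z) * (RtoC u - Ci * RtoC z))))) = exp (d * z ^ 2) * exp (- (d * u ^ 2))).
      { rewrite Cmod_Cexp, <- exp_plus. f_equal.
        change (- Re (RtoC d * ((RtoC u - Ci * RtoC z) * (RtoC u - Ci * RtoC z))) = d * z ^ 2 + - (d * u ^ 2)).
        rewrite Re_mult_R. unfold Re; simpl. ring. }
      rewrite E.
      assert (B1 := kerC_envelope (INR (S k)) (u + v) y). assert (B2 := H k (u + v)). assert (B3 := quad_exp_bound d v u Hd).
      apply Rle_trans with ((C0 * inv_sq k * exp (4 * Rabs (u + v))) * (exp (d * z ^ 2) * exp (- (d * u ^ 2)))).
      { apply Rmult_le_compat_r; [apply Rmult_le_pos; left; apply exp_pos|lra]. }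
      replace (C0 * inv_sq k * exp (4 * Rabs (u + v)) * (exp (d * z ^ 2) * exp (- (d * u ^ 2)))) with
        (C0 * inv_sq k * exp (d * z ^ 2) * (exp (4 * Rabs (u + v)) * exp (- (d * u ^ 2)))) by ring.
      unfold K0. replace (C0 * exp (d * z ^ 2) * exp (4 * Rabs v + 25 / (4 * d)) * inv_sq k * exp (- (1) * Rabs u)) with
        (C0 * inv_sq k * exp (d * z ^ 2) * (exp (4 * Rabs v + 25 / (4 * d)) * exp (- (1) * Rabs u))) by ring.
      apply Rmult_le_compat_l; auto.
      apply Rmult_le_pos; [apply Rmult_le_pos; [lra|left; apply inv_sq_pos]|left; apply exp_pos].
  - apply (ex_series_scal (V := R_NormedModule)). apply ex_series_inv_sq.
  - intros u.
    apply (Cser_ext (fun k => Cexp (- (RtoC d * ((RtoC u - Ci * RtoC z) * (RtoC u - Ci * RtoC z)))) * kerC (INR (S k)) (xy (u + v) y)))%C; [intros; ring|].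
    rewrite (Cmult_comm (PhiC _)). apply Cser_scal, PhiC_Cser; auto.
  - eauto.
Qed.

Lemma PhiC_contour v al d : 0 < d -> 0 <= al < PI / 4 ->
  CI (fun u => RtoC (Phi0 (u + v)) * Cexp (- (RtoC d * ((RtoC u - Ci * RtoC al) * (RtoC u - Ci * RtoC al)))))%C =
  CI (fun u => PhiC (xy (u + v) al) * Cexp (- (RtoC d * (RtoC u * RtoC u))))%C.
Proof.
  intros Hd Hal.
  assert (H0 : 0 < cos (2 * 0)) by (rewrite Rmult_0_r, cos_0; lra).
  assert (Ha : 0 < cos (2 * al)) by (apply cos_gt_0; generalize PI_RGT_0; lra).
  destruct (PhiC_CI_series 0 al v d Hd H0) as [K1 [_ S1]].
  destruct (PhiC_CI_series al 0 v d Hd Ha) as [K2 [_ S2]].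
  rewrite (CI_ext (fun u => RtoC (Phi0 (u + v)) * Cexp (- (RtoC d * ((RtoC u - Ci * RtoC al) * (RtoC u - Ci * RtoC al)))))%C
   (fun u => PhiC (xy (u + v) 0) * Cexp (- (RtoC d * ((RtoC u - Ci * RtoC al) * (RtoC u - Ci * RtoC al)))))%C) by (intros; rewrite PhiC_R; auto).
  rewrite (CI_ext (fun u => PhiC (xy (u + v) al) * Cexp (- (RtoC d * (RtoC u * RtoC u))))%C
    (fun u => PhiC (xy (u + v) al) * Cexp (- (RtoC d * ((RtoC u - Ci * RtoC 0) * (RtoC u - Ci * RtoC 0)))))%C).
  2: { intros. do 4 f_equal. ring. }
  eapply Cser_unique; [exact S1|]. eapply Cser_ext; [|exact S2].
  intros k. simpl.
  rewrite (CI_ext _ (fun u => kerC (INR (S k)) (xy (u + v) al) * Cexp (- (RtoC d * (RtoC u * RtoC u))))%C).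
  2: { intros. do 4 f_equal. ring. }
  rewrite <- ker_contour; [|apply lt_0_INR; lia|auto|lra].
  apply CI_ext. intros u. rewrite xy_0, kerC_R. auto.
Qed.

(** After the contour shift the Gaussian is real and centred at 0; the dilation u = 2 eta s
    normalises its width and cancels the factor 1 / eta. *)
Lemma J_formula2 eta v al : 0 < eta -> 0 <= al < PI / 4 ->
  exists c K, 0 < c /\ Cdecay c K (fun s => PhiC (xy (2 * eta * s + v) al) * gauss (RtoC s))%C /\
  J eta v al = (4 * Kg * CI (fun s => PhiC (xy (2 * eta * s + v) al) * gauss (RtoC s)))%C.
Proof.
  intros He Hal. set (d := / (4 * eta ^ 2)).
  assert (P4 : 0 < 4 * eta ^ 2) by (apply Rmult_lt_0_compat; [lra|apply pow_lt; auto]).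
  assert (Hd : 0 < d) by (apply Rinv_0_lt_compat; auto).
  assert (H0 : 0 < cos (2 * 0)) by (rewrite Rmult_0_r, cos_0; lra).
  assert (Ha : 0 < cos (2 * al)) by (apply cos_gt_0; generalize PI_RGT_0; lra).
  assert (Ne : RtoC eta <> 0%C). { intros Q. apply (f_equal Re) in Q. simpl in Q. lra. }
  destruct (PhiC_CI_series 0 al v d Hd H0) as [K1 [W1 _]].
  destruct (PhiC_CI_series al 0 v d Hd Ha) as [K2 [W2 _]].
  set (F := fun u => (PhiC (xy (u + v) al) * Cexp (- (RtoC d * ((RtoC u - Ci * RtoC 0) * (RtoC u - Ci * RtoC 0)))))%C) in *.
  assert (E2 : forall s, F (2 * eta * s) = (PhiC (xy (2 * eta * s + v) al) * gauss (RtoC s))%C).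
  { intros s. unfold F, gauss. do 3 f_equal. unfold d.
    rewrite RtoC_inv by lra. rewrite !RtoC_mult, RtoC_pow. simpl Cpow. field. auto. }
  exists (1 * (2 * eta)), K2. split; [lra|]. split.
  { eapply Cdecay_ext; [exact E2|]. apply (Cdecay_dilate 1 K2 (2 * eta) F); auto. lra. }
  rewrite J_formula1 by auto. fold d.
  set (G := fun u => (RtoC (Phi0 (u + v)) * Cexp (- (RtoC d * ((RtoC u - Ci * RtoC al) * (RtoC u - Ci * RtoC al)))))%C).
  assert (W1' : Cdecay 1 K1 G).
  { eapply Cdecay_ext; [|exact W1]. intros; unfold G; simpl. rewrite PhiC_R; auto. }
  rewrite (CI_ext _ (fun u => G (u + - v))).
  2: { intros u. unfold G. f_equal; [do 2 f_equal; ring|]. do 2 f_equal. unfold xy. rewrite RtoC_plus, RtoC_opp. f_equal. ring. }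
  rewrite (CI_shift 1 K1 (- v) G Rlt_0_1 W1'). unfold G. rewrite PhiC_contour by auto.
  rewrite (CI_ext _ F).
  2: { intros u. unfold F. do 4 f_equal. ring. }
  rewrite <- (CI_dilate 1 K2 (2 * eta) F Rlt_0_1 ltac:(lra) W2).
  rewrite (CI_ext _ _ E2).
  rewrite RtoC_inv by lra. rewrite RtoC_mult. field. auto.
Qed.

(** By [PhiC_Lip], replacing [PhiC] at v + 2 eta s by its value at v costs O(eta). The limiting
    factor 4 Kg^2 does not depend on v and al. *)
Lemma J_limit v al : 0 <= al < PI / 4 -> exists B, forall eta, 0 < eta <= 1 ->
  Cmod (J eta v al - 4 * Kg * (Kg * PhiC (xy v al))) <= B * eta.
Proof.
  intros Hal.
  assert (Ha : 0 < cos (2 * al)) by (apply cos_gt_0; generalize PI_RGT_0; lra).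
  destruct (PhiC_Lip al Ha) as [L [HL Lip]].
  destruct (Cdecay_gauss 0) as [K0 W0].
  set (P := PhiC (xy v al)).
  (* For eta <= 1 the exponent is at most 4|v| + 9|s| - s^2, and 10|s| - s^2 <= 25 leaves
     e^(-|s|). *)
  set (B1 := 2 * L * exp (4 * Rabs v) * exp (25)).
  exists (Cmod (4 * Kg) * (4 * B1)). intros eta He.
  destruct (J_formula2 eta v al ltac:(lra) Hal) as [c [K [Hc [W ->]]]].
  assert (W0' : Cdecay 1 (Cmod P * K0) (fun s => P * gauss (RtoC s))%C).
  { apply Cdecay_scal. eapply Cdecay_ext; [|exact W0]. intros s; simpl. rewrite xy_0; auto. }
  set (c1 := Rmin c 1). assert (Hc1 : 0 < c1) by (apply Rmin_glb_lt; lra).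
  assert (V := Cdecay_weaken c c1 K K _ (Rmin_l _ _) (Rle_refl _) W).
  assert (V0 := Cdecay_weaken 1 c1 _ _ _ (Rmin_r c 1) (Rle_refl _) W0').
  assert (D := Cdecay_minus _ _ _ _ _ V V0).
  assert (W1 : Cdecay 1 (B1 * eta) (fun s => PhiC (xy (2 * eta * s + v) al) * gauss (RtoC s) - P * gauss (RtoC s))%C).
  { split; [apply D|]. intros s.
    replace (PhiC (xy (2 * eta * s + v) al) * gauss (RtoC s) - P * gauss (RtoC s))%C with
      ((PhiC (xy (2 * eta * s + v) al) - P) * gauss (RtoC s))%C by ring.
    rewrite Cmod_mult. replace (2 * eta * s + v) with (v + 2 * eta * s) by ring.
    assert (Q := Lip v (2 * eta * s)). fold P in Q.
    assert (E : Cmod (gauss (RtoC s)) = exp (- s ^ 2)).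
    { unfold gauss. rewrite Cmod_Cexp. f_equal. unfold Re; simpl. ring. }
    rewrite E.
    assert (As := Rabs_pos s).
    assert (R1 : Rabs (2 * eta * s) = 2 * eta * Rabs s) by (rewrite !Rabs_mult, (Rabs_pos_eq 2), (Rabs_pos_eq eta); lra).
    rewrite R1 in Q.
    eapply Rle_trans; [apply Rmult_le_compat_r; [left; apply exp_pos|exact Q]|].
    unfold B1.
    replace (L * (2 * eta * Rabs s * exp (4 * (Rabs v + 2 * eta * Rabs s))) * exp (- s ^ 2)) with
      (2 * L * eta * (Rabs s * exp (4 * (Rabs v + 2 * eta * Rabs s)) * exp (- s ^ 2))) by ring.
    replace (2 * L * exp (4 * Rabs v) * exp 25 * eta * exp (- (1) * Rabs s)) with
      (2 * L * eta * (exp (4 * Rabs v) * exp 25 * exp (- (1) * Rabs s))) by ring.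
    apply Rmult_le_compat_l; [apply Rmult_le_pos; lra|].
    apply Rle_trans with (exp (Rabs s) * exp (4 * (Rabs v + 2 * eta * Rabs s)) * exp (- s ^ 2)).
    - apply Rmult_le_compat_r; [left; apply exp_pos|]. apply Rmult_le_compat_r; [left; apply exp_pos|].
      generalize (exp_ineq1_le (Rabs s)). lra.
    - rewrite <- !exp_plus. apply exp_le. rewrite <- (pow2_abs s).
      generalize (pow2_ge_0 (Rabs s - 5)). nra. }
  replace (4 * Kg * CI (fun s => PhiC (xy (2 * eta * s + v) al) * gauss (RtoC s)) - 4 * Kg * (Kg * P))%C with
    (4 * Kg * CI (fun s => PhiC (xy (2 * eta * s + v) al) * gauss (RtoC s) - P * gauss (RtoC s)))%C.
  2: { rewrite (CI_minus c1 K (Cmod P * K0)); auto.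
       rewrite (CI_scal 1 K0) ; [unfold Kg at 3; ring|lra|].
       eapply Cdecay_ext; [|exact W0]. intros s; simpl. rewrite xy_0; auto. }
  rewrite Cmod_mult. rewrite Rmult_assoc. apply Rmult_le_compat_l; [apply Cmod_ge_0|].
  eapply Rle_trans; [apply (CI_bound 1 (B1 * eta)); [lra|exact W1]|]. unfold Rdiv. rewrite Rinv_1. lra.
Qed.

Lemma Cmod_damp eta v al t : Cmod (damp eta v al t) = exp (al * t - eta ^ 2 * t ^ 2).
Proof.
  unfold damp, Ef, Qexp. rewrite Cmod_Cexp. f_equal. unfold xy, Re; simpl. ring.
Qed.

Lemma damp_real eta al t : damp eta 0 al t = RtoC (exp (al * t - eta ^ 2 * t ^ 2)).
Proof.
  unfold damp, Ef, Qexp. rewrite <- Cexp_R. f_equal. unfold xy. apply Ceq; unfold Re, Im; simpl; ring.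
Qed.

Lemma X_real t : X (RtoC t) = RtoC (Re (X (RtoC t))).
Proof. apply T_real, even_rapid_Phi0. Qed.

(* |X| differs from +-X only on a bounded set, so a constant sign of X at infinity makes J almost maximal on the imaginary axis. *)
Lemma J_ineq e T0 : (e = 1 \/ e = -1) -> (forall t, T0 <= Rabs t -> 0 <= e * Re (X (RtoC t))) ->
  exists B, forall eta v al, 0 < eta -> 0 <= al <= 1 -> Cmod (J eta v al) <= Cmod (J eta 0 al) + B.
Proof.
  intros He Hs. destruct X_bounded as [M [HM HX]].
  (* For |t| < T0 the weight is at most e^|t| <= e^(2 T0) e^(-|t|) and the defect |X| -+ X at most 2
     M, so the defect decays at rate 1 with constant B, uniformly in eta, v and al. *)
  set (B := 2 * M * exp (2 * Rabs T0)). exists (2 * B / 1). intros eta v al Heta Hal.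
  destruct (J_Cdecay eta v al Heta) as [K1 W1]. destruct (J_Cdecay eta 0 al Heta) as [K0 W0].
  set (x := fun t => Re (X (RtoC t))).
  set (w := fun t => exp (al * t - eta ^ 2 * t ^ 2)).
  assert (Hw : forall t, 0 < w t) by (intros; apply exp_pos).
  assert (Ax : forall t, Cmod (X (RtoC t)) = Rabs (x t)) by (intros; rewrite X_real, Cmod_R; auto).
  assert (E1 : forall t, Cmod (damp eta v al t * X (RtoC t)) = w t * Rabs (x t)).
  { intros t. rewrite Cmod_mult, Cmod_damp, Ax. auto. }
  assert (R0 : Rdecay 1 K0 (fun t => w t * x t)).
  { destruct (Cdecay_re _ _ _ W0) as [A A']. split.
    - intros t. apply (continuous_ext (fun u => Re (damp eta 0 al u * X (RtoC u)))); auto.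
      intros u. rewrite damp_real, Re_mult_R. auto.
    - intros t. replace (w t * x t) with (Re (damp eta 0 al t * X (RtoC t))); [apply A'|]. rewrite damp_real, Re_mult_R. auto. }
  assert (RA : Rdecay 1 K0 (fun t => w t * Rabs (x t))).
  { destruct R0 as [A A']. split.
    - intros t. apply (continuous_ext (fun u => Rabs (w u * x u))).
      + intros u. rewrite Rabs_mult, (Rabs_pos_eq (w u)); auto. generalize (Hw u); lra.
      + apply (continuous_comp' (fun u => w u * x u) Rabs); auto. apply continuous_Rabs.
    - intros t. rewrite Rabs_mult, Rabs_Rabsolu, <- Rabs_mult. auto. }
  set (K := Rmax K0 K1).
  apply Rle_trans with (Int (fun t => w t * Rabs (x t))).
  - apply (CI_le 1 K); [lra| | |intros; rewrite E1; lra].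
    + apply (Cdecay_weaken 1 1 K1); [lra|apply Rmax_r|auto].
    + destruct RA as [A A']. split; auto. intros t. eapply Rle_trans; [apply A'|].
      apply Rmult_le_compat_r; [left; apply exp_pos|apply Rmax_l].
  - assert (Rq : Rdecay 1 B (fun t => 1 * (w t * Rabs (x t)) + - e * (w t * x t))).
    { assert (RS := Rdecay_plus 1 _ _ _ _ (Rdecay_scal 1 _ 1 _ RA) (Rdecay_scal 1 _ (- e) _ R0)).
      split; [apply RS|]. intros t.
      replace (1 * (w t * Rabs (x t)) + - e * (w t * x t)) with (w t * (Rabs (x t) - e * x t)) by ring.
      destruct (Rle_or_lt T0 (Rabs t)) as [H|H].
      - specialize (Hs t H). fold (x t) in Hs.
        replace (Rabs (x t)) with (e * x t).
        + rewrite Rminus_eq_0, Rmult_0_r, Rabs_R0. apply Rmult_le_pos; [|left; apply exp_pos].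
          unfold B. apply Rmult_le_pos; [lra|left; apply exp_pos].
        + unfold Rabs. destruct He as [-> | ->], (Rcase_abs (x t)); lra.
      - rewrite Rabs_mult, (Rabs_pos_eq (w t)) by (generalize (Hw t); lra).
        assert (Hx := HX t). rewrite Ax in Hx.
        assert (Rabs (Rabs (x t) - e * x t) <= 2 * M).
        { apply Rabs_le. revert Hx. unfold Rabs. destruct He as [-> | ->], (Rcase_abs (x t)); intros; lra. }
        apply Rle_trans with (w t * (2 * M)); [apply Rmult_le_compat_l; [generalize (Hw t)|]; lra|].
        unfold B. replace (2 * M * exp (2 * Rabs T0) * exp (- (1) * Rabs t)) with ((exp (2 * Rabs T0) * exp (- (1) * Rabs t)) * (2 * M)) by ring.
        apply Rmult_le_compat_r; [lra|]. unfold w. rewrite <- exp_plus. apply exp_le.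
        assert (T0 <= Rabs T0) by apply Rle_abs. assert (t <= Rabs t) by apply Rle_abs.
        generalize (pow2_ge_0 (eta * t)) (Rabs_pos t). nra. }
    assert (E : Int (fun t => 1 * (w t * Rabs (x t)) + - e * (w t * x t)) = 1 * Int (fun t => w t * Rabs (x t)) + - e * Int (fun t => w t * x t))
      by (apply (Int_lin 1 K0 K0); auto; lra).
    assert (Bq := Int_bound 1 B _ Rlt_0_1 Rq).
    assert (EJ : Int (fun t => w t * x t) = Re (J eta 0 al)).
    { change (Re (J eta 0 al)) with (Int (fun t => Re (damp eta 0 al t * X (RtoC t)))). apply Int_ext. intros t. rewrite damp_real, Re_mult_R. auto. }
    assert (HJ := re_le_Cmod (J eta 0 al)). rewrite <- EJ in HJ.
    assert (e * Int (fun t => w t * x t) <= Rabs (Int (fun t => w t * x t))).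
    { unfold Rabs. destruct He as [-> | ->], (Rcase_abs (Int (fun t => w t * x t))); lra. }
    assert (G := Rle_abs (Int (fun t => 1 * (w t * Rabs (x t)) + - e * (w t * x t)))). lra.
Qed.

(** [J_ineq] as eta tends to 0, divided by 4 Kg^2; its constant survives because it is independent
    of eta. *)
Lemma PhiC_ineq e T0 : (e = 1 \/ e = -1) -> (forall t, T0 <= Rabs t -> 0 <= e * Re (X (RtoC t))) ->
  exists B, forall v al, 0 <= al < PI / 4 -> Cmod (PhiC (xy v al)) <= Cmod (PhiC (xy 0 al)) + B.
Proof.
  intros He Hs. destruct (J_ineq e T0 He Hs) as [B HB].
  destruct Kg_pos as [k [Hk Ek]].
  assert (P4 : 0 < 4 * (k * k)) by nra.
  exists (B / (4 * (k * k))). intros v al Hal.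
  destruct (J_limit v al Hal) as [B1 H1]. destruct (J_limit 0 al Hal) as [B2 H2].
  assert (Em : forall w, Cmod (4 * Kg * (Kg * w)) = 4 * (k * k) * Cmod w).
  { intros w. rewrite Ek. replace (4 * RtoC k * (RtoC k * w))%C with (RtoC (4 * (k * k)) * w)%C by (rewrite !RtoC_mult; ring).
    rewrite Cmod_mult, Cmod_R, Rabs_pos_eq; lra. }
  apply Rmult_le_reg_l with (4 * (k * k)); auto.
  replace (4 * (k * k) * (Cmod (PhiC (xy 0 al)) + B / (4 * (k * k)))) with (4 * (k * k) * Cmod (PhiC (xy 0 al)) + B) by (field; lra).
  rewrite <- !Em.
  apply Rle_plus_epsilon. intros eps Heps.
  set (D := Rabs B1 + Rabs B2 + 1). assert (HD : 0 < D) by (generalize (Rabs_pos B1) (Rabs_pos B2); unfold D; lra).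
  set (eta := Rmin 1 (eps / D)).
  assert (He1 : 0 < eta <= 1). { split; [apply Rmin_glb_lt; [lra|apply Rdiv_lt_0_compat; lra]|apply Rmin_l]. }
  assert (He2 : D * eta <= eps).
  { apply Rle_trans with (D * (eps / D)); [apply Rmult_le_compat_l; [lra|apply Rmin_r]|right; field; lra]. }
  specialize (HB eta v al (proj1 He1) ltac:(generalize PI_4; lra)). specialize (H1 eta He1). specialize (H2 eta He1).
  set (a := (4 * Kg * (Kg * PhiC (xy v al)))%C) in *. set (b := (4 * Kg * (Kg * PhiC (xy 0 al)))%C) in *.
  assert (Q1 : Cmod a <= Cmod (J eta v al) + Cmod (J eta v al - a)).
  { replace a with (J eta v al - (J eta v al - a))%C at 1 by ring. eapply Rle_trans; [apply Cmod_triangle|]. rewrite Cmod_opp. lra. }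
  assert (Q2 : Cmod (J eta 0 al) <= Cmod b + Cmod (J eta 0 al - b)).
  { replace (J eta 0 al) with (b + (J eta 0 al - b))%C at 1 by ring. apply Cmod_triangle. }
  assert (B1 * eta + B2 * eta <= D * eta).
  { unfold D. generalize (Rle_abs B1) (Rle_abs B2). nra. }
  lra.
Qed.

(** * Growth of the continued series as al tends to pi/4 *)

Lemma Series_exp_geom_le M : 0 < M -> Series (fun k => exp (- (/ M * INR (S k)))) <= M.
Proof.
  intros HM. assert (HiM := Rinv_0_lt_compat _ HM).
  set (rho := exp (- / M)).
  assert (Hr : 0 < rho < 1). { split; [apply exp_pos|]. rewrite <- exp_0. apply exp_increasing. lra. }
  rewrite (Series_ext _ (fun k => rho * rho ^ k)).
  2: { intros k. unfold rho. rewrite exp_pow_INR, <- exp_plus, S_INR. f_equal. ring. }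
  rewrite Series_scal_l, Series_geom by (rewrite Rabs_pos_eq; lra).
  assert (E : rho * (1 + / M) <= 1).
  { assert (G := exp_ineq1_le (/ M)). assert (F : rho * exp (/ M) = 1).
    { unfold rho. rewrite <- exp_plus. replace (- / M + / M) with 0 by ring. apply exp_0. }
    rewrite <- F. apply Rmult_le_compat_l; lra. }
  apply Rmult_le_reg_r with (1 - rho); [lra|]. rewrite Rmult_assoc, Rinv_l, Rmult_1_r by lra.
  assert (M * (rho * (1 + / M)) <= M * 1) by (apply Rmult_le_compat_l; lra).
  replace (M * (rho * (1 + / M))) with (M * rho + rho) in H by (field; lra). lra.
Qed.

(** Converts Gaussian bounds, with 3 <= PI, into exponentials that sum geometrically. *)
Lemma pow_gauss_le j y : 0 <= y -> y ^ j * exp (- (3 * y ^ 2)) <= INR (fact j) * exp 1 * exp (- y).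
Proof.
  intros Hy. assert (HF := INR_fact_lt_0 j).
  assert (H := pow_fact_le_exp j y Hy).
  assert (H1 : y ^ j <= INR (fact j) * exp y).
  { apply Rmult_le_reg_r with (/ INR (fact j)); [apply Rinv_0_lt_compat; auto|].
    replace (INR (fact j) * exp y * / INR (fact j)) with (exp y) by (field; lra). exact H. }
  apply Rle_trans with (INR (fact j) * exp y * exp (- (3 * y ^ 2))); [apply Rmult_le_compat_r; [left; apply exp_pos|auto]|].
  rewrite !Rmult_assoc. apply Rmult_le_compat_l; [lra|]. rewrite <- !exp_plus. apply exp_le.
  generalize (pow2_ge_0 (y - 1 / 3)). nra.
Qed.

(** Twice the sum is a_0 plus the sum of a_k + a_(k+1). *)
Lemma Cser_alternating a l b : Cser a l -> (forall k, Cmod (a k + a (S k)) <= b k) -> ex_series b ->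
  2 * Cmod l <= Cmod (a 0%nat) + Series b.
Proof.
  intros Ha Hb Eb. assert (H1 := Cser_incr_n a l 1 Ha).
  assert (H2 := Cser_plus _ _ _ _ Ha H1).
  assert (B := Cser_le _ b _ H2 Hb Eb).
  replace (2 * Cmod l) with (Cmod (RtoC 2 * l)) by (rewrite Cmod_mult, Cmod_R, Rabs_pos_eq; lra).
  replace (RtoC 2 * l)%C with (a 0%nat + (l + (l - Csum a 1)))%C.
  - eapply Rle_trans; [apply Cmod_triangle|]. apply Rplus_le_compat_l. exact B.
  - replace (Csum a 1) with (a 0%nat); [ring|]. simpl. try ring.
Qed.

Lemma Cser_Re_ge a l (w : C) g : Cser a l -> Cmod w = 1 -> (forall k, g k <= Re (w * a k)) -> ex_series g ->
  Series g <= Cmod l.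
Proof.
  intros Ha Hw Hg Eg.
  assert (H := Cser_scal w a l Ha). apply Cser_components in H. destruct H as [H _].
  apply Rle_trans with (Re (w * l)).
  - destruct Eg as [s Hs]. rewrite (is_series_unique _ _ Hs).
    apply (is_lim_seq_le (sum_n g) (sum_n (fun k => Re (w * a k))) s (Re (w * l))); auto.
    intros n. apply sum_n_m_le. auto.
  - eapply Rle_trans; [apply Rle_abs|]. eapply Rle_trans; [apply re_le_Cmod|]. rewrite Cmod_mult, Hw. lra.
Qed.

Lemma cos_sin_nat n : cos (INR n * PI) = (-1) ^ n /\ sin (INR n * PI) = 0.
Proof.
  induction n as [|n [IH1 IH2]].
  - simpl. rewrite Rmult_0_l, cos_0, sin_0. auto.
  - rewrite S_INR, Rmult_plus_distr_r, Rmult_1_l, neg_cos, neg_sin, IH1, IH2. simpl. split; ring.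
Qed.

(** The phase e^(-i PI n^2), which is (-1)^n, kept with the exponent n^2 in which it arises. *)
Definition sgn (n : nat) : R := (-1) ^ (n * n).

Lemma sgn_S n : sgn (S n) = - sgn n.
Proof.
  unfold sgn. replace (S n * S n)%nat with (n * n + (2 * n + 1))%nat by lia.
  rewrite pow_add, (pow_add _ (2 * n)), (pow_mult _ 2 n). replace ((-1) ^ 2) with 1 by ring. rewrite pow1. ring.
Qed.

Lemma sgn_sq n : Rabs (sgn n) = 1.
Proof. apply pow_1_abs. Qed.

Lemma Cexp_sgn n m : Cexp (- (RtoC (INR m * PI * INR n ^ 2) * Ci)) = RtoC (sgn n ^ m).
Proof.
  replace (- (RtoC (INR m * PI * INR n ^ 2) * Ci))%C with ((0, - (INR (n * n * m) * PI)) : C).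
  2: { rewrite !mult_INR. apply Ceq; simpl; ring. }
  unfold Cexp, Re, Im; simpl. rewrite exp_0, cos_neg, sin_neg.
  destruct (cos_sin_nat (n * n * m)) as [-> ->]. unfold sgn. rewrite pow_mult. apply Ceq; simpl; ring.
Qed.

(** For x = 0 and e^(2 i al) = p + i, this is [kerC r] without the oscillating factor e^(-i PI r^2).
    It is smooth in the real variable r, so differences of consecutive terms can be estimated by its
    derivative. *)
Definition ikernel (x : R) (al : R) (p : C) (r : R) : C :=
  ((RtoC (2 * PI ^ 2 * r ^ 4) * Cexp (RtoC (9 / 2) * xy x al) - RtoC (3 * PI * r ^ 2) * Cexp (RtoC (5 / 2) * xy x al))
    * Cexp (- (RtoC (PI * r ^ 2) * p)))%C.

Lemma kerC_imag al p n : Cexp (2 * xy 0 al) = (p + Ci)%C ->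
  kerC (INR n) (xy 0 al) = (RtoC (sgn n) * ikernel 0 al p (INR n))%C.
Proof.
  intros Hp. unfold kerC, ikernel. rewrite Hp.
  replace (- (RtoC (PI * INR n ^ 2) * (p + Ci)))%C with (- (RtoC (PI * INR n ^ 2) * p) + - (RtoC (INR 1 * PI * INR n ^ 2) * Ci))%C.
  2: { simpl INR. rewrite Rmult_1_l. ring. }
  rewrite Cexp_plus, Cexp_sgn, pow_1. ring.
Qed.

Lemma Cmod_gauss_p p r : Cmod (Cexp (- (RtoC (PI * r ^ 2) * p))) = exp (- (PI * r ^ 2 * Re p)).
Proof.
  rewrite Cmod_Cexp. f_equal. change (- Re (RtoC (PI * r ^ 2) * p) = - (PI * r ^ 2 * Re p)). rewrite Re_mult_R. auto.
Qed.

Definition ikernel' (al : R) (p : C) (r : R) : C :=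
  ((RtoC (8 * PI ^ 2 * r ^ 3) * Cexp (RtoC (9 / 2) * xy 0 al) - RtoC (6 * PI * r) * Cexp (RtoC (5 / 2) * xy 0 al))
    * Cexp (- (RtoC (PI * r ^ 2) * p)) - RtoC (2 * PI * r) * p * ikernel 0 al p r)%C.

Lemma Cderiv_RtoC_mul (g : R -> R) r l (c : C) : is_derive g r l -> Cderiv (fun r => RtoC (g r) * c)%C r (RtoC l * c)%C.
Proof.
  intros H. apply (Cderiv_eq _ _ (RtoC l * c + RtoC (g r) * 0)%C); [ring|].
  apply (Cderiv_mult (fun r => RtoC (g r)) (fun _ => c)); [apply Cderiv_RtoC; auto|apply Cderiv_const].
Qed.

Lemma Cderiv_ikernel al p r : Cderiv (ikernel 0 al p) r (ikernel' al p r).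
Proof.
  unfold ikernel', ikernel. generalize (Cexp (RtoC (9 / 2) * xy 0 al)) (Cexp (RtoC (5 / 2) * xy 0 al)). intros c9 c5.
  set (g := fun r => (RtoC (2 * PI ^ 2 * r ^ 4) * c9 - RtoC (3 * PI * r ^ 2) * c5)%C).
  set (h := fun r => (- (RtoC (PI * r ^ 2) * p))%C).
  assert (Dg : Cderiv g r (RtoC (8 * PI ^ 2 * r ^ 3) * c9 - RtoC (6 * PI * r) * c5)%C).
  { apply (Cderiv_minus (fun r => RtoC (2 * PI ^ 2 * r ^ 4) * c9)%C (fun r => RtoC (3 * PI * r ^ 2) * c5)%C).
    - apply (Cderiv_RtoC_mul (fun r => 2 * PI ^ 2 * r ^ 4)). auto_derive; auto; ring.
    - apply (Cderiv_RtoC_mul (fun r => 3 * PI * r ^ 2)). auto_derive; auto; ring. }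
  assert (Dh : Cderiv h r (- (RtoC (2 * PI * r) * p))%C).
  { apply (Cderiv_opp (fun r => RtoC (PI * r ^ 2) * p)%C), (Cderiv_RtoC_mul (fun r => PI * r ^ 2)). auto_derive; auto; ring. }
  refine (Cderiv_eq _ _ _ _ _ (Cderiv_mult g (fun r => Cexp (h r)) r _ _ Dg (Cderiv_Cexp h r _ Dh))).
  unfold g, h. ring.
Qed.

(** In the scaled variable y = r / M only y, y^3 and y^5 times e^(-3 y^2) occur, bounded by 1, 6 and
    120 times e^(1 - y): 24 + (128 + 192) 6 + 512 120 = 63384. *)
Lemma ikernel'_bound al p M r : 1 <= M -> 0 <= r -> Re p = / M ^ 2 -> Cmod p <= 2 / M ^ 2 ->
  Cmod (ikernel' al p r) <= 63384 * exp 1 * (M ^ 3 * exp (- (/ M * r))).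
Proof.
  intros HM Hr Hp1 Hp2.
  set (y := / M * r).
  assert (HiM : 0 < / M) by (apply Rinv_0_lt_compat; lra).
  assert (Hy : 0 <= y) by (apply Rmult_le_pos; lra).
  assert (Er : r = M * y) by (unfold y; field; lra).
  destruct PI_bounds as [HP1 HP2].
  assert (HP3 : PI ^ 2 <= 16) by nra.
  assert (HP4 : 0 <= PI ^ 2) by apply pow2_ge_0.
  assert (E9 : Cmod (Cexp (RtoC (9 / 2) * xy 0 al)) = 1) by (rewrite Cmod_exp_xy, Rmult_0_r; apply exp_0).
  assert (E5 : Cmod (Cexp (RtoC (5 / 2) * xy 0 al)) = 1) by (rewrite Cmod_exp_xy, Rmult_0_r; apply exp_0).
  set (E := exp (- (3 * y ^ 2))).
  assert (HE : 0 < E) by apply exp_pos.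
  assert (EE : Cmod (Cexp (- (RtoC (PI * r ^ 2) * p))) <= E).
  { rewrite Cmod_gauss_p. apply exp_le. rewrite Hp1.
    replace (PI * r ^ 2 * / M ^ 2) with (PI * y ^ 2) by (rewrite Er; field; lra). generalize (pow2_ge_0 y). nra. }
  assert (P1 := pow_gauss_le 1 y Hy). assert (P3 := pow_gauss_le 3 y Hy). assert (P5 := pow_gauss_le 5 y Hy).
  fold E in P1, P3, P5.
  replace (INR (fact 1)) with 1 in P1 by (simpl; ring). replace (INR (fact 3)) with 6 in P3 by (simpl; ring).
  replace (INR (fact 5)) with 120 in P5 by (simpl; ring).
  fold y. set (e := exp 1 * exp (- y)). 
  replace (1 * exp 1 * exp (- y)) with e in P1 by (unfold e; ring).
  replace (6 * exp 1 * exp (- y)) with (6 * e) in P3 by (unfold e; ring).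
  replace (120 * exp 1 * exp (- y)) with (120 * e) in P5 by (unfold e; ring).
  replace (63384 * exp 1 * (M ^ 3 * exp (- y))) with (M ^ 3 * (63384 * e)) by (unfold e; ring).
  assert (He : 0 < e) by (apply Rmult_lt_0_compat; apply exp_pos).
  assert (HM3 : M <= M ^ 3) by (replace (M ^ 3) with (M * M * M) by ring; nra).
  assert (Q8 : 0 <= 8 * PI ^ 2 * r ^ 3) by (apply Rmult_le_pos; [lra|apply pow_le; auto]).
  assert (Q6 : 0 <= 6 * PI * r) by (apply Rmult_le_pos; lra).
  assert (A1 : Cmod (RtoC (8 * PI ^ 2 * r ^ 3) * Cexp (RtoC (9 / 2) * xy 0 al) - RtoC (6 * PI * r) * Cexp (RtoC (5 / 2) * xy 0 al))
    <= M ^ 3 * (128 * y ^ 3 + 24 * y ^ 1)).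
  { eapply Rle_trans; [apply Cmod_triangle|]. rewrite Cmod_opp, !Cmod_mult, E9, E5, !Cmod_RtoC_pos, !Rmult_1_r by auto.
    rewrite Er. replace (8 * PI ^ 2 * (M * y) ^ 3) with (M ^ 3 * y ^ 3 * (8 * PI ^ 2)) by ring.
    assert (0 <= y ^ 3) by (apply pow_le; auto). assert (0 <= M ^ 3) by (apply pow_le; lra).
    assert (M ^ 3 * y ^ 3 * (8 * PI ^ 2) <= M ^ 3 * y ^ 3 * 128) by (apply Rmult_le_compat_l; [apply Rmult_le_pos; auto|lra]).
    assert (6 * PI * (M * y) <= 24 * (M ^ 3 * y)).
    { assert (M * y <= M ^ 3 * y) by (apply Rmult_le_compat_r; lra).
      assert (0 <= M * y) by (apply Rmult_le_pos; lra). nra. }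
    lra. }
  assert (A2 : Cmod (RtoC (2 * PI * r) * p * ikernel 0 al p r) <= M ^ 3 * (512 * y ^ 5 + 192 * y ^ 3) * E).
  { unfold ikernel. rewrite !Cmod_mult, Cmod_RtoC_pos by (apply Rmult_le_pos; lra).
    assert (B1 : Cmod (RtoC (2 * PI ^ 2 * r ^ 4) * Cexp (RtoC (9 / 2) * xy 0 al) - RtoC (3 * PI * r ^ 2) * Cexp (RtoC (5 / 2) * xy 0 al))
     <= 2 * PI ^ 2 * r ^ 4 + 3 * PI * r ^ 2).
    { eapply Rle_trans; [apply Cmod_triangle|]. rewrite Cmod_opp, !Cmod_mult, E9, E5, !Cmod_RtoC_pos, !Rmult_1_r; [lra|apply coef5_pos|apply coef9_pos]. }
    assert (B2 : 2 * PI ^ 2 * r ^ 4 + 3 * PI * r ^ 2 <= M ^ 4 * (32 * y ^ 4 + 12 * y ^ 2)).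
    { rewrite Er. replace (2 * PI ^ 2 * (M * y) ^ 4) with (M ^ 4 * y ^ 4 * (2 * PI ^ 2)) by ring.
      assert (0 <= y ^ 4) by (apply pow_le; auto). assert (0 <= M ^ 4) by (apply pow_le; lra).
      assert (M ^ 4 * y ^ 4 * (2 * PI ^ 2) <= M ^ 4 * y ^ 4 * 32) by (apply Rmult_le_compat_l; [apply Rmult_le_pos; auto|lra]).
      assert (M ^ 2 <= M ^ 4). { replace (M ^ 4) with (M ^ 2 * M ^ 2) by ring. assert (1 <= M ^ 2) by nra. nra. }
      assert (3 * PI * (M * y) ^ 2 <= 12 * (M ^ 4 * y ^ 2)).
      { assert ((M * y) ^ 2 <= M ^ 4 * y ^ 2) by (rewrite Rpow_mult_distr; apply Rmult_le_compat_r; [apply pow2_ge_0|auto]).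
        assert (0 <= (M * y) ^ 2) by apply pow2_ge_0. nra. }
      lra. }
    assert (B3 : 2 * PI * r * Cmod p <= 16 * y / M).
    { apply Rle_trans with (2 * PI * r * (2 / M ^ 2)).
      - apply Rmult_le_compat_l; auto. apply Rmult_le_pos; lra.
      - rewrite Er. replace (2 * PI * (M * y) * (2 / M ^ 2)) with (4 * PI * (y / M)) by (field; lra).
        assert (0 <= y / M) by (apply Rmult_le_pos; lra). replace (16 * y / M) with (16 * (y / M)) by (field; lra). nra. }
    replace (M ^ 3 * (512 * y ^ 5 + 192 * y ^ 3) * E) with ((16 * y / M) * ((M ^ 4 * (32 * y ^ 4 + 12 * y ^ 2)) * E)) by (field; lra).
    apply Rmult_le_compat; auto.
    - apply Rmult_le_pos; [apply Rmult_le_pos; lra|apply Cmod_ge_0].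
    - apply Rmult_le_pos; apply Cmod_ge_0.
    - apply Rmult_le_compat; auto using Cmod_ge_0. lra. }
  unfold ikernel'. eapply Rle_trans; [apply Cmod_triangle|]. rewrite Cmod_opp, (Cmod_mult (_ - _)).
  assert (A3 := Rmult_le_compat _ _ _ _ (Cmod_ge_0 _) (Cmod_ge_0 _) A1 EE).
  apply Rle_trans with (M ^ 3 * (128 * (y ^ 3 * E) + 24 * (y ^ 1 * E) + (512 * (y ^ 5 * E) + 192 * (y ^ 3 * E)))); [lra|].
  apply Rmult_le_compat_l; [apply pow_le; lra|lra].
Qed.

(* Here e^(2 i al) = p + i with p small, so r contributes (-1)^r times a function of r that varies on the scale M: pairing
   consecutive terms gains a factor M over the trivial bound M^5. *)
Lemma PhiC_upper M al p : 1 <= M -> 0 < cos (2 * al) -> Cexp (2 * xy 0 al) = (p + Ci)%C -> Re p = / M ^ 2 -> Cmod p <= 2 / M ^ 2 ->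
  Cmod (PhiC (xy 0 al)) <= 50 + 63384 * exp 1 * M ^ 4.
Proof.
  intros HM Hc Hp Hp1 Hp2.
  assert (HiM : 0 < / M) by (apply Rinv_0_lt_compat; lra).
  set (D := 63384 * exp 1 * M ^ 3).
  assert (HD : 0 <= D). { apply Rmult_le_pos; [generalize (exp_pos 1); lra|apply pow_le; lra]. }
  assert (H := Cser_alternating _ _ (fun k => 2 * D * exp (- (/ M * INR (S k)))) (PhiC_Cser 0 al Hc)).
  assert (B0 : Cmod (kerC (INR 1) (xy 0 al)) <= 50).
  { rewrite (kerC_imag al p 1 Hp), Cmod_mult, Cmod_R, sgn_sq, Rmult_1_l. unfold ikernel. rewrite Cmod_mult, Cmod_gauss_p.
    simpl INR. rewrite !pow1, !Rmult_1_r.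
    assert (E9 : Cmod (Cexp (RtoC (9 / 2) * xy 0 al)) = 1) by (rewrite Cmod_exp_xy, Rmult_0_r; apply exp_0).
    assert (E5 : Cmod (Cexp (RtoC (5 / 2) * xy 0 al)) = 1) by (rewrite Cmod_exp_xy, Rmult_0_r; apply exp_0).
    destruct PI_bounds as [HP1 HP2].
    rewrite <- (Rmult_1_r 50). apply Rmult_le_compat; [apply Cmod_ge_0|left; apply exp_pos| |].
    - eapply Rle_trans; [apply Cmod_triangle|]. rewrite Cmod_opp, !Cmod_mult, E9, E5, !Cmod_RtoC_pos by (nra || lra). nra.
    - apply Rle_trans with (exp 0); [apply exp_le|rewrite exp_0; lra]. rewrite Hp1. assert (0 < / M ^ 2) by (apply Rinv_0_lt_compat, pow_lt; lra). nra. }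
  assert (ES : Series (fun k => 2 * D * exp (- (/ M * INR (S k)))) <= 2 * D * M).
  { rewrite Series_scal_l. apply Rmult_le_compat_l; [lra|apply Series_exp_geom_le; lra]. }
  assert (2 * Cmod (PhiC (xy 0 al)) <= Cmod (kerC (INR 1) (xy 0 al)) + Series (fun k => 2 * D * exp (- (/ M * INR (S k))))).
  { apply H.
    - intros k. rewrite !(kerC_imag al p _ Hp), (sgn_S (S k)).
      replace (RtoC (sgn (S k)) * ikernel 0 al p (INR (S k)) + RtoC (- sgn (S k)) * ikernel 0 al p (INR (S (S k))))%C
        with (- (RtoC (sgn (S k)) * (ikernel 0 al p (INR (S (S k))) - ikernel 0 al p (INR (S k)))))%C by (rewrite RtoC_opp; ring).
      rewrite Cmod_opp, Cmod_mult, Cmod_R, sgn_sq, Rmult_1_l.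
      assert (Q := Cderiv_bounded (ikernel 0 al p) (ikernel' al p) (INR (S k)) (INR (S (S k))) (D * exp (- (/ M * INR (S k))))).
      rewrite (S_INR (S k)) in *. replace (INR (S k) + 1 - INR (S k)) with 1 in Q by ring. rewrite Rabs_R1, Rmult_1_r in Q.
      replace (2 * D * exp (- (/ M * INR (S k)))) with (2 * (D * exp (- (/ M * INR (S k))))) by ring.
      apply Q.
      + intros; apply Cderiv_ikernel.
      + rewrite Rmin_left, Rmax_right by lra. intros t Ht. assert (K := pos_INR (S k)).
        eapply Rle_trans; [apply (ikernel'_bound al p M); auto; lra|].
        unfold D. replace (63384 * exp 1 * M ^ 3 * exp (- (/ M * INR (S k)))) with (63384 * exp 1 * (M ^ 3 * exp (- (/ M * INR (S k))))) by ring.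
        apply Rmult_le_compat_l; [generalize (exp_pos 1); lra|]. apply Rmult_le_compat_l; [apply pow_le; lra|].
        apply exp_le. nra.
    - apply (ex_series_scal (V := R_NormedModule)). apply ex_series_exp_geom; auto. }
  replace (63384 * exp 1 * M ^ 4) with (D * M) by (unfold D; ring). lra.
Qed.

Lemma kerC_shifted v al p n : exp (2 * v) = 2 -> Cexp (2 * xy 0 al) = (p + Ci)%C ->
  kerC (INR n) (xy v al) = ((RtoC (2 * PI ^ 2 * INR n ^ 4) * Cexp (RtoC (9 / 2) * xy v al) - RtoC (3 * PI * INR n ^ 2) * Cexp (RtoC (5 / 2) * xy v al))
    * Cexp (- (RtoC (2 * (PI * INR n ^ 2)) * p)))%C.
Proof.
  intros Hv Hp. unfold kerC. f_equal.
  assert (E : Cexp (2 * xy v al) = (2 * (p + Ci))%C).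
  { transitivity (RtoC (exp (2 * v)) * Cexp (2 * xy 0 al))%C; [|rewrite Hv, Hp; auto].
    rewrite <- (Cexp_R (2 * v)), <- Cexp_plus. f_equal. unfold xy. rewrite RtoC_mult. ring. }
  rewrite E.
  replace (- (RtoC (PI * INR n ^ 2) * (2 * (p + Ci))))%C with
    (- (RtoC (2 * (PI * INR n ^ 2)) * p) + - (RtoC (INR 2 * PI * INR n ^ 2) * Ci))%C.
  2: { simpl INR. rewrite !RtoC_mult, RtoC_plus. ring. }
  rewrite Cexp_plus, Cexp_sgn. replace (sgn n ^ 2) with 1; [ring|].
  rewrite <- pow2_abs, sgn_sq. ring.
Qed.

Lemma sum_window (f : nat -> R) c m : ex_series f -> (forall k, 0 <= f k) ->
  (forall k, (m <= k < 2 * m)%nat -> c <= f k) -> (1 <= m)%nat -> INR m * c <= Series f.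
Proof.
  intros Hex H0 Hc Hm.
  rewrite (Series_incr_n f (2 * m)) by (lia || auto).
  assert (P : 0 <= Series (fun k => f (2 * m + k)%nat)).
  { rewrite <- (Rmult_0_l (Series (fun k => f (2 * m + k)%nat))), <- Series_scal_l.
    apply Series_le; [intros n; rewrite Rmult_0_l; split; [lra|auto]|]. apply (ex_series_incr_n f). auto. }
  rewrite (tech2 f (pred m) (pred (2 * m))) by lia.
  assert (P1 : 0 <= sum_f_R0 f (pred m)) by (apply cond_pos_sum; auto).
  assert (P2 : INR m * c <= sum_f_R0 (fun i => f (S (pred m) + i)%nat) (pred (2 * m) - S (pred m))).
  { replace (pred (2 * m) - S (pred m))%nat with (pred m) by lia.
    apply Rle_trans with (sum_f_R0 (fun _ => c) (pred m)).
    - rewrite sum_cte. replace (S (pred m)) with m by lia. lra.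
    - apply sum_Rle. intros n Hn. apply Hc. lia. }
  lra.
Qed.

(* With e^(2v) = 2 the sign (-1)^r becomes (-1)^(2r) and there is no cancellation. *)
Lemma PhiC_lower v : exp (2 * v) = 2 -> exists D, 0 <= D /\ forall m al p, (1 <= m)%nat -> 0 < cos (2 * al) ->
  Cexp (2 * xy 0 al) = (p + Ci)%C -> Re p = / INR m ^ 2 -> Rabs (Im p) <= / INR m ^ 4 ->
  exp (-32) * INR m ^ 5 - D * INR m ^ 3 <= Cmod (PhiC (xy v al)).
Proof.
  intros Hv.
  set (c9 := exp (9 / 2 * v)). set (c5 := exp (5 / 2 * v)).
  assert (H9 : 1 <= c9). { unfold c9. rewrite <- exp_0. apply exp_le. assert (0 < v); [|lra].
    apply Rnot_le_lt. intros Q. assert (exp (2 * v) <= exp 0) by (apply exp_le; lra). rewrite exp_0 in H. lra. }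
  assert (H5 : 0 < c5) by apply exp_pos.
  (* First part: the error of the phase, 2 PI^2 <= 32 times 32 y^8, with y^8 costing 8! = 40320.
     Second part: the subordinate term of the kernel, 3 PI <= 12 times 2!. *)
  exists ((1024 * 40320 * c9 + 24 * c5) * exp 1). split; [generalize (exp_pos 1); nra|].
  intros m al p Hm Hc Hp Hp1 Hp2. set (M := INR m) in *.
  assert (HM : 1 <= M) by (apply (le_INR 1); auto).
  set (D := (1024 * 40320 * c9 + 24 * c5) * exp 1).
  assert (HD : 0 <= D) by (unfold D; generalize (exp_pos 1); nra).
  destruct PI_bounds as [HP1 HP2].
  assert (HiM : 0 < / M) by (apply Rinv_0_lt_compat; lra).
  set (E := fun k => exp (- (2 * PI * (/ M * INR (S k)) ^ 2))).
  set (A := fun k => INR (S k) ^ 4 * E k).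
  assert (Yp : forall k, 0 <= / M * INR (S k)) by (intros; apply Rmult_le_pos; [lra|apply pos_INR]).
  assert (E3 : forall k, E k <= exp (- (3 * (/ M * INR (S k)) ^ 2))).
  { intros k. apply exp_le. generalize (pow2_ge_0 (/ M * INR (S k))). nra. }
  assert (EP : forall k, 0 < E k) by (intros; apply exp_pos).
  assert (ExG := ex_series_exp_geom (/ M) HiM).
  assert (ExA : ex_series A).
  { apply (ex_series_le (V := R_CompleteNormedModule) A (fun k => (M ^ 4 * (INR (fact 4) * exp 1)) * exp (- (/ M * INR (S k))))).
    2: apply (ex_series_scal (V := R_NormedModule)); auto.
    intros k. change (Rabs (A k) <= (M ^ 4 * (INR (fact 4) * exp 1)) * exp (- (/ M * INR (S k)))).
    assert (0 <= INR (S k) ^ 4) by (apply pow_le, pos_INR).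
    rewrite Rabs_pos_eq by (apply Rmult_le_pos; [auto|left; auto]).
    unfold A. replace (INR (S k) ^ 4) with (M ^ 4 * (/ M * INR (S k)) ^ 4) by (field; lra).
    rewrite !Rmult_assoc. apply Rmult_le_compat_l; [apply pow_le; lra|].
    rewrite <- Rmult_assoc. eapply Rle_trans; [|apply pow_gauss_le; auto].
    apply Rmult_le_compat_l; [apply pow_le; auto|auto]. }
  set (g := fun k => A k - D * M ^ 2 * exp (- (/ M * INR (S k)))).
  assert (Exg : ex_series g).
  { apply (ex_series_minus A); auto. apply (ex_series_scal (V := R_NormedModule)); auto. }
  (* The m indices with m < r <= 2m contribute at least M^4 exp(-32) each, since y = r / M <= 2
     gives 2 PI y^2 <= 32. *)
  assert (SA : M * (M ^ 4 * exp (-32)) <= Series A).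
  { apply sum_window; auto.
    - intros k. apply Rmult_le_pos; [apply pow_le, pos_INR|left; auto].
    - intros k Hk. assert (L1 : M <= INR (S k)) by (apply le_INR; lia).
      assert (L2 : INR (S k) <= 2 * M). { unfold M. change 2 with (INR 2). rewrite <- mult_INR. apply le_INR. lia. }
      apply Rmult_le_compat; [apply pow_le; lra|left; apply exp_pos|apply pow_incr; lra|].
      apply exp_le. assert (/ M * INR (S k) <= 2).
      { apply Rmult_le_reg_l with M; [lra|]. rewrite <- Rmult_assoc, Rinv_r by lra. lra. }
      assert (0 <= (/ M * INR (S k)) ^ 2 <= 4) by (specialize (Yp k); nra). nra. }
  apply Rle_trans with (Series g).
  { unfold g. rewrite Series_minus; auto. 2: apply (ex_series_scal (V := R_NormedModule)); auto.
    rewrite Series_scal_l. assert (S0 := Series_exp_geom_le M ltac:(lra)).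
    assert (D * M ^ 2 * Series (fun k => exp (- (/ M * INR (S k)))) <= D * M ^ 2 * M).
    { apply Rmult_le_compat_l; auto. apply Rmult_le_pos; auto. apply pow2_ge_0. }
    replace (exp (-32) * M ^ 5) with (M * (M ^ 4 * exp (-32))) by ring.
    replace (D * M ^ 3) with (D * M ^ 2 * M) by ring. lra. }
  (* This unit factor cancels the argument of e^(9 w / 2), so the dominant part of every term is
     nearly a positive real. *)
  apply (Cser_Re_ge _ _ (Cexp (RtoC (9 / 2) * xy 0 (- al))) g (PhiC_Cser v al Hc)); auto.
  { rewrite Cmod_exp_xy, Rmult_0_r. apply exp_0. }
  intros k. rewrite (kerC_shifted v al p _ Hv Hp).
  set (r := INR (S k)). set (K := Cexp (- (RtoC (2 * (PI * r ^ 2)) * p))).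
  set (y := / M * r). assert (Hy := Yp k). fold r in Hy. fold y in Hy.
  assert (Er : r = M * y) by (unfold y; field; lra).
  assert (EK : E k = exp (- (2 * PI * y ^ 2))) by reflexivity.
  assert (Ear : 2 * (PI * r ^ 2) * Re p = 2 * PI * y ^ 2) by (rewrite Hp1, Er; field; lra).
  assert (CK : Cmod K = E k).
  { unfold K. rewrite Cmod_Cexp, EK. f_equal. change (- Re (RtoC (2 * (PI * r ^ 2)) * p) = - (2 * PI * y ^ 2)). rewrite Re_mult_R, Ear. auto. }
  assert (Hr0 : 0 <= r) by apply pos_INR.
  (* The remaining phase is 2 PI r^2 Im p. With |Im p| <= M^(-4) and cos x >= 1 - x^2/2 the loss r^4
     x^2/2 is at most 2 PI^2 y^8, which is at most 32 y^8. *)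
  assert (RK : E k * (r ^ 4 - 32 * y ^ 8) <= r ^ 4 * Re K).
  { unfold K. rewrite Re_Cexp.
    change (Re (- (RtoC (2 * (PI * r ^ 2)) * p))) with (- Re (RtoC (2 * (PI * r ^ 2)) * p)).
    change (Im (- (RtoC (2 * (PI * r ^ 2)) * p))) with (- Im (RtoC (2 * (PI * r ^ 2)) * p)).
    rewrite Re_mult_R, Im_mult_R, Ear, <- EK.
    set (x := - (2 * (PI * r ^ 2) * Im p)).
    assert (C1 := cos_ge x).
    assert (r ^ 4 * (x ^ 2 / 2) <= 32 * y ^ 8).
    { unfold x. replace (r ^ 4 * ((- (2 * (PI * r ^ 2) * Im p)) ^ 2 / 2)) with (2 * PI ^ 2 * (r ^ 4 * Rabs (Im p)) ^ 2).
      2: { rewrite Rpow_mult_distr, pow2_abs. field. }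
      assert (0 <= r ^ 4 * Rabs (Im p) <= y ^ 4).
      { split; [apply Rmult_le_pos; [apply pow_le; auto|apply Rabs_pos]|].
        replace (y ^ 4) with (r ^ 4 * / M ^ 4) by (unfold y; field; lra). apply Rmult_le_compat_l; [apply pow_le; auto|auto]. }
      replace (y ^ 8) with (y ^ 4 * y ^ 4) by ring.
      assert ((r ^ 4 * Rabs (Im p)) ^ 2 <= y ^ 4 * y ^ 4) by nra.
      assert (0 <= y ^ 4 * y ^ 4) by nra. assert (2 * PI ^ 2 <= 32) by nra.
      apply Rle_trans with (2 * PI ^ 2 * (y ^ 4 * y ^ 4)); [apply Rmult_le_compat_l; [nra|auto]|apply Rmult_le_compat_r; auto]. }
    replace (r ^ 4 * (E k * cos x)) with (E k * (r ^ 4 * cos x)) by ring.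
    apply Rmult_le_compat_l; [left; auto|].
    assert (r ^ 4 * (1 - x ^ 2 / 2) <= r ^ 4 * cos x) by (apply Rmult_le_compat_l; [apply pow_le; auto|auto]). lra. }
  set (W := (Cexp (RtoC (9 / 2) * xy 0 (- al)) * (RtoC (3 * PI * r ^ 2) * Cexp (RtoC (5 / 2) * xy v al) * K))%C).
  assert (EW : (Cexp (RtoC (9 / 2) * xy 0 (- al)) * ((RtoC (2 * PI ^ 2 * r ^ 4) * Cexp (RtoC (9 / 2) * xy v al) -
      RtoC (3 * PI * r ^ 2) * Cexp (RtoC (5 / 2) * xy v al)) * K) = RtoC (2 * PI ^ 2 * c9) * (RtoC (r ^ 4) * K) - W)%C).
  { unfold W. replace (RtoC (2 * PI ^ 2 * c9)) with (RtoC (2 * PI ^ 2) * (Cexp (RtoC (9 / 2) * xy 0 (- al)) * Cexp (RtoC (9 / 2) * xy v al)))%C.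
    - rewrite (RtoC_mult (2 * PI ^ 2) (r ^ 4)). ring.
    - rewrite <- Cexp_plus, (RtoC_mult (2 * PI ^ 2) c9). f_equal. unfold c9. rewrite <- Cexp_R. f_equal. unfold xy. rewrite RtoC_mult, RtoC_opp. ring. }
  rewrite EW.
  change (g k <= Re (RtoC (2 * PI ^ 2 * c9) * (RtoC (r ^ 4) * K)) - Re W).
  rewrite !Re_mult_R.
  assert (BW : Re W <= 12 * c5 * r ^ 2 * E k).
  { eapply Rle_trans; [apply Rle_abs|]. eapply Rle_trans; [apply re_le_Cmod|].
    unfold W. rewrite !Cmod_mult, !Cmod_exp_xy, CK, Rmult_0_r, exp_0, Rmult_1_l, Cmod_RtoC_pos by apply coef5_pos. fold c5.
    apply Rmult_le_compat_r; [left; auto|]. 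
    replace (12 * c5 * r ^ 2) with (12 * r ^ 2 * c5) by ring. apply Rmult_le_compat_r; [lra|].
    apply Rmult_le_compat_r; [apply pow2_ge_0|lra]. }
  assert (P8 := pow_gauss_le 8 y Hy). assert (P2 := pow_gauss_le 2 y Hy).
  replace (INR (fact 8)) with 40320 in P8 by (rewrite !fact_simpl, !mult_INR; simpl; ring). replace (INR (fact 2)) with 2 in P2 by (simpl; ring).
  specialize (E3 k). fold r y in E3.
  set (ee := exp 1 * exp (- y)). assert (Pee : 0 < ee) by (apply Rmult_lt_0_compat; apply exp_pos).
  assert (P8' : y ^ 8 * E k <= 40320 * ee).
  { unfold ee. rewrite <- Rmult_assoc. eapply Rle_trans; [|exact P8]. apply Rmult_le_compat_l; [apply pow_le; auto|auto]. }
  assert (P2' : y ^ 2 * E k <= 2 * ee).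
  { unfold ee. rewrite <- Rmult_assoc. eapply Rle_trans; [|exact P2]. apply Rmult_le_compat_l; [apply pow_le; auto|auto]. }
  assert (HM2 : 1 <= M ^ 2) by nra.
  assert (HPP : 9 <= PI ^ 2 <= 16) by (split; nra).
  assert (Hpc : 1 <= 2 * PI ^ 2 * c9 <= 32 * c9) by (split; nra).
  assert (PA : 0 <= A k) by (apply Rmult_le_pos; [apply pow_le, pos_INR|left; auto]).
  assert (G1 : 2 * PI ^ 2 * c9 * (E k * (r ^ 4 - 32 * y ^ 8)) <= 2 * PI ^ 2 * c9 * (r ^ 4 * Re K)) by (apply Rmult_le_compat_l; lra).
  assert (G2 : 1 * A k <= 2 * PI ^ 2 * c9 * A k) by (apply Rmult_le_compat_r; lra).
  assert (Y8 : 0 <= y ^ 8 * E k) by (apply Rmult_le_pos; [apply pow_le; auto|left; auto]).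
  assert (G3 : 2 * PI ^ 2 * c9 * (32 * (y ^ 8 * E k)) <= 32 * c9 * (32 * (40320 * ee))) by (apply Rmult_le_compat; lra).
  assert (G4 : 12 * c5 * r ^ 2 * E k <= 24 * c5 * M ^ 2 * ee).
  { replace (12 * c5 * r ^ 2 * E k) with (12 * c5 * M ^ 2 * (y ^ 2 * E k)) by (rewrite Er; ring).
    replace (24 * c5 * M ^ 2 * ee) with (12 * c5 * M ^ 2 * (2 * ee)) by ring.
    apply Rmult_le_compat_l; auto. apply Rmult_le_pos; lra. }
  assert (G5 : 32 * c9 * (32 * (40320 * ee)) <= M ^ 2 * (32 * c9 * (32 * (40320 * ee)))).
  { assert (0 <= 32 * c9 * (32 * (40320 * ee))) by (apply Rmult_le_pos; lra). nra. }
  assert (EA : E k * r ^ 4 = A k) by (unfold A; fold r; ring).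
  replace (g k) with (A k - (M ^ 2 * (32 * c9 * (32 * (40320 * ee))) + 24 * c5 * M ^ 2 * ee)) by (unfold g, D, ee; fold r; fold y; ring).
  replace (2 * PI ^ 2 * c9 * (E k * (r ^ 4 - 32 * y ^ 8))) with (2 * PI ^ 2 * c9 * A k - 2 * PI ^ 2 * c9 * (32 * (y ^ 8 * E k))) in G1 by (rewrite <- EA; ring).
  lra.
Qed.

(** With 2 al = acos q the real part of e^(2 i al) is exactly q, and the imaginary part misses 1 by
    1 - sqrt(1 - q^2) <= q^2. *)
Lemma angle_near_quarter_pi q : 0 < q <= 1 -> exists al p, 0 <= al < PI / 4 /\ 0 < cos (2 * al) /\
  Cexp (2 * xy 0 al) = (p + Ci)%C /\ Re p = q /\ Rabs (Im p) <= q ^ 2.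
Proof.
  intros Hq. exists (acos q / 2), ((q, sin (acos q) - 1) : C).
  assert (B := acos_bound q). assert (Cq : cos (acos q) = q) by (apply cos_acos; lra).
  replace (2 * (acos q / 2)) with (acos q) by field. rewrite Cq.
  assert (HPI := PI_RGT_0).
  assert (S0 : 0 <= sin (acos q)) by (apply sin_ge_0; lra).
  assert (S1 := SIN_bound (acos q)).
  assert (S2 := sin2_cos2 (acos q)). unfold Rsqr in S2. rewrite Cq in S2.
  repeat split; try lra.
  - apply Rnot_le_lt. intros H. assert (cos (acos q) <= 0) by (apply cos_le_0; lra). lra.
  - unfold Cexp. replace (Re (2 * xy 0 (acos q / 2))) with 0 by (unfold Re, xy; simpl; ring).
    replace (Im (2 * xy 0 (acos q / 2))) with (acos q) by (unfold Im, xy; simpl; field).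
    rewrite exp_0, Cq. apply Ceq; simpl; ring.
  - simpl Im. apply Rabs_le. nra.
Qed.

Lemma X_no_constant_sign e T0 : (e = 1 \/ e = -1) -> ~ (forall t, T0 <= Rabs t -> 0 <= e * Re (X (RtoC t))).
Proof.
  intros He H. destruct (PhiC_ineq e T0 He H) as [B HB].
  set (v := ln 2 / 2).
  assert (Hv : exp (2 * v) = 2) by (unfold v; replace (2 * (ln 2 / 2)) with (ln 2) by field; apply exp_ln; lra).
  destruct (PhiC_lower v Hv) as [D [HD L]].
  set (K := 63384 * exp 1). set (ka := exp (-32)). assert (Hka : 0 < ka) by apply exp_pos.
  assert (HK : 0 < K) by (unfold K; generalize (exp_pos 1); lra).
  (* Large enough for the lower bound ka M^5 - D M^3 to exceed the upper bound 50 + K M^4 by more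
     than B. *)
  destruct (nat_above ((D + 50 + K + Rabs B) / ka + 1)) as [m Hm].
  set (M := INR m) in *.
  assert (Q : 0 <= (D + 50 + K + Rabs B) / ka) by (apply Rdiv_le_0_compat; [generalize (Rabs_pos B); lra|auto]).
  assert (HM : 1 <= M) by lra.
  assert (Hm1 : (1 <= m)%nat) by (apply INR_le; exact HM).
  assert (P2 : 1 <= M ^ 2) by nra.
  assert (Hq : 0 < / M ^ 2 <= 1). { split; [apply Rinv_0_lt_compat; lra|]. rewrite <- Rinv_1. apply Rinv_le_contravar; lra. }
  destruct (angle_near_quarter_pi _ Hq) as [al [p [Hal [Hc [Hp [Hp1 Hp2]]]]]].
  assert (Hp3 : Cmod p <= 2 / M ^ 2).
  { eapply Rle_trans; [apply Cmod_le_sum|]. rewrite Hp1, Rabs_pos_eq by lra. unfold Rdiv. nra. }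
  assert (U := PhiC_upper M al p HM Hc Hp Hp1 Hp3). fold K in U.
  assert (Hp4 : Rabs (Im p) <= / INR m ^ 4).
  { fold M. replace (/ M ^ 4) with ((/ M ^ 2) ^ 2) by (field; lra). auto. }
  assert (Lw := L m al p Hm1 Hc Hp Hp1 Hp4). fold M ka in Lw.
  assert (I := HB v al Hal).
  assert (F : ka * M ^ 5 <= D * M ^ 3 + 50 + K * M ^ 4 + Rabs B) by (generalize (Rle_abs B); lra).
  assert (M4 : 1 <= M ^ 4) by (replace (M ^ 4) with (M ^ 2 * M ^ 2) by ring; nra).
  assert (M3 : M ^ 3 <= M ^ 4). { replace (M ^ 4) with (M ^ 3 * M) by ring. assert (0 <= M ^ 3) by (apply pow_le; lra). nra. }
  assert (G : (D + 50 + K + Rabs B) < ka * M).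
  { assert ((D + 50 + K + Rabs B) / ka < M) by lra. apply (Rmult_lt_compat_l ka) in H0; auto.
    replace (ka * ((D + 50 + K + Rabs B) / ka)) with (D + 50 + K + Rabs B) in H0 by (field; lra). lra. }
  assert (G2 : (D + 50 + K + Rabs B) * M ^ 4 < ka * M * M ^ 4) by (apply Rmult_lt_compat_r; lra).
  assert (D * M ^ 3 <= D * M ^ 4) by (apply Rmult_le_compat_l; auto).
  assert (Rabs B <= Rabs B * M ^ 4) by (generalize (Rabs_pos B); nra).
  replace (ka * M * M ^ 4) with (ka * M ^ 5) in G2 by ring. lra.
Qed.

Theorem Hardy s : exists t, s < t /\ X (RtoC t) = 0%C.
Proof.
  apply NNPP. intros H.
  set (x := fun t => Re (X (RtoC t))).
  assert (Cx : forall t, continuity_pt x t) by (intros t; apply continuity_pt_filterlim; exact (proj1 (Ccont_X t))).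
  set (s0 := Rmax s 0 + 1).
  assert (Hs0 : s < s0 /\ 0 < s0) by (unfold s0; generalize (Rmax_l s 0) (Rmax_r s 0); lra).
  assert (Nz : forall t, s0 <= t -> x t <> 0).
  { intros t Ht Q. apply H. exists t. split; [lra|]. rewrite X_real. fold (x t). rewrite Q. auto. }
  (* Evenness carries the sign from [s0, infinity) to the negative half-line; on [s0, infinity) it
     is constant by the intermediate value theorem. *)
  assert (Ev : forall t, x (Rabs t) = x t).
  { intros t. unfold Rabs. destruct (Rcase_abs t); auto. unfold x. rewrite RtoC_opp. unfold X. rewrite T_even; auto using even_rapid_Phi0. }
  set (e := if Rle_dec 0 (x s0) then 1 else -1).
  apply (X_no_constant_sign e s0); [unfold e; destruct Rle_dec; auto|].
  intros t Ht. change (0 <= e * x t). rewrite <- Ev.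
  apply Rnot_lt_le. intros Q.
  assert (N0 := Nz s0 (Rle_refl _)). assert (N1 := Nz (Rabs t) Ht).
  destruct (Req_dec s0 (Rabs t)) as [E|E].
  { rewrite <- E in *. unfold e in Q. destruct (Rle_dec 0 (x s0)); lra. }
  unfold e in Q. destruct (Rle_dec 0 (x s0)) as [h|h].
  - destruct (IVT (fun t => - x t) s0 (Rabs t)) as [z [Hz1 Hz2]]; [|lra|lra|lra|].
    + intros a. apply continuity_pt_opp, Cx.
    + apply (Nz z); lra.
  - destruct (IVT x s0 (Rabs t)) as [z [Hz1 Hz2]]; [exact Cx|lra|lra|lra|]. apply (Nz z); lra.
Qed.

(** * Hurwitz's theorem and conclusion *)

Lemma analytic_leading_term f z : analytic f z ->
  (exists r, 0 < r /\ forall h, Cmod h < r -> f (z + h)%C = 0%C) \/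
  exists (n : nat) (c : C) (K r : R), c <> 0%C /\ 0 <= K /\ 0 < r /\
    forall h, Cmod h <= r -> Cmod (f (z + h)%C - c * h ^ n) <= K * Cmod h ^ S n.
Proof.
  intros (a & r & M & H). assert (Hr := proj1 H). assert (HM := expansion_M_pos _ _ _ _ _ H).
  destruct (classic (forall k, a k = 0%C)) as [Z|Z].
  - left. exists r. split; auto. intros h Hh.
    apply (Cser_unique (fun k => a k * h ^ k)%C); [apply H; auto|].
    apply (Cser_finite _ 0); auto. intros; rewrite Z; ring.
  - right. apply not_all_ex_not in Z. 
    destruct (dec_inh_nat_subset_has_unique_least_element (fun n => a n <> 0%C)) as [n [[Hn Hl] _]]; auto.
    { intros n. apply classic. }
    exists n, (a n), (2 * M / r ^ S n), (r / 2).
    assert (P := pow_lt r (S n) Hr).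
    split; auto. split; [apply Rdiv_le_0_compat; lra|]. split; [lra|].
    intros h Hh. eapply Rle_trans; [apply (expansion_lead _ _ _ _ _ _ n H Hh)|].
    + intros j Hj. apply NNPP. intros Q. apply Hl in Q. lia.
    + right. unfold Rdiv. rewrite Rpow_mult_distr, pow_inv. ring.
Qed.

(** One of |Re b|, |Im b| is at least |b| / 2, so one of the rotations by 0, PI, PI/2, -PI/2
    suffices, and d is an n-th root of it. *)
Lemma rotation_to_left (b : C) n : (1 <= n)%nat -> exists d : C, Cmod d = 1 /\ Re (b * d ^ n) <= - (Cmod b / 2).
Proof.
  intros Hn.
  assert (Hroot : forall th, exists d : C, Cmod d = 1 /\ (d ^ n)%C = Cexp (Ci * RtoC th)).
  { intros th. exists (Cexp (Ci * RtoC (th / INR n))). split; [apply Cmod_Cexp_i|].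
    assert (P : 0 < INR n) by (apply lt_0_INR; lia).
    assert (G : forall k, (Cexp (Ci * RtoC (th / INR n)) ^ k)%C = Cexp (Ci * RtoC (INR k * (th / INR n)))).
    { induction k as [|k IH].
      - simpl. rewrite Rmult_0_l, Cmult_0_r, Cexp_0. auto.
      - simpl Cpow. rewrite IH, <- Cexp_plus, S_INR. f_equal. rewrite !RtoC_mult, RtoC_plus. ring. }
    rewrite G. do 3 f_equal. field. lra. }
  assert (HS := Cmod_le_sum b).
  assert (E : forall th, Re (b * Cexp (Ci * RtoC th)) = Re b * cos th - Im b * sin th).
  { intros th. unfold Cexp, Re, Im; simpl. replace (0 * th - 1 * 0) with 0 by ring. replace (0 * 0 + 1 * th) with th by ring.
    rewrite exp_0. ring. }
  assert (G : exists th, Re (b * Cexp (Ci * RtoC th)) <= - (Cmod b / 2)).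
  { destruct (Rle_or_lt (Cmod b / 2) (Rabs (Re b))) as [h|h].
    - destruct (Rle_or_lt (Re b) 0).
      + exists 0. rewrite E, cos_0, sin_0. rewrite Rabs_left1 in h; lra.
      + exists PI. rewrite E, cos_PI, sin_PI. rewrite Rabs_pos_eq in h; lra.
    - assert (h' : Cmod b / 2 <= Rabs (Im b)) by lra. destruct (Rle_or_lt (Im b) 0).
      + exists (- (PI / 2)). rewrite E, cos_neg, sin_neg, cos_PI2, sin_PI2. rewrite Rabs_left1 in h'; lra.
      + exists (PI / 2). rewrite E, cos_PI2, sin_PI2. rewrite Rabs_pos_eq in h'; lra. }
  destruct G as [th Hth]. destruct (Hroot th) as [d [Hd1 Hd2]]. exists d. rewrite Hd2. auto.
Qed.

(* d'Alembert: in a suitable direction the first nonconstant term of the expansion decreases the modulus. *)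
Lemma min_modulus g z rho : analytic g z -> g z <> 0%C -> 0 < rho -> (forall h, Cmod h < rho -> Cmod (g z) <= Cmod (g (z + h)%C)) ->
  exists r, 0 < r /\ forall h, Cmod h < r -> g (z + h)%C = g z.
Proof.
  intros Hg Hz Hrho Hmin.
  destruct (analytic_leading_term (fun w => g w - g z)%C z) as [[r [Hr H]]|[n [c [K [r [Hc [HK [Hr H]]]]]]]].
  { apply analytic_minus; auto. apply analytic_const. }
  { exists r. split; auto. intros h Hh. apply Cminus_eq, H; auto. }
  exfalso.
  assert (Pc := proj1 (Cmod_gt_0 c) Hc). assert (Pz := proj1 (Cmod_gt_0 _) Hz).
  set (b := (c / g z)%C).
  assert (Pb : 0 < Cmod b). { unfold b. rewrite Cmod_div by auto. apply Rdiv_lt_0_compat; auto. }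
  destruct n as [|n].
  { assert (G : Cmod c <= 0); [|lra]. apply Rle_plus_epsilon. intros eps Heps. 
    specialize (H 0%C ltac:(rewrite Cmod_0; lra)). rewrite Cplus_0_r, Cmod_0 in H. simpl in H.
    replace (g z - g z - c * 1)%C with (- c)%C in H by ring. rewrite Cmod_opp in H. lra. }
  destruct (rotation_to_left b (S n) ltac:(lia)) as [d [Hd1 Hd2]].
  set (K' := K / Cmod (g z)). assert (HK' : 0 <= K') by (apply Rdiv_le_0_compat; auto).
  set (B := Cmod b) in *.
  (* In turn: validity of the expansion, the disc of the hypothesis, s = t^(n+1) <= t, B s <= 1/2
     for the estimate [M1], and an error term below half of the gain B s / 4. *)
  set (t := Rmin (Rmin r (rho / 2)) (Rmin (Rmin 1 (/ (2 * B))) (B / (8 * (K' + 1))))).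
  assert (P1 : 0 < / (2 * B)) by (apply Rinv_0_lt_compat; lra).
  assert (P2 : 0 < B / (8 * (K' + 1))) by (apply Rdiv_lt_0_compat; lra).
  assert (Ht0 : 0 < t) by (unfold t; repeat apply Rmin_glb_lt; lra).
  assert (Ht1 : t <= r) by (unfold t; eapply Rle_trans; [apply Rmin_l|apply Rmin_l]).
  assert (Ht2 : t <= rho / 2) by (unfold t; eapply Rle_trans; [apply Rmin_l|apply Rmin_r]).
  assert (Ht3 : t <= 1) by (unfold t; eapply Rle_trans; [apply Rmin_r|]; eapply Rle_trans; [apply Rmin_l|apply Rmin_l]).
  assert (Ht4 : t <= / (2 * B)) by (unfold t; eapply Rle_trans; [apply Rmin_r|]; eapply Rle_trans; [apply Rmin_l|apply Rmin_r]).
  assert (Ht5 : t <= B / (8 * (K' + 1))) by (unfold t; eapply Rle_trans; [apply Rmin_r|apply Rmin_r]).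
  set (h := (RtoC t * d)%C).
  assert (Hh : Cmod h = t) by (unfold h; rewrite Cmod_mult, Cmod_R, Hd1, Rabs_pos_eq; lra).
  specialize (H h ltac:(lra)). rewrite Hh in H.
  specialize (Hmin h ltac:(lra)).
  set (s := t ^ S n) in *.
  assert (Hs : 0 < s) by (apply pow_lt; auto).
  assert (Hst : s <= t). { unfold s. simpl. assert (t ^ n <= 1) by (rewrite <- (pow1 n); apply pow_incr; lra). nra. }
  assert (HsB : B * s <= / 2).
  { apply Rle_trans with (B * / (2 * B)); [apply Rmult_le_compat_l; lra|right; field; lra]. }
  set (w := (b * d ^ S n)%C) in *.
  assert (Hw : Cmod w = B) by (unfold w; rewrite Cmod_mult, Cmod_pow, Hd1, pow1; unfold B; ring).
  assert (M1 : Cmod (1 + RtoC s * w) <= 1 - B * s / 4).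
  (* The square is 1 + 2 s Re w + (B s)^2 <= 1 - B s + B s / 2, which is below (1 - B s / 4)^2. *)
  { apply Rsqr_incr_0_var; [|lra]. 
    assert (E : Rsqr (Cmod (1 + RtoC s * w)) = 1 + 2 * s * Re w + s ^ 2 * B ^ 2).
    { assert (CM : forall x : C, Rsqr (Cmod x) = Re x ^ 2 + Im x ^ 2).
      { intros x. unfold Cmod. rewrite Rsqr_sqrt; [reflexivity|]. apply Rplus_le_le_0_compat; apply pow2_ge_0. }
      rewrite CM. rewrite <- Hw. replace (Cmod w ^ 2) with (Re w ^ 2 + Im w ^ 2) by (rewrite <- CM; unfold Rsqr; ring).
      unfold Re, Im; simpl. ring. }
    rewrite E. unfold Rsqr.
    assert (s * Re w <= s * (- (B / 2))) by (apply Rmult_le_compat_l; lra).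
    assert (0 < B * s) by (apply Rmult_lt_0_compat; auto).
    assert ((B * s) * (B * s) <= / 2 * (B * s)) by (apply Rmult_le_compat_r; lra).
    replace (s ^ 2 * B ^ 2) with ((B * s) * (B * s)) by ring. nra. }
  assert (EQ : g (z + h)%C = (g z * (1 + RtoC s * w) + (g (z + h) - g z - c * h ^ S n))%C).
  { unfold w, b, h, s. rewrite Cpow_mul, RtoC_pow. field. auto. }
  assert (U : Cmod (g (z + h)%C) <= Cmod (g z) * (1 - B * s / 4) + K * t ^ S (S n)).
  { rewrite EQ. eapply Rle_trans; [apply Cmod_triangle|]. rewrite Cmod_mult.
    apply Rplus_le_compat; auto. apply Rmult_le_compat_l; lra. }
  change (t ^ S (S n)) with (t * s) in U.
  assert (EK : K = Cmod (g z) * K') by (unfold K'; field; lra).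
  assert (V : K' * t <= B / 8).
  { apply Rle_trans with ((K' + 1) * (B / (8 * (K' + 1)))); [apply Rmult_le_compat; lra|right; field; lra]. }
  rewrite EK in U.
  assert (K' * t * s <= B / 8 * s) by (apply Rmult_le_compat_r; lra).
  assert (0 < B * s) by (apply Rmult_lt_0_compat; auto).
  assert (Cmod (g z) * (1 - B * s / 4 + K' * t * s) < Cmod (g z) * 1) by (apply Rmult_lt_compat_l; lra).
  lra.
Qed.

Lemma constant_of_locally g z k r : (forall w, analytic g w) -> 0 < r -> (forall h, Cmod h < r -> g (z + h)%C = k) ->
  forall w, g w = k.
Proof.
  intros Hg Hr Hk w. apply Cminus_eq.
  destruct (Ceq_dec w z) as [->|Hwz].
  { rewrite <- (Hk 0%C) by (rewrite Cmod_0; auto). rewrite Cplus_0_r. ring. }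
  assert (Hd : (w - z)%C <> 0%C) by (intros Q; apply Hwz, Cminus_eq; auto).
  assert (Pd := proj1 (Cmod_gt_0 _) Hd).
  replace w with (z + RtoC 1 * (w - z))%C at 1 by ring.
  apply (identity_line (fun u => g u - k)%C z (w - z)%C (r / Cmod (w - z))); auto.
  - intros t. apply analytic_minus; auto. apply analytic_const.
  - apply Rdiv_lt_0_compat; auto.
  - intros t Ht. rewrite Hk; [ring|]. rewrite Cmod_mult, Cmod_R, Rabs_pos_eq by lra.
    apply Rlt_le_trans with (r / Cmod (w - z) * Cmod (w - z)); [apply Rmult_lt_compat_r; lra|right; field; lra].
Qed.

(** If the infimum -l of |g| were not attained, every point would have a neighbourhood on which |g|
    exceeds -l by the radius d; compactness makes d uniform, contradicting the choice of l as a
    supremum of -|g|. *)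
Lemma min_on_square g z0 s : (forall w, analytic g w) -> 0 < s -> exists h1 : C, Rabs (Re h1) <= s /\ Rabs (Im h1) <= s /\
  forall h : C, Rabs (Re h) <= s -> Rabs (Im h) <= s -> Cmod (g (z0 + h1)%C) <= Cmod (g (z0 + h)%C).
Proof.
  intros Hg Hs.
  set (E := fun y => exists h : C, Rabs (Re h) <= s /\ Rabs (Im h) <= s /\ y = - Cmod (g (z0 + h)%C)).
  destruct (completeness E) as [l [Hl1 Hl2]].
  { exists 0. intros y (h & _ & _ & ->). generalize (Cmod_ge_0 (g (z0 + h)%C)). lra. }
  { exists (- Cmod (g (z0 + 0)%C)), 0%C. simpl. rewrite Rabs_R0. repeat split; lra. }
  apply NNPP. intros Hno.
  assert (Hlt : forall h : C, Rabs (Re h) <= s -> Rabs (Im h) <= s -> - l < Cmod (g (z0 + h)%C)).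
  { intros h H1 H2. apply Rnot_le_lt. intros Q. apply Hno. exists h. repeat split; auto.
    intros h' H1' H2'. assert (- Cmod (g (z0 + h')%C) <= l) by (apply Hl1; exists h'; auto). lra. }
  assert (Hd : forall u v, exists d : posreal, - s <= u <= s -> - s <= v <= s -> forall x y, Rabs (x - u) < d -> Rabs (y - v) < d ->
    - l + d <= Cmod (g (z0 + (x, y))%C)).
  { intros u v. destruct (classic ((- s <= u <= s) /\ - s <= v <= s)) as [[Hu Hv]|H].
    2: { exists (mkposreal 1 Rlt_0_1). tauto. }
    assert (L := Hlt ((u, v) : C) ltac:(apply Rabs_le; auto) ltac:(apply Rabs_le; auto)).
    set (ep := (Cmod (g (z0 + (u, v))%C) + l) / 2).
    destruct (analytic_continuous g (z0 + (u, v))%C (Hg _) ep) as [d [Hd0 Hd]]; [unfold ep; lra|].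
    assert (P : 0 < Rmin (d / 2) ep) by (apply Rmin_glb_lt; unfold ep; lra).
    exists (mkposreal _ P). simpl. intros _ _ x y Hx Hy.
    assert (B1 := Rmin_l (d / 2) ep). assert (B2 := Rmin_r (d / 2) ep).
    assert (Q := Hd ((x - u, y - v) : C)).
    replace (z0 + (u, v) + ((x - u)%R, (y - v)%R))%C with (z0 + (x, y))%C in Q by (apply Ceq; simpl; ring).
    assert (Q1 : Cmod ((x - u, y - v) : C) < d). { eapply Rle_lt_trans; [apply Cmod_le_sum|]. simpl. lra. }
    specialize (Q Q1).
    assert (T : Cmod (g (z0 + (u, v))%C) <= Cmod (g (z0 + (x, y))%C) + Cmod (g (z0 + (x, y)) - g (z0 + (u, v)))%C).
    { replace (g (z0 + (u, v))%C) with (g (z0 + (x, y)) - (g (z0 + (x, y)) - g (z0 + (u, v))))%C at 1 by ring.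
      eapply Rle_trans; [apply Cmod_triangle|]. rewrite Cmod_opp. lra. }
    unfold ep in *. lra. }
  destruct (compactness_value_2d (- s) s (- s) s (fun u v => proj1_sig (constructive_indefinite_description _ (Hd u v)))) as [d H].
  assert (HU : l <= l - d).
  { apply Hl2. intros y (h & H1 & H2 & ->). apply Rabs_le_between in H1. apply Rabs_le_between in H2.
    assert (G : - l + d <= Cmod (g (z0 + h)%C)); [|lra].
    apply Rnot_lt_le. intros Q. apply (H (Re h) (Im h) H1 H2). intros (u & v & Hu & Hv & Hx & Hy & Hdd).
    destruct (constructive_indefinite_description _ (Hd u v)) as [d' Hd']. simpl in *.
    specialize (Hd' Hu Hv (Re h) (Im h) Hx Hy). replace ((Re h, Im h) : C) with h in Hd' by (destruct h; auto). lra. }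
  generalize (cond_pos d). lra.
Qed.

(** By minimum modulus instead of winding numbers. Around z0 the leading term keeps |f| >= m, so |F
    N| > m/2 there while |F N z0| < m/2. The minimum over a square is then interior, and a nonzero
    interior minimum would make [F N] constant. *)
Lemma Hurwitz (f : C -> C) (F : nat -> C -> C) z0 w rho : (forall z, analytic f z) -> (forall N z, analytic (F N) z) ->
  (forall Rad eps, 0 <= Rad -> 0 < eps -> exists N0, forall N, (N0 <= N)%nat -> forall z, Cmod z <= Rad -> Cmod (f z - F N z)%C < eps) ->
  f z0 = 0%C -> f w <> 0%C -> 0 < rho ->
  exists N0, forall N, (N0 <= N)%nat -> exists h, Cmod h <= rho /\ F N (z0 + h)%C = 0%C.
Proof.
  intros Hf HF Hc Hz Hw Hrho.
  destruct (analytic_leading_term f z0 (Hf z0)) as [[r [Hr H]]|[n [c [K [r [Hc0 [HK [Hr H]]]]]]]].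
  { exfalso. apply Hw. apply (constant_of_locally f z0 0%C r); auto. }
  assert (Pc := proj1 (Cmod_gt_0 c) Hc0).
  destruct n as [|n].
  { exfalso. specialize (H 0%C ltac:(rewrite Cmod_0; lra)). rewrite Cplus_0_r, Cmod_0, Hz in H. simpl in H.
    replace (0 - c * 1)%C with (- c)%C in H by ring. rewrite Cmod_opp in H. lra. }
  set (s := Rmin (Rmin (rho / 2) (r / 2)) (Cmod c / (4 * (K + 1)))).
  assert (P1 : 0 < Cmod c / (4 * (K + 1))) by (apply Rdiv_lt_0_compat; lra).
  assert (Hs0 : 0 < s) by (unfold s; repeat apply Rmin_glb_lt; lra).
  assert (Hs1 : s <= rho / 2) by (unfold s; eapply Rle_trans; [apply Rmin_l|apply Rmin_l]).
  assert (Hs2 : s <= r / 2) by (unfold s; eapply Rle_trans; [apply Rmin_l|apply Rmin_r]).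
  assert (Hs3 : s <= Cmod c / (4 * (K + 1))) by (unfold s; apply Rmin_r).
  set (m := s ^ S n * (Cmod c / 2)).
  assert (Hm : 0 < m) by (apply Rmult_lt_0_compat; [apply pow_lt; auto|lra]).
  (* An annulus rather than a circle: the square of half-side s reaches beyond the disc of radius s,
     but not beyond radius 2 s. *)
  assert (Hlow : forall h, s <= Cmod h <= 2 * s -> m <= Cmod (f (z0 + h)%C)).
  { intros h Hh. specialize (H h ltac:(lra)).
    assert (T : Cmod (c * h ^ S n)%C <= Cmod (f (z0 + h)%C) + Cmod (f (z0 + h) - c * h ^ S n)%C).
    { replace (c * h ^ S n)%C with (f (z0 + h) - (f (z0 + h) - c * h ^ S n))%C at 1 by ring.
      eapply Rle_trans; [apply Cmod_triangle|]. rewrite Cmod_opp. lra. }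
    rewrite Cmod_mult, Cmod_pow in T. change (Cmod h ^ S (S n)) with (Cmod h * Cmod h ^ S n) in H.
    set (q := Cmod h ^ S n) in *. assert (Hq : s ^ S n <= q) by (apply pow_incr; lra).
    assert (Hq0 := pow_lt s (S n) Hs0).
    assert (K * Cmod h <= Cmod c / 2).
    { apply Rle_trans with ((K + 1) * (2 * (Cmod c / (4 * (K + 1))))); [apply Rmult_le_compat; lra|right; field; lra]. }
    assert (K * Cmod h * q <= Cmod c / 2 * q) by (apply Rmult_le_compat_r; lra).
    assert (s ^ S n * (Cmod c / 2) <= q * (Cmod c / 2)) by (apply Rmult_le_compat_r; lra).
    unfold m. lra. }
  destruct (Hc (Cmod z0 + 2 * s) (m / 2)) as [N0 HN0]; [generalize (Cmod_ge_0 z0); lra|lra|].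
  exists N0. intros N HN. specialize (HN0 N HN).
  destruct (min_on_square (F N) z0 s (HF N) Hs0) as [h1 [A1 [A2 Hmin]]].
  assert (B0 : Cmod (F N (z0 + 0)%C) < m / 2).
  { rewrite Cplus_0_r. specialize (HN0 z0 ltac:(lra)). rewrite Hz in HN0.
    replace (0 - F N z0)%C with (- F N z0)%C in HN0 by ring. rewrite Cmod_opp in HN0. auto. }
  assert (B1 : forall h, s <= Cmod h <= 2 * s -> m / 2 < Cmod (F N (z0 + h)%C)).
  { intros h Hh. assert (L := Hlow h Hh). 
    assert (Z : Cmod (z0 + h) <= Cmod z0 + 2 * s) by (eapply Rle_trans; [apply Cmod_triangle|lra]).
    specialize (HN0 _ Z).
    assert (Cmod (f (z0 + h)%C) <= Cmod (F N (z0 + h)%C) + Cmod (f (z0 + h) - F N (z0 + h))%C); [|lra].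
    replace (f (z0 + h)%C) with (F N (z0 + h) + (f (z0 + h) - F N (z0 + h)))%C at 1 by ring. apply Cmod_triangle. }
  assert (B2 : Cmod (F N (z0 + h1)%C) < m / 2).
  { eapply Rle_lt_trans; [apply (Hmin 0%C); simpl; rewrite Rabs_R0; lra|auto]. }
  assert (L1 := Cmod_le_sum h1). assert (L2 := re_le_Cmod h1). assert (L3 := im_le_Cmod h1).
  assert (Hin : Cmod h1 < s). { apply Rnot_le_lt. intros Q. specialize (B1 h1 ltac:(lra)). lra. }
  exists h1. split; [lra|].
  apply NNPP. intros Hnz.
  destruct (min_modulus (F N) (z0 + h1)%C (s - Cmod h1) (HF N _) Hnz) as [r' [Hr' Hk]]; [lra| |].
  { intros h Hh. rewrite <- Cplus_assoc. assert (Cmod (h1 + h) <= s) by (generalize (Cmod_triangle h1 h); lra).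
    apply Hmin; eapply Rle_trans; [apply re_le_Cmod|auto|apply im_le_Cmod|auto]. }
  assert (Hcst := constant_of_locally _ _ _ _ (HF N) Hr' Hk (z0 + RtoC s)%C).
  specialize (B1 (RtoC s)). rewrite Cmod_R, Rabs_pos_eq, Hcst in B1 by lra. specialize (B1 ltac:(lra)). lra.
Qed.

(** The zero function has constant sign, which [X_no_constant_sign] excludes; [Hurwitz] needs this
    nontriviality. *)
Lemma X_nonzero : exists w, X w <> 0%C.
Proof.
  apply not_all_ex_not. intros H. apply (X_no_constant_sign 1 0); auto.
  intros t _. rewrite H. simpl. lra.
Qed.

Definition fold_quadrant (z : C) : C := (Rabs (Re z), Rabs (Im z)).

Lemma T_fold p z : even_rapid p -> T p z = 0%C -> T p (fold_quadrant z) = 0%C.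
Proof.
  intros Hp H.
  assert (HN : T p (- z) = 0%C) by (rewrite T_even; auto).
  assert (HC : forall w, T p w = 0%C -> T p (Cconj w) = 0%C) by (intros w Hw; rewrite T_conj, Hw; auto; apply Ceq; unfold Cconj, Re, Im; simpl; ring).
  unfold fold_quadrant, Rabs. destruct (Rcase_abs (Re z)), (Rcase_abs (Im z)).
  - exact HN.
  - replace ((- Re z, Im z) : C) with (Cconj (- z)); [auto|]. apply Ceq; unfold Cconj, Re, Im; simpl; ring.
  - exact (HC z H).
  - destruct z. exact H.
Qed.

Theorem proposition1 :
  (forall N : nat, (1 <= N)%nat -> monotonic_zeros (Xi_N N) first_quadrant) ->
  forall z : C, Xi z = 0%C -> Im z = 0.
Proof.
  intros Hmono z Hz. rewrite Xi_eq_X in Hz. apply NNPP. intros Him.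
  set (a := fold_quadrant z).
  assert (Ha : X a = 0%C) by (apply T_fold; auto using even_rapid_Phi0).
  assert (Hs : 0 < Im a) by (apply Rabs_pos_lt; auto).
  destruct (Hardy (Re a)) as [t [Ht HXt]].
  destruct X_nonzero as [w Hw].
  (* A third of each gap: real parts stay ordered, Re a + rho < t - rho, and imaginary parts stay
     reversed, rho < Im a - rho. *)
  set (rho := Rmin (Im a / 3) ((t - Re a) / 3)).
  assert (Hr0 : 0 < rho) by (apply Rmin_glb_lt; lra).
  assert (Hr1 := Rmin_l (Im a / 3) ((t - Re a) / 3)). assert (Hr2 := Rmin_r (Im a / 3) ((t - Re a) / 3)). fold rho in Hr1, Hr2.
  assert (HX : forall z, analytic X z) by (intros; apply analytic_T, even_rapid_Phi0).
  assert (HF : forall N z, analytic (T (PN N)) z) by (intros; apply analytic_T, even_rapid_PN).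
  destruct (Hurwitz X (fun N => T (PN N)) a w rho HX HF X_PN_uniform Ha Hw Hr0) as [N1 H1].
  destruct (Hurwitz X (fun N => T (PN N)) (RtoC t) w rho HX HF X_PN_uniform HXt Hw Hr0) as [N2 H2].
  set (N := (N1 + N2 + 1)%nat).
  destruct (H1 N ltac:(unfold N; lia)) as [h1 [B1 Z1]]. destruct (H2 N ltac:(unfold N; lia)) as [h2 [B2 Z2]].
  assert (HN : (1 <= N)%nat) by (unfold N; lia).
  apply T_fold in Z1; [|apply even_rapid_PN]. apply T_fold in Z2; [|apply even_rapid_PN].
  rewrite <- Xi_N_T in Z1, Z2 by auto.
  assert (Q : forall z, first_quadrant (fold_quadrant z)) by (intros; split; apply Rabs_pos).
  assert (R1 := Rle_trans _ _ _ (re_le_Cmod h1) B1). assert (R2 := Rle_trans _ _ _ (re_le_Cmod h2) B2).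
  assert (I1 := Rle_trans _ _ _ (im_le_Cmod h1) B1). assert (I2 := Rle_trans _ _ _ (im_le_Cmod h2) B2).
  apply Rabs_le_between in R1, R2, I1.
  assert (Pa : 0 <= Re a) by apply Rabs_pos.
  assert (E1 : Re (fold_quadrant (a + h1)) <= Re a + rho).
  { change (Rabs (Re a + Re h1) <= Re a + rho). apply Rabs_le. lra. }
  assert (E2 : t - rho <= Re (fold_quadrant (RtoC t + h2))).
  { change (t - rho <= Rabs (t + Re h2)). eapply Rle_trans; [|apply Rle_abs]. lra. }
  assert (E3 : Im a - rho <= Im (fold_quadrant (a + h1))).
  { change (Im a - rho <= Rabs (Im a + Im h1)). eapply Rle_trans; [|apply Rle_abs]. lra. }
  assert (E4 : Im (fold_quadrant (RtoC t + h2)) <= rho).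
  { change (Rabs (0 + Im h2) <= rho). rewrite Rplus_0_l. auto. }
  assert (M := proj2 (Hmono N HN) _ _ (Q (a + h1)%C) (Q (RtoC t + h2)%C) Z1 Z2 ltac:(lra)).
  lra.
Qed.
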